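(* Let $\alpha \ge 0$ and let $p$ be a real number. Suppose that either of the following conditions holds: (a) $2+\alpha+\sqrt{\alpha^2+\frac{7}{2}\alpha+3} \le p < 2(2+\alpha)$; (b) $2+2\alpha < p < 2+\alpha+\sqrt{\alpha^2+\frac{7}{2}\alpha+3}$ and $$\int_0^1 I_t\left(\frac{2+\alpha}{p}, 1-\frac{2+\alpha}{p}\right) t^{2p-4\alpha-5}(1-t^4)^\alpha\,dt - \frac{1}{4(\alpha+1)} \le 0 .$$ Then the Hilbert matrix operator $\mathcal{H}$ is bounded on $A^p_\alpha$ and $$\|\mathcal{H}\|_{A^p_\alpha \to A^p_\alpha} = \frac{\pi}{\sin\frac{(2+\alpha)\pi}{p}}.$$
   Context: $\mathbb{D}$ is the open unit disk. For $f(z)=\sum_{k\ge0} a_k z^k$ analytic on $\mathbb{D}$, the Hilbert matrix operator is $\mathcal{H}(f)(z)=\sum_{n=0}^\infty\left(\sum_{k=0}^\infty \frac{a_k}{n+k+1}\right)z^n$. For $\alpha\ge 0$ and $p\ge1$, the weighted Bergman space $A^p_\alpha$ consists of analytic $f$ on $\mathbb{D}$ with $\|f\|_{A^p_\alpha}=\left(\int_{\mathbb{D}}|f(w)|^p\,dA_\alpha(w)\right)^{1/p}<\infty$, where $dA_\alpha(w)=(\alpha+1)(1-|w|^2)^\alpha\,dA(w)$ and $dA$ is normalized Lebesgue area measure on $\mathbb{D}$. $B(x,y)=\int_0^1 s^{x-1}(1-s)^{y-1}ds$ is the Beta function, $B_t(x,y)=\int_0^t s^{x-1}(1-s)^{y-1}ds$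 the incomplete Beta function, and $I_t(x,y)=B_t(x,y)/B(x,y)$ the regularized incomplete Beta function. *)

(* Defs.v *)
From HB Require Import structures.
From mathcomp Require Import all_boot all_order all_algebra.
From mathcomp Require Import all_classical all_reals all_analysis.
From mathcomp Require Import complex.
Set Implicit Arguments. Unset Strict Implicit. Unset Printing Implicit Defensive.
Import Order.TTheory GRing.Theory Num.Theory.
Import numFieldNormedType.Exports.
Local Open Scope classical_set_scope.
Local Open Scope ring_scope.

Section Defs.
Variable R : realType.

Definition cmod (z : R[i]) : R := Num.sqrt (complex.Re z ^+ 2 + complex.Im z ^+ 2).

Definition ccvg_to (u : nat -> R[i]) (l : R[i]) : Prop :=
  ((fun n => complex.Re (u n)) @ \oo --> complex.Re l) /\ ((fun n => complex.Im (u n)) @ \oo --> complex.Im l).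

Definition cseries_cvg (u : nat -> R[i]) : Prop :=
  exists l, ccvg_to (fun n => \sum_(k < n) u k) l.

(* value of the series sum_k u k (meaningful when it converges) *)
Definition cseries (u : nat -> R[i]) : R[i] :=
  complex.Complex (limn (fun n => complex.Re (\sum_(k < n) u k)))
          (limn (fun n => complex.Im (\sum_(k < n) u k))).

(* An analytic function on the unit disk D, given by its Taylor coefficients
   a : nat -> R[i]: the power series sum_k a_k z^k converges for every |z| < 1. *)
Definition analytic_on_disk (a : nat -> R[i]) : Prop :=
  forall z : R[i], cmod z < 1 -> cseries_cvg (fun k => a k * z ^+ k).

Definition pseries_fun (a : nat -> R[i]) (z : R[i]) : R[i] :=
  cseries (fun k => a k * z ^+ k).

Definition disk : set (R * R) := [set w | w.1 ^+ 2 + w.2 ^+ 2 < 1].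

Definition leb2 := ((@lebesgue_measure R) \x (@lebesgue_measure R))%E.

(* density of dA_alpha w.r.t. Lebesgue measure dx dy:
   dA_alpha = (alpha+1)(1-|w|^2)^alpha dA,  dA = dx dy / pi *)
Definition weight (alpha : R) (w : R * R) : R :=
  (alpha + 1) * (1 - (w.1 ^+ 2 + w.2 ^+ 2)) `^ alpha / pi.

Definition bergman_int (p alpha : R) (a : nat -> R[i]) : \bar R :=
  (\int[leb2]_(w in disk)
      ((cmod (pseries_fun a (complex.Complex w.1 w.2))) `^ p * weight alpha w)%:E)%E.

Definition in_bergman (p alpha : R) (a : nat -> R[i]) : Prop :=
  analytic_on_disk a /\ (bergman_int p alpha a < +oo)%E.

Definition bergman_norm (p alpha : R) (a : nat -> R[i]) : R :=
  (fine (bergman_int p alpha a)) `^ (p^-1).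

Definition hilbert_term (a : nat -> R[i]) (n k : nat) : R[i] :=
  a k / (n + k + 1)%:R.

Definition hilbert (a : nat -> R[i]) (n : nat) : R[i] :=
  cseries (hilbert_term a n).

Definition beta_inc (t x y : R) : R :=
  fine (\int[@lebesgue_measure R]_(s in `]0%R, t%R[)
          ((s `^ (x - 1)) * ((1 - s) `^ (y - 1)))%:E)%E.

Definition beta_fun (x y : R) : R := beta_inc 1 x y.

Definition beta_reg (t x y : R) : R := beta_inc t x y / beta_fun x y.

Definition condb_integral (p alpha : R) : \bar R :=
  (\int[@lebesgue_measure R]_(t in `]0%R, 1%R[)
     (beta_reg t ((2 + alpha) / p) (1 - (2 + alpha) / p)
        * t `^ (2 * p - 4 * alpha - 5) * (1 - t ^+ 4) `^ alpha)%:E)%E.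

End Defs.

(* Main.v *)
Require Import Defs.
From HB Require Import structures.
From mathcomp Require Import all_boot all_order all_algebra.
From mathcomp Require Import all_classical all_reals all_analysis.
From mathcomp Require Import complex measurable_realfun.
From mathcomp Require Import ring lra zify.
Set Implicit Arguments.
Unset Strict Implicit.
Unset Printing Implicit Defensive.
Import Order.TTheory GRing.Theory Num.Theory.
Import numFieldNormedType.Exports.
Local Open Scope classical_set_scope.
Local Open Scope ring_scope.

(** Put [x = (2 + alpha) / p].  One has [H f (z) = \int_0^1 omega f (t omega) dt] with
[omega = 1 / (1 - (1 - t) z)].  Hoelder's inequality against the Beta kernel
[t ^ (x - 1) (1 - t) ^ (- x)], whose integral is [pi / sin (pi x)], the substitution
[u = 1 - (1 - t) z] and polar coordinates in [u] with [|u| = t / s ^ 2] reduce the upper bound to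
[\int I_s s ^ (2 p - 4 alpha - 5) (1 - s ^ 4) ^ alpha A ds <= \int s ^ 3 (1 - s ^ 4) ^ alpha A ds],
where [A] is nondecreasing in [s], being the circular means of [|f| ^ p].  In case (a) the integrands
compare pointwise because [I_s <= s ^ x]; in case (b) they cross once, as [I] is log-convex in
[log s], so that [A] may be replaced by a constant, and this is the assumed inequality.  Polynomials
suffice: [\sum_k |a_k| / (k + 1)] is finite on the Bergman space, and Fatou's lemma passes to the limit.
The bound is attained asymptotically by [f = (1 - z) ^ (- g)] with [g] increasing to [x]: here
[H f = f D] with [D 1 = pi / sin (pi g)], and the mass of [|f| ^ p] concentrates at [1]. *)

(** The relation [x * p = 2 + alpha] is what makes the weights match: the Hoelder factor, the
    Jacobian and the image of the weight then multiply to the Beta kernel itself, restricted to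
    [t < s], and integrating over [t] produces [I_s]. In case (a) the bound on [p] says exactly that
    the exponent [x - 2 (4 + 2 alpha - p)], left over after [I_s <= s ^ x], is nonnegative.
    Monotonicity of circular means, usually a consequence of subharmonicity, comes here from a
    finite positive kernel on roots of unity. Such a kernel handles boundedly many Taylor
    coefficients at a time, which is why polynomials are treated before general [f]. The value
    [pi / sin (pi x)] results from two recursions, one for Beta values and one for cosine integrals,
    which generate the same partial products of Euler's cosine product, so that these cancel. For
    sharpness the exponents [g] are rational: then [(1 - z) ^ (- g)] is a power of a root of
    [1 / (1 - z)] and its modulus is found algebraically, with no branch of the logarithm. Closeness
    of [D] to [D 1] must be uniform in [g], because the neighbourhood of 1 is fixed before [g]
    approaches [x]. *)

Section Measurability.
Variable R : realType.

Lemma measurable_inv : measurable_fun setT (fun x : R => x^-1).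
Proof.
have -> : (fun x : R => x^-1) = (fun x : R => if 0 <= x then x `^ (-1) else - ((- x) `^ (-1))).
  apply/funext => x; case: ifPn => x0; first by rewrite powR_inv1.
  by rewrite powR_inv1 ?invrN ?opprK // oppr_ge0 ltW // ltNge.
apply: measurable_fun_ifT.
- by apply: measurable_fun_ler; [exact: measurable_cst|exact: measurable_id].
- exact: measurable_powR.
- apply: measurable_funN.
  apply: (measurableT_comp (measurable_powR (-1)) (g := fun x : R => - x)).
  by apply: measurable_funN; exact: measurable_id.
Qed.

Lemma measurable_sqrt : measurable_fun setT (@Num.sqrt R).
Proof.
have -> : @Num.sqrt R = (fun x : R => if 0 <= x then x `^ 2^-1 else 0).
  apply/funext => x; case: ifPn => x0; first by rewrite powR12_sqrt.
  by rewrite ler0_sqrtr // ltW // ltNge.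
apply: measurable_fun_ifT.
- by apply: measurable_fun_ler; [exact: measurable_cst|exact: measurable_id].
- exact: measurable_powR.
- exact: measurable_cst.
Qed.

End Measurability.

(** Directed by the syntax of the function body. Opaque functions are closed by [assumption] in
    [meas]; the last clause takes whatever is left to be an [if]. *)
Ltac meas1 := lazymatch goal with
  | |- measurable_fun _ (fun _ => ?c) => exact: measurable_cst
  | |- measurable_fun _ (fun x => x) => exact: measurable_id
  | |- measurable_fun _ (@fst _ _) => exact: measurable_fst
  | |- measurable_fun _ (@snd _ _) => exact: measurable_snd
  | |- measurable_fun _ (fun x => EFin (@?f x)) => apply/measurable_EFinP
  | |- measurable_fun ?D (fun x => GRing.add (@?f x) (GRing.opp (@?g x))) =>
      first [apply: (@measurable_funB _ _ _ D f g) | apply: (@emeasurable_funB _ _ _ D f g)]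
  | |- measurable_fun ?D (fun x => GRing.add (@?f x) (@?g x)) =>
      first [apply: (@measurable_funD _ _ _ D f g) | apply: (@emeasurable_funD _ _ _ D f g)]
  | |- measurable_fun ?D (fun x => GRing.opp (@?f x)) => apply: (@measurable_funN _ _ _ D f)
  | |- measurable_fun ?D (fun x => GRing.mul (@?f x) (@?g x)) =>
      first [apply: (@measurable_funM _ _ _ D f g) | apply: (@emeasurable_funM _ _ _ D f g)]
  | |- measurable_fun ?D (fun x => GRing.exp (@?f x) ?n) =>
      apply: (@measurable_funX _ _ _ D f n)
  | |- measurable_fun ?D (fun x => GRing.inv (@?f x)) =>
      apply: (measurableT_comp (@measurable_inv _) (g := f))
  | |- measurable_fun ?D (fun x => powR (@?f x) ?p) =>
      apply: (measurableT_comp (measurable_powR p) (g := f))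
  | |- measurable_fun ?D (fun x => Num.norm (@?f x)) =>
      apply: (measurableT_comp (@normr_measurable _ setT) (g := f))
  | |- measurable_fun ?D (fun x => Num.sqrt (@?f x)) =>
      apply: (measurableT_comp (@measurable_sqrt _) (g := f))
  | |- measurable_fun ?D (fun x => adde (@?f x) (@?g x)) =>
      apply: (@emeasurable_funD _ _ _ D f g)
  | |- measurable_fun ?D (fun x => mule (@?f x) (@?g x)) =>
      apply: (@emeasurable_funM _ _ _ D f g)
  | |- measurable_fun ?D (fun x => Order.lt (@?f x) (@?g x)) =>
      apply: (@measurable_fun_ltr _ _ _ D f g)
  | |- measurable_fun ?D (fun x => Order.le (@?f x) (@?g x)) =>
      apply: (@measurable_fun_ler _ _ _ D f g)
  | |- measurable_fun ?D (Order.lt ?a) =>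
      apply: (@measurable_fun_ltr _ _ _ D (fun=> a) (fun x => x))
  | |- measurable_fun ?D (Order.le ?a) =>
      apply: (@measurable_fun_ler _ _ _ D (fun=> a) (fun x => x))
  | |- measurable_fun ?D (fun x => andb (@?f x) (@?g x)) =>
      apply: (@measurable_and _ _ D f g)
  | |- measurable_fun ?D (fun x => pair (@?f x) (@?g x)) =>
      apply: (@measurable_fun_pair _ _ _ _ _ _ f g)
  | |- measurable_fun ?D (fun x => fst (@?f x)) =>
      apply: (measurableT_comp measurable_fst (g := f))
  | |- measurable_fun ?D (fun x => snd (@?f x)) =>
      apply: (measurableT_comp measurable_snd (g := f))
  | |- measurable_fun _ _ => apply: measurable_fun_ifT
  end.
Ltac meas := repeat first [assumption | meas1].

(** * Affine substitutions, Tonelli's theorem and polar coordinates *)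

Section ChangeOfVariables.
Variable R : realType.
Local Notation mu := (@lebesgue_measure R).
Local Notation nu := (@leb2 R).

Lemma measurable_affine (c d : R) : measurable_fun setT (fun x : R => c * x + d).
Proof. by meas. Qed.

(** Both sides are measures, so half-open intervals suffice. For [c < 0] the preimage is closed at
    the other end, with the same length. *)
Lemma lebesgue_measure_affine (c d : R) (A : set (measurableTypeR R)) : c != 0 -> measurable A ->
  mu A = (`|c|%:E * pushforward mu ((fun x => c * x + d)%R : measurableTypeR R -> measurableTypeR R) A)%E.
Proof.
move=> c0 mA.
have mphi : measurable_fun setT ((fun x => c * x + d) : measurableTypeR R -> measurableTypeR R).
  exact: measurable_affine.
pose m1 := mscale (NngNum (normr_ge0 c)) (pushforward mu ((fun x => c * x + d)%R : measurableTypeR R -> measurableTypeR R)) : {measure set (measurableTypeR R) -> \bar R}.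
pose m' := m1 mphi.
rewrite (@lebesgue_measure_unique R m') // => _ [[a b] _ <-] /=.
rewrite /m' /mscale /= /pushforward.
(* The cases come in the order [c < 0], [c > 0], [c = 0]. *)
have [c_gt0|c_lt0|c_eq0] := ltgtP c 0; last by rewrite c_eq0 eqxx in c0.
-   rewrite [X in _ = (_ * mu X)%E](_ : _ = `[(b - d) / c, (a - d) / c[%classic); last first.
    apply/seteqP; split => x /=; rewrite !in_itv /=.
      by move=> /andP[h1 h2]; rewrite ler_ndivrMr // ltr_ndivlMr //; apply/andP; split; lra.
    by rewrite ler_ndivrMr // ltr_ndivlMr // => /andP[h1 h2]; apply/andP; split; lra.
  rewrite !lebesgue_measure_itv /= !lte_fin ltr_nM2r ?invr_lt0 // ltrD2r.
  case: ifP => ab; last by rewrite mule0.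
  rewrite -EFinB -!EFinD -EFinM ltr0_norm //; congr EFin; field.
  by rewrite lt_eqF.
- rewrite [X in _ = (_ * mu X)%E](_ : _ = `](a - d) / c, (b - d) / c]%classic); last first.
    apply/seteqP; split => x /=; rewrite !in_itv /=.
      by move=> /andP[h1 h2]; rewrite ler_pdivlMr // ltr_pdivrMr //; apply/andP; split; lra.
    by rewrite ler_pdivlMr // ltr_pdivrMr // => /andP[h1 h2]; apply/andP; split; lra.
  rewrite !lebesgue_measure_itv /= !lte_fin ltr_pM2r ?invr_gt0 // ltrD2r.
  case: ifP => ab; last by rewrite mule0.
  rewrite -EFinB -!EFinD -EFinM gtr0_norm //; congr EFin; field.
  by rewrite gt_eqF.
Qed.

Lemma ge0_integral_affine (c d : R) (f : R -> \bar R) : c != 0 ->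
  measurable_fun setT f -> (forall x, 0 <= f x)%E ->
  (\int[mu]_x f x = `|c|%:E * \int[mu]_x f (c * x + d)%R)%E.
Proof.
move=> c0 mf f0.
have mphi : measurable_fun setT ((fun x => c * x + d) : measurableTypeR R -> measurableTypeR R).
  exact: measurable_affine.
pose m1 := mscale (NngNum (normr_ge0 c)) (pushforward mu ((fun x => c * x + d)%R : measurableTypeR R -> measurableTypeR R)) : {measure set (measurableTypeR R) -> \bar R}.
pose m' := m1 mphi.
have -> : (\int[mu]_x f x = \int[m']_x f x)%E.
  apply: eq_measure_integral => A mA _; first [exact: (lebesgue_measure_affine d c0 mA)|exact/esym/(lebesgue_measure_affine d c0 mA)].
rewrite ge0_integral_mscale //=.
congr (_ * _)%E.
by rewrite ge0_integral_pushforward //=.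
Qed.

Lemma leb2E (f : R * R -> \bar R) : measurable_fun setT f -> (forall w, 0 <= f w)%E ->
  (\int[nu]_w f w = \int[mu]_x \int[mu]_y f (x, y))%E.
Proof. by move=> mf f0; rewrite /leb2 fubini_tonelli1. Qed.

Lemma leb2Esym (f : R * R -> \bar R) : measurable_fun setT f -> (forall w, 0 <= f w)%E ->
  (\int[nu]_w f w = \int[mu]_y \int[mu]_x f (x, y))%E.
Proof. by move=> mf f0; rewrite /leb2 fubini_tonelli2. Qed.

Definition sqn (w : R * R) : R := w.1 ^+ 2 + w.2 ^+ 2.

Lemma sqn_ge0 w : 0 <= sqn w.
Proof. by rewrite addr_ge0 ?sqr_ge0. Qed.

Lemma measurable_sqn : measurable_fun setT sqn.
Proof. by rewrite /sqn; meas. Qed.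

Lemma ge0_leb2_affine (c d1 d2 : R) (f : R * R -> \bar R) : c != 0 ->
  measurable_fun setT f -> (forall w, 0 <= f w)%E ->
  (\int[nu]_w f w = (c ^+ 2)%:E * \int[nu]_w f (c * w.1 + d1, c * w.2 + d2)%R)%E.
Proof.
move=> c0 mf f0.
have mg : measurable_fun setT (fun w : R * R => f (c * w.1 + d1, c * w.2 + d2)).
  by apply: (measurableT_comp mf); meas.
rewrite leb2E // leb2E //.
have mF := @measurable_fun_fubini_tonelli_F _ _ _ _ _ mu f mf f0.
have F0 x : (0 <= \int[mu]_y f (x, y))%E by apply: integral_ge0.
rewrite [LHS](ge0_integral_affine d1 c0 mF F0).
have -> : c ^+ 2 = `|c| * `|c| by rewrite -expr2 real_normK ?num_real.
rewrite EFinM -muleA; congr (_ * _)%E.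
have mH : measurable_fun setT (fun w : R * R => f (c * w.1 + d1, w.2)).
  by apply: (measurableT_comp mf); meas.
rewrite -ge0_integralZl//.
- apply: eq_integral => x _; rewrite /fubini_F.
  rewrite (@ge0_integral_affine c d2 (fun y => f (c * x + d1, y))) //.
  by apply: (measurableT_comp mf); meas.
- exact: (@measurable_fun_fubini_tonelli_F _ _ _ _ _ mu _ mg).
- by move=> x _; apply: integral_ge0.
Qed.

Lemma derive1_invX4 (x : R) : x != 0 -> is_derive x 1 (fun y : R => - (y^-1) ^+ 4) (4 * x^-1 ^+ 5).
Proof.
move=> x0.
have H := @is_deriveV R idfun x 1 1 x0 (is_derive_id x 1).
have H2 := @is_deriveX _ _ (fun y : R => y^-1) 4 x 1 _ H.
have H3 := @is_deriveN _ _ _ _ _ _ _ H2.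
apply: is_derive_eq H3 _ => /=.
rewrite /GRing.scale /= exprVn /idfun; field.
by [].
Qed.

Lemma integral_tailX5 (m : R) : 0 < m ->
  (\int[mu]_s (if (0 < s) && (m < s ^+ 4) then 4 * s^-1 ^+ 5 else 0)%:E = (m^-1)%:E)%E.
Proof.
move=> m0.
pose a := Num.sqrt (Num.sqrt m).
have a0 : 0 < a by rewrite !sqrtr_gt0.
have a4 : a ^+ 4 = m.
  by rewrite (exprM a 2 2) /a !sqr_sqrtr // ?sqrtr_ge0 // ltW.
transitivity (\int[mu]_(s in `[a, +oo[) (4 * s^-1 ^+ 5)%:E)%E.
  rewrite -integral_itv_obnd_cbnd; last first.
    apply/measurable_EFinP; apply: measurable_funTS; meas.
  rewrite [RHS]integral_mkcond; apply: eq_integral => s _.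
  rewrite patchE.
  case: ifPn => [/andP[s0]|].
    rewrite -a4 ltr_pXn2r // ?nnegrE ?ltW // => h.
    by rewrite mem_set //= in_itv /= h.
  rewrite -a4 => h; case: ifPn => //.
  rewrite inE /= in_itv /= andbT => h2; case/negP: h.
  by rewrite (lt_trans a0 h2) ltr_pXn2r // ?nnegrE ltW // (lt_trans a0 h2).
rewrite (@ge0_continuous_FTC2y R _ (fun y : R => - (y^-1) ^+ 4) a 0).
- by rewrite -EFinB sub0r opprK -a4 exprVn.
- move=> x ax; rewrite mulr_ge0 // exprn_ge0 // invr_ge0 ltW //; exact: lt_le_trans ax.
- apply: continuous_in_subspaceT => x; rewrite inE /= in_itv /= andbT => ax.
  apply: cvgM; first exact: cvg_cst.
  apply: (@cvg_comp _ _ _ (fun y : R => y^-1) (fun y : R => y ^+ 5)); last exact: exprn_continuous.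
  by apply: cvgV; [rewrite gt_eqF // (lt_le_trans a0)|exact: cvg_id].
- rewrite -[X in _ --> X]oppr0; apply: cvgN.
  have -> : 0 = (0 : R) ^+ 4 by rewrite expr0n.
  apply: (@cvg_comp _ _ _ (fun y : R => y^-1) (fun y : R => y ^+ 4)); last exact: exprn_continuous.
  by apply/gtr0_cvgV0; [exact: nbhs_pinfty_gt|exact: cvg_id].
- by move=> x ax; have [] := @derive1_invX4 x (lt0r_neq0 (lt_trans a0 ax)).
- apply: cvg_at_right_filter; apply: cvgN.
  apply: (@cvg_comp _ _ _ (fun y : R => y^-1) (fun y : R => y ^+ 4)); last exact: exprn_continuous.
  by apply: cvgV; [rewrite gt_eqF|exact: cvg_id].
- move=> x; rewrite in_itv /= andbT => ax.
  rewrite derive1E.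
  by have [_ ->] := @derive1_invX4 x (lt0r_neq0 (lt_trans a0 ax)).
Qed.


Lemma leb2_eq_off0 (f g : R * R -> \bar R) :
  measurable_fun setT f -> measurable_fun setT g ->
  (forall w, 0 <= f w)%E -> (forall w, 0 <= g w)%E ->
  (forall w, 0 < sqn w -> f w = g w) -> (\int[nu]_w f w = \int[nu]_w g w)%E.
Proof.
move=> mf mg f0 g0 fg.
apply: ge0_ae_eq_integral => //.
exists [set (0, 0)]; split.
- have -> : [set (0 : R, 0 : R)] = [set 0] `*` [set 0].
    by apply/seteqP; split => -[x y] /= => [[-> ->]|[-> ->]].
  by apply: measurableX; exact: measurable_set1.
- have -> : [set (0 : R, 0 : R)] = [set 0] `*` [set 0].
    by apply/seteqP; split => -[x y] /= => [[-> ->]|[-> ->]].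
  by rewrite [LHS](product_measure1E mu mu)//; rewrite [X in (X * _)%E](lebesgue_measure_set1 0) mul0e.
- move=> [x y] /= H; apply: contrapT => xy; apply: H => _; apply: fg.
  rewrite lt_def sqn_ge0 andbT; apply/eqP => h; apply: xy.
  move/eqP: h; rewrite /sqn /= paddr_eq0 ?sqr_ge0 // !expf_eq0 /=.
  by move=> /andP[/eqP -> /eqP ->].
Qed.

Let leb2_sigma_finite : sigma_finite setT (product_measure1 mu mu).
Proof.
have /sigma_finiteP[F [TF ndF Foo]] := sigma_finiteT mu.
exists (fun n => F n `*` F n).
  apply/seteqP; split => -[x y] // _.
  have [n _ Fx] : (\bigcup_n F n) x by rewrite -TF.
  have [m _ Fy] : (\bigcup_n F n) y by rewrite -TF.
  exists (maxn n m) => //; split => /=.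
    by move: x Fx; exact/subsetPset/ndF/leq_maxl.
  by move: y Fy; exact/subsetPset/ndF/leq_maxr.
move=> k; have [mk k_fin] := Foo k; split; first exact: measurableX.
by rewrite [X in (X < _)%E](product_measure1E mu mu mk mk) lte_mul_pinfty // ge0_fin_numE.
Qed.

(* The library instance for [\x] is shadowed by the one for products of probabilities. *)
Let nus : {sigma_finite_measure set (measurableTypeR R * measurableTypeR R)%type -> \bar R} :=
  HB.pack_for {sigma_finite_measure set (measurableTypeR R * measurableTypeR R)%type -> \bar R}
    (product_measure1 mu mu)
    (Measure_isSigmaFinite.Build _ _ _ (product_measure1 mu mu) leb2_sigma_finite).

Lemma tonelli12 (f : R * (R * R) -> \bar R) : measurable_fun setT f -> (forall w, 0 <= f w)%E ->
  (\int[mu]_s \int[nu]_z f (s, z) = \int[nu]_z \int[mu]_s f (s, z))%E.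
Proof. by move=> mf f0; exact (@fubini_tonelli _ _ _ _ R mu nus f mf f0). Qed.

Lemma measurable_tonelli12_1 (f : R * (R * R) -> \bar R) :
  measurable_fun setT f -> (forall w, 0 <= f w)%E ->
  measurable_fun setT (fun s => \int[nu]_z f (s, z))%E.
Proof. by move=> mf f0; exact (@measurable_fun_fubini_tonelli_F _ _ _ _ R nus f mf f0). Qed.

Lemma measurable_tonelli12_2 (f : R * (R * R) -> \bar R) :
  measurable_fun setT f -> (forall w, 0 <= f w)%E ->
  measurable_fun setT (fun z => \int[mu]_s f (s, z))%E.
Proof. by move=> mf f0; exact (@measurable_fun_fubini_tonelli_G _ _ _ _ R mu f mf f0). Qed.

(* Polar coordinates without angles: the circle of radius [s ^+ 2] is parametrised by the
   direction of a point of the punctured disk. Rescaling [s] by [|z|^(1/2)] and then [z] by [s ^+ 2]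
   turns the right-hand side into [\int g w |w|^2 \int_{s^4 > |w|^2} 4 s^-5]. *)
Lemma polar (g : R * R -> \bar R) : measurable_fun setT g -> (forall w, 0 <= g w)%E ->
  (\int[nu]_w g w = \int[mu]_s ((if 0 < s then 4 * s ^+ 3 else 0)%:E *
     \int[nu]_z ((if (0 < sqn z) && (sqn z < 1) then 1 else 0)%:E *
       g (s ^+ 2 / Num.sqrt (sqn z) * z.1, s ^+ 2 / Num.sqrt (sqn z) * z.2)%R)))%E.
Proof.
move=> mg g0; have msq := measurable_sqn.
have msq1 : measurable_fun setT (fun z : R * (R * R) => sqn z.2) by apply: (measurableT_comp msq); meas.
pose c1 (s : R) : R := if 0 < s then 4 * s ^+ 3 else 0.
pose c2 (z : R * R) : R := if (0 < sqn z) && (sqn z < 1) then 1 else 0.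
pose G (u : R * (R * R)) := ((c1 u.1 * c2 u.2)%:E * g (u.1 ^+ 2 / Num.sqrt (sqn u.2) * u.2.1, u.1 ^+ 2 / Num.sqrt (sqn u.2) * u.2.2)%R)%E.
pose H (u : R * (R * R)) := ((c1 u.1 * c2 u.2 * sqn u.2)%:E * g (u.1 ^+ 2 * u.2.1, u.1 ^+ 2 * u.2.2)%R)%E.
pose K (u : R * (R * R)) := ((if (0 < u.1) && (0 < sqn u.2) && (sqn u.2 < u.1 ^+ 4) then sqn u.2 * (4 * u.1^-1 ^+ 5) else 0)%:E * g u.2)%E.
have c1_ge0 s : 0 <= c1 s by rewrite /c1; case: ifP => // s0; rewrite mulr_ge0 // exprn_ge0 // ltW.
have c2_ge0 z : 0 <= c2 z by rewrite /c2; case: ifP.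
have mc1 : measurable_fun setT (fun z : R * (R * R) => c1 z.1) by rewrite /c1; meas.
have mc2 : measurable_fun setT (fun z : R * (R * R) => c2 z.2) by rewrite /c2; meas.
have mc2' : measurable_fun setT c2 by rewrite /c2 /=; meas.
have mG : measurable_fun setT G.
  by rewrite /G; apply: emeasurable_funM; [meas|apply: (measurableT_comp mg); meas].
have mH : measurable_fun setT H.
  by rewrite /H; apply: emeasurable_funM; [meas|apply: (measurableT_comp mg); meas].
have mK : measurable_fun setT K.
  by rewrite /K; apply: emeasurable_funM; [meas|apply: (measurableT_comp mg); meas].
have G0 u : (0 <= G u)%E by rewrite /G mule_ge0 // lee_fin mulr_ge0.
have H0 u : (0 <= H u)%E by rewrite /H mule_ge0 // lee_fin !mulr_ge0 // sqn_ge0.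
have K0 u : (0 <= K u)%E.
  rewrite /K mule_ge0 // lee_fin; case: ifP => // /andP[/andP[h1 h2] _].
  by rewrite !mulr_ge0 ?exprn_ge0 ?invr_ge0 ?sqn_ge0 // ltW.
symmetry.
transitivity (\int[mu]_s \int[nu]_z G (s, z))%E.
  apply: eq_integral => s _; rewrite -ge0_integralZl//.
  - apply: eq_integral => z _; rewrite /G /= EFinM -muleA; congr (_ * _)%E.
  - apply: emeasurable_funM; first by meas.
    by apply: (measurableT_comp mg); meas.
  - by move=> z _; rewrite mule_ge0 // lee_fin; exact: c2_ge0.
  - by rewrite lee_fin; exact: c1_ge0.
rewrite (tonelli12 mG) //.
transitivity (\int[nu]_z \int[mu]_s H (s, z))%E.
  apply: eq_integral => z _.
  have [z0|z0] := ltP 0 (sqn z); last first.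
    have c20 : c2 z = 0 by rewrite /c2 ltNge z0.
    by rewrite !integral0_eq // => s _; rewrite /G /H /= c20 ?mulr0 ?mul0r mul0e.
  set c := Num.sqrt (Num.sqrt (sqn z)).
  have c0 : 0 < c by rewrite !sqrtr_gt0.
  have cc : c ^+ 2 = Num.sqrt (sqn z) by rewrite sqr_sqrtr // sqrtr_ge0.
  have mGz : measurable_fun setT (fun s => G (s, z)) by apply: (measurableT_comp mG); meas.
  rewrite (@ge0_integral_affine c 0 (fun s => G (s, z))) //; last by rewrite gt_eqF.
  rewrite -ge0_integralZl//; last first.
    by apply: (measurableT_comp mGz); meas.
  apply: eq_integral => s _.
  rewrite /G /H /= addr0 muleA -EFinM gtr0_norm //.
  have c4 : sqn z = c ^+ 4 by rewrite (exprM c 2 2) cc sqr_sqrtr // ltW.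
  have -> : (c * s) ^+ 2 / Num.sqrt (sqn z) = s ^+ 2.
    by rewrite -cc; field; rewrite gt_eqF.
  congr (_%:E * _)%E.
  rewrite /c1 pmulr_rgt0 //; case: ifP => _; last by rewrite !mul0r mulr0.
  by rewrite c4; ring.
rewrite -(tonelli12 mH) //.
transitivity (\int[mu]_s \int[nu]_w K (s, w))%E.
  apply: eq_integral => s _.
  have [s0|s0] := ltP 0 s; last first.
    by rewrite !integral0_eq // => z _; rewrite /K /H /= /c1 ?ltNge s0 ?mul0r mul0e.
  have mKs : measurable_fun setT (fun w => K (s, w)) by apply: (measurableT_comp mK); meas.
  have k0 : (0 <= (s ^+ 2 ^+ 2)%:E)%E by rewrite lee_fin !exprn_ge0 // ltW.
  rewrite (@ge0_leb2_affine (s ^+ 2) 0 0 (fun w => K (s, w))) //; last by rewrite gt_eqF // exprn_gt0.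
  rewrite -ge0_integralZl//; last first.
    by apply: (measurableT_comp mKs); meas.
  apply: eq_integral => z _.
  rewrite /K /H /= !addr0 muleA -EFinM.
  congr (_%:E * _)%E.
  have -> : sqn (s ^+ 2 * z.1, s ^+ 2 * z.2) = s ^+ 4 * sqn z by rewrite /sqn /=; ring.
  rewrite /c1 /c2 s0 /= pmulr_rgt0 ?exprn_gt0 // gtr_pMr ?exprn_gt0 //.
  case: ifP => _; last by rewrite !mulr0 mul0r.
  by field; rewrite gt_eqF.
rewrite (tonelli12 mK) //.
have mint := measurable_tonelli12_2 mK K0.
apply: leb2_eq_off0 => //.
  by move=> w; apply: integral_ge0.
move=> w w0.
under eq_integral => s _.
  rewrite /K /= w0 andbT muleC.
  have -> : (if (0 < s) && (sqn w < s ^+ 4) then sqn w * (4 * s^-1 ^+ 5) else 0) =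
    sqn w * (if (0 < s) && (sqn w < s ^+ 4) then 4 * s^-1 ^+ 5 else 0).
    by case: ifP => // _; rewrite mulr0.
  rewrite EFinM muleA.
  over.
rewrite ge0_integralZl//.
- by rewrite integral_tailX5 // -muleA -EFinM mulfV ?mule1 // gt_eqF.
- by meas.
- by move=> s _; rewrite lee_fin; case: ifP => // /andP[s0 _]; rewrite mulr_ge0 // exprn_ge0 // invr_ge0 ltW.
- by rewrite mule_ge0 // lee_fin ltW.
Qed.

End ChangeOfVariables.

(** * Plane isometries and circular means *)

Section PlaneIsometries.
Variable R : realType.
Local Notation mu := (@lebesgue_measure R).
Local Notation nu := (@leb2 R).
Implicit Type f : R * R -> \bar R.

Lemma leb2_reflect f : measurable_fun setT f -> (forall w, 0 <= f w)%E ->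
  (\int[nu]_w f (w.1, - w.2)%R = \int[nu]_w f w)%E.
Proof.
move=> mf f0.
have mg : measurable_fun setT (fun w : R * R => f (w.1, - w.2)) by apply: (measurableT_comp mf); meas.
rewrite leb2E // leb2E //; apply: eq_integral => x _.
have N1 : (-1 : R) != 0 by rewrite oppr_eq0 oner_eq0.
have mfx : measurable_fun setT (fun y => f (x, y)) by apply: (measurableT_comp mf); meas.
rewrite [RHS](ge0_integral_affine 0 N1 mfx (fun y => f0 (x, y))) normrN1 mul1e.
by apply: eq_integral => y _; rewrite addr0 mulN1r.
Qed.

Lemma leb2_swap f : measurable_fun setT f -> (forall w, 0 <= f w)%E ->
  (\int[nu]_w f (w.2, w.1) = \int[nu]_w f w)%E.
Proof.
move=> mf f0.
have mg : measurable_fun setT (fun w : R * R => f (w.2, w.1)) by apply: (measurableT_comp mf); meas.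
by rewrite leb2E // leb2Esym.
Qed.

(** For [c != 0] a rotation is the product of [(x, y) |-> (c x - s y, y)] and
    [(x, y) |-> (x, y / c + s x / c)]. Each changes one coordinate affinely, so one-dimensional
    substitutions suffice, and the factors [|c|] and [1 / |c|] cancel. For [c = 0] the rotation is
    made of a swap and a reflection. *)
Lemma leb2_rotate f (c s : R) : c ^+ 2 + s ^+ 2 = 1 ->
  measurable_fun setT f -> (forall w, 0 <= f w)%E ->
  (\int[nu]_w f (c * w.1 - s * w.2, s * w.1 + c * w.2)%R = \int[nu]_w f w)%E.
Proof.
move=> cs mf f0.
have [c0|c0] := eqVneq c 0.
  have s1 : s = 1 \/ s = -1.
    by move: cs; rewrite c0 expr0n add0r => /eqP; rewrite sqrf_eq1 => /orP[] /eqP; [left|right].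
  have mf' : measurable_fun setT (fun w : R * R => f (w.1, - w.2)) by apply: (measurableT_comp mf); meas.
  have mf'' : measurable_fun setT (fun w : R * R => f (w.2, w.1)) by apply: (measurableT_comp mf); meas.
  have mf3 : measurable_fun setT (fun w : R * R => f (w.2, - w.1)) by apply: (measurableT_comp mf); meas.
  case: s1 => ->.
    rewrite -[RHS](leb2_swap mf f0) -[RHS](leb2_reflect mf'') //=.
    by apply: eq_integral => -[x y] _ /=; rewrite c0 !mul0r sub0r mul1r addr0 mul1r.
  rewrite -[RHS](leb2_reflect mf f0) -[RHS](leb2_swap mf') //=.
  by apply: eq_integral => -[x y] _ /=; rewrite c0 !mul0r sub0r mulN1r opprK addr0 mulN1r.
pose G (w : R * R) := f (w.1, c^-1 * w.2 + s * w.1 / c).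
have mG : measurable_fun setT G by apply: (measurableT_comp mf) => /=; meas.
have mF : measurable_fun setT (fun w : R * R => f (c * w.1 - s * w.2, s * w.1 + c * w.2)).
  by apply: (measurableT_comp mf); meas.
have G0 w : (0 <= G w)%E by exact: f0.
have FG w : f (c * w.1 - s * w.2, s * w.1 + c * w.2) = G (c * w.1 - s * w.2, w.2).
  rewrite /G /=; congr (f (_, _)).
  transitivity (s * w.1 + (1 - s ^+ 2) / c * w.2); last by field.
  by rewrite -cs addrK expr2 mulfK.
have c1 : 0 < `|c| by rewrite normr_gt0.
have E : (`|c|%:E * (\int[nu]_w f (c * w.1 - s * w.2, s * w.1 + c * w.2)%R) = `|c|%:E * \int[nu]_w f w)%E.
  transitivity (\int[nu]_w G w)%E.
    rewrite leb2Esym // [RHS]leb2Esym // -ge0_integralZl//; last 2 first.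
    - exact: (@measurable_fun_fubini_tonelli_G _ _ _ _ _ mu _ mF).
    - by move=> y _; apply: integral_ge0.
    apply: eq_integral => y _.
    have mGy : measurable_fun setT (fun x => G (x, y)) by apply: (measurableT_comp mG); meas.
    rewrite [RHS](ge0_integral_affine (- (s * y)) c0 mGy (fun x => G0 (x, y))).
    by congr (_ * _)%E; apply: eq_integral => x _; rewrite (FG (x, y)).
  rewrite leb2E // [X in _ = (_ * X)%E]leb2E // -ge0_integralZl//; last 2 first.
  - exact: (@measurable_fun_fubini_tonelli_F _ _ _ _ _ mu _ mf).
  - by move=> y _; apply: integral_ge0.
  apply: eq_integral => x _.
  have mfx : measurable_fun setT (fun y => f (x, y)) by apply: (measurableT_comp mf); meas.
  have ci0 : c^-1 != 0 by rewrite invr_eq0.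
  rewrite [X in _ = (_ * X)%E](ge0_integral_affine (s * x / c) ci0 mfx (fun y => f0 (x, y))).
  by rewrite muleA -EFinM normfV mulfV ?mul1e // gt_eqF.
have /(congr1 (fun u => (`|c|^-1)%:E * u)%E) := E.
by rewrite !muleA -!EFinM mulVf ?gt_eqF // !mul1e.
Qed.

Definition puncdisk (z : R * R) : R := if (0 < sqn z) && (sqn z < 1) then 1 else 0.

Lemma puncdisk_ge0 z : 0 <= puncdisk z.
Proof. by rewrite /puncdisk; case: ifP. Qed.

Lemma measurable_puncdisk : measurable_fun setT puncdisk.
Proof. by have msq := @measurable_sqn R; rewrite /puncdisk /=; meas. Qed.

Definition on_circle (r : R) (z : R * R) : R * R :=
  (r / Num.sqrt (sqn z) * z.1, r / Num.sqrt (sqn z) * z.2).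

(** An unnormalised circular mean over the circle of radius [r]. The direction of a point of the
    punctured disk plays the part of the angle, so that rotation invariance is inherited from plane
    measure; the total mass is the area of the disk. *)
Definition circ (h : R * R -> \bar R) (r : R) : \bar R :=
  (\int[nu]_z ((puncdisk z)%:E * h (on_circle r z)))%E.

Lemma measurable_on_circle : measurable_fun setT (fun u : R * (R * R) => on_circle u.1 u.2).
Proof.
have msq1 : measurable_fun setT (fun z : R * (R * R) => sqn z.2).
  by apply: (measurableT_comp (@measurable_sqn R)); meas.
by rewrite /on_circle; meas.
Qed.

Lemma measurable_on_circle_r r : measurable_fun setT (on_circle r).
Proof. by have msq := @measurable_sqn R; rewrite /on_circle; meas. Qed.

Lemma circ_integrand_ge0 (h : R * R -> \bar R) r : (forall w, 0 <= h w)%E ->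
  forall z, (0 <= (puncdisk z)%:E * h (on_circle r z))%E.
Proof. by move=> h0 z; rewrite mule_ge0 // lee_fin puncdisk_ge0. Qed.

Lemma measurable_circ_integrand (h : R * R -> \bar R) r : measurable_fun setT h ->
  measurable_fun setT (fun z => (puncdisk z)%:E * h (on_circle r z))%E.
Proof.
move=> mh; apply: emeasurable_funM.
  by apply/measurable_EFinP; exact: measurable_puncdisk.
exact: (measurableT_comp mh (measurable_on_circle_r r)).
Qed.

Lemma circ_ge0 (h : R * R -> \bar R) r : (forall w, 0 <= h w)%E -> (0 <= circ h r)%E.
Proof. by move=> h0; apply: integral_ge0 => z _; exact: circ_integrand_ge0. Qed.

Lemma measurable_circ (h : R * R -> \bar R) : measurable_fun setT h ->
  (forall w, 0 <= h w)%E -> measurable_fun setT (circ h).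
Proof.
move=> mh h0.
have mH : measurable_fun setT (fun u : R * (R * R) => (puncdisk u.2)%:E * h (on_circle u.1 u.2))%E.
  apply: emeasurable_funM.
    apply/measurable_EFinP; apply: (measurableT_comp measurable_puncdisk); meas.
  exact: (measurableT_comp mh measurable_on_circle).
by apply: (measurable_tonelli12_1 mH) => -[s z]; exact: circ_integrand_ge0.
Qed.

Lemma le_circ (h1 h2 : R * R -> \bar R) r1 r2 :
  measurable_fun setT h1 -> measurable_fun setT h2 -> (forall w, 0 <= h1 w)%E -> (forall w, 0 <= h2 w)%E ->
  (forall z, puncdisk z = 1%R -> h1 (on_circle r1 z) <= h2 (on_circle r2 z))%E -> (circ h1 r1 <= circ h2 r2)%E.
Proof.
move=> m1 m2 h10 h20 h12; apply: ge0_le_integral => //.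
- by move=> z _; exact: circ_integrand_ge0.
- exact: measurable_circ_integrand.
- exact: measurable_circ_integrand.
- move=> z _; rewrite /puncdisk; case: ifPn => zP; last by rewrite !mul0e.
  by rewrite !mul1e h12 // /puncdisk zP.
Qed.

Lemma circ_rotate (h : R * R -> \bar R) (c s r : R) : c ^+ 2 + s ^+ 2 = 1 ->
  measurable_fun setT h -> (forall w, 0 <= h w)%E ->
  circ (fun w => h (c * w.1 - s * w.2, s * w.1 + c * w.2)%R) r = circ h r.
Proof.
move=> cs mh h0.
rewrite /circ -[RHS](leb2_rotate cs); last 2 first.
- exact: measurable_circ_integrand.
- exact: circ_integrand_ge0.
apply: eq_integral => z _ /=.
have E : sqn (c * z.1 - s * z.2, s * z.1 + c * z.2) = sqn z.
  rewrite /sqn /=; transitivity ((c ^+ 2 + s ^+ 2) * (z.1 ^+ 2 + z.2 ^+ 2)); first by ring.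
  by rewrite cs mul1r.
rewrite /puncdisk /on_circle E /=; congr (_ * h (_, _))%E; ring.
Qed.

Lemma circ_conj (h : R * R -> \bar R) (r : R) :
  measurable_fun setT h -> (forall w, 0 <= h w)%E ->
  circ (fun w => h (w.1, - w.2)%R) r = circ h r.
Proof.
move=> mh h0.
rewrite /circ -[RHS]leb2_reflect; last 2 first.
- exact: measurable_circ_integrand.
- exact: circ_integrand_ge0.
apply: eq_integral => z _ /=.
have E : sqn (z.1, - z.2) = sqn z by rewrite /sqn /= sqrrN.
by rewrite /puncdisk /on_circle E /= mulrN.
Qed.

Lemma polar_circ (g : R * R -> \bar R) : measurable_fun setT g -> (forall w, 0 <= g w)%E ->
  (\int[nu]_w g w = \int[mu]_s ((if 0 < s then 4 * s ^+ 3 else 0)%:E * circ g (s ^+ 2)%R))%E.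
Proof. exact: polar. Qed.

Lemma sqn_on_circle r z : 0 < sqn z -> sqn (on_circle r z) = r ^+ 2.
Proof.
move=> z0; rewrite /sqn /= !exprMn -mulrDr -/(sqn z) exprVn sqr_sqrtr ?ltW //.
by rewrite -mulrA mulVf ?mulr1 // gt_eqF.
Qed.

End PlaneIsometries.

(** * The complex modulus and measurability of complex-valued functions *)

Section ComplexModulus.
Variable R : realType.
Implicit Types z w : R[i].

(** Carries the laws of the norm of [R[i]] over to [cmod], by injectivity of the embedding of
    [R]. *)
Lemma cmodE z : (cmod z)%:C%C = `|z|.
Proof. by rewrite normc_def. Qed.

Lemma cmod_ge0 z : 0 <= cmod z.
Proof. exact: sqrtr_ge0. Qed.

Lemma cmodM z w : cmod (z * w) = cmod z * cmod w.
Proof. by apply: (@complexI R); rewrite rmorphM /= !cmodE normrM. Qed.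

Lemma cmodD z w : cmod (z + w) <= cmod z + cmod w.
Proof. by rewrite -lecR rmorphD /= !cmodE ler_normD. Qed.

Lemma cmodN z : cmod (- z) = cmod z.
Proof. by apply: (@complexI R); rewrite !cmodE normrN. Qed.

Lemma cmod0 : cmod (0 : R[i]) = 0.
Proof. by apply: (@complexI R); rewrite cmodE normr0. Qed.

Lemma cmod1 : cmod (1 : R[i]) = 1.
Proof. by apply: (@complexI R); rewrite cmodE normr1. Qed.

Lemma cmodX z n : cmod (z ^+ n) = cmod z ^+ n.
Proof. by apply: (@complexI R); rewrite rmorphXn /= !cmodE normrX. Qed.

Lemma cmodV z : cmod (z^-1) = (cmod z)^-1.
Proof. by apply: (@complexI R); rewrite fmorphV /= !cmodE normfV. Qed.

Lemma cmod_eq0 z : (cmod z == 0) = (z == 0).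
Proof. by rewrite -(inj_eq (@complexI R)) cmodE normr_eq0. Qed.

Lemma cmod_real (x : R) : cmod x%:C%C = `|x|.
Proof. by rewrite /cmod /= expr0n addr0 sqrtr_sqr. Qed.

Lemma cmod_nat n : cmod (n%:R : R[i]) = n%:R.
Proof. by apply: (@complexI R); rewrite cmodE normr_nat rmorph_nat. Qed.

Lemma cmod_sum (I : Type) (r : seq I) (P : pred I) (F : I -> R[i]) :
  cmod (\sum_(i <- r | P i) F i) <= \sum_(i <- r | P i) cmod (F i).
Proof.
elim/big_rec2: _ => [|i y x _ H]; first by rewrite cmod0.
by rewrite (le_trans (cmodD _ _)) // lerD2l.
Qed.

Lemma cmod_sqr z : cmod z ^+ 2 = complex.Re z ^+ 2 + complex.Im z ^+ 2.
Proof. by rewrite sqr_sqrtr // addr_ge0 ?sqr_ge0. Qed.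

Lemma cmod_mul_conj z : (cmod z ^+ 2)%:C%C = z * z^*%C.
Proof. by rewrite rmorphXn /= cmodE sqr_normc. Qed.

Lemma cmod_conj z : cmod z^*%C = cmod z.
Proof. by case: z => a b; rewrite /cmod /= sqrrN. Qed.

Lemma Re_le_cmod z : `|complex.Re z| <= cmod z.
Proof. by rewrite -lecR cmodE; exact: normc_ge_Re. Qed.

Lemma Im_le_cmod z : `|complex.Im z| <= cmod z.
Proof. by rewrite -sqrtr_sqr /cmod ler_wsqrtr // lerDr sqr_ge0. Qed.

Lemma cmod_le_ReIm z : cmod z <= `|complex.Re z| + `|complex.Im z|.
Proof.
rewrite -(@ler_pXn2r _ 2) ?nnegrE ?cmod_ge0 ?addr_ge0 // cmod_sqr sqrrD !real_normK ?num_real //.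
by rewrite lerD2r lerDl mulrn_wge0 // mulr_ge0.
Qed.

Lemma Re_sum (I : Type) (r : seq I) (P : pred I) (F : I -> R[i]) :
  complex.Re (\sum_(i <- r | P i) F i) = \sum_(i <- r | P i) complex.Re (F i).
Proof. by elim/big_rec2: _ => [//|i y x _ <-]; case: (F i) => ? ?; case: x. Qed.

Lemma Im_sum (I : Type) (r : seq I) (P : pred I) (F : I -> R[i]) :
  complex.Im (\sum_(i <- r | P i) F i) = \sum_(i <- r | P i) complex.Im (F i).
Proof. by elim/big_rec2: _ => [//|i y x _ <-]; case: (F i) => ? ?; case: x. Qed.

Definition cpt (w : R * R) : R[i] := complex.Complex w.1 w.2.

Lemma cmod_cpt (w : R * R) : cmod (cpt w) = Num.sqrt (sqn w).
Proof. by []. Qed.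

Lemma cmod_cpt_sqr (w : R * R) : cmod (cpt w) ^+ 2 = sqn w.
Proof. by rewrite cmod_sqr. Qed.

Section Measurable.
Variables (d : measure_display) (T : measurableType d).
Implicit Type f : T -> R[i].

Definition cmeasurable f := measurable_fun setT (fun x => complex.Re (f x)) /\
  measurable_fun setT (fun x => complex.Im (f x)).

Lemma cmeasurable_cst c : cmeasurable (fun _ => c).
Proof. by split; meas. Qed.

Lemma cmeasurableD f g : cmeasurable f -> cmeasurable g -> cmeasurable (fun x => f x + g x).
Proof.
move=> [f1 f2] [g1 g2]; split.
  have -> : (fun x => complex.Re (f x + g x)) = (fun x => complex.Re (f x) + complex.Re (g x)).
    by apply/funext => x; case: (f x) => ? ?; case: (g x).
  by meas.
have -> : (fun x => complex.Im (f x + g x)) = (fun x => complex.Im (f x) + complex.Im (g x)).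
  by apply/funext => x; case: (f x) => ? ?; case: (g x).
by meas.
Qed.

Lemma cmeasurableM f g : cmeasurable f -> cmeasurable g -> cmeasurable (fun x => f x * g x).
Proof.
move=> [f1 f2] [g1 g2]; split.
  have -> : (fun x => complex.Re (f x * g x)) =
      (fun x => complex.Re (f x) * complex.Re (g x) - complex.Im (f x) * complex.Im (g x)).
    by apply/funext => x; case: (f x) => ? ?; case: (g x).
  by meas.
have -> : (fun x => complex.Im (f x * g x)) =
    (fun x => complex.Re (f x) * complex.Im (g x) + complex.Im (f x) * complex.Re (g x)).
  by apply/funext => x; case: (f x) => ? ?; case: (g x).
by meas.
Qed.

Lemma cmeasurableX f n : cmeasurable f -> cmeasurable (fun x => f x ^+ n).
Proof.
move=> mf; elim: n => [|n IH]; first exact: cmeasurable_cst.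
by rewrite (_ : (fun x => _) = (fun x => f x * f x ^+ n)) ?funeqE // => [|x]; [exact: cmeasurableM|rewrite exprS].
Qed.

Lemma cmeasurable_sum (I : Type) (r : seq I) (F : I -> T -> R[i]) :
  (forall i, cmeasurable (F i)) -> cmeasurable (fun x => \sum_(i <- r) F i x).
Proof.
move=> mF; elim: r => [|i r IH].
  rewrite (_ : (fun x => _) = (fun x => 0)); first exact: cmeasurable_cst.
  by apply/funext => x; rewrite big_nil.
rewrite (_ : (fun x => _) = (fun x => F i x + \sum_(i <- r) F i x)); first exact: cmeasurableD.
by apply/funext => x; rewrite big_cons.
Qed.

Lemma measurable_cmod f : cmeasurable f -> measurable_fun setT (fun x => cmod (f x)).
Proof. by move=> [f1 f2]; rewrite /cmod; meas. Qed.

Lemma cmeasurable_inv f : cmeasurable f -> cmeasurable (fun x => (f x)^-1).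
Proof.
move=> [f1 f2]; split.
  have -> : (fun x => complex.Re (f x)^-1) =
      (fun x => complex.Re (f x) / (complex.Re (f x) ^+ 2 + complex.Im (f x) ^+ 2)).
    by apply/funext => x; case: (f x).
  by meas.
have -> : (fun x => complex.Im (f x)^-1) =
    (fun x => - (complex.Im (f x) / (complex.Re (f x) ^+ 2 + complex.Im (f x) ^+ 2))).
  by apply/funext => x; case: (f x) => a b /=; rewrite ?mulNr.
by meas.
Qed.

End Measurable.

Definition cpoly (a : nat -> R[i]) (N : nat) (z : R[i]) : R[i] := \sum_(k < N) a k * z ^+ k.

Lemma cmeasurable_cpoly d (T : measurableType d) a N (f : T -> R[i]) :
  cmeasurable f -> cmeasurable (fun x => cpoly a N (f x)).
Proof.
move=> mf; apply: cmeasurable_sum => k; apply: cmeasurableM; first exact: cmeasurable_cst.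
exact: cmeasurableX.
Qed.

Lemma cmeasurable_cpt : cmeasurable cpt.
Proof. by split => /=; meas. Qed.

End ComplexModulus.

(** * Roots of unity *)

Section RootsOfUnity.
Variable R : realType.

(** A [2 ^ n]-th root [w] of [-1] has order exactly [2 ^ (n + 1)]: the order divides that power of
    2, and a proper divisor would give [w ^ (2 ^ n) = 1]. *)
Lemma large_primitive_root n : exists N (w : R[i]), [/\ (n < N)%N, cmod w = 1 & N.-primitive_root w].
Proof.
pose h := (2 ^ n)%N; have h0 : (0 < h)%N by rewrite expn_gt0.
pose w : R[i] := h.-root (-1).
have wh : w ^+ h = -1 by rewrite rootCK.
have h2 : (0 < 2 ^ n.+1)%N by rewrite expn_gt0.
have wN : w ^+ (2 ^ n.+1) = 1 by rewrite expnS mulnC exprM wh sqrrN expr1n.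
exists (2 ^ n.+1)%N, w; split.
- by rewrite (leq_trans (ltn_expl n (isT : 1 < 2)%N)) // leq_exp2l.
- have : cmod w ^+ h = 1 by rewrite -cmodX wh cmodN cmod1.
  by move=> /eqP; rewrite pexpr_eq1 ?cmod_ge0 // => /eqP.
- have [m pm md] := prim_order_exists h2 wN.
  have /(dvdn_pfactor _ _ (isT : prime 2)) [e en me] := md.
  have [ee|ne] := eqVneq e n.+1; first by rewrite -ee -me.
  have : w ^+ h = 1.
    by apply/eqP; rewrite -(prim_order_dvd pm) me dvdn_exp2l // -ltnS ltn_neqAle ne en.
  by rewrite wh => /eqP; rewrite eq_sym -subr_eq0 opprK -mulr2n pnatr_eq0.
Qed.

Lemma sum_prim_root (N : nat) (w : R[i]) k : N.-primitive_root w ->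
  \sum_(j < N) w ^+ (j * k) = if (N %| k)%N then N%:R else 0.
Proof.
move=> pw; have N0 := prim_order_gt0 pw.
case: ifPn => Nk.
  rewrite (eq_bigr (fun=> 1)) ?sumr_const ?card_ord // => j _.
  by rewrite mulnC exprM (eqP (_ : w ^+ k == 1)) ?expr1n // -(prim_order_dvd pw).
have wk1 : w ^+ k - 1 != 0 by rewrite subr_eq0 -(prim_order_dvd pw).
apply: (mulfI wk1); rewrite mulr0.
under eq_bigr do rewrite mulnC exprM.
by rewrite -subrX1 -exprM mulnC exprM (prim_expr_order pw) expr1n subrr.
Qed.

End RootsOfUnity.

(** * Convexity of real powers *)

Section Convexity.
Variable R : realType.

(** The tangent of [x ^ p] at [m] lies below the graph; this is Young's inequality for [x] and
    [m ^ (p - 1)]. Jensen's and Hoelder's inequalities are later obtained by summing or integrating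
    it at a suitable [m]. *)
Lemma powR_tangent (p x m : R) : 1 < p -> 0 <= x -> 0 <= m ->
  p * m `^ (p - 1) * x <= x `^ p + (p - 1) * m `^ p.
Proof.
move=> p1 x0 m0.
have p0 : 0 < p by rewrite (lt_trans ltr01).
have pm1 : 0 < p - 1 by rewrite subr_gt0.
have q0 : 0 < p / (p - 1) by rewrite divr_gt0.
have conj : p^-1 + (p / (p - 1))^-1 = 1 by field; rewrite !gt_eqF.
have := conjugate_powR x0 (powR_ge0 m (p - 1)) p0 q0 conj.
rewrite -powRrM; have -> : (p - 1) * (p / (p - 1)) = p by field; rewrite gt_eqF.
move=> H; have := ler_wpM2l (ltW p0) H.
have -> : p * (x * m `^ (p - 1)) = p * m `^ (p - 1) * x by ring.
move=> /le_trans; apply.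
rewrite le_eqVlt; apply/orP; left; apply/eqP.
by field; rewrite !gt_eqF.
Qed.

(** The tangent inequality at the mean [m], averaged with weights [K]. *)
Lemma powR_jensen (I : finType) (K x : I -> R) (p : R) : 1 < p ->
  (forall i, 0 <= K i) -> (forall i, 0 <= x i) -> \sum_i K i = 1 ->
  (\sum_i K i * x i) `^ p <= \sum_i K i * x i `^ p.
Proof.
move=> p1 K0 x0 K1; set m := \sum_i K i * x i.
have m0 : 0 <= m by apply: sumr_ge0 => i _; rewrite mulr_ge0.
have : \sum_i K i * (p * m `^ (p - 1) * x i) <= \sum_i K i * (x i `^ p + (p - 1) * m `^ p).
  by apply: ler_sum => i _; rewrite ler_wpM2l // powR_tangent.
under [X in X <= _ -> _]eq_bigr do rewrite mulrCA.
rewrite -mulr_sumr -/m -mulrA [_ * m]mulrC mulr_powRB1 //; last by rewrite (lt_trans ltr01).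
under [X in _ <= X -> _]eq_bigr do rewrite mulrDr.
rewrite big_split /= -mulr_suml K1 mul1r.
set s := \sum_i _; lra.
Qed.

End Convexity.

(** * Monotonicity of circular means of polynomials *)

Section CircularMeans.
Variable R : realType.

(** Expanding the square with [w^* = w ^ (N - 1)] and summing over [j] keeps the pairs with
    [v = u + l] modulo [N]. Since [t + l < N], the congruence is an equality, and it has [t - l]
    solutions below [t], with truncated subtraction. *)
Lemma fejer_sum (N : nat) (w : R[i]) t l : N.-primitive_root w -> cmod w = 1 -> (t + l < N)%N ->
  \sum_(j < N) (cmod (\sum_(u < t) w ^+ (j * u)) ^+ 2)%:C%C * w ^+ (j * l) =
  N%:R * (t - l)%:R.
Proof.
move=> pw w1 tlN; have N0 := prim_order_gt0 pw.
have wc : w^*%C = w ^+ N.-1.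
  have w0 : w != 0 by rewrite -cmod_eq0 w1 oner_eq0.
  apply: (mulfI w0); rewrite -cmod_mul_conj w1 expr1n -exprS prednK //.
  by rewrite (prim_expr_order pw).
transitivity (\sum_(u < t) \sum_(v < t) \sum_(j < N) w ^+ (j * (u + l + v * N.-1))).
  under eq_bigr => j _.
    rewrite cmod_mul_conj rmorph_sum /= big_distrlr /= mulr_suml.
    under eq_bigr => u _.
      rewrite mulr_suml.
      under eq_bigr => v _.
        have -> : w ^+ (j * u) * (w ^+ (j * v))^*%C * w ^+ (j * l) = w ^+ (j * (u + l + v * N.-1)).
          by rewrite rmorphXn /= wc -exprM -!exprD; congr (_ ^+ _); lia.
        over.
      over.
    over.
  rewrite exchange_big /=; apply: eq_bigr => u _.
  by rewrite exchange_big.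
have E (u v : 'I_t) : \sum_(j < N) w ^+ (j * (u + l + v * N.-1)) = if (v == u + l :> nat)%N then N%:R else 0.
  rewrite (sum_prim_root _ pw).
  have -> // : (N %| u + l + v * N.-1)%N = (v == u + l :> nat)%N.
  apply/idP/eqP => [|->]; last first.
    by apply/dvdnP; exists (u + l)%N; case: N N0 {tlN pw wc} => // N _; rewrite /=; lia.
  have uN := ltn_ord u; have vN := ltn_ord v.
  move=> H; have H2 : (N %| v * N)%N by rewrite dvdn_mull.
  have H3 : (u + l + v * N.-1 + v = u + l + v * N)%N by case: N N0 {tlN pw wc H H2} => // N _; rewrite /=; lia.
  have : (u + l = v %[mod N])%N.
    rewrite -[in LHS](modnMDl v) addnC -H3 -modnDml (eqP H) add0n //.
  by rewrite !modn_small //; lia.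
transitivity (\sum_(u < t) (if (u + l < t)%N then N%:R else 0 : R[i])).
  apply: eq_bigr => u _.
  under eq_bigr do rewrite E.
  case: ifPn => ult.
    rewrite (bigD1 (Ordinal ult)) //= eqxx big1 ?addr0 // => v vu.
    by case: ifP => // /eqP vE; move: vu; rewrite -val_eqE /= vE eqxx.
  rewrite big1 // => v _; case: ifP => // /eqP vE.
  by move: ult; rewrite -vE ltn_ord.
rewrite -big_mkcond /=.
have -> : \sum_(u < t | (u + l < t)%N) (N%:R : R[i]) = N%:R * (\sum_(u < t | (u + l < t)%N) 1)%:R.
  by rewrite natr_sum mulr_sumr; apply: eq_bigr => u _; rewrite mulr1.
congr (_ * _%:R).
rewrite (eq_bigl (fun u : 'I_t => u < t - l)%N); last by move=> u; rewrite ltn_subRL addnC.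
by rewrite -(big_ord_widen t (fun=> 1%N)) ?leq_subr // sum1_card card_ord.
Qed.

(** Summation by parts done twice: the second difference of [rho ^ t] is [rho ^ t (1 - rho) ^ 2].
    Truncated subtraction makes [t + 1 - l] a tent function of [l], and the two last terms absorb
    the cut at [d]. For [rho] in [[0, 1]] all coefficients are nonnegative, and tents are the
    multipliers of Fejer kernels. *)
Lemma power_as_tents (rho : R) d l : (l <= d)%N ->
  \sum_(t < d) rho ^+ t * (1 - rho) ^+ 2 * (t.+1 - l)%:R + rho ^+ d * (1 - rho) * (d.+1 - l)%:R
    + rho ^+ d.+1 = rho ^+ l.
Proof.
elim: d => [|d IH].
  by rewrite leqn0 => /eqP ->; rewrite big_ord0 expr0 expr1 subn0; ring.
rewrite leq_eqVlt => /predU1P[->|ld].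
  rewrite big1 ?add0r => [|t _].
    by rewrite subSnn !exprS; ring.
  by rewrite (eqP (_ : t.+1 - d.+1 == 0)%N) ?mulr0 // subn_eq0.
rewrite -[RHS](IH ld) big_ord_recr /= !exprS.
have -> : (d.+2 - l)%:R = (d.+1 - l)%:R + 1 :> R by rewrite subSn ?natr1 // ltnW.
by ring.
Qed.

(* A positive kernel on the [N]-th roots of unity, built from Fejer kernels, which multiplies the
   coefficient of [z ^+ l] by [rho ^+ l] for every [l <= d]. *)
Lemma poisson_kernel (rho : R) d : 0 <= rho <= 1 ->
  exists N (w : R[i]) (K : 'I_N -> R), [/\ cmod w = 1, forall j, 0 <= K j &
   forall l, (l <= d)%N -> \sum_j (K j)%:C%C * w ^+ (j * l) = (rho ^+ l)%:C%C].
Proof.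
move=> /andP[r0 r1].
(* [N > 2 (d + 1)] prevents wrap-around in [fejer_sum] for kernels of order at most [d + 1] and
   [l <= d]. *)
have [N [w [nN w1 pw]]] := large_primitive_root R (d.+1 + d.+1).
have N0 := prim_order_gt0 pw.
pose F t (j : nat) : R := cmod (\sum_(u < t) w ^+ (j * u)) ^+ 2.
(* The mass [rho ^ (d + 1)] at [j = 0] realises the constant term of [power_as_tents]. *)
exists N, w, (fun j => N%:R^-1 * (\sum_(t < d) rho ^+ t * (1 - rho) ^+ 2 * F t.+1 j
   + rho ^+ d * (1 - rho) * F d.+1 j) + (if j == 0%N :> nat then rho ^+ d.+1 else 0)).
have F0 t j : 0 <= F t j by rewrite exprn_ge0 // cmod_ge0.
have r1' : 0 <= 1 - rho by rewrite subr_ge0.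
split => // [j|l ld].
  rewrite addr_ge0 //; last by case: ifP => // _; rewrite exprn_ge0.
  rewrite mulr_ge0 ?invr_ge0 // addr_ge0 //.
    by apply: sumr_ge0 => t _; rewrite !mulr_ge0 ?exprn_ge0 ?cmod_ge0.
  by rewrite !mulr_ge0 ?exprn_ge0 ?cmod_ge0.
have Nn0 : (N%:R : R[i]) != 0 by rewrite pnatr_eq0 -lt0n.
rewrite -[in RHS](power_as_tents rho ld).
transitivity (\sum_(j < N) (N%:R^-1 * (\sum_(t < d) (rho ^+ t * (1 - rho) ^+ 2)%:C%C * ((F t.+1 j)%:C%C * w ^+ (j * l))
    + (rho ^+ d * (1 - rho))%:C%C * ((F d.+1 j)%:C%C * w ^+ (j * l))) +
    (if j == 0%N :> nat then (rho ^+ d.+1)%:C%C else 0))).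
  apply: eq_bigr => j _.
  rewrite rmorphD /= rmorphM /= fmorphV /= rmorph_nat rmorphD /= rmorph_sum /= [in LHS]mulrDl.
  congr (_ + _).
    rewrite -[LHS]mulrA [in LHS]mulrDl [in LHS]mulr_suml; congr (_ * (_ + _)); last by rewrite rmorphM /= mulrA.
    by apply: eq_bigr => t _; rewrite [in LHS]rmorphM /= mulrA.
  case: ifP => [/eqP j0|]; last by rewrite mul0r.
  by rewrite j0 mul0n expr0 mulr1.
rewrite big_split /= -mulr_sumr; rewrite !rmorphD /=; congr (_ + _); last first.
  by rewrite (bigD1 (Ordinal N0)) //= big1 ?addr0 // => j; rewrite -val_eqE /= => /negPf ->.
rewrite big_split /= mulrDr; congr (_ + _); last first.
  rewrite -mulr_sumr (fejer_sum pw w1); last by lia.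
  by rewrite mulrCA mulKf // [RHS]rmorphM /= rmorph_nat.
rewrite exchange_big /= mulr_sumr rmorph_sum /=; apply: eq_bigr => t _.
rewrite -mulr_sumr (fejer_sum pw w1); last by have := ltn_ord t; lia.
by rewrite mulrCA mulKf // [RHS]rmorphM /= rmorph_nat.
Qed.

Lemma circ_sum (I : finType) (K : I -> R) (h : I -> R * R -> \bar R) r :
  (forall i, 0 <= K i) -> (forall i, measurable_fun setT (h i)) -> (forall i w, 0 <= h i w)%E ->
  (circ (fun w => \sum_i (K i)%:E * h i w) r = \sum_i (K i)%:E * circ (h i) r)%E.
Proof.
move=> K0 mh h0; rewrite /circ.
transitivity (\int[@leb2 R]_z \sum_i ((K i)%:E * ((puncdisk z)%:E * h i (on_circle r z))))%E.
  apply: eq_integral => z _; rewrite ge0_sume_distrr.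
    by apply: eq_bigr => i _; rewrite muleCA.
  by move=> i _; rewrite mule_ge0 // lee_fin.
have mz i : measurable_fun setT (fun z => (puncdisk z)%:E * h i (on_circle r z))%E.
  exact: measurable_circ_integrand.
have z0 i z : (0 <= (puncdisk z)%:E * h i (on_circle r z))%E by exact: circ_integrand_ge0.
rewrite ge0_integral_sum //.
- apply: eq_bigr => i _; have Ki : (0 <= (K i)%:E)%E by rewrite lee_fin.
  by rewrite ge0_integralZl //; exact: mz.
- by move=> i; apply: emeasurable_funM; [exact: measurable_cst|exact: mz].
- by move=> i z _; rewrite mule_ge0 // lee_fin.
Qed.

Definition polypow (p : R) (a : nat -> R[i]) N (v : R * R) : \bar R :=
  (cmod (cpoly a N (cpt v)) `^ p)%:E.

Lemma polypow_ge0 p a N v : (0 <= polypow p a N v)%E.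
Proof. by rewrite lee_fin powR_ge0. Qed.

Lemma measurable_polypow p a N : measurable_fun setT (polypow p a N).
Proof.
apply/measurable_EFinP; apply: (measurableT_comp (measurable_powR _)).
by apply: measurable_cmod; apply: cmeasurable_cpoly; exact: cmeasurable_cpt.
Qed.

Lemma cpt_on_circle (r : R) v : cpt (on_circle r v) = (r / Num.sqrt (sqn v))%:C%C * cpt v.
Proof. by case: v => x y; rewrite /on_circle /cpt /= /real_complex_def; apply/eqP; rewrite eq_complex /= !mul0r subr0 addr0 !eqxx. Qed.

(** By the kernel, the dilate by [rho] of a polynomial is an average of its rotations with
    nonnegative weights; the case [l = 0] says that they sum to 1. Jensen's inequality applies
    pointwise, and [circ] does not see rotations. *)
Lemma circ_polypow_mono p a N (r rho : R) : 1 < p -> 0 <= rho <= 1 ->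
  (circ (polypow p a N) (rho * r) <= circ (polypow p a N) r)%E.
Proof.
move=> p1 rho01.
have [M [w [K [w1 K0 Kl]]]] := poisson_kernel N rho01.
have K1 : \sum_j K j = 1.
  apply: (@complexI R); rewrite rmorph_sum /= -[RHS](Kl 0%N) //.
  by apply: eq_bigr => j _; rewrite muln0 expr0 mulr1.
pose rot (j : 'I_M) (v : R * R) : R * R :=
  (complex.Re (w ^+ j) * v.1 - complex.Im (w ^+ j) * v.2, complex.Im (w ^+ j) * v.1 + complex.Re (w ^+ j) * v.2).
have cptrot j v : cpt (rot j v) = w ^+ j * cpt v.
  rewrite /cpt /rot /=; case: (w ^+ j) => c s; apply/eqP; rewrite eq_complex /=.
  by rewrite [s * v.1 + _]addrC !eqxx.
have mh := measurable_polypow p a N.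
have mrot j : measurable_fun setT (rot j) by rewrite /rot; meas.
have mhr j : measurable_fun setT (fun v => polypow p a N (rot j v)) by exact: (measurableT_comp mh (mrot j)).
have -> : circ (polypow p a N) r = circ (fun v => \sum_j (K j)%:E * polypow p a N (rot j v))%E r.
  rewrite circ_sum //; last by move=> j v; exact: polypow_ge0.
  under eq_bigr => j _.
    rewrite (@circ_rotate _ (polypow p a N) (complex.Re (w ^+ j)) (complex.Im (w ^+ j))) //.
    - over.
    - by rewrite -cmod_sqr cmodX w1 !expr1n.
    - by move=> v; exact: polypow_ge0.
  rewrite -ge0_sume_distrl; last by move=> j _; rewrite lee_fin.
  by rewrite sumEFin K1 mul1e.
apply: le_circ => //.
- by apply: emeasurable_sum => j; have mj := mhr j; meas.
- by move=> v; exact: polypow_ge0.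
- by move=> v; apply: sume_ge0 => j _; rewrite mule_ge0 ?polypow_ge0 // lee_fin.
move=> v _; rewrite /polypow.
under eq_bigr do rewrite -EFinM.
rewrite sumEFin lee_fin.
apply: le_trans (powR_jensen (x := fun j => cmod (cpoly a N (cpt (rot j (on_circle r v))))) p1 K0 _ K1); last first.
  by move=> j; exact: cmod_ge0.
apply: ge0_ler_powR; rewrite ?nnegrE ?cmod_ge0 //.
- by rewrite ltW // (lt_trans ltr01).
- by apply: sumr_ge0 => j _; rewrite mulr_ge0 ?cmod_ge0.
set u := cpt (on_circle r v).
have -> : cpt (on_circle (rho * r) v) = rho%:C%C * u.
  by rewrite /u !cpt_on_circle mulrA -rmorphM /= mulrA.
have -> : cpoly a N (rho%:C%C * u) = \sum_j (K j)%:C%C * cpoly a N (w ^+ j * u).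
  rewrite /cpoly; under [RHS]eq_bigr do rewrite mulr_sumr.
  rewrite exchange_big /=; apply: eq_bigr => k _.
  rewrite exprMn -rmorphXn /= -(Kl k) ?(ltnW (ltn_ord k)) // mulr_suml mulr_sumr.
  by apply: eq_bigr => j _; rewrite exprMn -exprM; ring.
apply: (le_trans (cmod_sum _ _ _)); apply: ler_sum => j _.
by rewrite cptrot cmodM cmod_real ger0_norm.
Qed.

End CircularMeans.

(** * One-dimensional integrals on open intervals and inversion *)

Section OneVariableIntegrals.
Variable R : realType.
Local Notation mu := (@lebesgue_measure R).

Lemma tonelli_RR (f : R * R -> \bar R) : measurable_fun setT f -> (forall w, 0 <= f w)%E ->
  (\int[mu]_x \int[mu]_y f (x, y) = \int[mu]_y \int[mu]_x f (x, y))%E.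
Proof. by move=> mf f0; rewrite -leb2E // leb2Esym. Qed.

(** Whole-line integrals of [if]-expressions are the working form, since affine substitution and
    Tonelli are stated on the whole space. *)
Lemma integral_ooE (a b : R) (f : R -> R) :
  (\int[mu]_(s in `]a, b[) (f s)%:E = \int[mu]_s (if (a < s) && (s < b) then f s else 0)%:E)%E.
Proof.
rewrite integral_mkcond; apply: eq_integral => s _; rewrite patchE.
case: ifPn => h; first by move: h; rewrite inE /= in_itv /= => ->.
by case: ifPn => // h2; move: h; rewrite notin_setE /= in_itv /= h2.
Qed.

(** The integrand may blow up at both ends, as [s ^ (a - 1)] does at 0; the formula on closed
    subintervals passes to the limit by monotone convergence. *)
Lemma ge0_FTC_oo (a b la lb : R) (f F : R -> R) : a < b ->
  (forall x, a < x < b -> 0 <= f x) ->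
  (forall x, a < x < b -> {for x, continuous f}) ->
  (forall x, a < x < b -> is_derive x 1 F (f x)) ->
  F x @[x --> a^'+] --> la -> F x @[x --> b^'-] --> lb ->
  (\int[mu]_(x in `]a, b[) (f x)%:E = (lb - la)%:E)%E.
Proof.
move=> ab f0 cf dF Fa Fb.
(* With [n + 3] each margin is less than half the length, so no closed subinterval degenerates. *)
pose e n : R := (b - a) / n.+3%:R.
have ba0 : 0 < b - a by rewrite subr_gt0.
have e0 n : 0 < e n by rewrite divr_gt0.
have e2 n : e n < (b - a) / 2.
  by rewrite ltr_pM2l // ltf_pV2 ?posrE // ltr_nat.
have ecv : e n @[n --> \oo] --> 0.
  rewrite -(mulr0 (b - a)); apply: cvgM; first exact: cvg_cst.
  have := @cvg_harmonic R; rewrite -(cvg_shiftn 2) => H.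
  apply: cvg_trans H; apply: near_eq_cvg; near=> n; by rewrite /harmonic /= addn2.
pose D n := `[a + e n, b - e n]%classic.
have AB n : a + e n < b - e n by have := e2 n; lra.
have sub n x : a + e n <= x <= b - e n -> a < x < b by have := e0 n; lra.
have DU : `]a, b[%classic = \bigcup_n D n.
  apply/seteqP; split => x /=; rewrite in_itv /=; last first.
    by move=> [n _]; rewrite /D /= in_itv /=; exact: sub.
  move=> /andP[ax xb].
  have m0 : 0 < Num.min (x - a) (b - x) by rewrite lt_min !subr_gt0 ax.
  have : \forall n \near \oo, e n < Num.min (x - a) (b - x).
    by move: ecv => /cvgr_lt; apply.
  move=> [n _ /(_ n (leqnn n))]; rewrite lt_min => /andP[h1 h2].
  by exists n => //; rewrite /D /= in_itv /=; apply/andP; split; lra.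
have nD : nondecreasing_seq D.
  move=> m n mn; apply/subsetPset => x; rewrite /D /= !in_itv /=.
  have : e n <= e m by rewrite ler_pM2l // lef_pV2 ?posrE // ler_nat.
  by lra.
have mD n : measurable (D n) by exact: measurable_itv.
have mf : measurable_fun `]a, b[ f.
  apply: open_continuous_measurable_fun => [|x /set_mem /=]; first exact: interval_open.
  by rewrite in_itv /= => /cf.
have mfD n : measurable_fun (D n) (EFin \o f).
  apply/measurable_EFinP; apply: (measurable_funS _ _ mf) => //.
  by rewrite DU; exact: bigcup_sup.
have fD n x : D n x -> (0 <= (EFin \o f) x)%E.
  by rewrite /D /= in_itv /= => /sub /f0; rewrite lee_fin.
have := ge0_nondecreasing_set_cvg_integral nD mD mfD fD (mu := mu).
rewrite -DU => H; apply: (cvg_unique _ H) => //.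
have E n : (\int[mu]_(x in D n) (EFin \o f) x = (F (b - e n) - F (a + e n))%:E)%E.
  rewrite /D (@continuous_FTC2 _ _ F) //=.
  - apply: continuous_in_subspaceT => x /set_mem /=; rewrite in_itv /= => /sub /cf //.
  - have dF' x : a < x < b -> derivable F x 1 by move=> /dF [].
    have cF x : a < x < b -> {for x, continuous F}.
      by move=> /dF' /derivable1_diffP/differentiable_continuous.
    have le1 := AB n; have le2 := e0 n.
    split.
    + by move=> x; rewrite in_itv /= => /andP[h1 h2]; apply: dF'; lra.
    + by apply: cvg_at_right_filter; apply: cF; lra.
    + by apply: cvg_at_left_filter; apply: cF; lra.
  - move=> x; rewrite in_itv /= => /andP[h1 h2]; rewrite derive1E.
    by have [|_ ->] := dF x => //; have := e0 n; lra.
suff : (F (b - e n) - F (a + e n))%:E @[n --> \oo] --> (lb - la)%:E.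
  by apply: cvg_trans; apply: near_eq_cvg; near=> n; rewrite E.
apply: cvg_EFin; first by near=> n.
apply: cvgB.
- move/cvg_at_leftP : Fb; apply; split => [n|].
    by have := e0 n; lra.
  by rewrite -[X in _ --> X]subr0; apply: cvgB => //; exact: cvg_cst.
- move/cvg_at_rightP : Fa; apply; split => [n|].
    by have := e0 n; lra.
  by rewrite -[X in _ --> X]addr0; apply: cvgD => //; exact: cvg_cst.
Unshelve. all: by end_near. Qed.

Lemma integral_powR (a u : R) : 0 < a -> 0 < u ->
  (\int[mu]_(s in `]0%R, u[) (a * s `^ (a - 1))%:E = (u `^ a)%:E)%E.
Proof.
move=> a0 u0.
rewrite -[in RHS](subr0 (u `^ a)).
apply: (@ge0_FTC_oo 0 u 0 (u `^ a) (fun s => a * s `^ (a - 1)) (fun s => s `^ a)) => //.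
- by move=> x _; rewrite mulr_ge0 ?powR_ge0 // ltW.
- move=> x /andP[x0 _]; apply: cvgM; first exact: cvg_cst.
  have [h _] := is_derive1_powR (a - 1) x0.
  by move/derivable1_diffP/differentiable_continuous : h.
- by move=> x /andP[x0 _]; exact: is_derive1_powR.
- exact: powR_cvg0.
- apply: cvg_at_left_filter.
  have [h _] := is_derive1_powR a u0.
  by move/derivable1_diffP/differentiable_continuous : h.
Qed.

(* Inversion invariance of the Haar measure [ds / s]: test against [1_{1 < v < 2}], whose mass is [1],
   and use only dilations. *)
Lemma ge0_integral_inversion (c : R) (h : R -> \bar R) : 0 < c ->
  measurable_fun setT h -> (forall x, 0 <= h x)%E ->
  (\int[mu]_s ((if 0 < s then 1 else 0)%:E * h s) =
   \int[mu]_s ((if 0 < s then c * s^-1 ^+ 2 else 0)%:E * h (c / s)%R))%E.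
Proof.
move=> c0 mh h0.
pose e (v : R) : R := if (1 < v) && (v < 2) then 1 else 0.
pose o (v : R) : R := if 0 < v then 1 else 0.
have e0 v : 0 <= e v by rewrite /e; case: ifP.
have o0 v : 0 <= o v by rewrite /o; case: ifP.
have ei : (\int[mu]_v (e v)%:E = 1)%E.
  rewrite -(integral_ooE 1 2 (fun=> 1)) integral_cst //= mul1e lebesgue_measure_itv /= lte_fin.
  by rewrite ltr1n /= -EFinD; congr EFin; ring.
have me : measurable_fun setT e by rewrite /e /=; meas.
have mo : measurable_fun setT o by rewrite /o /=; meas.
symmetry.
pose G (u : R * R) := ((o u.1 * (c * u.1^-1 ^+ 2) * e u.2)%:E * h (c / u.1)%R)%E.
pose H (u : R * R) := ((o u.1 * o u.2 * (c * u.1^-1) * e (u.1 * u.2))%:E * h (c / u.1)%R)%E.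
pose K (u : R * R) := ((o u.1 * o u.2 * (c * u.1^-1) * e u.1)%:E * h (c * u.2 / u.1)%R)%E.
have mo1 : measurable_fun setT (fun u : R * R => o u.1) by apply: (measurableT_comp mo); meas.
have mo2 : measurable_fun setT (fun u : R * R => o u.2) by apply: (measurableT_comp mo); meas.
have me1 : measurable_fun setT (fun u : R * R => e u.1) by apply: (measurableT_comp me); meas.
have me2 : measurable_fun setT (fun u : R * R => e u.2) by apply: (measurableT_comp me); meas.
have me12 : measurable_fun setT (fun u : R * R => e (u.1 * u.2)) by apply: (measurableT_comp me); meas.
have mh1 : measurable_fun setT (fun u : R * R => h (c / u.1)) by apply: (measurableT_comp mh); meas.
have mh2 : measurable_fun setT (fun u : R * R => h (c * u.2 / u.1)) by apply: (measurableT_comp mh); meas.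
have mG : measurable_fun setT G by rewrite /G; meas.
have mH : measurable_fun setT H by rewrite /H; meas.
have mK : measurable_fun setT K by rewrite /K; meas.
have oV (v : R) : o v * v^-1 >= 0 by rewrite /o; case: ifP => [v0|]; rewrite ?mul0r // mul1r invr_ge0 ltW.
have cV (v : R) : 0 <= c * v^-1 ^+ 2 by apply: mulr_ge0; [exact: ltW|exact: sqr_ge0].
have ooV (v w : R) : 0 <= o v * o w * (c * v^-1).
  have -> : o v * o w * (c * v^-1) = c * (o w * (o v * v^-1)) by ring.
  by apply: mulr_ge0; [exact: ltW|exact: mulr_ge0].
have G0 u : (0 <= G u)%E.
  by rewrite mule_ge0 // lee_fin; apply: mulr_ge0 => //; exact: mulr_ge0.
have H0 u : (0 <= H u)%E by rewrite mule_ge0 // lee_fin mulr_ge0.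
have K0 u : (0 <= K u)%E by rewrite mule_ge0 // lee_fin mulr_ge0.
transitivity (\int[mu]_s \int[mu]_v G (s, v))%E.
  apply: eq_integral => s _; rewrite /G /=.
  under eq_integral do rewrite EFinM muleAC.
  rewrite ge0_integralZl //.
  - rewrite ei mule1 /o; case: ifP => _; first by rewrite mul1r.
    by rewrite mul0r.
  - by meas.
  - by move=> v _; rewrite lee_fin.
  - by rewrite mule_ge0 // lee_fin; exact: mulr_ge0.
transitivity (\int[mu]_s \int[mu]_w H (s, w))%E.
  apply: eq_integral => s _.
  have [s0|s0] := ltP 0 s; last first.
    by rewrite !integral0_eq // => v _; rewrite /G /H /= /o ltNge s0 /= ?mul0r mul0e.
  have sn0 : s != 0 by rewrite gt_eqF.
  have mGs : measurable_fun setT (fun v => G (s, v)) by apply: (measurableT_comp mG); meas.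
  rewrite (ge0_integral_affine 0 sn0 mGs (fun v => G0 (s, v))) -ge0_integralZl //; last first.
    by apply: (measurableT_comp mGs); meas.
  apply: eq_integral => w _; rewrite /G /H /= addr0 muleA -EFinM gtr0_norm //.
  congr (_%:E * _)%E.
  have [w0|w0] := ltP 0 w; first by rewrite {3}/o w0; field.
  have -> : e (s * w) = 0; last by rewrite !mulr0.
  by rewrite /e; case: ifP => // /andP[h1 _]; have := mulr_ge0_le0 (ltW s0) w0; lra.
rewrite (tonelli_RR mH) //.
transitivity (\int[mu]_w \int[mu]_y K (y, w))%E.
  apply: eq_integral => w _.
  have [w0|w0] := ltP 0 w; last first.
    by rewrite !integral0_eq // => v _; rewrite /K /H /= {2}/o ltNge w0 /= ?mulr0 ?mul0r mul0e.
  have wn0 : w != 0 by rewrite gt_eqF.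
  have mKw : measurable_fun setT (fun y => K (y, w)) by apply: (measurableT_comp mK); meas.
  rewrite (ge0_integral_affine 0 wn0 mKw (fun y => K0 (y, w))) -ge0_integralZl //; last first.
    by apply: (measurableT_comp mKw); meas.
  apply: eq_integral => s _; rewrite /K /H /= addr0 muleA -EFinM gtr0_norm //.
  have -> : o (w * s) = o s by rewrite /o pmulr_rgt0.
  have [s0|s0] := ltP 0 s; last by rewrite /o ltNge s0 /= !mul0r mulr0 !mul0e.
  have -> : c * w / (w * s) = c / s by field; rewrite wn0 gt_eqF.
  congr (_%:E * _)%E; rewrite [s * w]mulrC; field.
  by rewrite wn0 gt_eqF.
rewrite -(tonelli_RR mK) //.
transitivity (\int[mu]_y ((e y)%:E * \int[mu]_s ((o s)%:E * h s)))%E; last first.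
  under eq_integral do rewrite muleC.
  rewrite ge0_integralZl //.
  - by rewrite ei mule1.
  - by meas.
  - by move=> v _; rewrite lee_fin.
  - by apply: integral_ge0 => v _; rewrite mule_ge0 // lee_fin.
apply: eq_integral => y _.
have [y0|y0] := ltP 0 y; last first.
  have -> : e y = 0 by rewrite /e; case: ifP => // /andP[]; rewrite ltNge (le_trans y0).
  by rewrite mul0e integral0_eq // => w _; rewrite /K /= /o ltNge y0 /= !mul0r mul0e.
have cy0 : c / y != 0 by rewrite mulf_neq0 ?invr_eq0 ?gt_eqF.
have mho : measurable_fun setT (fun s => (o s)%:E * h s)%E by meas.
rewrite (@ge0_integral_affine _ (c / y) 0 (fun s => (o s)%:E * h s)%E) //; last first.
  by move=> s; rewrite mule_ge0 // lee_fin.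
rewrite muleA -EFinM -ge0_integralZl //.
- apply: eq_integral => w _; rewrite /K /= addr0 muleA -EFinM.
  have -> : o (c / y * w) = o w by rewrite /o pmulr_rgt0 // divr_gt0.
  rewrite [c * w / y]mulrAC; congr (_%:E * _)%E.
  by rewrite gtr0_norm ?divr_gt0 // {1}/o y0 mul1r; ring.
- by apply: (measurableT_comp mho); meas.
- by move=> w _; rewrite mule_ge0 // lee_fin.
- by rewrite lee_fin mulr_ge0.
Qed.

End OneVariableIntegrals.

(** * The Beta function: recursions, bounds near the diagonal, a product formula *)

Section BetaFunction.
Variable R : realType.
Local Notation mu := (@lebesgue_measure R).

Definition bker (a c s : R) : R := if (0 < s) && (s < 1) then s `^ (a - 1) * (1 - s) `^ (c - 1) else 0.

Definition ebeta (a c : R) : \bar R := (\int[mu]_s (bker a c s)%:E)%E.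

Lemma bker_ge0 a c s : 0 <= bker a c s.
Proof. by rewrite /bker; case: ifP => // _; rewrite mulr_ge0 ?powR_ge0. Qed.

Lemma measurable_bker a c : measurable_fun setT (bker a c).
Proof. by rewrite /bker /=; meas. Qed.

Lemma ebeta_ge0 a c : (0 <= ebeta a c)%E.
Proof. by apply: integral_ge0 => s _; rewrite lee_fin bker_ge0. Qed.

Lemma ebeta_sym a c : ebeta a c = ebeta c a.
Proof.
have N1 : (-1 : R) != 0 by rewrite oppr_eq0 oner_eq0.
have mb : measurable_fun setT (EFin \o bker a c) by apply/measurable_EFinP; exact: measurable_bker.
rewrite /ebeta (ge0_integral_affine 1 N1 mb); last by move=> s; rewrite lee_fin bker_ge0.
rewrite normrN1 mul1e; apply: eq_integral => s _ /=; congr EFin.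
rewrite /bker mulN1r [- s + 1]addrC; have -> : 1 - (1 - s) = s by ring.
have -> : (0 < 1 - s) && (1 - s < 1) = (0 < s) && (s < 1).
  by rewrite subr_gt0 gtrDl oppr_lt0 andbC.
by case: ifP => // _; rewrite mulrC.
Qed.

(** All comparisons of Beta values below are instances; two terms on the right leave room for
    inequalities between geometric and arithmetic means. *)
Lemma le_ebeta2 (a c a1 c1 a2 c2 l1 l2 : R) : 0 <= l1 -> 0 <= l2 ->
  (forall s, 0 < s < 1 -> s `^ (a - 1) * (1 - s) `^ (c - 1) <=
    l1 * (s `^ (a1 - 1) * (1 - s) `^ (c1 - 1)) + l2 * (s `^ (a2 - 1) * (1 - s) `^ (c2 - 1))) ->
  (ebeta a c <= l1%:E * ebeta a1 c1 + l2%:E * ebeta a2 c2)%E.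
Proof.
move=> l10 l20 H.
have m1 := measurable_bker a1 c1; have m2 := measurable_bker a2 c2; have m0 := measurable_bker a c.
rewrite /ebeta -!ge0_integralZl//; try by first [by meas|by move=> s _; rewrite lee_fin bker_ge0].
rewrite -ge0_integralD//; try by first [by meas|by move=> s _; rewrite -EFinM lee_fin mulr_ge0 // bker_ge0].
apply: ge0_le_integral => //.
- by move=> s _; rewrite lee_fin bker_ge0.
- by meas.
- by meas.
by move=> s _; rewrite -!EFinM -EFinD lee_fin /bker; case: ifP => [/H //|_]; rewrite !mulr0 addr0.
Qed.

Lemma ebeta_split a c : 0 < a -> 0 < c -> (ebeta a c = ebeta (a + 1) c + ebeta a (c + 1))%E.
Proof.
move=> a0 c0.
have m1 := measurable_bker (a + 1) c; have m2 := measurable_bker a (c + 1).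
rewrite /ebeta -ge0_integralD//; try by first [by meas|by move=> s _; rewrite lee_fin bker_ge0].
apply: eq_integral => s _; rewrite -EFinD; congr EFin; rewrite /bker.
case: ifP => [/andP[s0 s1]|_]; last by rewrite addr0.
have s1' : 0 <= 1 - s by rewrite subr_ge0 ltW.
rewrite !addrK -(mulr_powRB1 (ltW s0) a0) -(mulr_powRB1 s1' c0); ring.
Qed.

Lemma integral_powR_0 (a u : R) : 0 < a -> 0 < u ->
  (\int[mu]_s (if (0 < s) && (s < u) then a * s `^ (a - 1) else 0)%:E = (u `^ a)%:E)%E.
Proof. by move=> a0 u0; rewrite -(integral_powR a0 u0) integral_ooE. Qed.

Lemma integral_powR_1 (c u : R) : 0 < c -> u < 1 ->
  (\int[mu]_s (if (u < s) && (s < 1) then c * (1 - s) `^ (c - 1) else 0)%:E = ((1 - u) `^ c)%:E)%E.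
Proof.
move=> c0 u1; have u0 : 0 < 1 - u by rewrite subr_gt0.
rewrite -(integral_powR_0 c0 u0).
have N1 : (-1 : R) != 0 by rewrite oppr_eq0 oner_eq0.
rewrite [RHS](@ge0_integral_affine _ (-1) 1 (fun s => (if (0 < s) && (s < 1 - u) then c * s `^ (c - 1) else 0)%:E)) //.
- rewrite normrN1 mul1e; apply: eq_integral => s _; congr EFin.
  rewrite mulN1r [- s + 1]addrC subr_gt0 ltrD2l ltrN2 andbC //.
- by meas.
- by move=> s; rewrite lee_fin; case: ifP => // _; rewrite mulr_ge0 ?powR_ge0 // ltW.
Qed.

(** Integration by parts in the form of Tonelli's theorem for [a u ^ (a - 1) c (1 - s) ^ (c - 1)] on
    the triangle [0 < u < s < 1], valid before finiteness is known. *)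
Lemma ebeta_parts a c : 0 < a -> 0 < c -> (a%:E * ebeta a (c + 1) = c%:E * ebeta (a + 1) c)%E.
Proof.
move=> a0 c0.
pose T (w : R * R) : R := if (0 < w.1) && (w.1 < w.2) && (w.2 < 1) then
  (a * w.1 `^ (a - 1)) * (c * (1 - w.2) `^ (c - 1)) else 0.
have mT : measurable_fun setT (EFin \o T) by apply/measurable_EFinP; rewrite /T /=; meas.
have T0 w : (0 <= (EFin \o T) w)%E.
  by rewrite lee_fin /T; case: ifP => // _; rewrite !mulr_ge0 ?powR_ge0 // ltW.
transitivity (\int[mu]_u \int[mu]_s (EFin \o T) (u, s))%E.
  symmetry.
  rewrite -ge0_integralZl//; last 3 first.
  - by apply/measurable_EFinP; exact: measurable_bker.
  - by move=> s _; rewrite lee_fin bker_ge0.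
  - by rewrite lee_fin ltW.
  apply: eq_integral => u _; rewrite /bker.
  have [u0|u0] := ltP 0 u; last first.
    by rewrite mule0 integral0_eq // => s _ /=; rewrite /T /= ltNge u0.
  have [u1|u1] := ltP u 1; last first.
    rewrite mule0 integral0_eq // => s _ /=; rewrite /T /= u0 /=.
    by case: ifP => // /andP[h1 h2]; exfalso; lra.
  rewrite /= addrK -EFinM mulrA EFinM -(integral_powR_1 c0 u1) -ge0_integralZl//; last 3 first.
  - by meas.
  - by move=> s _; rewrite lee_fin; case: ifP => // _; rewrite mulr_ge0 ?powR_ge0 // ltW.
  - by rewrite lee_fin mulr_ge0 ?powR_ge0 // ltW.
  apply: eq_integral => s _; rewrite /T /= u0 /= -EFinM; congr EFin.
  by case: ifP; rewrite ?mulr0.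
rewrite (tonelli_RR mT T0).
rewrite -ge0_integralZl//; last 3 first.
- by apply/measurable_EFinP; exact: measurable_bker.
- by move=> s _; rewrite lee_fin bker_ge0.
- by rewrite lee_fin ltW.
apply: eq_integral => s _; rewrite /bker.
have [s1|s1] := ltP s 1; last first.
  by rewrite andbF mule0 integral0_eq // => u _ /=; rewrite /T /= [s < 1]ltNge s1 /= andbF.
have [s0|s0] := ltP 0 s; last first.
  rewrite mule0 integral0_eq // => u _ /=; rewrite /T /=.
  by case: ifP => // /andP[/andP[h1 h2] _]; exfalso; lra.
rewrite /= addrK -EFinM mulrCA [s `^ a * _]mulrC.
rewrite [X in X%:E](_ : _ = (c * (1 - s) `^ (c - 1)) * s `^ a); last by ring.
rewrite EFinM -(integral_powR_0 a0 s0) -ge0_integralZl//; last 3 first.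
- by meas.
- by move=> u _; rewrite lee_fin; case: ifP => // _; rewrite mulr_ge0 ?powR_ge0 // ltW.
- by rewrite lee_fin mulr_ge0 ?powR_ge0 // ltW.
apply: eq_integral => u _; rewrite /T /= s1 andbT -EFinM; congr EFin.
by case: ifP => _; rewrite ?mulr0 // mulrC.
Qed.

Lemma ebeta_rec a c : 0 < a -> 0 < c -> (a%:E * ebeta a c = (a + c)%:E * ebeta (a + 1) c)%E.
Proof.
move=> a0 c0; rewrite (ebeta_split a0 c0) ge0_muleDr ?ebeta_ge0 // (ebeta_parts a0 c0).
by rewrite -ge0_muleDl ?lee_fin ?(ltW a0) ?(ltW c0).
Qed.

Lemma powR_le1 (u b : R) : 0 <= u <= 1 -> 0 <= b -> u `^ b <= 1.
Proof.
move=> /andP[u0 u1] b0; have e : (1 : R) `^ b = 1 by rewrite powR1.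
by rewrite -[X in _ <= X]e; apply: ge0_ler_powR; rewrite ?nnegrE.
Qed.

Lemma ebeta_le1 a c : 1 <= a -> 1 <= c -> (ebeta a c <= 1)%E.
Proof.
move=> a1 c1.
have := @integral_powR_0 1 1 ltr01 ltr01; rewrite powR1 => <-.
apply: ge0_le_integral => //.
- by move=> s _; rewrite lee_fin bker_ge0.
- by apply/measurable_EFinP; exact: measurable_bker.
- by meas.
move=> s _; rewrite lee_fin /bker; case: ifP => // /andP[s0 s1].
rewrite mul1r subrr powRr0 mulr_ile1 ?powR_ge0 ?powR_le1 ?subr_ge0 //; apply/andP; split; lra.
Qed.

(** Two uses of the recursion raise both parameters above 1, where the integrand is at most 1. *)
Lemma ebeta_fin a c : 0 < a -> 0 < c -> ebeta a c \is a fin_num.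
Proof.
move=> a0 c0.
have a10 : 0 < a + 1 by rewrite addr_gt0.
have h : (a%:E * (c%:E * ebeta a c) < +oo)%E.
  rewrite muleCA (ebeta_rec a0 c0) muleCA [ebeta (a + 1) c]ebeta_sym (ebeta_rec c0 a10).
  have le : (ebeta (c + 1) (a + 1) <= 1)%E by apply: ebeta_le1; rewrite lerDr ltW.
  have lf : ebeta (c + 1) (a + 1) \is a fin_num.
    by rewrite ge0_fin_numE ?ebeta_ge0 // (le_lt_trans le) // ltry.
  by rewrite -(fineK lf) -!EFinM ltry.
rewrite ge0_fin_numE ?ebeta_ge0 //.
have acp : (0 < (a * c)%:E)%E by rewrite lte_fin mulr_gt0.
move: h; rewrite muleA -EFinM; have := ebeta_ge0 a c.
by case: (ebeta a c) => [r _ _|_|//]; rewrite ?ltry // gt0_muley.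
Qed.

(* Locked: otherwise [ring] and [lra] compare distinct values by unfolding the integral. *)
Definition rbeta : R -> R -> R := locked (fun a c => fine (ebeta a c)).

Lemma rbeta_def a c : rbeta a c = fine (ebeta a c).
Proof. by rewrite /rbeta -lock. Qed.

Lemma rbetaE a c : 0 < a -> 0 < c -> ebeta a c = (rbeta a c)%:E.
Proof. by move=> a0 c0; rewrite rbeta_def fineK // ebeta_fin. Qed.

Lemma rbeta_sym a c : rbeta a c = rbeta c a.
Proof. by rewrite !rbeta_def ebeta_sym. Qed.

Lemma rbeta_ge0 a c : 0 <= rbeta a c.
Proof. by rewrite rbeta_def; exact/fine_ge0/ebeta_ge0. Qed.

Lemma rbeta_recl a c : 0 < a -> 0 < c -> a * rbeta a c = (a + c) * rbeta (a + 1) c.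
Proof.
move=> a0 c0; have := ebeta_rec a0 c0.
have a10 : 0 < a + 1 by rewrite addr_gt0.
by rewrite (rbetaE a0 c0) (rbetaE a10 c0) -!EFinM => -[].
Qed.

Lemma rbeta_recr a c : 0 < a -> 0 < c -> c * rbeta a c = (a + c) * rbeta a (c + 1).
Proof. by move=> a0 c0; rewrite (rbeta_sym a c) (rbeta_recl c0 a0) (rbeta_sym a (c + 1)) [c + a]addrC. Qed.

Lemma rbeta_step a c : 0 < a -> 0 < c ->
  (a * c) * rbeta a c = ((a + c) * (a + c + 1)) * rbeta (a + 1) (c + 1).
Proof.
move=> a0 c0; have a10 : 0 < a + 1 by rewrite addr_gt0.
have e1 := rbeta_recl a0 c0; have e2 := rbeta_recr a10 c0.
transitivity (c * (a * rbeta a c)); first by ring.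
rewrite e1; transitivity ((a + c) * (c * rbeta (a + 1) c)); first by ring.
by rewrite e2; ring.
Qed.

Lemma le_rbeta2 (a c a1 c1 a2 c2 l1 l2 : R) : 0 < a -> 0 < c -> 0 < a1 -> 0 < c1 -> 0 < a2 -> 0 < c2 ->
  0 <= l1 -> 0 <= l2 ->
  (forall s, 0 < s < 1 -> s `^ (a - 1) * (1 - s) `^ (c - 1) <=
    l1 * (s `^ (a1 - 1) * (1 - s) `^ (c1 - 1)) + l2 * (s `^ (a2 - 1) * (1 - s) `^ (c2 - 1))) ->
  rbeta a c <= l1 * rbeta a1 c1 + l2 * rbeta a2 c2.
Proof.
move=> a0 c0 a10 c10 a20 c20 l10 l20 H; have := le_ebeta2 l10 l20 H.
by rewrite (rbetaE a0 c0) (rbetaE a10 c10) (rbetaE a20 c20) -!EFinM -EFinD lee_fin.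
Qed.

Lemma weighted_amgm (x u v : R) : 0 < x < 1 -> 0 <= u -> 0 <= v -> u `^ x * v `^ (1 - x) <= x * u + (1 - x) * v.
Proof.
move=> /andP[x0 x1] u0 v0; have x1' : 0 < 1 - x by rewrite subr_gt0.
have xi : 0 < x^-1 by rewrite invr_gt0.
have xi' : 0 < (1 - x)^-1 by rewrite invr_gt0.
have := conjugate_powR (powR_ge0 u x) (powR_ge0 v (1 - x)) xi xi'.
rewrite !invrK -!powRrM mulfV ?gt_eqF // mulfV ?gt_eqF // !powRr1 //.
by rewrite addrC subrK => /(_ erefl); rewrite [u * x]mulrC [v * _]mulrC.
Qed.

Lemma powRDp (s e f : R) : 0 < s -> s `^ (e + f) = s `^ e * s `^ f.
Proof. by move=> s0; rewrite powRD // (gt_eqF s0) implybT. Qed.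

Lemma powRDn (s e : R) : 0 < s -> s `^ (e + 1) = s `^ e * s.
Proof. by move=> s0; rewrite powRDp // powRr1 // ltW. Qed.

Section CentralBeta.
Variables (x m : R).
Hypotheses (x01 : 0 < x < 1) (m0 : 0 < m).

Let x0 : 0 < x. Proof. by case/andP: x01. Qed.
Let x1 : 0 < 1 - x. Proof. by case/andP: x01 => _; rewrite subr_gt0. Qed.
Let xm : 0 < x + m. Proof. exact: addr_gt0. Qed.
Let xm1 : 0 < 1 - x + m. Proof. exact: addr_gt0. Qed.
Let m1 : 0 < m + 1. Proof. exact: addr_gt0. Qed.
Let h0 : 0 < 2^-1 + m. Proof. by rewrite addr_gt0 // invr_gt0. Qed.
Let i2 : 0 <= 2^-1 :> R. Proof. by rewrite invr_ge0. Qed.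

Lemma rbeta_diag : rbeta (m + 1) m = rbeta m m / 2 /\ rbeta m (m + 1) = rbeta m m / 2.
Proof.
have e1 := rbeta_recl m0 m0; have e2 : rbeta m (m + 1) = rbeta (m + 1) m by rewrite rbeta_sym.
rewrite e2; have -> : rbeta (m + 1) m = rbeta m m / 2; last by [].
have mn0 : m != 0 by rewrite gt_eqF.
by apply: (mulfI mn0); rewrite mulrA e1; field.
Qed.

(** Pointwise [s ^ x (1 - s) ^ (1 - x) <= x s + (1 - x) (1 - s)], and raising either parameter of
    the diagonal value by 1 halves it. *)
Lemma rbeta_central_le : rbeta (x + m) (1 - x + m) <= rbeta m m / 2.
Proof.
have [d1 d2] := rbeta_diag.
have -> : rbeta m m / 2 = x * rbeta (m + 1) m + (1 - x) * rbeta m (m + 1) by rewrite d1 d2; ring.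
apply: (le_rbeta2 xm xm1 m1 m0 m0 m1 (ltW x0) (ltW x1)) => s /andP[s0 s1].
have s1' : 0 < 1 - s by rewrite subr_gt0.
have := weighted_amgm x01 (ltW s0) (ltW s1').
have P : 0 <= s `^ (m - 1) * (1 - s) `^ (m - 1) by rewrite mulr_ge0 ?powR_ge0.
move=> /(ler_wpM2l P).
have -> : x + m - 1 = x + (m - 1) by ring.
have -> : 1 - x + m - 1 = 1 - x + (m - 1) by ring.
have -> : m + 1 - 1 = (m - 1) + 1 by ring.
rewrite !powRDn // !powRDp //.
by congr (_ <= _); ring.
Qed.

(** By symmetry the right-hand side is the mean of a kernel and its mirror image, and their
    geometric mean does not depend on [x]. *)
Lemma rbeta_central_ge : rbeta (2^-1 + m) (2^-1 + m) <= rbeta (x + m) (1 - x + m).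
Proof.
have -> : rbeta (x + m) (1 - x + m) = 2^-1 * rbeta (x + m) (1 - x + m) + 2^-1 * rbeta (1 - x + m) (x + m).
  by rewrite [rbeta (1 - x + m) _]rbeta_sym; field.
apply: (le_rbeta2 h0 h0 xm xm1 xm1 xm i2 i2) => s /andP[s0 s1].
have s1' : 0 < 1 - s by rewrite subr_gt0.
pose h1 := s `^ (x / 2) * (1 - s) `^ ((1 - x) / 2).
pose h2 := s `^ ((1 - x) / 2) * (1 - s) `^ (x / 2).
have P : 0 <= s `^ (m - 1) * (1 - s) `^ (m - 1) by rewrite mulr_ge0 ?powR_ge0.
have sq (u e : R) : 0 < u -> u `^ e = u `^ (e / 2) * u `^ (e / 2).
  by move=> u0; rewrite -powRDp // -splitr.
have : h1 * h2 <= 2^-1 * h1 ^+ 2 + 2^-1 * h2 ^+ 2 by have := sqr_ge0 (h1 - h2); lra.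
move=> /(ler_wpM2l P).
have -> : x + m - 1 = x + (m - 1) by ring.
have -> : 1 - x + m - 1 = 1 - x + (m - 1) by ring.
have -> : 2^-1 + m - 1 = (x / 2 + (1 - x) / 2) + (m - 1) by field.
rewrite ![_ `^ (_ + (m - 1))]powRDp //.
rewrite ![_ `^ (x / 2 + _)]powRDp //.
rewrite [s `^ x]sq // [(1 - s) `^ (1 - x)]sq // [s `^ (1 - x)]sq // [(1 - s) `^ x]sq // /h1 /h2.
by congr (_ <= _); ring.
Qed.

Lemma rbeta_half_ge : 2 * rbeta (m + 1) (m + 1) <= rbeta (2^-1 + m) (2^-1 + m).
Proof.
suff : rbeta (m + 1) (m + 1) <= 2^-1 * rbeta (2^-1 + m) (2^-1 + m) + 0 * rbeta (2^-1 + m) (2^-1 + m) by lra.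
apply: (le_rbeta2 m1 m1 h0 h0 h0 h0 i2 (lexx 0)) => s /andP[s0 s1].
have s1' : 0 < 1 - s by rewrite subr_gt0.
pose w := s `^ 2^-1 * (1 - s) `^ 2^-1.
have w2 : w ^+ 2 = s * (1 - s) by rewrite exprMn !powR12_sqrt ?ltW // !sqr_sqrtr // ltW.
have w0 : 0 <= w by rewrite mulr_ge0 ?powR_ge0.
have P : 0 <= s `^ (m - 1) * (1 - s) `^ (m - 1) by rewrite mulr_ge0 ?powR_ge0.
have wl : w <= 2^-1.
  rewrite -(@ler_pXn2r _ 2) ?nnegrE // ?invr_ge0 // w2.
  by have := sqr_ge0 (s - 2^-1); lra.
have : w ^+ 2 <= 2^-1 * w by rewrite expr2 ler_wpM2r.
rewrite w2 => /(ler_wpM2l P).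
have -> : 2^-1 + m - 1 = 2^-1 + (m - 1) by ring.
have -> : m + 1 - 1 = (m - 1) + 1 by ring.
rewrite mul0r addr0 !powRDn // ![_ `^ (2^-1 + _)]powRDp // /w.
by congr (_ <= _); ring.
Qed.

(** With [rbeta_central_ge] this shows that the ratio of the two Beta values tends to 1 as [m]
    grows, with an explicit rate; it takes the place of Stirling asymptotics. *)
Lemma rbeta_central_bounds : rbeta (x + m) (1 - x + m) <= (1 + (2 * m)^-1) * rbeta (2^-1 + m) (2^-1 + m).
Proof.
apply: (le_trans rbeta_central_le).
have e := rbeta_step m0 m0.
have m21 : 0 < 2 * m + 1 by rewrite addr_gt0 // mulr_gt0.
have E : rbeta m m / 2 = (1 + (2 * m)^-1) * (2 * rbeta (m + 1) (m + 1)).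
  have mm : m * m != 0 by rewrite mulf_neq0 // gt_eqF.
  by apply: (mulfI mm); rewrite mulrA e; field; rewrite gt_eqF.
have i0 : 0 <= 1 + (2 * m)^-1 by rewrite addr_ge0 // invr_ge0 mulr_ge0 // ltW.
by rewrite E; exact: ler_wpM2l i0 _ _ rbeta_half_ge.
Qed.

End CentralBeta.

Lemma rbeta11 : rbeta 1 1 = 1.
Proof.
apply: EFin_inj; rewrite -rbetaE // /ebeta.
have := @integral_powR_0 1 1 ltr01 ltr01; rewrite powR1 => <-.
apply: eq_integral => s _; rewrite /bker subrr; case: ifP => // _.
by rewrite !powRr0 mulr1.
Qed.

Lemma rbeta1l c : 0 < c -> rbeta 1 c = c^-1.
Proof.
move=> c0; have := integral_powR_1 c0 ltr01; rewrite subr0 powR1 => e.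
have : (c%:E * ebeta 1 c = 1)%E.
  rewrite -e -ge0_integralZl//; last 3 first.
  - by apply/measurable_EFinP; exact: measurable_bker.
  - by move=> s _; rewrite lee_fin bker_ge0.
  - by rewrite lee_fin ltW.
  apply: eq_integral => s _; rewrite -EFinM /bker subrr; congr EFin.
  by case: ifP => _; rewrite ?mulr0 // powRr0 mul1r.
rewrite rbetaE // -EFinM => -[] h; apply: (mulfI (lt0r_neq0 c0)).
by rewrite h mulfV // gt_eqF.
Qed.

Lemma rbeta_nat_gt0 m : 0 < rbeta m.+1%:R m.+1%:R.
Proof.
elim: m => [|m IH]; first by rewrite rbeta11.
have m0 : 0 < m.+1%:R :> R by [].
have := rbeta_step m0 m0; rewrite natr1 => e.
have K0 : 0 < (m.+1%:R + m.+1%:R) * (m.+1%:R + m.+1%:R + 1) :> R by rewrite mulr_gt0.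
by rewrite -(pmulr_rgt0 _ K0) -e !mulr_gt0.
Qed.

(** The partial products of Euler's product for [cos (pi * y)]. *)
Definition cosprod (y : R) m := \prod_(k < m) (1 - 4 * y ^+ 2 / (k.*2.+1)%:R ^+ 2).

(** Compares [rbeta_step] at [x] and at [1 / 2]: with [y = x - 1 / 2], the factor
    [(x + m) (1 - x + m)] equals [(m + 1 / 2) ^ 2 - y ^ 2], that is [(m + 1 / 2) ^ 2] times the next
    factor of [cosprod]. *)
Lemma rbeta_prod (x : R) m : 0 < x < 1 ->
  rbeta (x + m%:R) (1 - x + m%:R) * rbeta 2^-1 2^-1 =
  cosprod (x - 2^-1) m * rbeta (2^-1 + m%:R) (2^-1 + m%:R) * rbeta x (1 - x).
Proof.
have alg (A A1 B B1 b0 bx E a h K c : R) : K != 0 -> a = c * h -> a * A = K * A1 -> h * B = K * B1 ->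
    A * b0 = E * B * bx -> A1 * b0 = (E * c) * B1 * bx.
  move=> K0 ac e1 e2 e; apply: (mulfI K0).
  have -> : K * (A1 * b0) = a * (A * b0) by rewrite [LHS]mulrA -e1 [RHS]mulrA.
  rewrite e ac; transitivity (c * E * (h * B) * bx); first by ring.
  by rewrite e2; ring.
move=> /andP[x0 x1]; have x1' : 0 < 1 - x by rewrite subr_gt0.
elim: m => [|m IH]; first by rewrite /cosprod big_ord0 !addr0; ring.
have h0 : 0 < (2^-1 : R) by rewrite invr_gt0.
have xm : 0 < x + m%:R by rewrite ltr_wpDr.
have xm1 : 0 < 1 - x + m%:R by rewrite ltr_wpDr.
have hm : 0 < 2^-1 + m%:R :> R by rewrite ltr_wpDr.
have e1 := rbeta_step xm xm1; have e2 := rbeta_step hm hm.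
rewrite /cosprod big_ord_recr /= -/(cosprod _ m) -natr1 !addrA.
have mE : m.*2.+1%:R = 2 * m%:R + 1 :> R by rewrite -natr1 -muln2 natrM mulrC.
have m1 : 2 * m%:R + 1 != 0 :> R by rewrite -mE pnatr_eq0.
have m2 : 2 * m%:R + 2 != 0 :> R by rewrite (_ : _ + 2 = (2 * m.+1)%:R) ?pnatr_eq0 // natrM -natr1; ring.
have KE : x + m%:R + (1 - x + m%:R) = 2 * m%:R + 1 by ring.
have KE' : 2^-1 + m%:R + (2^-1 + m%:R) = 2 * m%:R + 1 :> R by field.
have KE2 : 2 * m%:R + 1 + 1 = 2 * m%:R + 2 :> R by ring.
rewrite KE KE2 in e1; rewrite KE' KE2 in e2.
apply: (alg _ _ _ _ _ _ _ _ _ _ _ (mulf_neq0 m1 m2) _ e1 e2 IH).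
by rewrite mE; field.
Qed.

End BetaFunction.

(** * Wallis-type integrals and the reflection formula *)

Section CosineProduct.
Variable R : realType.
Local Notation mu := (@lebesgue_measure R).

(** A deformation of Wallis's integrals: the step from [n] to [n + 2] brings in
    [(n + 2) ^ 2 - 4 y ^ 2], the numerator of an Euler factor, and [n = 1] gives the cosine
    itself. *)
Definition wallis (n : nat) (y : R) : R := \int[mu]_(t in `[0, pi / 2]) (cos (2 * y * t) * cos t ^+ n).

Lemma pihalf_gt0 : 0 < pi / 2 :> R.
Proof. by rewrite divr_gt0 // pi_gt0. Qed.

Lemma continuous_cosM (c : R) : continuous (fun t : R => cos (c * t)).
Proof.
move=> t; apply: (@continuous_comp _ _ _ (fun t => c * t) cos); last exact: continuous_cos.
exact: mulrl_continuous.
Qed.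

Lemma continuous_cosX n : continuous (fun t : R => cos t ^+ n).
Proof.
move=> t; apply: (@continuous_comp _ _ _ cos (fun t => t ^+ n)).
  exact: continuous_cos.
exact: exprn_continuous.
Qed.

Lemma continuous_wallis_integrand n y : continuous (fun t : R => cos (2 * y * t) * cos t ^+ n).
Proof. by move=> t; apply: cvgM; [exact: continuous_cosM|exact: continuous_cosX]. Qed.

Lemma integrable_wallis n y :
  mu.-integrable `[0, pi / 2] (EFin \o (fun t : R => cos (2 * y * t) * cos t ^+ n)).
Proof.
apply: continuous_compact_integrable; first exact: segment_compact.
by apply: continuous_in_subspaceT => t _; exact: continuous_wallis_integrand.
Qed.

Let d_cosM (c t : R) : is_derive t (1 : R) (fun t : R => cos (c * t)) (- c * sin (c * t)).
Proof. by apply: is_derive_eq; rewrite /GRing.scale /= mulr1; ring. Qed.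

Let d_sinM (c t : R) : is_derive t (1 : R) (fun t : R => sin (c * t)) (c * cos (c * t)).
Proof. by apply: is_derive_eq; rewrite /GRing.scale /= mulr1; ring. Qed.

Let d_cosX n (t : R) : is_derive t (1 : R) (fun t : R => cos t ^+ n.+1) (- n.+1%:R * cos t ^+ n * sin t).
Proof. rewrite (_ : (fun _ => _) = (@cos R ^+ n.+1)); last by rewrite exprfctE.
by apply: (is_derive_eq (is_deriveX n.+1 (is_derive_cos t))); rewrite /GRing.scale /=; ring. Qed.

Let FTC2_pihalf (f F : R -> R) (v : R) : continuous f -> (forall t : R, is_derive t (1 : R) F (f t)) ->
  F (pi / 2) - F 0 = v -> \int[mu]_(t in `[0, pi / 2]) f t = v.
Proof.
move=> cf dF <-; rewrite /Rintegral (@continuous_FTC2 _ f F) //.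
- exact: pihalf_gt0.
- by apply: continuous_in_subspaceT => t _; exact: cf.
- have cF : continuous F by move=> t; have [/derivable1_diffP/differentiable_continuous] := dF t.
  split; first by move=> t _; have [] := dF t.
    by apply: cvg_at_right_filter; exact: cF.
  by apply: cvg_at_left_filter; exact: cF.
- by move=> t _; rewrite derive1E; have [_ ->] := dF t.
Qed.

Lemma wallis1 y : (1 - 4 * y ^+ 2) * wallis 1 y = cos (pi * y).
Proof.
rewrite /wallis -RintegralZl //; last exact: integrable_wallis.
apply: (@FTC2_pihalf _ (fun t => cos (2 * y * t) * sin t - 2 * y * (sin (2 * y * t) * cos t))).
- move=> t; apply: cvgM; first exact: cvg_cst.
  exact: continuous_wallis_integrand.
- move=> t.
  have h1 := is_deriveM (d_cosM (2 * y) t) (is_derive_sin t).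
  have h2 := is_deriveM (d_sinM (2 * y) t) (is_derive_cos t).
  have h3 := is_deriveB h1 (is_deriveZ (2 * y) h2).
  apply: (is_derive_eq h3); rewrite /GRing.scale /= expr1; ring.
- rewrite sin_pihalf cos_pihalf !mulr0 sin0 !mul0r !mulr0 !subr0 mulr1.
  by congr cos; field.
Qed.

Lemma wallis_rec n y : (n.+2%:R ^+ 2 - 4 * y ^+ 2) * wallis n.+2 y = n.+2%:R * n.+1%:R * wallis n y.
Proof.
have i1 := integrable_wallis n.+2 y; have i2 := integrable_wallis n y.
apply/eqP; rewrite -subr_eq0; apply/eqP; rewrite /wallis -!RintegralZl // -RintegralB //; last 2 first.
- by apply: (@integrableZl _ _ _ mu _ _ _ _ i1).
- by apply: (@integrableZl _ _ _ mu _ _ _ _ i2).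
(* An explicit antiderivative, found by integrating by parts twice; it vanishes at both ends. *)
apply: (@FTC2_pihalf (fun t => (n.+2%:R ^+ 2 - 4 * y ^+ 2) * (cos (2 * y * t) * cos t ^+ n.+2) -
      n.+2%:R * n.+1%:R * (cos (2 * y * t) * cos t ^+ n)) (fun t => n.+2%:R * (cos (2 * y * t) * (cos t ^+ n.+1 * sin t))
   - 2 * y * (sin (2 * y * t) * cos t ^+ n.+2)) 0); last first.
- by rewrite cos_pihalf !expr0n /= mul0r !mulr0 sin0 !mulr0 !mul0r !mulr0 !subr0.
- move=> t.
  have h1 := is_deriveM (d_cosM (2 * y) t) (is_deriveM (d_cosX n t) (is_derive_sin t)).
  have h2 := is_deriveM (d_sinM (2 * y) t) (d_cosX n.+1 t).
  have h3 := is_deriveB (is_deriveZ n.+2%:R h1) (is_deriveZ (2 * y) h2).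
  apply: (is_derive_eq h3); rewrite /GRing.scale mulrfctE /=.
  have s2 : sin t * sin t = 1 - cos t ^+ 2 by rewrite -(cos2Dsin2 t); ring.
  rewrite !exprS -natr1 -[n.+1%:R]natr1.
  set c := cos t; set s := sin t; set C := cos (2 * y * t); set S := sin _; set e := c ^+ n.
  rewrite -/c -/s in s2.
  have -> : (n%:R + 1 + 1) * (C * (c * e * c + s * (- (n%:R + 1) * e * s)) + c * e * s * (- (2 * y) * S)) -
     2 * y * (S * (- (n%:R + 1 + 1) * (c * e) * s) + c * (c * e) * (2 * y * C)) =
     (n%:R + 1 + 1) * (C * (c * e * c - (n%:R + 1) * e * (s * s))) - 4 * y ^+ 2 * C * (c * (c * e)) by ring.
  by rewrite s2; ring.
- move=> t; apply: cvgB; (apply: cvgM; [exact: cvg_cst|exact: continuous_wallis_integrand]).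
Qed.

Lemma cos_itv_ge0 t : `[0, pi / 2]%classic t -> 0 <= cos t :> R.
Proof.
move=> /=; rewrite in_itv /= => /andP[t0 t1]; apply: cos_ge0_pihalf; rewrite t1 andbT.
by rewrite (le_trans _ t0) // oppr_le0 ltW // pihalf_gt0.
Qed.

Lemma wallis_le n y : wallis n y <= wallis n 0.
Proof.
apply: le_Rintegral => //; try exact: integrable_wallis.
move=> t /cos_itv_ge0 c0; rewrite mulr0 mul0r cos0 ler_wpM2r ?exprn_ge0 ?cos_le1 //.
Qed.

(* As [|2 y| <= 1], [1 - cos (2 y t) <= 1 - cos t <= 1 - cos t ^+ 2] on [[0, pi / 2]]. *)
Lemma wallis_ge n y : -2^-1 <= y <= 2^-1 -> wallis n.+2 0 <= wallis n y.
Proof.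
move=> /andP[y1 y2].
apply: le_Rintegral => //; try exact: integrable_wallis.
move=> t tI; have c0 := cos_itv_ge0 tI.
move: tI => /=; rewrite in_itv /= => /andP[t0 t1].
rewrite mulr0 mul0r cos0 mul1r !exprS mulrA ler_wpM2r ?exprn_ge0 //.
have c1 := cos_le1 t.
apply: (@le_trans _ _ (cos t)); first by rewrite ler_piMr.
have yt : `|2 * y * t| <= t.
  rewrite normrM (ger0_norm t0) ler_piMl // ler_norml; apply/andP; split; lra.
rewrite -(cos_norm (2 * y * t)).
have pi0 := pi_gt0 R.
have [e|ne] := eqVneq `|2 * y * t| t; first by rewrite e.
rewrite ltW // ltr_cos ?in_itv /=.
- by rewrite lt_def eq_sym ne.
- by rewrite normr_ge0 /= (le_trans yt) // (le_trans t1) //; lra.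
- by rewrite t0 /= (le_trans t1) //; lra.
Qed.

Lemma wallis_gt0 n : 0 < wallis n 0.
Proof.
have w0 : 0 < wallis 0 0.
  rewrite /wallis (_ : Rintegral _ _ _ = pi / 2); first exact: pihalf_gt0.
  apply: (@FTC2_pihalf _ (fun t : R => t)); last by rewrite subr0.
  - exact: continuous_wallis_integrand.
  - by move=> t; rewrite mulr0 mul0r cos0 expr0 mulr1; exact: is_derive_id.
have w1 : 0 < wallis 1 0 by have := wallis1 0; rewrite expr0n /= mulr0 subr0 mul1r mulr0 cos0 => ->.
have step m : 0 < wallis m 0 -> 0 < wallis m.+2 0.
  move=> h; have := wallis_rec m 0; rewrite expr0n /= mulr0 subr0 => e.
  by rewrite -(pmulr_rgt0 _ (_ : 0 < m.+2%:R ^+ 2)) ?e ?mulr_gt0 // exprn_gt0.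
suff : 0 < wallis n 0 /\ 0 < wallis n.+1 0 by case.
by elim: n => [|n [h1 h2]]; split => //; exact: step.
Qed.

(** [wallis_ge] compares with index [n + 2] at 0, and the recursion at 0 makes that
    [(n + 1) / (n + 2)] times [wallis n 0]. *)
Lemma wallis_ratio n y : -2^-1 <= y <= 2^-1 -> (1 - n.+2%:R^-1) * wallis n 0 <= wallis n y.
Proof.
move=> hy; have := wallis_ge n hy; apply: le_trans.
have := wallis_rec n 0; rewrite expr0n /= mulr0 subr0 => e.
have n2 : n.+2%:R != 0 :> R by rewrite pnatr_eq0.
suff -> : wallis n.+2 0 = (1 - n.+2%:R^-1) * wallis n 0 by [].
apply: (mulfI (expf_neq0 2 n2)); rewrite e -[n.+2%:R]natr1 in n2 *; field.
by rewrite (_ : 1 + n%:R + 1 = n.+1%:R + 1) // -natr1 [1 + _]addrC.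
Qed.

(** The recursion at [y] against that at 0 contributes [1 - 4 y ^ 2 / (n + 2) ^ 2]. The chain starts
    at [n = 1], hence the odd denominators of [cosprod]. *)
Lemma cos_wallis (y : R) m : cos (pi * y) * wallis m.*2.+1 0 = cosprod y m.+1 * wallis m.*2.+1 y.
Proof.
elim: m => [|m IH].
  rewrite /cosprod big_ord_recr big_ord0 /= mul1r expr1n divr1 wallis1.
  by have := wallis1 0; rewrite expr0n /= mulr0 subr0 mul1r mulr0 cos0 => ->; rewrite mulr1.
rewrite /cosprod big_ord_recr /= -/(cosprod y m.+1) doubleS.
set n := m.*2.+1 in IH *.
have e1 := wallis_rec n y; have := wallis_rec n 0; rewrite expr0n /= mulr0 subr0 => e0.
have n2 : n.+2%:R != 0 :> R by rewrite pnatr_eq0.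
apply: (mulfI (expf_neq0 2 n2)).
transitivity (cos (pi * y) * (n.+2%:R ^+ 2 * wallis n.+2 0)); first by ring.
rewrite e0; transitivity (n.+2%:R * n.+1%:R * (cosprod y m.+1 * wallis n y)); first by rewrite -IH; ring.
transitivity (cosprod y m.+1 * ((n.+2%:R ^+ 2 - 4 * y ^+ 2) * wallis n.+2 y)); first by rewrite e1; ring.
by field.
Qed.

Lemma eq_of_harmonic_bounds (a c : R) : 0 <= c ->
  (forall m : nat, c * (1 - m.+1%:R^-1) <= a <= c * (1 + m.+1%:R^-1)) -> a = c.
Proof.
move=> c0 h.
have le0 x : (forall m : nat, x <= c * m.+1%:R^-1) -> x <= 0.
  move=> hx; have cv : c * m.+1%:R^-1 @[m --> \oo] --> c * 0.
    by apply: cvgM; [exact: cvg_cst|exact: cvg_harmonic].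
  rewrite -(mulr0 c) -(cvg_lim _ cv) //; apply: limr_ge; first by apply/cvg_ex; exists (c * 0).
  by near=> m; exact: hx.
apply/eqP; rewrite eq_le; apply/andP; split; rewrite -subr_le0; apply: le0 => m.
  by have /andP[_] := h m; move: (m.+1%:R^-1) => i; rewrite mulrDr mulr1 => ?; lra.
by have /andP[+ _] := h m; move: (m.+1%:R^-1) => i; rewrite mulrBr mulr1 => ?; lra.
Unshelve. all: by end_near. Qed.

(** The same [cosprod] occurs in [rbeta_prod] and [cos_wallis] and is eliminated between them. What
    remains is a product of two ratios, [F / G] and [Dy / D], each within [1 / (m + 1)] of 1. *)
Lemma rbeta_cos (x : R) : 0 < x < 1 -> rbeta x (1 - x) * cos (pi * (x - 2^-1)) = rbeta 2^-1 2^-1.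
Proof.
move=> x01.
have nm (k : nat) : (k.+1 <= k.*2.+3)%N by lia.
have hy : -2^-1 <= x - 2^-1 <= 2^-1 by move: x01 => /andP[h1 h2]; apply/andP; split; lra.
have yy := rbeta_prod _ x01.
set y := x - 2^-1 in hy yy *; set bx := rbeta x (1 - x) in yy *; set bh := rbeta 2^-1 2^-1 in yy *.
have bh0 : 0 <= bh by exact: rbeta_ge0.
have bx0 : 0 <= bx by exact: rbeta_ge0.
apply: eq_of_harmonic_bounds => // m.
have m0 : 0 < m.+1%:R :> R by [].
have A := rbeta_central_ge x01 m0; have B := rbeta_central_bounds x01 m0.
have P := yy m.+1; have W := cos_wallis y m.
have W1 := wallis_ratio m.*2.+1 hy; have W2 := wallis_le m.*2.+1 y; have W0 := wallis_gt0 m.*2.+1.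
set D := wallis m.*2.+1 0 in W W0 W1 W2 *; set Dy := wallis _ y in W W1 W2 *.
set E := cosprod y m.+1 in P W *; set G := rbeta (2^-1 + _) _ in A B P *.
set F := rbeta (x + _) _ in A B P *; set C := cos _ in W *.
have G0 : 0 < G.
  apply: lt_le_trans (rbeta_half_ge m0).
  by rewrite mulr_gt0 // natr1 rbeta_nat_gt0.
have i0 : 0 < m.+1%:R^-1 :> R by rewrite invr_gt0.
have i1 : (2 * m.+1%:R)^-1 <= m.+1%:R^-1 :> R by rewrite lef_pV2 ?posrE ?mulr_gt0 // ler_peMl // ler1n.
have i2 : m.*2.+3%:R^-1 <= m.+1%:R^-1 :> R by rewrite lef_pV2 ?posrE // ler_nat.
have E1 : bx * C = bh * (F / G * (Dy / D)).
  have GD : G * D != 0 by rewrite mulf_neq0 ?gt_eqF.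
  apply: (mulIf GD); transitivity (bx * G * (C * D)); first by ring.
  rewrite W; transitivity (E * G * bx * Dy); first by ring.
  by rewrite -P; field; rewrite !gt_eqF.
have f1 : 1 <= F / G by rewrite ler_pdivlMr // mul1r.
have f2 : F / G <= 1 + m.+1%:R^-1.
  by rewrite ler_pdivrMr // (le_trans B) // ler_wpM2r ?(ltW G0) // lerD2l.
have d1 : 1 - m.+1%:R^-1 <= Dy / D.
  by rewrite ler_pdivlMr // (le_trans _ W1) // ler_wpM2r ?(ltW W0) // lerD2l lerN2.
have d2 : Dy / D <= 1 by rewrite ler_pdivrMr // mul1r.
have i3 : m.+1%:R^-1 <= 1 :> R by rewrite invf_le1 // ler1n.
have d0 : 0 <= Dy / D by rewrite (le_trans _ d1) // subr_ge0.
rewrite E1; apply/andP; split; apply: ler_wpM2l => //.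
  by rewrite (le_trans d1) // ler_peMl.
by rewrite (le_trans _ f2) // ler_piMr // (le_trans ler01).
Qed.

Lemma sin_pi_cos (x : R) : sin (pi * x) = cos (pi * (x - 2^-1)).
Proof.
have -> : pi * (x - 2^-1) = pi * x - pi / 2 by field.
by rewrite cosB cos_pihalf sin_pihalf mulr0 add0r mulr1.
Qed.

Lemma sin_gt0_01 (x : R) : 0 < x < 1 -> 0 < sin (pi * x).
Proof.
move=> /andP[x0 x1]; have p0 := pi_gt0 R.
by apply: sin_gt0_pi; rewrite mulr_gt0 //= gtr_pMr.
Qed.

(* [rbeta x (1 - x) * sin (pi * x)] is constant; its value is found by letting [x] tend to [0]. *)
Lemma rbeta_reflection (x : R) : 0 < x < 1 -> rbeta x (1 - x) = pi / sin (pi * x).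
Proof.
suff H : rbeta 2^-1 2^-1 = pi :> R.
  move=> x01; have s0 := sin_gt0_01 x01.
  apply: (mulIf (lt0r_neq0 s0)); rewrite divfK ?gt_eqF //.
  by rewrite sin_pi_cos rbeta_cos // H.
(* By the recursion [t B (t, 1 - t) = B (t + 1, 1 - t)], and this lies between [1 / (1 + t)] and
   [1 / (1 - t)], so both bounds tend to the derivative [pi] of [sin (pi t)] at 0. *)
have bnd (t : R) : 0 < t < 1 -> sin (pi * t) / t / (1 + t) <= rbeta 2^-1 2^-1 <= sin (pi * t) / t / (1 - t).
  move=> t01; have /andP[t0 t1] := t01.
  have s0 := sin_gt0_01 t01; have t1' : 0 < 1 - t by rewrite subr_gt0.
  have tp : 0 < t + 1 by rewrite addr_gt0.
  have := rbeta_recl t0 t1'; rewrite (_ : t + (1 - t) = 1) ?mul1r => [e|]; last by ring.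
  have E : rbeta 2^-1 2^-1 = sin (pi * t) / t * rbeta (t + 1) (1 - t).
    by rewrite -(rbeta_cos t01) -sin_pi_cos -e; field; rewrite gt_eqF.
  have q0 : 0 <= sin (pi * t) / t by rewrite divr_ge0 // ltW.
  have L : (1 + t)^-1 <= rbeta (t + 1) (1 - t).
    rewrite [1 + t]addrC -(rbeta1l tp) rbeta_sym.
    suff : rbeta (t + 1) 1 <= 1 * rbeta (t + 1) (1 - t) + 0 * rbeta 1 1 by rewrite mul1r mul0r addr0.
    apply: le_rbeta2 => // s /andP[u0 u1]; rewrite mul1r mul0r addr0 ler_wpM2l ?powR_ge0 //.
    have s01 : 0 <= 1 - s <= 1 by apply/andP; split; lra.
    have sp : 0 < (1 - s) `^ t by rewrite powR_gt0 // subr_gt0.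
    by rewrite subrr powRr0 addrAC subrr sub0r powRN invf_ge1 // powR_le1 // ltW.
  have U : rbeta (t + 1) (1 - t) <= (1 - t)^-1.
    rewrite -(rbeta1l t1').
    suff : rbeta (t + 1) (1 - t) <= 1 * rbeta 1 (1 - t) + 0 * rbeta 1 1 by rewrite mul1r mul0r addr0.
    apply: le_rbeta2 => // s /andP[u0 u1]; rewrite mul1r mul0r addr0 ler_wpM2r ?powR_ge0 //.
    have s01 : 0 <= s <= 1 by apply/andP; split; lra.
    by rewrite subrr powRr0 addrK powR_le1 // ltW.
  by rewrite E; apply/andP; split; apply: ler_wpM2l.
pose u (n : nat) : R := n.+2%:R^-1.
have u01 n : 0 < u n < 1 by rewrite /u invr_gt0 ltr0n /= invf_lt1 ?ltr1n.
have ucv : u n @[n --> \oo] --> 0.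
  have := @cvg_harmonic R; rewrite -(cvg_shiftn 1) => H.
  by apply: cvg_trans H; apply: near_eq_cvg; near=> n; rewrite /harmonic /= addn1.
have scv : sin (pi * u n) / u n @[n --> \oo] --> (pi : R).
  have dS : is_derive (0 : R) (1 : R) (fun t : R => sin (pi * t)) pi.
    by apply: is_derive_eq; rewrite /GRing.scale /= mulr0 cos0 mul1r mulr1.
  have [dv ev] := dS.
  have H : h^-1 *: (sin (pi * (h *: 1 + 0)) - sin (pi * 0)) @[h --> 0^'] --> (pi : R).
    by move: dv; rewrite /derivable -[X in _ -> _ --> X]ev; exact.
  have uD : u n @[n --> \oo] --> (0 : R)^'.
    move=> A /= [e /= e0 eA]; have /cvgrPdist_lt /(_ e e0) := ucv.
    by apply: filterS => n un; apply: eA => //=; have /andP[/lt0r_neq0] := u01 n.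
  have : (u n)^-1 *: (sin (pi * (u n *: 1 + 0)) - sin (pi * 0)) @[n --> \oo] --> (pi : R).
    exact: (cvg_comp _ _ uD H).
  by under eq_fun do rewrite mulr0 sin0 subr0 addr0 /GRing.scale /= mulr1 mulrC.
have n1 : (1 : R) != 0 by rewrite oner_eq0.
have l1 : sin (pi * u n) / u n / (1 + u n) @[n --> \oo] --> (pi / (1 + 0) : R).
  apply: cvgM => //; apply: cvgV; first by rewrite addr0.
  by apply: cvgD => //; exact: cvg_cst.
have l2 : sin (pi * u n) / u n / (1 - u n) @[n --> \oo] --> (pi / (1 - 0) : R).
  apply: cvgM => //; apply: cvgV; first by rewrite subr0.
  by apply: cvgB => //; exact: cvg_cst.
apply/eqP; rewrite eq_le; apply/andP; split.
  rewrite (_ : pi = pi / (1 - 0)); last by rewrite subr0 divr1.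
  rewrite -(cvg_lim _ l2) //; apply: limr_ge; first by apply/cvg_ex; eexists; exact: l2.
  by near=> n; have /andP[] := bnd _ (u01 n).
rewrite (_ : pi = pi / (1 + 0)); last by rewrite addr0 divr1.
rewrite -(cvg_lim _ l1) //; apply: limr_le; first by apply/cvg_ex; eexists; exact: l1.
by near=> n; have /andP[] := bnd _ (u01 n).
Unshelve. all: by end_near. Qed.

End CosineProduct.

Section IntegralOverType.
Context d (T : measurableType d) (R : realType).
Variable m : {measure set T -> \bar R}.

Lemma integralTZl (f : T -> \bar R) (k : R) : measurable_fun setT f -> (forall t, 0 <= f t)%E ->
  0 <= k -> (\int[m]_t (k%:E * f t) = k%:E * \int[m]_t f t)%E.
Proof. by move=> mf f0 k0; apply: ge0_integralZl => //; exact: measurableT. Qed.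

Lemma integralTD (f g : T -> \bar R) : measurable_fun setT f -> (forall t, 0 <= f t)%E ->
  measurable_fun setT g -> (forall t, 0 <= g t)%E ->
  (\int[m]_t (f t + g t) = \int[m]_t f t + \int[m]_t g t)%E.
Proof. by move=> mf f0 mg g0; apply: ge0_integralD => //; exact: measurableT. Qed.

Lemma le_integralT (f g : T -> \bar R) : measurable_fun setT f -> (forall t, 0 <= f t)%E ->
  measurable_fun setT g -> (forall t, f t <= g t)%E ->
  (\int[m]_t f t <= \int[m]_t g t)%E.
Proof. by move=> mf f0 mg fg; apply: ge0_le_integral => //; exact: measurableT. Qed.

End IntegralOverType.

(** * The regularized incomplete Beta function with parameters [x] and [1 - x] *)

Section IncompleteBeta.
Variable R : realType.
Local Notation mu := (@lebesgue_measure R).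

Section FixedParameter.
Variable x : R.
Hypothesis x01 : 0 < x < 1.

Let x0 : 0 < x. Proof. by case/andP: x01. Qed.
Let x1 : 0 < 1 - x. Proof. by case/andP: x01 => _; rewrite subr_gt0. Qed.

Definition einc (s : R) : \bar R := (\int[mu]_t (if t < s then bker x (1 - x) t else 0)%:E)%E.

Lemma einc_ge0 s : (0 <= einc s)%E.
Proof. by apply: integral_ge0 => t _; rewrite lee_fin; case: ifP => // _; exact: bker_ge0. Qed.

Lemma measurable_einc : measurable_fun setT einc.
Proof.
have mb := measurable_bker x (1 - x).
have m2 : measurable_fun setT (fun w : R * R => bker x (1 - x) w.2) by apply: (measurableT_comp mb); meas.
pose T (w : R * R) : \bar R := (if w.2 < w.1 then bker x (1 - x) w.2 else 0)%:E.
have mT : measurable_fun setT T by rewrite /T; meas.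
have T0 w : (0 <= T w)%E by rewrite lee_fin; case: ifP => // _; exact: bker_ge0.
exact: (@measurable_fun_fubini_tonelli_F _ _ _ _ _ mu T mT T0).
Qed.

Lemma einc_le s : (einc s <= ebeta x (1 - x))%E.
Proof.
have mb := measurable_bker x (1 - x).
apply: ge0_le_integral => //.
- by move=> t _; rewrite lee_fin; case: ifP => // _; exact: bker_ge0.
- by meas.
- by meas.
- by move=> t _; rewrite lee_fin; case: ifP => // _; exact: bker_ge0.
Qed.

Lemma einc_fin s : einc s \is a fin_num.
Proof.
rewrite ge0_fin_numE ?einc_ge0 // (le_lt_trans (einc_le s)) //.
by rewrite -ge0_fin_numE ?ebeta_ge0 // ebeta_fin.
Qed.

Lemma einc1 : einc 1 = ebeta x (1 - x).
Proof.
apply: eq_integral => t _; rewrite /bker.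
by case: (ltP t 1) => //; rewrite andbF.
Qed.

Lemma beta_inc_einc s : s <= 1 -> beta_inc s x (1 - x) = fine (einc s).
Proof.
move=> s1; rewrite /beta_inc integral_ooE; congr fine; apply: eq_integral => t _.
rewrite /bker; case: (ltP t s) => ts; rewrite ?andbF //.
by rewrite (lt_le_trans ts s1).
Qed.

Lemma rbeta01_gt0 : 0 < rbeta x (1 - x).
Proof. by rewrite rbeta_reflection // divr_gt0 ?pi_gt0 // sin_gt0_01. Qed.

Definition rreg (s : R) : R := fine (einc s) / rbeta x (1 - x).

Lemma rreg_ge0 s : 0 <= rreg s.
Proof. by rewrite divr_ge0 ?rbeta_ge0 // fine_ge0 // einc_ge0. Qed.

Lemma einc_rreg s : einc s = (rbeta x (1 - x) * rreg s)%:E.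
Proof. by rewrite mulrC divfK ?gt_eqF ?rbeta01_gt0 // fineK // einc_fin. Qed.

Lemma beta_reg_rreg s : s <= 1 -> beta_reg s x (1 - x) = rreg s.
Proof.
move=> s1; have e1 : Defs.beta_fun x (1 - x) = rbeta x (1 - x).
  by apply: EFin_inj; rewrite -rbetaE // -einc1 -(fineK (einc_fin 1)) /Defs.beta_fun (beta_inc_einc (lexx (1 : R))).
by rewrite /beta_reg e1 (beta_inc_einc s1).
Qed.

Lemma measurable_rreg : measurable_fun setT rreg.
Proof.
rewrite /rreg; apply: measurable_funM; last exact: measurable_cst.
by apply: (measurableT_comp (@fine_measurable R setT measurableT)); exact: measurable_einc.
Qed.

(** What the substitution [t = s u] leaves of the incomplete Beta integral once [s ^ x] is taken
    out. Its integral over [u] is Euler's integral for the hypergeometric function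
    [2F1 (x, x; x + 1; s)], up to the factor [1 / x]. *)
Definition jker (s u : R) : R := if (0 < u) && (u < 1) then u `^ (x - 1) * (1 - s * u) `^ (- x) else 0.

Lemma jker_ge0 s u : 0 <= jker s u.
Proof. by rewrite /jker; case: ifP => // _; rewrite mulr_ge0 ?powR_ge0. Qed.

Lemma measurable_jker s : measurable_fun setT (jker s).
Proof. by rewrite /jker /=; meas. Qed.

Definition ejint (s : R) : \bar R := (\int[mu]_u (jker s u)%:E)%E.

Lemma ejint_ge0 s : (0 <= ejint s)%E.
Proof. by apply: integral_ge0 => u _; rewrite lee_fin jker_ge0. Qed.

Lemma einc_ejint (s : R) : 0 < s <= 1 -> einc s = ((s `^ x)%:E * ejint s)%E.
Proof.
move=> /andP[s0 s1].
have mb := measurable_bker x (1 - x); have mj := measurable_jker s.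
have me : measurable_fun setT (fun t : R => (if t < s then bker x (1 - x) t else 0)%:E) by meas.
have f0 (t : R) : (0 <= (if t < s then bker x (1 - x) t else 0)%:E)%E.
  by rewrite lee_fin; case: ifP => // _; exact: bker_ge0.
rewrite /einc (ge0_integral_affine 0 (lt0r_neq0 s0) me f0) (gtr0_norm s0) /ejint.
transitivity (\int[mu]_u (s%:E * (if s * u + 0 < s then bker x (1 - x) (s * u + 0) else 0)%:E))%E.
  rewrite ge0_integralZl; first by [].
  - exact: measurableT.
  - by apply: (measurableT_comp me); meas.
  - by move=> u _; exact: f0.
  - by rewrite lee_fin ltW.
transitivity (\int[mu]_u ((s `^ x)%:E * (jker s u)%:E))%E; last first.
  rewrite ge0_integralZl; first by [].
  - exact: measurableT.
  - by meas.
  - by move=> u _; rewrite lee_fin jker_ge0.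
  - by rewrite lee_fin powR_ge0.
apply: eq_integral => u _; rewrite -!EFinM addr0; congr EFin.
rewrite gtr_pMr // /bker /jker pmulr_rgt0 //.
case: (ltP u 1) => u1; last by rewrite !andbF !mulr0.
case: (ltP 0 u) => u0 /=; last by rewrite !mulr0.
have -> : s * u < 1 by rewrite (lt_le_trans _ s1) // gtr_pMr.
rewrite powRM ?ltW // -(mulr_powRB1 (ltW s0) x0).
have -> : 1 - x - 1 = - x by ring.
ring.
Qed.

Lemma ejint1 : ejint 1 = ebeta x (1 - x).
Proof.
apply: eq_integral => u _; rewrite /jker mul1r /bker.
by have -> : 1 - x - 1 = - x by ring.
Qed.

Lemma ejint_le (s : R) : 0 < s <= 1 -> (ejint s <= ejint 1)%E.
Proof.
move=> /andP[s0 s1]; apply: ge0_le_integral; first exact: measurableT.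
- by move=> u _; rewrite lee_fin jker_ge0.
- by apply/measurable_EFinP; exact: measurable_jker.
- by apply/measurable_EFinP; exact: measurable_jker.
move=> u _; rewrite lee_fin /jker; case: ifP => // /andP[u0 u1].
rewrite ler_wpM2l ?powR_ge0 // !powRN lef_pV2 ?posrE ?powR_gt0 ?subr_gt0 ?mul1r //; last first.
  by rewrite (le_lt_trans _ u1) // ger_pMl.
apply: ge0_ler_powR; rewrite ?nnegrE ?subr_ge0 ?(ltW x0) ?(ltW u1) //.
  by rewrite (le_trans _ (ltW u1)) // ger_pMl.
by rewrite lerD2l lerN2 ger_pMl.
Qed.

Lemma ejint_fin (s : R) : 0 < s <= 1 -> ejint s \is a fin_num.
Proof.
move=> s01; rewrite ge0_fin_numE ?ejint_ge0 //; apply: (le_lt_trans (ejint_le s01)); rewrite ejint1.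
by rewrite -ge0_fin_numE ?ebeta_ge0 // ebeta_fin.
Qed.

(** The quotient of the incomplete integral by [s ^ x] is [ejint s], which is at most its value at
    [s = 1], the full Beta integral. *)
Lemma rreg_le_powR s : 0 < s < 1 -> rreg s <= s `^ x.
Proof.
move=> /andP[s0 s1]; have s01 : 0 < s <= 1 by rewrite s0 ltW.
rewrite ler_pdivrMr ?rbeta01_gt0 // -lee_fin fineK ?einc_fin // einc_ejint // EFinM.
by rewrite -(rbetaE x0 x1) -ejint1; apply: lee_wpmul2l (ejint_le s01); rewrite lee_fin powR_ge0.
Qed.

(** Locked like [rbeta], so that [ring] and [field] take its values as atoms. *)
Definition rjint : R -> R := locked (fun s => fine (ejint s)).

Lemma rjintE (s : R) : 0 < s <= 1 -> ejint s = (rjint s)%:E.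
Proof. by move=> s01; rewrite /rjint -lock fineK // ejint_fin. Qed.

Lemma rjint_gt0 (s : R) : 0 < s <= 1 -> 0 < rjint s.
Proof.
move=> s01; have /andP[s0 s1] := s01.
apply: (@lt_le_trans _ _ (x^-1)); first by rewrite invr_gt0.
rewrite -lee_fin -rjintE // -[x^-1]mul1r.
have := integral_powR_0 x0 ltr01; rewrite powR1 => E.
rewrite mulrC EFinM -E -(integralTZl mu); last 3 first.
- by meas.
- by move=> u; rewrite lee_fin; case: ifP => // _; rewrite mulr_ge0 ?powR_ge0 // ltW.
- by rewrite invr_ge0 ltW.
apply: ge0_le_integral; first exact: measurableT.
- by move=> u _; rewrite -EFinM lee_fin; case: ifP => // _; rewrite ?mulr0 // !mulr_ge0 ?powR_ge0 ?invr_ge0 // ltW.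
- by meas.
- by apply/measurable_EFinP; exact: measurable_jker.
move=> u _; rewrite -EFinM lee_fin /jker; case: ifP => [/andP[u0 u1]|]; last by rewrite mulr0.
rewrite mulKf ?gt_eqF // ler_peMr ?powR_ge0 // powRN invf_ge1 ?powR_gt0 ?subr_gt0 ?powR_le1 ?(ltW x0) //.
  by rewrite subr_ge0 lerBlDr lerDl mulr_ge0 ?(ltW s0) ?(ltW u0) // andbT (le_trans _ (ltW u1)) // ger_pMl.
by rewrite (le_lt_trans _ u1) // ger_pMl.
Qed.

(* Log-convexity of [s |-> rreg (expR (- s))], from the pointwise inequality
   [(1 - t u) ^ l * (1 - u) ^ (1 - l) <= 1 - t ^ l * u] and Hoelder's inequality. *)
Lemma rreg_powR t l : 0 < t < 1 -> 0 < l < 1 -> rreg (t `^ l) <= rreg t `^ l.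
Proof.
move=> /andP[t0 t1] l01; have /andP[l0 l1] := l01.
have l1' : 0 < 1 - l by rewrite subr_gt0.
have t01 : 0 < t <= 1 by rewrite t0 ltW.
have tl0 : 0 < t `^ l by rewrite powR_gt0.
have tl1 : t `^ l <= 1 by rewrite powR_le1 // ?ltW // (ltW t0) ltW.
have tl01 : 0 < t `^ l <= 1 by rewrite tl0.
have one01 : 0 < (1 : R) <= 1 by rewrite ltr01 lexx.
have Jt0 := rjint_gt0 t01; have J10 := rjint_gt0 one01.
have main : rjint (t `^ l) <= rjint t `^ l * rjint 1 `^ (1 - l).
  set K := rjint t `^ l * rjint 1 `^ (1 - l).
  have K0 : 0 <= K by rewrite mulr_ge0 ?powR_ge0.
  rewrite -lee_fin -rjintE //.
  (* Hoelder's inequality made linear: [K] is rewritten as a combination of the two integrals, so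
     that a pointwise weighted arithmetic-geometric inequality is enough. *)
  have -> : K%:E = ((K * (l / rjint t))%:E * ejint t + (K * ((1 - l) / rjint 1))%:E * ejint 1)%E.
    rewrite (rjintE t01) (rjintE one01) -!EFinM -EFinD; congr EFin.
    by field; rewrite !gt_eqF.
  have c1 : 0 <= K * (l / rjint t) by rewrite mulr_ge0 // divr_ge0 ?ltW.
  have c2 : 0 <= K * ((1 - l) / rjint 1) by rewrite mulr_ge0 // divr_ge0 ?ltW.
  have mj := measurable_jker; have mjt := mj t; have mj1 := mj 1.
  rewrite /ejint -(integralTZl mu); last 3 first.
  - by meas.
  - by move=> u; rewrite lee_fin jker_ge0.
  - by [].
  rewrite -(integralTZl mu); last 3 first.
  - by meas.
  - by move=> u; rewrite lee_fin jker_ge0.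
  - by [].
  rewrite -(integralTD mu); last 4 first.
  - by meas.
  - by move=> u; rewrite -EFinM lee_fin mulr_ge0 ?jker_ge0.
  - by meas.
  - by move=> u; rewrite -EFinM lee_fin mulr_ge0 ?jker_ge0.
  apply: ge0_le_integral; first exact: measurableT.
  - by move=> u _; rewrite lee_fin jker_ge0.
  - by apply/measurable_EFinP; exact: measurable_jker.
  - by meas.
  move=> /= u _; rewrite -!EFinM -EFinD lee_fin /jker; case: ifP => [/andP[u0 u1]|]; last by rewrite !mulr0 addr0.
  have u1' : 0 < 1 - u by rewrite subr_gt0.
  have tu1 : t * u < 1 by rewrite (lt_trans _ u1) // gtr_pMl.
  have tu1' : 0 < 1 - t * u by rewrite subr_gt0.
  have tlu1' : 0 < 1 - t `^ l * u by rewrite subr_gt0 (le_lt_trans _ u1) // ger_pMl.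
  (* Add the weighted inequalities for the pairs [(1 - t u, 1 - u)] and [(t u, u)]; their right-hand
     sides sum to 1. *)
  have P1 : (1 - t * u) `^ l * (1 - u) `^ (1 - l) <= 1 - t `^ l * u.
    have h1 := weighted_amgm l01 (ltW tu1') (ltW u1').
    have tu0 : 0 <= t * u by rewrite mulr_ge0 ?ltW.
    have h2 := weighted_amgm l01 tu0 (ltW u0).
    have e2 : (t * u) `^ l * u `^ (1 - l) = t `^ l * u.
      by rewrite powRM ?ltW // -mulrA -powRDp // (_ : l + (1 - l) = 1) ?powRr1 ?ltW //; ring.
    by rewrite e2 in h2; lra.
  rewrite (mulrCA (K * _)) (mulrCA (K * ((1 - l) / _))) -mulrDr mul1r; apply: ler_wpM2l; first exact: powR_ge0.
  set A := (1 - t * u) `^ (- x); set B := (1 - u) `^ (- x).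
  have P2 : (1 - t `^ l * u) `^ (- x) <= A `^ l * B `^ (1 - l).
    have -> : A `^ l * B `^ (1 - l) = ((1 - t * u) `^ l * (1 - u) `^ (1 - l)) `^ (- x).
      by rewrite (powRM (- x) (powR_ge0 _ _) (powR_ge0 _ _)) /A /B (powRAC _ (- x) l) (powRAC _ (- x) (1 - l)).
    set W := (1 - t * u) `^ l * _ in P1 *.
    have W0 : 0 < W by rewrite mulr_gt0 ?powR_gt0.
    rewrite !powRN lef_pV2 ?posrE ?powR_gt0 //.
    by apply: ge0_ler_powR; rewrite ?nnegrE ?(ltW x0) ?(ltW tlu1') ?(ltW W0).
  apply: (le_trans P2).
  have q1 : 0 <= A / rjint t by rewrite divr_ge0 ?powR_ge0 ?ltW.
  have q2 : 0 <= B / rjint 1 by rewrite divr_ge0 ?powR_ge0 ?ltW.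
  have := ler_wpM2l K0 (weighted_amgm l01 q1 q2).
  have split1 (a b : R) : 0 < b -> 0 <= a -> (a / b) `^ l * b `^ l = a `^ l.
    by move=> b0 a0; rewrite -powRM ?divr_ge0 ?(ltW b0) // divfK // gt_eqF.
  have split2 (a b : R) : 0 < b -> 0 <= a -> (a / b) `^ (1 - l) * b `^ (1 - l) = a `^ (1 - l).
    by move=> b0 a0; rewrite -powRM ?divr_ge0 ?(ltW b0) // divfK // gt_eqF.
  rewrite -(split1 A (rjint t)) ?powR_ge0 // -(split2 B (rjint 1)) ?powR_ge0 // /K.
  by congr (_ <= _); ring.
have e1 : fine (einc (t `^ l)) = t `^ (l * x) * rjint (t `^ l).
  by rewrite einc_ejint // rjintE //= -powRrM.
have e2 : fine (einc t) = t `^ x * rjint t by rewrite einc_ejint // rjintE.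
have e3 : rbeta x (1 - x) = rjint 1 by apply: EFin_inj; rewrite -rbetaE // -ejint1 rjintE.
rewrite /rreg e1 e2 e3 ler_pdivrMr //.
have -> : (t `^ x * rjint t / rjint 1) `^ l * rjint 1 = t `^ (l * x) * (rjint t `^ l * rjint 1 `^ (1 - l)).
  have -> : rjint 1 `^ (1 - l) = rjint 1 * (rjint 1)^-1 `^ l.
    by rewrite -powR_inv1 ?(ltW J10) // -powRrM mulN1r -[X in X * _](powRr1 (ltW J10)) -powRDp.
  rewrite !powRM ?mulr_ge0 ?powR_ge0 ?invr_ge0 ?(ltW Jt0) ?(ltW J10) // -powRrM [x * l]mulrC; ring.
by rewrite ler_wpM2l // powR_ge0.
Qed.

End FixedParameter.

End IncompleteBeta.

(** * Comparison of the two radial kernels *)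

Section KeyInequality.
Variable R : realType.
Local Notation mu := (@lebesgue_measure R).
Variables alpha p : R.
Hypotheses (alpha0 : 0 <= alpha) (p_gt : 2 + 2 * alpha < p).

Definition bexp : R := (2 + alpha) / p.

Lemma bexp_p_gt0 : 0 < p. Proof. by move: alpha0 p_gt; lra. Qed.

Lemma bexp01 : 0 < bexp < 1.
Proof.
have p0 := bexp_p_gt0; rewrite /bexp divr_gt0 //=; last by move: alpha0; lra.
by rewrite ltr_pdivrMr // mul1r; move: alpha0 p_gt; lra.
Qed.

(* The substitution [r = s ^ 2] in the radial integrals makes these kernels match the integral of condition (b). *)
Definition hker (s : R) : R :=
  if (0 < s) && (s < 1) then rreg bexp s * s `^ (2 * p - 4 * alpha - 5) * (1 - s ^+ 4) `^ alpha else 0.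

Definition wker (s : R) : R := if (0 < s) && (s < 1) then s ^+ 3 * (1 - s ^+ 4) `^ alpha else 0.

Lemma measurable_hker : measurable_fun setT hker.
Proof. by have mr := measurable_rreg bexp; rewrite /hker; meas. Qed.

Lemma measurable_wker : measurable_fun setT wker.
Proof. by rewrite /wker; meas. Qed.

Lemma hker_ge0 s : 0 <= hker s.
Proof. rewrite /hker; case: ifP => // _.
exact: mulr_ge0 (mulr_ge0 (rreg_ge0 bexp s) (powR_ge0 _ _)) (powR_ge0 _ _). Qed.

Lemma wker_ge0 s : 0 <= wker s.
Proof. by rewrite /wker; case: ifP => // /andP[s0 _]; rewrite mulr_ge0 ?powR_ge0 // exprn_ge0 // ltW. Qed.

Lemma expr4_lt1 (s : R) : 0 < s < 1 -> 0 < 1 - s ^+ 4.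
Proof. by move=> /andP[s0 s1]; rewrite subr_gt0 exprn_ilt1 // ltW. Qed.

Lemma is_derive_1_subX4 (s : R) : is_derive s 1 (fun s : R => 1 - s ^+ 4) (- (4 * s ^+ 3)).
Proof.
have h := is_deriveB (is_derive_cst (1 : R) s 1) (is_deriveX 4 (is_derive_id s 1)).
by apply: (is_derive_eq h); rewrite sub0r /GRing.scale /= mulr1 mulr_natl.
Qed.

(** This is the constant of condition (b), which therefore says that the integral of [hker] is at
    most that of [wker]. *)
Lemma integral_wker : (\int[mu]_s (wker s)%:E = (1 / (4 * (alpha + 1)))%:E)%E.
Proof.
have a1 : 0 < alpha + 1 by move: alpha0; lra.
pose F (s : R) := - (1 - s ^+ 4) `^ (alpha + 1) / (4 * (alpha + 1)).
rewrite -(integral_ooE 0 1 (fun s => s ^+ 3 * (1 - s ^+ 4) `^ alpha)).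
have dF (s : R) : 0 < s < 1 -> is_derive s 1 F (s ^+ 3 * (1 - s ^+ 4) `^ alpha).
  move=> /expr4_lt1 h.
  have d1 : is_derive s 1 (fun s : R => 1 - s ^+ 4) (- (4 * s ^+ 3)).
    exact: is_derive_1_subX4.
  have d2 := is_derive1_powR (alpha + 1) h.
  have d3 := @is_derive1_comp R (fun u => u `^ (alpha + 1)) (fun s : R => 1 - s ^+ 4) s _ _ d2 d1.
  have d4 := is_deriveM (is_deriveN d3) (is_derive_cst ((4 * (alpha + 1))^-1 : R) s 1).
  apply: (is_derive_eq d4).
  rewrite scaler0 add0r /GRing.scale /=; have -> : alpha + 1 - 1 = alpha by ring.
  by field; rewrite gt_eqF.
have -> : 1 / (4 * (alpha + 1)) = 0 - - (1 / (4 * (alpha + 1))) by ring.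
apply: (@ge0_FTC_oo R 0 1 _ _ _ F) => //.
- by move=> s /andP[s0 s1]; rewrite mulr_ge0 ?powR_ge0 // exprn_ge0 // ltW.
- move=> s s01; apply: cvgM; first exact: exprn_continuous.
  have h := expr4_lt1 s01.
  have c1 : {for s, continuous (fun s : R => 1 - s ^+ 4)}.
    by apply: cvgB; [exact: cvg_cst|exact: exprn_continuous].
  apply: (@continuous_comp _ _ _ (fun s : R => 1 - s ^+ 4) (fun u => u `^ alpha)); first exact: c1.
  have [d _] := is_derive1_powR alpha h.
  by move/derivable1_diffP/differentiable_continuous : d.
- apply: cvg_at_right_filter.
  have -> : - (1 / (4 * (alpha + 1))) = F 0 by rewrite /F expr0n /= subr0 powR1 mulNr.
  have d1 : is_derive (0 : R) 1 (fun s : R => 1 - s ^+ 4) (- (4 * 0 ^+ 3)).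
    exact: is_derive_1_subX4.
  have h : 0 < 1 - (0 : R) ^+ 4 by rewrite expr0n subr0.
  have d2 := is_derive1_powR (alpha + 1) h.
  have d3 := @is_derive1_comp R (fun u => u `^ (alpha + 1)) (fun s : R => 1 - s ^+ 4) 0 _ _ d2 d1.
  have [d _] := is_deriveM (is_deriveN d3) (is_derive_cst ((4 * (alpha + 1))^-1 : R) (0 : R) 1).
  by move/derivable1_diffP/differentiable_continuous : d.
- have c1 : (fun s : R => - (1 - s ^+ 4) / (4 * (alpha + 1))) x @[x --> 1^'-] --> (0 : R).
    apply: cvg_at_left_filter.
    have -> : (0 : R) = (fun s : R => - (1 - s ^+ 4) / (4 * (alpha + 1))) 1 by rewrite expr1n subrr oppr0 mul0r.
    apply: cvgM; last exact: cvg_cst.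
    by apply: cvgN; apply: cvgB; [exact: cvg_cst|exact: exprn_continuous].
  apply: (@squeeze_cvgr _ _ _ _ (fun s : R => - (1 - s ^+ 4) / (4 * (alpha + 1))) (fun=> 0)); last 2 first.
  + exact: c1.
  + exact: cvg_cst.
  near=> s.
  have s01 : 0 < s < 1 by apply/andP; split; near: s; [exact: nbhs_left_gt|exact: nbhs_left_lt].
  have h := expr4_lt1 s01.
  have i0 : 0 <= (4 * (alpha + 1))^-1 by rewrite invr_ge0 mulr_ge0 // ltW.
  rewrite /F !mulNr lerN2 ler_wpM2r //=; last first.
    rewrite (powRDn _ h) ler_piMl ?(ltW h) // powR_le1 // (ltW h) /= lerBlDr lerDl exprn_ge0 //.
    by case/andP: s01 => /ltW.
    by rewrite oppr_le0 mulr_ge0 ?powR_ge0.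
Unshelve. all: by end_near.
Qed.

Lemma hkerE s : 0 < s < 1 -> hker s = wker s * (s `^ (- (2 * (4 + 2 * alpha - p))) * rreg bexp s).
Proof.
move=> s01; rewrite /hker /wker s01; have /andP[s0 s1] := s01.
have -> : 2 * p - 4 * alpha - 5 = 3%:R + - (2 * (4 + 2 * alpha - p)) by ring.
rewrite (powRDp _ _ s0) (powR_mulrn 3 (ltW s0)); ring.
Qed.

Definition hyp_a := 2 + alpha + Num.sqrt (alpha ^+ 2 + 7 / 2 * alpha + 3) <= p.

(** After [I_s <= s ^ x] the quotient of the kernels is at most a power of [s]. Its exponent times
    [p / 2] is [(p - (2 + alpha)) ^ 2 - (alpha ^ 2 + 7 / 2 alpha + 3)], and (a) places [p] beyond
    the larger root. *)
Lemma hker_le_wker_a : hyp_a -> forall s, hker s <= wker s.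
Proof.
move=> ha s; case: (boolP (0 < s < 1)) => s01; last by rewrite /hker /wker (negbTE s01).
rewrite (hkerE s01) ler_piMr ?wker_ge0 //.
have /andP[s0 s1] := s01.
have := rreg_le_powR bexp01 s01; move/(ler_wpM2l (powR_ge0 s (- (2 * (4 + 2 * alpha - p))))).
move=> h; apply: (le_trans h).
rewrite -(powRDp _ _ s0); apply: powR_le1; first by rewrite (ltW s0) (ltW s1).
have p0 := bexp_p_gt0.
have D0 : 0 <= alpha ^+ 2 + 7 / 2 * alpha + 3 by rewrite !addr_ge0 ?sqr_ge0 // mulr_ge0.
have h1 : Num.sqrt (alpha ^+ 2 + 7 / 2 * alpha + 3) <= p - (2 + alpha) by move: ha; rewrite /hyp_a; lra.
have h2 : alpha ^+ 2 + 7 / 2 * alpha + 3 <= (p - (2 + alpha)) ^+ 2.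
  rewrite -[X in X <= _](sqr_sqrtr D0) lerXn2r ?nnegrE ?sqrtr_ge0 //.
  by rewrite (le_trans _ h1) ?sqrtr_ge0.
rewrite /bexp.
have -> : - (2 * (4 + 2 * alpha - p)) + (2 + alpha) / p =
  ((p - (2 + alpha)) ^+ 2 - (alpha ^+ 2 + 7 / 2 * alpha + 3)) * 2 / p by field; rewrite gt_eqF.
by rewrite divr_ge0 ?(ltW p0) // mulr_ge0 // subr_ge0.
Qed.

(* [rreg bexp s / s ^ (2 (4 + 2 alpha - p))] crosses 1 at most once because [rreg_powR] holds. *)
Lemma hker_cross s t : 0 < s -> s < t -> t < 1 -> wker t < hker t -> wker s < hker s.
Proof.
move=> s0 st t1.
have t0 := lt_trans s0 st; have s1 := lt_trans st t1.
have t01 : 0 < t < 1 by rewrite t0. have s01 : 0 < s < 1 by rewrite s0.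
have key u : 0 < u < 1 -> (wker u < hker u) = (u `^ (2 * (4 + 2 * alpha - p)) < rreg bexp u).
  move=> u01; rewrite (hkerE u01); have /andP[u0 u1] := u01.
  have w0 : 0 < wker u by rewrite /wker u01 mulr_gt0 ?exprn_gt0 ?powR_gt0 ?expr4_lt1.
  by rewrite ltr_pMr // mulrC powRN ltr_pdivlMr ?powR_gt0 // mul1r.
rewrite !key // => h.
(* The exponent with [t = s ^ l]; it lies in [(0, 1)] because [s < t < 1]. *)
pose l := ln t / ln s.
have ls0 : ln s < 0 by rewrite ln_lt0.
have lt0 : ln t < 0 by rewrite ln_lt0.
have l01 : 0 < l < 1.
  rewrite /l; apply/andP; split; first by rewrite nmulr_rgt0 // invr_lt0.
  by rewrite ltr_ndivrMr // mul1r ltr_ln ?posrE.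
have tE : t = s `^ l.
  by rewrite /powR gt_eqF // /l divfK ?lt_eqF // lnK ?posrE.
have := rreg_powR bexp01 s01 l01; rewrite -tE => h2.
have := lt_le_trans h h2; rewrite {1}tE powRAC.
have /andP[l0 l1] := l01.
rewrite !ltNge; apply: contra => h3.
by apply: (ge0_ler_powR (ltW l0)); rewrite ?nnegrE ?powR_ge0 ?rreg_ge0.
Qed.

Lemma integral_hker_b : (condb_integral p alpha <= (1 / (4 * (alpha + 1)))%:E)%E ->
  (\int[mu]_s (hker s)%:E <= \int[mu]_s (wker s)%:E)%E.
Proof.
rewrite integral_wker /condb_integral integral_ooE => h; apply: le_trans h.
rewrite le_eqVlt; apply/orP; left; apply/eqP; apply: eq_integral => s _; congr EFin.
rewrite /hker; case: ifP => // /andP[s0 s1].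
by rewrite -(beta_reg_rreg bexp01 (ltW s1)).
Qed.

(** Case (b) is a Chebyshev-type argument. The set [S] where [hker] exceeds [wker] is an initial
    segment of [(0, 1)] by [hker_cross]. With [M] the supremum of [g] on [S], monotonicity gives
    [g <= M] on [S] and [g >= M] off it, so [(hker - wker) (g - M) <= 0] everywhere; the integral of
    [M (hker - wker)] is nonpositive by hypothesis. *)
Lemma hker_le_wker (g : R -> R) (C : R) :
  hyp_a \/ (condb_integral p alpha <= (1 / (4 * (alpha + 1)))%:E)%E ->
  measurable_fun setT g -> (forall s, 0 <= g s <= C) ->
  (forall s t, 0 < s -> s < t -> t < 1 -> g s <= g t) ->
  (\int[mu]_s (hker s * g s)%:E <= \int[mu]_s (wker s * g s)%:E)%E.
Proof.
move=> hab mg gC gm.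
have mh := measurable_hker; have mw := measurable_wker.
have g0 s : 0 <= g s by case/andP: (gC s).
have h0 := hker_ge0; have w0 := wker_ge0.
have pw : (forall s, hker s <= wker s) -> (\int[mu]_s (hker s * g s)%:E <= \int[mu]_s (wker s * g s)%:E)%E.
  move=> hw; apply: le_integralT.
  - by meas.
  - by move=> s; rewrite lee_fin mulr_ge0.
  - by meas.
  - by move=> s; rewrite lee_fin ler_wpM2r.
case: hab => [ha|hb]; first exact/pw/hker_le_wker_a.
pose S := [set s | 0 < s < 1 /\ wker s < hker s].
case: (pselect (S = set0)) => [S0|/eqP/set0P[s1 Ss1]].
  apply: pw => s; rewrite leNgt; apply/negP => sl.
  have : S s; last by rewrite S0.
  split=> //; move: sl; rewrite /hker /wker; case: ifP => //; by rewrite ltxx.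
pose M := sup (g @` S).
have hs : has_sup (g @` S).
  split; first by exists (g s1), s1.
  by exists C => _ [s _ <-]; case/andP: (gC s).
have M0 : 0 <= M by apply: (le_trans (g0 s1)); apply: (sup_upper_bound hs); exists s1.
have wfin : (\int[mu]_s (wker s)%:E)%E \is a fin_num by rewrite integral_wker.
(* The product inequality, arranged so that every term is nonnegative and can be integrated in the
   extended reals; the common term is cancelled at the end because it is finite. *)
have pt s : hker s * g s + M * wker s <= wker s * g s + M * hker s.
  case: (boolP (0 < s < 1)) => s01; last by rewrite /hker /wker (negbTE s01) !mul0r mulr0.
  case: (ltP (wker s) (hker s)) => hw.
    have : g s <= M by apply: (sup_upper_bound hs); exists s.
    move: (g s) hw => G; move: (hker s) (wker s) => H W; nra.
  have : M <= g s.
    apply: ge_sup; first by exists (g s1), s1.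
    move=> _ [t [/andP[t0 t1] wt] <-].
    have ts : t < s.
      rewrite ltNge; apply/negP; rewrite le_eqVlt => /orP[/eqP e|st].
        by move: wt; rewrite -e ltNge hw.
      by move: (hker_cross (proj1 (andP s01)) st t1 wt); rewrite ltNge hw.
    by apply: gm => //; case/andP: s01.
  move: (g s) hw => G; move: (hker s) (wker s) => H W; nra.
have I1 := integral_hker_b hb.
have : (\int[mu]_s (hker s * g s)%:E + M%:E * \int[mu]_s (wker s)%:E <=
        \int[mu]_s (wker s * g s)%:E + M%:E * \int[mu]_s (wker s)%:E)%E.
  apply: (@le_trans _ _ (\int[mu]_s (wker s * g s)%:E + M%:E * \int[mu]_s (hker s)%:E)%E); last first.
    by rewrite leeD2l // lee_wpmul2l // lee_fin.
  rewrite -(integralTZl mu); last 3 first.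
  - by meas.
  - by move=> s; rewrite lee_fin.
  - by [].
  rewrite -(integralTZl mu); last 3 first.
  - by meas.
  - by move=> s; rewrite lee_fin.
  - by [].
  rewrite -(integralTD mu); last 4 first.
  - by meas.
  - by move=> s; rewrite lee_fin mulr_ge0.
  - by meas.
  - by move=> s; rewrite -EFinM lee_fin mulr_ge0.
  rewrite -(integralTD mu); last 4 first.
  - by meas.
  - by move=> s; rewrite lee_fin mulr_ge0.
  - by meas.
  - by move=> s; rewrite -EFinM lee_fin mulr_ge0.
  apply: le_integralT.
  - by meas.
  - by move=> s; rewrite -EFinM lee_fin addr_ge0 ?mulr_ge0.
  - by meas.
  - by move=> s; rewrite -!EFinM -!EFinD lee_fin.
by rewrite leeD2rE // fin_numM.
Qed.

End KeyInequality.

(** * The integral representation on polynomials *)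

Section HilbertPolynomial.
Variable R : realType.
Local Notation mu := (@lebesgue_measure R).

Definition hcoef (a : nat -> R[i]) (N n : nat) : R[i] := \sum_(k < N) a k / (n + k + 1)%:R.

(* With [omega = 1 / (1 - (1 - t) z)], this is [omega * q (t omega)] for [q = cpoly a N]. *)
Definition twist (z : R[i]) (t : R) : R[i] := (1 - (1 - t)%:C%C * z)^-1.

Definition tpoly a N (z : R[i]) (t : R) : R[i] := twist z t * cpoly a N (t%:C%C * twist z t).

Lemma rbeta_binom n k : 'C(n + k, k)%:R * rbeta k.+1%:R n.+1%:R = (n + k + 1)%:R^-1 :> R.
Proof.
elim: n => [|n IH].
  by rewrite add0n binn mul1r rbeta_sym rbeta1l ?ltr0n // addn1.
have k0 : 0 < k.+1%:R :> R by rewrite ltr0n.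
have n0 : 0 < n.+1%:R :> R by rewrite ltr0n.
have := rbeta_recr k0 n0; rewrite natr1 -natrD => e.
have b : (n.+1 * 'C(n.+1 + k, k) = (n + k + 1) * 'C(n + k, k))%N.
  have -> : 'C(n.+1 + k, k) = 'C(n.+1 + k, n.+1) by rewrite -[RHS]bin_sub ?leq_addr // addKn.
  have -> : 'C(n + k, k) = 'C(n + k, n) by rewrite -[RHS]bin_sub ?leq_addr // addKn.
  by rewrite -mul_bin_diag addSn /= addn1.
have b' : n.+1%:R * 'C(n.+1 + k, k)%:R = (n + k + 1)%:R * 'C(n + k, k)%:R :> R by rewrite -!natrM b.
have m0 : (n + k + 1)%:R != 0 :> R by rewrite pnatr_eq0 addn1.
have m1 : (n.+1 + k + 1)%:R != 0 :> R by rewrite pnatr_eq0 addn1.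
have en : (k.+1 + n.+1 = n.+1 + k + 1)%N by lia.
rewrite en in e.
apply: (mulfI m1); rewrite mulfV // mulrCA -e mulrCA mulrA b' -mulrA IH.
by rewrite mulfV.
Qed.

(** A Bernstein polynomial, with integral [1 / (n + k + 1)] over [(0, 1)]. It is preferred to
    [t ^ (n + k)] because summing it against [z ^ n] over [n] gives [t ^ k omega ^ (k + 1)], the
    form behind [tpoly]. *)
Definition bern n k (t : R) : R := if (0 < t) && (t < 1) then 'C(n + k, k)%:R * t ^+ k * (1 - t) ^+ n else 0.

Lemma measurable_bern n k : measurable_fun setT (bern n k).
Proof. by rewrite /bern; meas. Qed.

Lemma bern_ge0 n k t : 0 <= bern n k t.
Proof.
by rewrite /bern; case: ifP => // /andP[t0 t1]; rewrite !mulr_ge0 ?exprn_ge0 // ?subr_ge0 ltW.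
Qed.

Lemma integral_bern n k : (\int[mu]_t (bern n k t)%:E = ((n + k + 1)%:R^-1)%:E)%E.
Proof.
rewrite -rbeta_binom EFinM -rbetaE ?ltr0n // /ebeta.
have mb := measurable_bker (k.+1%:R : R) n.+1%:R.
rewrite -(integralTZl mu); last 3 first.
- by meas.
- by move=> t; rewrite lee_fin bker_ge0.
- exact: ler0n.
apply: eq_integral => t _; rewrite -EFinM; congr EFin; rewrite /bern /bker.
case: ifP => [/andP[t0 t1]|]; last by rewrite mulr0.
rewrite -!natr1 !addrK !powR_mulrn ?mulrA // ?subr_ge0 ltW //.
Qed.

(** The coefficients are of either sign and the integral of [G] may be infinite. Separating positive
    and negative parts keeps all integrands nonnegative, so no integrability of the combination is
    asked for. *)
Lemma lincomb_le (I : Type) (r : seq I) (c J : I -> R) (f : I -> R -> R) (G : R -> \bar R) :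
  (forall i, measurable_fun setT (f i)) -> (forall i t, 0 <= f i t) ->
  (forall i, \int[mu]_t (f i t)%:E = (J i)%:E)%E ->
  measurable_fun setT G -> (forall t, 0 <= G t)%E ->
  (forall t, ((\sum_(i <- r) c i * f i t)%:E <= G t)%E) ->
  ((\sum_(i <- r) c i * J i)%:E <= \int[mu]_t G t)%E.
Proof.
move=> mf f0 fJ mG G0 h.
pose cp i := Num.max (c i) 0; pose cm i := Num.max (- c i) 0.
have cpm i : c i = cp i - cm i by rewrite /cp /cm; case: (lerP (c i) 0) => h1; case: (lerP (- c i) 0) => h2; lra.
have cp0 i : 0 <= cp i by rewrite /cp le_max lexx orbT.
have cm0 i : 0 <= cm i by rewrite /cm le_max lexx orbT.
have int_comb (d : I -> R) : (forall i, 0 <= d i) ->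
    [/\ measurable_fun setT (fun t => (\sum_(i <- r) d i * f i t)%:E),
      forall t, (0 <= (\sum_(i <- r) d i * f i t)%:E)%E &
      (\int[mu]_t (\sum_(i <- r) d i * f i t)%:E = (\sum_(i <- r) d i * J i)%:E)%E].
  move=> d0; elim: r {h} => [|i r [IH1 IH2 IH3]].
    split.
    - have -> : (fun t => (\sum_(i <- [::]) d i * f i t)%:E) = (fun=> 0%:E) by apply/funext => t; rewrite big_nil.
      exact: measurable_cst.
    - by move=> t; rewrite big_nil.
    - by under eq_integral do rewrite big_nil; rewrite integral0 big_nil.
  have E t : (\sum_(j <- i :: r) d j * f j t)%:E = ((d i)%:E * (f i t)%:E + (\sum_(j <- r) d j * f j t)%:E)%E.
    by rewrite big_cons EFinD EFinM.
  have m1 := mf i.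
  have m2 : measurable_fun setT (fun t => (d i)%:E * (f i t)%:E)%E by meas.
  split.
  - by rewrite (funext E); apply: emeasurable_funD.
  - move=> t; rewrite lee_fin sumr_ge0 // => j _; exact: mulr_ge0.
  - rewrite (funext E) (integralTD mu m2 _ IH1 IH2); last first.
      by move=> t; rewrite -EFinM lee_fin mulr_ge0.
    rewrite (integralTZl mu); last 3 first.
    + by meas.
    + by move=> t; rewrite lee_fin.
    + exact: d0.
    by rewrite IH3 fJ big_cons EFinD EFinM.
have [mp p0 Ip] := int_comb cp cp0; have [mm m0 Im] := int_comb cm cm0.
have -> : \sum_(i <- r) c i * J i = \sum_(i <- r) cp i * J i - \sum_(i <- r) cm i * J i.
  by rewrite -sumrB; apply: eq_bigr => i _; rewrite -mulrBl -cpm.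
rewrite EFinB leeBlDr // -Ip -Im -(integralTD mu mG G0 mm m0).
apply: le_integralT => //.
- exact: emeasurable_funD.
- move=> t; rewrite -leeBlDr // -EFinB -sumrB.
  by under eq_bigr => i _ do rewrite -mulrBl -cpm.
Qed.

(** The truncation at [M] of the binomial series of [(1 - v) ^ (- (k + 1))]. *)
Definition bsum (A : comNzRingType) (k M : nat) (v : A) : A := \sum_(n < M) 'C(n + k, k)%:R * v ^+ n.

Lemma bsum0 (A : comNzRingType) M (v : A) : (1 - v) * bsum 0 M v = 1 - v ^+ M.
Proof.
have -> : bsum 0 M v = \sum_(n < M) v ^+ n by apply: eq_bigr => n _; rewrite addn0 bin0 mul1r.
by rewrite -opprB mulNr -subrX1 opprB.
Qed.

Lemma bsum_rec (A : comNzRingType) k M (v : A) :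
  (1 - v) * bsum k.+1 M v = bsum k M v - 'C(M + k, k.+1)%:R * v ^+ M.
Proof.
elim: M => [|M IH]; first by rewrite /bsum !big_ord0 add0n bin_small // mul0r subrr mulr0.
rewrite /bsum !big_ord_recr /= -!/(bsum _ _ _) mulrDr IH addnS binS natrD exprS; ring.
Qed.

(** Bounds the truncation error of [bsum] uniformly for [|v| <= rho]; the recursion on [k] mirrors
    [bsum_rec], each step dividing by [1 - rho]. *)
Fixpoint berr (rho : R) (k M : nat) : R :=
  if k is k'.+1 then (berr rho k' M + 'C(M + k', k'.+1)%:R * rho ^+ M) / (1 - rho) else rho ^+ M / (1 - rho).

Section Rho.
Variable rho : R.
Hypothesis rho01 : 0 <= rho < 1.

Let rho0 : 0 <= rho. Proof. by case/andP: rho01. Qed.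
Let rho1 : 0 < 1 - rho. Proof. by case/andP: rho01 => _; rewrite subr_gt0. Qed.

Lemma cmod_1B_ge (v : R[i]) : cmod v <= rho -> 1 - rho <= cmod (1 - v).
Proof.
move=> h; rewrite lerBlDr; apply: (@le_trans _ _ (cmod (1 - v) + cmod v)); last by rewrite lerD2l.
by rewrite -[X in X <= _](cmod1 R) -[X in cmod X <= _](subrK v) cmodD.
Qed.

Lemma bsum_err k M (v : R[i]) : cmod v <= rho -> cmod (bsum k M v - (1 - v)^-1 ^+ k.+1) <= berr rho k M.
Proof.
move=> vr; have h1 := cmod_1B_ge vr.
have p1 : 0 < cmod (1 - v) by exact: lt_le_trans rho1 h1.
have v1 : 1 - v != 0 by rewrite -cmod_eq0 gt_eqF.
have red (A : R[i]) (e : R) : cmod ((1 - v) * A) <= e -> cmod A <= e / (1 - rho).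
  move=> h; rewrite ler_pdivlMr // mulrC; apply: le_trans h; rewrite cmodM.
  by rewrite ler_wpM2r ?cmod_ge0.
have pw : cmod (v ^+ M) <= rho ^+ M by rewrite cmodX lerXn2r ?nnegrE ?cmod_ge0.
elim: k => [|k IH] /=; apply: red.
  rewrite mulrBr expr1 mulfV //.
  rewrite bsum0.
  by rewrite addrC addrA addNr add0r cmodN.
rewrite mulrBr bsum_rec exprS (mulrA (1 - v)) mulfV // mul1r.
have -> : forall X Y Z : R[i], X - Y - Z = (X - Z) - Y by move=> X Y Z; ring.
apply: (le_trans (cmodD _ _)); apply: lerD; first exact: IH.
by rewrite cmodN cmodM cmod_nat ler_wpM2l ?ler0n.
Qed.

Lemma binom_sum_le k M : \sum_(n < M) 'C(n + k, k)%:R * rho ^+ n <= (1 - rho)^-1 ^+ k.+1.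
Proof.
rewrite -/(bsum k M rho); elim: k M => [|k IH] M.
  rewrite expr1 -[X in _ <= X]mul1r ler_pdivlMr // mulrC bsum0.
  by rewrite gerBl exprn_ge0.
rewrite exprSr ler_pdivlMr // mulrC bsum_rec.
by apply: le_trans (IH M); rewrite gerBl mulr_ge0 ?ler0n ?exprn_ge0.
Qed.

(** Up to raising the upper index by 1, this is the general term of a series with bounded
    nonnegative partial sums. *)
Lemma binom_term_cvg0 k : (fun M => 'C(M + k, k.+1)%:R * rho ^+ M : R) @ \oo --> (0 : R).
Proof.
have c : cvgn (series (fun n => 'C(n + k.+1, k.+1)%:R * rho ^+ n : R)).
  apply: nondecreasing_is_cvgn.
    apply/nondecreasing_seqP => n; rewrite /series /= big_nat_recr //= lerDl.
    by rewrite mulr_ge0 ?ler0n ?exprn_ge0.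
  exists ((1 - rho)^-1 ^+ k.+2) => _ [M _ <-]; rewrite /series /= big_mkord; exact: binom_sum_le.
have := cvg_series_cvg_0 c.
apply: (@squeeze_cvgr _ _ _ _ (fun=> 0) (fun n => 'C(n + k.+1, k.+1)%:R * rho ^+ n : R)); last exact: cvg_cst.
near=> M; rewrite mulr_ge0 ?ler0n ?exprn_ge0 //= ler_wpM2r ?exprn_ge0 // ler_nat.
by rewrite addnS leq_bin2l.
Unshelve. all: by end_near.
Qed.

Lemma berr_cvg0 k : berr rho k @ \oo --> (0 : R).
Proof.
have rc : (fun M => rho ^+ M : R) @ \oo --> (0 : R).
  by apply: cvg_expr; rewrite ger0_norm // -subr_gt0.
elim: k => [|k IH].
  rewrite /= -(mul0r (1 - rho)^-1); apply: cvgM; [exact: rc|exact: cvg_cst].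
rewrite /= -(mul0r (1 - rho)^-1) -[X in X / _](addr0 0); apply: cvgM; last exact: cvg_cst.
by apply: cvgD; [exact: IH|exact: binom_term_cvg0].
Qed.

End Rho.

Lemma cmeasurable_twist z : cmeasurable (twist z).
Proof.
apply: cmeasurable_inv; apply: cmeasurableD; first exact: cmeasurable_cst.
have -> : (fun t : R => - ((1 - t)%:C%C * z)) = (fun t : R => (t - 1)%:C%C * z).
  by apply/funext => t; rewrite -mulNr -raddfN opprB.
apply: cmeasurableM; last exact: cmeasurable_cst.
by split => /=; meas.
Qed.

Lemma measurable_cmod_tpoly a N z : measurable_fun setT (fun t => cmod (tpoly a N z t)).
Proof.
apply: measurable_cmod; apply: cmeasurableM; first exact: cmeasurable_twist.
apply: cmeasurable_cpoly; apply: cmeasurableM; last exact: cmeasurable_twist.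
by split => /=; meas.
Qed.

Definition tint a N (z : R[i]) : \bar R :=
  (\int[mu]_t (if (0 < t) && (t < 1) then cmod (tpoly a N z t) else 0)%:E)%E.

(** Turns a bound on a modulus into one on a real part, which is a real linear combination of the
    integrals of [bern], as [lincomb_le] requires. *)
Lemma cmod_unit (u : R[i]) : exists2 l : R[i], cmod l <= 1 & complex.Re (l * u) = cmod u.
Proof.
case: (eqVneq u 0) => [->|u0]; first by exists 0; rewrite ?mulr0 cmod0.
have c0 : cmod u != 0 by rewrite cmod_eq0.
exists (u^*%C * ((cmod u)^-1)%:C%C).
  by rewrite cmodM cmod_conj cmod_real ger0_norm ?invr_ge0 ?cmod_ge0 // mulfV.
rewrite mulrAC [u^*%C * u]mulrC -cmod_mul_conj -rmorphM /= expr2 mulfK //.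
Qed.

Lemma Re_real_mul (u : R[i]) (x : R) : complex.Re (u * x%:C%C) = complex.Re u * x.
Proof. by case: u => a b /=; rewrite mulr0 subr0. Qed.

(** The integral formula for [H] at the level of partial sums, as an inequality: only finite sums
    are exchanged with the integral, and the truncation error is uniform in [t] because
    [|(1 - t) z| <= |z|]. *)
Lemma hilbert_partial_le a N M (z : R[i]) : cmod z < 1 ->
  ((cmod (\sum_(n < M) hcoef a N n * z ^+ n))%:E <=
   tint a N z + (\sum_(k < N) cmod (a k) * berr (cmod z) k M)%:E)%E.
Proof.
move=> z1; have z01 : 0 <= cmod z < 1 by rewrite cmod_ge0.
set E := \sum_(k < N) _.
have mT := measurable_cmod_tpoly a N z.
have E0 : 0 <= E.
  apply: sumr_ge0 => k _; apply: mulr_ge0; first exact: cmod_ge0.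
  have := bsum_err z01 k M (lexx (cmod z)); apply: le_trans; exact: cmod_ge0.
have i1 : (\int[mu]_t (if (0 < t) && (t < 1) then 1 else 0)%:E = 1 :> \bar R)%E.
  have := @integral_powR_0 R 1 1 ltr01 ltr01; rewrite powR1 => <-.
  apply: eq_integral => t _; case: ifP => // /andP[t0 _].
  by rewrite subrr powRr0 mulr1.
have [l l1 <-] := cmod_unit (\sum_(n < M) hcoef a N n * z ^+ n).
have -> : complex.Re (l * \sum_(n < M) hcoef a N n * z ^+ n) =
   \sum_(i : 'I_N * 'I_M) complex.Re (l * a i.1 * z ^+ i.2) * (i.2 + i.1 + 1)%:R^-1.
  rewrite -(pair_bigA _ (fun (i : 'I_N) (n : 'I_M) => complex.Re (l * a i * z ^+ n) * (n + i + 1)%:R^-1)) /=.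
  rewrite exchange_big mulr_sumr Re_sum /=; apply: eq_bigr => n _.
  rewrite /hcoef mulr_suml mulr_sumr Re_sum; apply: eq_bigr => k _.
  rewrite -Re_real_mul; congr complex.Re.
  rewrite fmorphV rmorph_nat; ring.
apply: (@le_trans _ _ (\int[mu]_t ((if (0 < t) && (t < 1) then cmod (tpoly a N z t) else 0)%:E +
   E%:E * (if (0 < t) && (t < 1) then 1 else 0)%:E))%E); last first.
  rewrite (integralTD mu); last 4 first.
  - by meas.
  - by move=> t; rewrite lee_fin; case: ifP => // _; exact: cmod_ge0.
  - by meas.
  - by move=> t; rewrite -EFinM lee_fin mulr_ge0 //; case: ifP.
  rewrite (integralTZl mu); last 3 first.
  - by meas.
  - by move=> t; rewrite lee_fin; case: ifP.
  - exact: E0.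
  by rewrite i1 mule1.
apply: (@lincomb_le _ _ _ _ (fun i : 'I_N * 'I_M => bern i.2 i.1)).
- by move=> i; exact: measurable_bern.
- by move=> i t; exact: bern_ge0.
- by move=> i; exact: integral_bern.
- by meas.
- move=> t; rewrite -EFinM -EFinD lee_fin; apply: addr_ge0; first by case: ifP => // _; exact: cmod_ge0.
  by rewrite mulr_ge0 //; case: ifP.
move=> t; rewrite -EFinM -EFinD lee_fin /bern.
case: ifP => [/andP[t0 t1]|_]; last by rewrite big1 ?mulr0 ?addr0 // => i _; rewrite mulr0.
rewrite mulr1.
pose v := (1 - t)%:C%C * z.
have vz : cmod v <= cmod z.
  by rewrite cmodM cmod_real ger0_norm ?subr_ge0 ?(ltW t1) // ler_piMl ?cmod_ge0 // gerBl ltW.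
have -> : \sum_(i : 'I_N * 'I_M) complex.Re (l * a i.1 * z ^+ i.2) * ('C(i.2 + i.1, i.1)%:R * t ^+ i.1 * (1 - t) ^+ i.2) =
  complex.Re (l * \sum_(k < N) a k * t%:C%C ^+ k * bsum k M v).
  rewrite -(pair_bigA _ (fun (i : 'I_N) (n : 'I_M) => complex.Re (l * a i * z ^+ n) * ('C(n + i, i)%:R * t ^+ i * (1 - t) ^+ n))) /=.
  rewrite mulr_sumr Re_sum; apply: eq_bigr => k _.
  rewrite /bsum !mulr_sumr Re_sum; apply: eq_bigr => n _.
  rewrite -Re_real_mul; congr complex.Re.
  rewrite !rmorphM rmorph_nat !rmorphXn /v exprMn; ring.
apply: (le_trans (ler_norm _)); apply: (le_trans (Re_le_cmod _)); rewrite cmodM.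
apply: (@le_trans _ _ (cmod (\sum_(k < N) a k * t%:C%C ^+ k * bsum k M v))); first by rewrite ler_piMl ?cmod_ge0.
have -> : \sum_(k < N) a k * t%:C%C ^+ k * bsum k M v = tpoly a N z t +
    \sum_(k < N) a k * t%:C%C ^+ k * (bsum k M v - (1 - v)^-1 ^+ k.+1).
  rewrite /tpoly /cpoly mulr_sumr -big_split; apply: eq_bigr => k _ /=.
  rewrite /twist -/v exprMn exprS; ring.
apply: (le_trans (cmodD _ _)); rewrite lerD2l.
apply: (le_trans (cmod_sum _ _ _)); apply: ler_sum => k _.
rewrite !cmodM cmodX cmod_real (ger0_norm (ltW t0)) -mulrA; apply: ler_wpM2l; first exact: cmod_ge0.
apply: le_trans (bsum_err z01 k M vz).
by rewrite ler_piMl ?cmod_ge0 // exprn_ile1 // ltW.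
Qed.

Lemma ccvg_cmod (u : nat -> R[i]) l : ccvg_to u l -> (fun n => cmod (u n)) @ \oo --> cmod l.
Proof.
move=> [h1 h2]; rewrite /cmod.
have c : (fun n => complex.Re (u n) * complex.Re (u n) + complex.Im (u n) * complex.Im (u n)) @ \oo -->
    complex.Re l * complex.Re l + complex.Im l * complex.Im l by apply: cvgD; apply: cvgM.
exact: continuous_cvg (@sqrt_continuous R _) c.
Qed.

Lemma cvg_lincomb0 (c : nat -> R) (u : nat -> nat -> R) N :
  (forall k, u k @ \oo --> (0 : R)) -> (fun M => \sum_(k < N) c k * u k M) @ \oo --> (0 : R).
Proof.
move=> h; elim: N => [|N IH].
  by under eq_fun do rewrite big_ord0; exact: cvg_cst.
have -> : (fun M => \sum_(k < N.+1) c k * u k M) = (fun M => \sum_(k < N) c k * u k M + c N * u N M).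
  by apply/funext => M; rewrite big_ord_recr.
have h2 : (fun M => c N * u N M) @ \oo --> c N * 0 by apply: cvgM; [exact: cvg_cst|exact: h].
by have := cvgD IH h2; rewrite mulr0 addr0; exact.
Qed.

Lemma hilbert_poly_le a N (z l : R[i]) : cmod z < 1 ->
  ccvg_to (fun M => \sum_(n < M) hcoef a N n * z ^+ n) l -> ((cmod l)%:E <= tint a N z)%E.
Proof.
move=> z1 /ccvg_cmod h; have z01 : 0 <= cmod z < 1 by rewrite cmod_ge0.
have t0 : (0 <= tint a N z)%E.
  by apply: integral_ge0 => t _; rewrite lee_fin; case: ifP => // _; exact: cmod_ge0.
have := fun M => hilbert_partial_le a N M z1.
move: t0; case: (tint a N z) => [I||] // _ hM; last by rewrite leey.
rewrite lee_fin.
have c2 : (fun M => I + \sum_(k < N) cmod (a k) * berr (cmod z) k M) @ \oo --> I.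
  rewrite -[X in _ --> X]addr0; apply: cvgD; first exact: cvg_cst.
  by apply: (cvg_lincomb0 (fun k => cmod (a k))) => k; exact: berr_cvg0.
apply: (ler_cvg_to h c2); near=> M.
by have := hM M; rewrite -EFinD lee_fin.
Unshelve. all: by end_near.
Qed.

End HilbertPolynomial.

(** * The norm inequality for polynomials *)

Section PolynomialBound.
Variable R : realType.
Local Notation mu := (@lebesgue_measure R).
Local Notation nu := (@leb2 R).

(** The Bergman weight extended by 0, without the factor [(alpha + 1) / pi]; the exponent is also
    allowed to be negative in the coefficient estimates. *)
Definition dweight (alpha : R) (z : R * R) : R := if sqn z < 1 then (1 - sqn z) `^ alpha else 0.

Lemma dweight_ge0 alpha z : 0 <= dweight alpha z.
Proof. by rewrite /dweight; case: ifP => // _; exact: powR_ge0. Qed.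

Lemma measurable_dweight alpha : measurable_fun setT (dweight alpha).
Proof. by have ms := @measurable_sqn R; rewrite /dweight; meas. Qed.

Lemma leb2_disk_fin : (\int[nu]_z (if sqn z < 1 then 1 else 0)%:E < +oo)%E.
Proof.
have ms := @measurable_sqn R.
pose b (x : R) : R := if (-1 < x) && (x < 1) then 1 else 0.
have b0 x : 0 <= b x by rewrite /b; case: ifP.
have mb : measurable_fun setT b by rewrite /b; meas.
have Ib : (\int[mu]_x (b x)%:E = 2%:E)%E.
  have e1 := @integral_powR_0 R 1 2 ltr01 (ltr0n R 2).
  have me : measurable_fun setT (fun x => (b x)%:E) by meas.
  have e0 x : (0 <= (b x)%:E)%E by rewrite lee_fin.
  rewrite (ge0_integral_affine (-1) (oner_neq0 R) me e0) normr1 mul1e.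
  rewrite powRr1 // in e1; rewrite -e1; apply: eq_integral => x _; congr EFin.
  rewrite /b subrr powRr0 mul1r; congr (if _ then _ else _).
  by congr andb; apply/idP/idP; lra.
have mb2 : measurable_fun setT (fun z : R * R => (b z.1 * b z.2)%:E).
  have m1 : measurable_fun setT (fun z : R * R => b z.1) by apply: (measurableT_comp mb); meas.
  have m2 : measurable_fun setT (fun z : R * R => b z.2) by apply: (measurableT_comp mb); meas.
  by meas.
apply: (@le_lt_trans _ _ (\int[nu]_z (b z.1 * b z.2)%:E)%E).
  apply: le_integralT.
  - by meas.
  - by move=> z; rewrite lee_fin; case: ifP.
  - exact: mb2.
  move=> [x y]; rewrite lee_fin; case: ifP => h; last exact: mulr_ge0 (b0 _) (b0 _).
  move: h; rewrite /b /sqn /= => h.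
  have -> : (-1 < x) && (x < 1).
    by apply/andP; split; have := sqr_ge0 y; nra.
  have -> : (-1 < y) && (y < 1).
    by apply/andP; split; have := sqr_ge0 x; nra.
  by rewrite mulr1.
rewrite (leb2E mb2); last by move=> z; rewrite lee_fin mulr_ge0.
have -> : (\int[mu]_x \int[mu]_y (b (x, y).1 * b (x, y).2)%:E = \int[mu]_x (2%:E * (b x)%:E))%E.
  apply: eq_integral => x _ /=.
  transitivity (\int[mu]_y ((b x)%:E * (b y)%:E))%E; first by apply: eq_integral => y _; rewrite EFinM.
  rewrite (integralTZl mu); first by rewrite Ib muleC.
  - by meas.
  - by move=> y; rewrite lee_fin.
  - exact: b0.
rewrite (integralTZl mu); first by rewrite Ib -EFinM ltry.
- by meas.
- by move=> x; rewrite lee_fin.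
- exact: ler0n.
Qed.

Variables alpha p : R.
Hypotheses (alpha0 : 0 <= alpha) (p_gt : 2 + 2 * alpha < p).

Let x := bexp alpha p.
Let x01 : 0 < x < 1. Proof. exact: bexp01. Qed.
Let p1 : 1 < p. Proof. by move: alpha0 p_gt; lra. Qed.
Let B := rbeta x (1 - x).
Let B0 : 0 < B. Proof. exact: rbeta01_gt0. Qed.
Let xp : x * p = 2 + alpha.
Proof. by rewrite /x /bexp divfK // gt_eqF // (lt_trans ltr01). Qed.

Variables (a : nat -> R[i]) (N : nat).

Definition kerp (t : R) : R := if (0 < t) && (t < 1) then bker (bexp alpha p) (1 - bexp alpha p) t `^ (1 - p) else 0.

Lemma kerp_ge0 t : 0 <= kerp t.
Proof. by rewrite /kerp; case: ifP => // _; exact: powR_ge0. Qed.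

Lemma measurable_kerp : measurable_fun setT kerp.
Proof. by have mb := measurable_bker (bexp alpha p) (1 - bexp alpha p); rewrite /kerp; meas. Qed.

(* Hoelder's inequality for [\int T = \int k ^ (1 / p') * (k ^ (- 1 / p') * T)] with [k] the Beta kernel. *)
Lemma tint_holder (z : R[i]) (M : R) : 0 <= M -> (M%:E <= tint a N z)%E ->
  ((B * (M / B) `^ p)%:E <= \int[mu]_t (kerp t * cmod (tpoly a N z t) `^ p)%:E)%E.
Proof.
move=> M0 hM; have mT := measurable_cmod_tpoly a N z; have mk := measurable_kerp.
have mb := measurable_bker x (1 - x).
have q0 : 0 <= M / B by rewrite divr_ge0 // ltW.
have T0 t : 0 <= cmod (tpoly a N z t) by exact: cmod_ge0.
have b0 t : 0 <= bker x (1 - x) t by exact: bker_ge0.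
pose m := M / B.
have mp : m `^ p = m `^ (p - 1) * m.
  have [->|m0] := eqVneq m 0; first by rewrite mulr0 powR0 // gt_eqF // (lt_trans ltr01).
  rewrite -powRDn ?subrK // lt_neqAle eq_sym m0; exact: q0.
have i1 : ((p * m `^ (p - 1))%:E * tint a N z <=
    \int[mu]_t (kerp t * cmod (tpoly a N z t) `^ p)%:E + ((p - 1) * m `^ p)%:E * ebeta x (1 - x))%E.
  have mind : measurable_fun setT (fun t : R => (if (0 < t) && (t < 1) then cmod (tpoly a N z t) else 0)%:E) by meas.
  rewrite /tint /ebeta -(integralTZl mu); last 3 first.
  - exact: mind.
  - by move=> t; rewrite lee_fin; case: ifP.
  - by rewrite mulr_ge0 ?powR_ge0 // (le_trans ler01) // ltW.
  rewrite -(integralTZl mu); last 3 first.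
  - by meas.
  - by move=> t; rewrite lee_fin.
  - by rewrite mulr_ge0 ?powR_ge0 // subr_ge0 ltW.
  rewrite -(integralTD mu); last 4 first.
  - by meas.
  - by move=> t; rewrite lee_fin mulr_ge0 ?kerp_ge0 ?powR_ge0.
  - by meas.
  - by move=> t; rewrite -EFinM lee_fin !mulr_ge0 ?powR_ge0 // subr_ge0 ltW.
  apply: le_integralT.
  - by meas.
  - move=> t; rewrite -EFinM lee_fin mulr_ge0 //; last by case: ifP.
    by rewrite mulr_ge0 ?powR_ge0 // (le_trans ler01) // ltW.
  - by meas.
  move=> t; rewrite -!EFinM -EFinD lee_fin /kerp -/x.
  case: ifP => [/andP[t0 t1]|]; last first.
    by move=> t01; rewrite mulr0 mul0r add0r !mulr_ge0 ?powR_ge0 // subr_ge0 ltW.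
  set T := cmod _; set k := bker _ _ _.
  have k0 : 0 < k.
    by rewrite /k /bker t0 t1 mulr_gt0 ?powR_gt0 // subr_gt0.
  have mk0 : 0 <= m * k by rewrite mulr_ge0 // ltW.
  (* The tangent is taken at [m k], the equality case of Hoelder's inequality, in which [T] is
     proportional to the kernel; [m = M / B] gives this multiple the integral [M]. *)
  have := powR_tangent p1 (T0 t) mk0; rewrite -/T => tg.
  have kk : k `^ (1 - p) * k `^ (p - 1) = 1.
    by rewrite -(powRDp _ _ k0) (_ : 1 - p + (p - 1) = 0) ?powRr0 //; ring.
  have kp : k `^ p = k `^ (p - 1) * k by rewrite -(powRDn _ k0) subrK.
  have := ler_wpM2l (powR_ge0 k (1 - p)) tg.
  rewrite !(powRM _ q0 (ltW k0)) kp.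
  have -> : k `^ (1 - p) * (p * (m `^ (p - 1) * k `^ (p - 1)) * T) = p * m `^ (p - 1) * T * (k `^ (1 - p) * k `^ (p - 1)) by ring.
  have -> : k `^ (1 - p) * (T `^ p + (p - 1) * (m `^ p * (k `^ (p - 1) * k))) =
    k `^ (1 - p) * T `^ p + (p - 1) * m `^ p * k * (k `^ (1 - p) * k `^ (p - 1)) by ring.
  by rewrite kk !mulr1.
have c0 : (0 <= (p * m `^ (p - 1))%:E)%E by rewrite lee_fin mulr_ge0 ?powR_ge0 // (le_trans ler01) // ltW.
have i2 := le_trans (lee_wpmul2l c0 hM) i1.
have /andP[x0 x1] := x01; have x1' : 0 < 1 - x by rewrite subr_gt0.
rewrite (rbetaE x0 x1') -/B in i2.
have -> : (B * (M / B) `^ p)%:E = ((p * m `^ (p - 1))%:E * M%:E - ((p - 1) * m `^ p)%:E * B%:E)%E.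
  rewrite -/m -!EFinM -EFinB; congr EFin; rewrite mp.
  have -> : M = m * B by rewrite /m divfK // gt_eqF.
  ring.
by rewrite leeBlDr.
Qed.

(** The image of the disk under [u = 1 - (1 - t) z] is the disk about 1 of radius [1 - t]. As
    [|1 - u| >= |1 - rho|], there [t < rho < 2 - t], and [1 - |z| ^ 2] has a bound depending on
    [rho] alone. The conditions [t < rho] and [t rho < 1] become [s < 1] and [t < s] when
    [rho = t / s ^ 2], and the weight bound becomes a product of functions of [t] and of [s]. *)
Lemma disk_image_bounds (t : R) (u : R * R) : 0 < t < 1 ->
  sqn (- (1 - t)^-1 * u.1 + (1 - t)^-1, - (1 - t)^-1 * u.2 + 0) < 1 ->
  let rho := Num.sqrt (sqn u) in
  [/\ t < rho, t * rho < 1 &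
   1 - sqn (- (1 - t)^-1 * u.1 + (1 - t)^-1, - (1 - t)^-1 * u.2 + 0) <= (rho ^+ 2 - t ^+ 2) / ((1 - t) * t)].
Proof.
case: u => u1 u2 /andP[t0 t1]; set rho := Num.sqrt _ => /= h.
have t1' : 0 < 1 - t by rewrite subr_gt0.
have rho0 : 0 <= rho by exact: sqrtr_ge0.
have rho2 : rho ^+ 2 = u1 ^+ 2 + u2 ^+ 2 by rewrite sqr_sqrtr // addr_ge0 // sqr_ge0.
have u1r : u1 <= rho.
  by apply: (le_trans (ler_norm _)); rewrite -sqrtr_sqr ler_wsqrtr // lerDl sqr_ge0.
have e : sqn (- (1 - t)^-1 * u1 + (1 - t)^-1, - (1 - t)^-1 * u2 + 0) = (1 - 2 * u1 + rho ^+ 2) / (1 - t) ^+ 2.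
  by rewrite /sqn /= rho2; field; rewrite gt_eqF.
have h2 : 1 - 2 * u1 + rho ^+ 2 < (1 - t) ^+ 2.
  by move: h; rewrite e ltr_pdivrMr ?exprn_gt0 // mul1r.
have h3 : (1 - rho) ^+ 2 < (1 - t) ^+ 2 by apply: le_lt_trans h2; nra.
have [r1 r2] : t < rho /\ rho < 2 - t.
  have : (rho - t) * (2 - t - rho) > 0 by nra.
  move=> hp; split; rewrite ltNge; apply/negP => hn; nra.
split; [by []|nra|].
rewrite e ler_pdivlMr ?mulr_gt0 //.
have -> : (1 - (1 - 2 * u1 + rho ^+ 2) / (1 - t) ^+ 2) * ((1 - t) * t) = ((1 - t) ^+ 2 - (1 - 2 * u1 + rho ^+ 2)) * t / (1 - t).
  by field; rewrite gt_eqF.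
rewrite ler_pdivrMr //.
have k1 : ((1 - t) ^+ 2 - (1 - 2 * u1 + rho ^+ 2)) * t <= (rho - t) * (2 - t - rho) * t.
  by rewrite ler_pM2r //; nra.
apply: (le_trans k1).
have -> : (rho ^+ 2 - t ^+ 2) * (1 - t) = (rho - t) * ((rho + t) * (1 - t)) by ring.
rewrite -mulrA ler_wpM2l ?subr_ge0 ?(ltW r1) //; nra.
Qed.

(** The radial majorant given by [disk_image_bounds]; [rho ^ (- p)] is the factor [|omega| ^ p],
    since [omega = 1 / u]. *)
Definition imgw (t rho : R) : R :=
  if (t < rho) && (t * rho < 1) then ((rho ^+ 2 - t ^+ 2) / ((1 - t) * t)) `^ alpha * rho `^ (- p) else 0.

Lemma imgw_ge0 t rho : 0 <= imgw t rho.
Proof. by rewrite /imgw; case: ifP => // _; rewrite mulr_ge0 ?powR_ge0. Qed.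

Lemma measurable_imgw t : measurable_fun setT (imgw t).
Proof. by rewrite /imgw; meas. Qed.

Definition invpow (t : R) (u : R * R) : R := cmod (cpoly a N (t%:C%C * (cpt u)^-1)) `^ p.

Lemma measurable_invpow t : measurable_fun setT (invpow t).
Proof.
rewrite /invpow; have m : measurable_fun setT (fun u : R * R => cmod (cpoly a N (t%:C%C * (cpt u)^-1))).
  apply: measurable_cmod; apply: cmeasurable_cpoly; apply: cmeasurableM; first exact: cmeasurable_cst.
  by apply: cmeasurable_inv; exact: cmeasurable_cpt.
by meas.
Qed.

(** For [|u| = s ^ 2] the point [t / u] has modulus [t / s ^ 2] and the direction of the conjugate
    of [u], and circular means are invariant under conjugation. *)
Lemma circ_invpow t s : 0 < t -> 0 < s -> circ (fun u => (invpow t u)%:E) (s ^+ 2) = circ (polypow p a N) (t / s ^+ 2).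
Proof.
move=> t0 s0.
transitivity (circ (fun w => polypow p a N (w.1, - w.2)) (t / s ^+ 2)); last first.
  exact: (circ_conj _ (measurable_polypow p a N) (polypow_ge0 p a N)).
have pt (z : R * R) : ((puncdisk z)%:E * (invpow t (on_circle (s ^+ 2) z))%:E =
    (puncdisk z)%:E * polypow p a N ((on_circle (t / s ^+ 2) z).1, - (on_circle (t / s ^+ 2) z).2)%R)%E; last first.
  by rewrite /circ; apply: eq_integral => z _; exact: pt.
have [zP|zP] := boolP ((0 < sqn z) && (sqn z < 1)); last first.
  have -> : puncdisk z = 0 by rewrite /puncdisk (negbTE zP).
  by transitivity (0 : \bar R)%E; [exact: mul0e|exact/esym/mul0e].
suff key : t%:C%C * (cpt (on_circle (s ^+ 2) z))^-1 = cpt ((on_circle (t / s ^+ 2) z).1, - (on_circle (t / s ^+ 2) z).2).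
  by rewrite /invpow key.
have /andP[z0 _] := zP.
have q0 : 0 < Num.sqrt (sqn z) by rewrite sqrtr_gt0.
have z2 := cmod_cpt_sqr z.
have c0 : cpt z != 0 by rewrite -cmod_eq0 gt_eqF // cmod_cpt.
have lin (r : R) : cpt (on_circle r z) = (r / Num.sqrt (sqn z))%:C%C * cpt z.
  by apply/eqP; rewrite eq_complex /= !mul0r subr0 addr0 !eqxx.
have linc (r : R) : cpt ((on_circle r z).1, - (on_circle r z).2) = (r / Num.sqrt (sqn z))%:C%C * (cpt z)^*%C.
  by apply/eqP; rewrite eq_complex /= !mul0r subr0 addr0 mulrN !eqxx.
rewrite lin linc.
have s20 : (s ^+ 2 / Num.sqrt (sqn z))%:C%C != 0 :> R[i].
  by rewrite (fmorph_eq0 (real_complex R)) mulf_neq0 ?invr_neq0 ?expf_neq0 ?gt_eqF.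
apply: (mulIf (mulf_neq0 s20 c0)); rewrite -mulrA mulVf ?mulf_neq0 // mulr1.
rewrite mulrACA [(cpt z)^*%C * _]mulrC -cmod_mul_conj z2 -!rmorphM /=; congr (_%:C%C).
move: (sqr_sqrtr (ltW z0)) q0; set Q := Num.sqrt _ => <- Q0.
by field; rewrite !gt_eqF.
Qed.

(* Substitute [u = 1 - (1 - t) z], use polar coordinates in [u], then [|u| = t / s ^ 2]. *)
Lemma twisted_integral_le (t : R) : 0 < t < 1 ->
  (\int[nu]_z (dweight alpha z * cmod (tpoly a N (cpt z) t) `^ p)%:E <=
   (4 * (t `^ (2 + alpha - p) * (1 - t) `^ (- (2 + alpha))))%:E *
   \int[mu]_s ((if (t < s) && (s < 1) then s `^ (2 * p - 4 * alpha - 5) * (1 - s ^+ 4) `^ alpha else 0)%:E *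
     circ (polypow p a N) (s ^+ 2)%R))%E.
Proof.
move=> t01; have /andP[t0 t1] := t01.
have t1' : 0 < 1 - t by rewrite subr_gt0.
have mi := measurable_imgw t; have mv := measurable_invpow t; have md := measurable_dweight alpha.
have ms := @measurable_sqn R.
have inv0 u : (0 <= (invpow t u)%:E)%E by rewrite lee_fin powR_ge0.
have mv' : measurable_fun setT (fun u => (invpow t u)%:E) by apply/measurable_EFinP.
have mT : measurable_fun setT (fun z : R * R => cmod (tpoly a N (cpt z) t)).
  apply: measurable_cmod; rewrite /tpoly /twist.
  have mt : cmeasurable (fun z : R * R => (1 - (1 - t)%:C%C * cpt z)^-1).
    apply: cmeasurable_inv; apply: cmeasurableD; first exact: cmeasurable_cst.
    have -> : (fun z : R * R => - ((1 - t)%:C%C * cpt z)) = (fun z : R * R => - (1 - t)%:C%C * cpt z).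
      by apply/funext => z; rewrite mulNr.
    by apply: cmeasurableM; [exact: cmeasurable_cst|exact: cmeasurable_cpt].
  apply: cmeasurableM; first exact: mt.
  by apply: cmeasurable_cpoly; apply: cmeasurableM; [exact: cmeasurable_cst|exact: mt].
pose c := - (1 - t)^-1.
have c0 : c != 0 by rewrite oppr_eq0 invr_eq0 gt_eqF.
pose f (z : R * R) := (dweight alpha z * cmod (tpoly a N (cpt z) t) `^ p)%:E.
have mf : measurable_fun setT f by rewrite /f; meas.
have f0 z : (0 <= f z)%E by rewrite lee_fin mulr_ge0 ?dweight_ge0 ?powR_ge0.
rewrite -/(f _) (ge0_leb2_affine ((1 - t)^-1) 0 c0 mf f0).
pose g (u : R * R) := (imgw t (Num.sqrt (sqn u)) * invpow t u)%:E.
have mg : measurable_fun setT g.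
  have m2 : measurable_fun setT (fun u : R * R => imgw t (Num.sqrt (sqn u))) by apply: (measurableT_comp mi); meas.
  by apply/measurable_EFinP; exact: measurable_funM m2 mv.
have g0 u : (0 <= g u)%E by rewrite lee_fin mulr_ge0 ?imgw_ge0 ?powR_ge0.
have c20 : (0 <= (c ^+ 2)%:E)%E by rewrite lee_fin sqr_ge0.
apply: (@le_trans _ _ ((c ^+ 2)%:E * \int[nu]_u g u)%E).
  apply: (lee_wpmul2l c20); apply: le_integralT.
  - by apply: (measurableT_comp mf); meas.
  - by move=> u; exact: f0.
  - exact: mg.
  move=> u; rewrite /f /g lee_fin /dweight.
  case: ifPn => [hu|_]; last by rewrite mul0r mulr_ge0 ?imgw_ge0 ?powR_ge0.
  have [h1 h2 h3] := disk_image_bounds t01 hu.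
  have rho0 := lt_trans t0 h1.
  rewrite /imgw h1 h2 -mulrA; apply: ler_pM; rewrite ?powR_ge0 //.
    apply: ge0_ler_powR => //; rewrite ?nnegrE.
    - by rewrite subr_ge0 ltW.
    - by apply: le_trans h3; rewrite subr_ge0 ltW.
  have tw : twist (cpt (c * u.1 + (1 - t)^-1, c * u.2 + 0)) t = (cpt u)^-1.
    rewrite /twist; congr (_^-1); apply/eqP; rewrite eq_complex /= !mul0r subr0 !addr0 /c.
    have t1n : 1 - t != 0 by rewrite gt_eqF.
    apply/andP; split; apply/eqP; by field.
  rewrite /tpoly tw cmodM cmodV cmod_cpt powRM ?invr_ge0 ?cmod_ge0 ?(ltW rho0) //.
  by rewrite powRN -powR_inv1 ?(ltW rho0) // powRAC powR_inv1 ?powR_ge0.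
rewrite (polar_circ mg g0).
have mA := measurable_circ (measurable_polypow p a N) (polypow_ge0 p a N).
have A0 s : (0 <= circ (polypow p a N) s)%E by exact/circ_ge0/polypow_ge0.
pose h (s : R) : \bar R := ((4 * s ^+ 3 * imgw t (s ^+ 2))%:E * circ (polypow p a N) (t / s ^+ 2))%E.
have mh : measurable_fun setT (fun s : R => (if 0 < s then 1%R else 0%R)%:E * h s)%E.
  have m2 : measurable_fun setT (fun s : R => imgw t (s ^+ 2)) by apply: (measurableT_comp mi); meas.
  have m3 : measurable_fun setT (fun s : R => circ (polypow p a N) (t / s ^+ 2)) by apply: (measurableT_comp mA); meas.
  by rewrite /h; meas.
have E1 : (\int[mu]_s ((if 0 < s then 4 * s ^+ 3 else 0)%:E * circ g (s ^+ 2)) =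
   \int[mu]_s ((if 0 < s then 1 else 0)%:E * ((if 0 < s then 1 else 0)%:E * h s)))%E.
  apply: eq_integral => s _; case: ifPn => s0; last by rewrite !mul0e.
  have -> : circ g (s ^+ 2) = ((imgw t (s ^+ 2))%:E * circ (fun u => (invpow t u)%:E) (s ^+ 2))%E.
    rewrite /circ -(integralTZl nu); last 3 first.
    - exact: (measurable_circ_integrand (s ^+ 2) mv').
    - exact: (@circ_integrand_ge0 R (fun u => (invpow t u)%:E) (s ^+ 2) inv0).
    - exact: imgw_ge0.
    apply: eq_integral => z _; rewrite /puncdisk; case: ifPn => zP; last by rewrite !mul0e mule0.
    have /andP[z0 _] := zP.
    by rewrite !mul1e /g sqn_on_circle // sqrtr_sqr ger0_norm ?sqr_ge0 // EFinM.
  by rewrite (circ_invpow t0 s0) !mul1e /h muleA -EFinM.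
(* Polar coordinates use radius [s ^ 2], so replacing [s] by [sqrt t / s] exchanges the radii
   [s ^ 2] and [t / s ^ 2]. *)
pose q := Num.sqrt t.
have q0 : 0 < q by rewrite sqrtr_gt0.
have q2 : q ^+ 2 = t by rewrite sqr_sqrtr // ltW.
have h0 s : (0 <= (if 0 < s then 1 else 0)%:E * h s)%E.
  case: ifPn => s0; last by rewrite mul0e.
  by rewrite mul1e mule_ge0 // lee_fin !mulr_ge0 ?imgw_ge0 // ?exprn_ge0 // ltW.
rewrite E1 (ge0_integral_inversion q0 mh h0).
have ms4 : measurable_fun setT (fun s : R => (if (t < s) && (s < 1) then s `^ (2 * p - 4 * alpha - 5) * (1 - s ^+ 4) `^ alpha else 0)%:E).
  by meas.
have mA2 : measurable_fun setT (fun s : R => circ (polypow p a N) (s ^+ 2)) by apply: (measurableT_comp mA); meas.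
have I0 s : (0 <= (if (t < s) && (s < 1) then s `^ (2 * p - 4 * alpha - 5) * (1 - s ^+ 4) `^ alpha else 0)%:E * circ (polypow p a N) (s ^+ 2)%R)%E.
  by rewrite mule_ge0 // lee_fin; case: ifP => // _; rewrite mulr_ge0 ?powR_ge0.
rewrite -(integralTZl mu); last 3 first.
- by apply: emeasurable_funM; [meas|apply: (measurableT_comp mh); meas].
- by move=> s; rewrite mule_ge0 // lee_fin; case: ifP => // s0; rewrite mulr_ge0 ?sqr_ge0 // ltW.
- exact: sqr_ge0.
rewrite -(integralTZl mu); last 3 first.
- exact: (emeasurable_funM ms4 mA2).
- exact: I0.
- by rewrite !mulr_ge0 ?powR_ge0.
rewrite le_eqVlt; apply/orP; left; apply/eqP; apply: eq_integral => s _.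
case: (ltP 0 s) => s0; last first.
  rewrite mul0e mule0 (_ : (t < s) = false) /= ?mul0e ?mule0 //.
  by apply/negbTE; rewrite -leNgt (le_trans s0) // ltW.
have -> : 0 < q / s by rewrite divr_gt0.
have sn : s != 0 by rewrite gt_eqF.
have qn : q != 0 by rewrite gt_eqF.
have qs2 : (q / s) ^+ 2 = t / s ^+ 2 by rewrite expr_div_n q2.
have ts : t / (q / s) ^+ 2 = s ^+ 2.
  by rewrite qs2; field; rewrite sn gt_eqF.
rewrite mul1e /h ts !muleA -!EFinM; congr (_%:E * _)%E.
rewrite qs2 /imgw.
have -> : (t < t / s ^+ 2) = (s < 1).
  by rewrite ltr_pdivlMr ?exprn_gt0 // gtr_pMr // expr_lt1 // ltW.
have -> : (t * (t / s ^+ 2) < 1) = (t < s).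
  rewrite mulrA ltr_pdivrMr ?exprn_gt0 // mul1r -expr2 ltr_pXn2r // ?nnegrE ltW //.
rewrite andbC; case: ifP => [/andP[ts1 s1]|_]; last by rewrite !mulr0.
have s4 : 0 <= 1 - s ^+ 4 by rewrite subr_ge0 exprn_ile1 // ltW.
have -> : ((t / s ^+ 2) ^+ 2 - t ^+ 2) / ((1 - t) * t) = t * ((1 - t)^-1 * ((1 - s ^+ 4) * (s ^+ 4)^-1)).
  by field; rewrite sn !gt_eqF.
have i0 : 0 <= (1 - t)^-1 by rewrite invr_ge0 ltW.
have j0 : 0 <= (s ^+ 4)^-1 by rewrite invr_ge0 exprn_ge0 // ltW.
rewrite (powRM _ (ltW t0)) ?mulr_ge0 // (powRM _ i0) ?mulr_ge0 // (powRM _ s4 j0).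
rewrite (powRM _ (ltW t0)) ?invr_ge0 ?exprn_ge0 ?(ltW s0) //.
have pinv (y e : R) : 0 < y -> (y^-1) `^ e = y `^ (- e).
  by move=> y0; rewrite -powR_inv1 ?(ltW y0) // -powRrM mulN1r.
have e4 : (s ^+ 4)^-1 `^ alpha = s `^ (4 * - alpha).
  by rewrite (pinv _ _ (exprn_gt0 4 s0)) -(powR_mulrn 4 (ltW s0)) -powRrM.
have e2 : (s ^+ 2)^-1 `^ (- p) = s `^ (2 * p).
  by rewrite (pinv _ _ (exprn_gt0 2 s0)) opprK -(powR_mulrn 2 (ltW s0)) -powRrM.
rewrite e4 e2 (pinv _ alpha t1').
have -> : t `^ (2 + alpha - p) = t `^ 2 * t `^ alpha * t `^ (- p) by rewrite -!powRDp.
have -> : (1 - t) `^ (- (2 + alpha)) = (1 - t) `^ (- 2) * (1 - t) `^ (- alpha) by rewrite -powRDp // opprD.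
have -> : 2 * p - 4 * alpha - 5 = 2 * p + 4 * - alpha + - 5 by ring.
rewrite !(powRDp _ _ s0).
have -> : c ^+ 2 = (1 - t) `^ (- 2) by rewrite /c sqrrN powRN (powR_mulrn 2 (ltW t1')) exprVn.
have -> : t `^ 2 = q ^+ 4 by rewrite (powR_mulrn 2 (ltW t0)) -q2 -exprM.
have -> : s `^ (- 5) = s^-1 ^+ 5 by rewrite powRN (powR_mulrn 5 (ltW s0)) exprVn.
by field.
Qed.

Lemma measurable_cmod_tpoly2 : measurable_fun setT (fun u : R * (R * R) => cmod (tpoly a N (cpt u.2) u.1)).
Proof.
apply: measurable_cmod; rewrite /tpoly /twist.
have mc : cmeasurable (fun u : R * (R * R) => cpt u.2) by split => /=; meas.
have mt : cmeasurable (fun u : R * (R * R) => (1 - (1 - u.1)%:C%C * cpt u.2)^-1).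
  apply: cmeasurable_inv; apply: cmeasurableD; first exact: cmeasurable_cst.
  have -> : (fun u : R * (R * R) => - ((1 - u.1)%:C%C * cpt u.2)) = (fun u => (u.1 - 1)%:C%C * cpt u.2).
    by apply/funext => z; rewrite -mulNr -raddfN opprB.
  by apply: cmeasurableM; [split => /=; meas|exact: mc].
apply: cmeasurableM; first exact: mt.
by apply: cmeasurable_cpoly; apply: cmeasurableM; [split => /=; meas|exact: mt].
Qed.

Let A s := circ (polypow p a N) (s ^+ 2).

Lemma circ_polypow_fin (s : R) : 0 <= s <= 1 -> (A s <= A 1)%E /\ A 1 \is a fin_num.
Proof.
move=> /andP[s0 s1]; split.
  have s2 : 0 <= s ^+ 2 <= 1 by rewrite exprn_ge0 //= exprn_ile1.
  by have := circ_polypow_mono a N 1 p1 s2; rewrite mulr1 /A expr1n.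
have ms := @measurable_sqn R.
rewrite ge0_fin_numE; last exact/circ_ge0/polypow_ge0.
pose K := (\sum_(k < N) cmod (a k)) `^ p.
apply: (@le_lt_trans _ _ (K%:E * \int[nu]_z (if sqn z < 1 then 1 else 0)%:E)%E).
  rewrite -(integralTZl nu); last 3 first.
  - by meas.
  - by move=> z; rewrite lee_fin; case: ifP.
  - exact: powR_ge0.
  apply: le_integralT.
  - by apply: measurable_circ_integrand; exact: measurable_polypow.
  - by apply: circ_integrand_ge0; exact: polypow_ge0.
  - by meas.
  move=> z; rewrite /puncdisk; case: ifPn => zP; last by rewrite mul0e -EFinM lee_fin mulr_ge0 ?powR_ge0 //; case: ifP.
  have /andP[z0 z1] := zP; rewrite z1 mul1e mule1 lee_fin /K.
  apply: ge0_ler_powR; rewrite ?nnegrE ?cmod_ge0 ?sumr_ge0 ?(le_trans ler01 (ltW p1)) //.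
    by move=> k _; exact: cmod_ge0.
  apply: (le_trans (cmod_sum _ _ _)); apply: ler_sum => k _.
  rewrite cmodM cmodX cmod_cpt sqn_on_circle // expr1n sqrtr_sqr normr1 expr1n mulr1 //.
have := leb2_disk_fin; set I := (\int[_]_z _)%E => hI.
have I0 : (0 <= I)%E by apply: integral_ge0 => z _; rewrite lee_fin; case: ifP.
by rewrite lte_mul_pinfty ?lee_fin ?powR_ge0.
Qed.

(** Multiplying [kerp t] by [t ^ (2 + alpha - p) (1 - t) ^ (- (2 + alpha))] gives the exponents
    [x - 1] and [- x] because [x p = 2 + alpha]. Tonelli then integrates the Beta kernel over
    [t < s], which turns the radial kernel into [B * hker]; the right-hand side in polar coordinates
    has the kernel [wker]. *)
Lemma twisted_total_le :
  hyp_a alpha p \/ (condb_integral p alpha <= (1 / (4 * (alpha + 1)))%:E)%E ->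
  (\int[nu]_z \int[mu]_t ((kerp t)%:E * (dweight alpha z * cmod (tpoly a N (cpt z) t) `^ p)%:E) <=
   B%:E * \int[nu]_z (dweight alpha z * cmod (cpoly a N (cpt z)) `^ p)%:E)%E.
Proof.
move=> hab; have md := measurable_dweight alpha; have mk := measurable_kerp.
have k0 := kerp_ge0; have d0 := dweight_ge0 alpha.
have mT := measurable_cmod_tpoly2.
have mA := measurable_circ (measurable_polypow p a N) (polypow_ge0 p a N).
have A0 s : (0 <= A s)%E by exact/circ_ge0/polypow_ge0.
have mA2 : measurable_fun setT A by apply: (measurableT_comp mA); meas.
have mu1 : measurable_fun setT (fun u : R * (R * R) => kerp u.1) by apply: (measurableT_comp mk); meas.
have mu2 : measurable_fun setT (fun u : R * (R * R) => dweight alpha u.2) by apply: (measurableT_comp md); meas.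
have mF : measurable_fun setT (fun u : R * (R * R) => (kerp u.1)%:E * (dweight alpha u.2 * cmod (tpoly a N (cpt u.2) u.1) `^ p)%:E)%E.
  by meas.
have F0 (u : R * (R * R)) : (0 <= (kerp u.1)%:E * (dweight alpha u.2 * cmod (tpoly a N (cpt u.2) u.1) `^ p)%:E)%E.
  by rewrite -EFinM lee_fin !mulr_ge0 ?powR_ge0.
rewrite -(tonelli12 mF F0) /=.
pose ww (t s : R) : R := if (t < s) && (s < 1) then s `^ (2 * p - 4 * alpha - 5) * (1 - s ^+ 4) `^ alpha else 0.
have ww0 t s : 0 <= ww t s by rewrite /ww; case: ifP => // _; rewrite mulr_ge0 ?powR_ge0.
have mb := measurable_bker x (1 - x).
have mw : measurable_fun setT (fun u : R * R => ww u.1 u.2) by rewrite /ww; meas.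
pose G (u : R * R) : \bar R := ((4 * (bker x (1 - x) u.1 * ww u.1 u.2))%:E * A u.2)%E.
have mG : measurable_fun setT G.
  have m1 : measurable_fun setT (fun u : R * R => bker x (1 - x) u.1) by apply: (measurableT_comp mb); meas.
  have m2 : measurable_fun setT (fun u : R * R => A u.2) by apply: (measurableT_comp mA2); meas.
  by rewrite /G; meas.
have G0 u : (0 <= G u)%E by rewrite mule_ge0 // lee_fin !mulr_ge0 // bker_ge0.
have mwt t : measurable_fun setT (ww t) by rewrite /ww; meas.
apply: (@le_trans _ _ (\int[mu]_t \int[mu]_s G (t, s))%E).
  apply: le_integralT.
  - exact: (measurable_tonelli12_1 mF F0).
  - by move=> t; apply: integral_ge0 => z _; exact: (F0 (t, z)).
  - exact: (@measurable_fun_fubini_tonelli_F _ _ _ _ _ mu G mG G0).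
  move=> t; have mTt : measurable_fun setT (fun z : R * R => cmod (tpoly a N (cpt z) t)).
    by apply: (measurableT_comp mT (g := fun z => (t, z))); meas.
  rewrite (integralTZl nu); last 3 first.
  - by meas.
  - by move=> z; rewrite lee_fin mulr_ge0 ?powR_ge0.
  - exact: k0.
  rewrite /kerp; case: ifPn => [t01|_]; last by rewrite mul0e; apply: integral_ge0 => s _; exact: G0.
  have := twisted_integral_le t01; rewrite -/(ww t) => h.
  have kk0 : (0 <= (bker (bexp alpha p) (1 - bexp alpha p) t `^ (1 - p))%:E)%E by rewrite lee_fin powR_ge0.
  apply: (le_trans (lee_wpmul2l kk0 h)).
  rewrite muleA -EFinM -(integralTZl mu); last 3 first.
  - by apply: emeasurable_funM => //; have mwt' := mwt t; meas.
  - by move=> s; apply: mule_ge0; [rewrite lee_fin; exact: ww0|exact: A0].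
  - by rewrite !mulr_ge0 ?powR_ge0.
  rewrite le_eqVlt; apply/orP; left; apply/eqP; apply: eq_integral => s _.
  rewrite /G /= muleA -EFinM; congr (_%:E * _)%E; rewrite -/x.
  have /andP[t0 t1] := t01; have t1' : 0 < 1 - t by rewrite subr_gt0.
  rewrite [RHS]mulrA; congr (_ * _); rewrite /bker t0 t1 /= powRM ?powR_ge0 // -!powRrM.
  rewrite mulrCA; congr (_ * _); rewrite mulrACA -!powRDp //.
  by congr (_ `^ _ * _ `^ _); rewrite -xp; ring.
rewrite (tonelli_RR mG G0).
have /andP[x0 x1] := x01.
(* A bounded real-valued copy of the circular means on [(0, 1)], cut off outside, as [hker_le_wker]
   expects. *)
have [g [mg gE gC]] : exists g : R -> R, [/\ measurable_fun setT g,
    forall s, 0 < s < 1 -> A s = (g s)%:E & forall s, 0 <= g s <= fine (A 1)].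
  pose g (s : R) : R := if (0 < s) && (s < 1) then fine (A s) else 0.
  have mg : measurable_fun setT g.
    have m1 : measurable_fun setT (fun s => fine (A s)).
      by apply: (measurableT_comp (@fine_measurable R setT measurableT)); exact: mA2.
    by rewrite /g; meas.
  have gE s : 0 < s < 1 -> A s = (g s)%:E.
    move=> s01; rewrite /g s01 fineK //; have /andP[s0 s1] := s01.
    have s01' : 0 <= s <= 1 by rewrite !ltW.
    have [h1 h2] := circ_polypow_fin s01'.
    by rewrite (ge0_fin_numE (A0 s)); apply: (le_lt_trans h1); rewrite -(ge0_fin_numE (A0 1)).
  have gC s : 0 <= g s <= fine (A 1).
    have one : 0 <= (1 : R) <= 1 by rewrite ler01 lexx.
    have [_ h3] := circ_polypow_fin one.
    apply/andP; split; first by rewrite /g; case: ifP => // _; exact: fine_ge0.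
    case: (boolP (0 < s < 1)) => s01; last by rewrite /g (negbTE s01) fine_ge0.
    rewrite -lee_fin -(gE _ s01) (fineK h3); have /andP[s0 s1] := s01.
    have s01' : 0 <= s <= 1 by rewrite !ltW.
    by have [h1 _] := circ_polypow_fin s01'.
  by exists g.
have gm s t : 0 < s -> s < t -> t < 1 -> g s <= g t.
  move=> s0 st t1; have t0 := lt_trans s0 st.
  have s01 : 0 < s < 1 by rewrite s0 (lt_trans st t1).
  have t01 : 0 < t < 1 by rewrite t0 t1.
  rewrite -lee_fin -(gE _ s01) -(gE _ t01) /A.
  have -> : s ^+ 2 = (s / t) ^+ 2 * t ^+ 2 by rewrite -exprMn divfK // gt_eqF.
  apply: circ_polypow_mono => //; rewrite exprn_ge0 ?divr_ge0 ?(ltW s0) ?(ltW t0) //=.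
  by rewrite exprn_ile1 ?divr_ge0 ?(ltW s0) ?(ltW t0) // ler_pdivrMr // mul1r ltW.
have mh := measurable_hker alpha p; have mwk := measurable_wker alpha.
have h0 := hker_ge0 alpha p; have w0 := wker_ge0 alpha.
have g0 s : 0 <= g s by case/andP: (gC s).
have E1 : (\int[mu]_s \int[mu]_t G (t, s) = (4 * B)%:E * \int[mu]_s (hker alpha p s * g s)%:E)%E.
  rewrite -(integralTZl mu); last 3 first.
  - by meas.
  - by move=> s; rewrite lee_fin mulr_ge0.
  - by rewrite mulr_ge0 // ltW.
  apply: eq_integral => s _; rewrite /hker; case: (boolP (0 < s < 1)) => s01; last first.
    rewrite mul0r mule0; transitivity (\int[mu]_(t in setT) (0 : \bar R))%E; last exact: integral0.
    apply: eq_integral => t _; rewrite /G /= /ww /bker.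
    case: ifP => [/andP[t0 t1]|_]; last by rewrite mul0r mulr0 mul0e.
    rewrite (_ : (t < s) && (s < 1) = false) ?mulr0 ?mul0e //.
    apply/negbTE; apply: contra s01 => /andP[ts ->]; by rewrite (lt_trans t0 ts).
  have /andP[s0 s1] := s01; rewrite -/x.
  set W := s `^ _ ; set W2 := (1 - s ^+ 4) `^ _.
  have W0 : 0 <= W * W2 by rewrite mulr_ge0 ?powR_ge0.
  transitivity (\int[mu]_t ((4 * (W * W2) * g s)%:E * (if t < s then bker x (1 - x) t else 0)%:E))%E.
    apply: eq_integral => t _; rewrite /G /= gE // /ww s1 andbT -!EFinM; congr EFin.
    by rewrite -/W -/W2; case: ifP => _; ring.
  rewrite (integralTZl mu); last 3 first.
  - by meas.
  - by move=> t; rewrite lee_fin; case: ifP => // _; exact: bker_ge0.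
  - exact: mulr_ge0 (mulr_ge0 (ler0n R 4) W0) (g0 s).
  rewrite -/(einc x s) (einc_rreg x01) -!EFinM; congr EFin; rewrite -/B; ring.
rewrite E1.
have B40 : (0 <= (4 * B)%:E)%E by rewrite lee_fin mulr_ge0 // ltW.
have key := hker_le_wker alpha0 p_gt hab mg gC gm.
apply: (le_trans (lee_wpmul2l B40 key)).
rewrite EFinM [(4%:E * _)%E]muleC -muleA; apply: lee_wpmul2l; first by rewrite lee_fin ltW.
have mP := measurable_polypow p a N.
have mD : measurable_fun setT (fun z : R * R => (dweight alpha z)%:E * polypow p a N z)%E.
  by apply: emeasurable_funM => //; meas.
have D0 z : (0 <= (dweight alpha z)%:E * polypow p a N z)%E by rewrite mule_ge0 ?polypow_ge0 // lee_fin.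
have -> : (\int[nu]_z (dweight alpha z * cmod (cpoly a N (cpt z)) `^ p)%:E =
   \int[nu]_z ((dweight alpha z)%:E * polypow p a N z))%E by apply: eq_integral => z _; rewrite EFinM.
rewrite (polar_circ mD D0) -(integralTZl mu); last 3 first.
- by meas.
- by move=> s; rewrite lee_fin mulr_ge0.
- exact: ler0n.
apply: le_integralT.
- by meas.
- by move=> s; rewrite -EFinM lee_fin !mulr_ge0.
- have mc := measurable_circ mD D0.
  have mc2 : measurable_fun setT (fun s : R => circ (fun z => (dweight alpha z)%:E * polypow p a N z)%E (s ^+ 2)).
    by apply: (measurableT_comp mc); meas.
  by meas.
move=> s; rewrite /wker; case: (boolP (0 < s < 1)) => s01; last first.
  rewrite mul0r mule0 mule_ge0 //; last exact: circ_ge0.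
  by rewrite lee_fin; case: ifP => // s0; rewrite mulr_ge0 // exprn_ge0 // ltW.
have /andP[s0 s1] := s01; rewrite s0.
have s4 : 0 < 1 - s ^+ 4 := expr4_lt1 s01.
have -> : circ (fun z => (dweight alpha z)%:E * polypow p a N z)%E (s ^+ 2) = (((1 - s ^+ 4) `^ alpha)%:E * A s)%E.
  rewrite /A /circ -(integralTZl nu); last 3 first.
  - by apply: measurable_circ_integrand.
  - by apply: circ_integrand_ge0; exact: polypow_ge0.
  - exact: powR_ge0.
  apply: eq_integral => z _; rewrite /puncdisk; case: ifPn => zP; last by rewrite !mul0e mule0.
  have /andP[z0 _] := zP.
  rewrite !mul1e /dweight sqn_on_circle // -exprM.
  by have -> : s ^+ (2 * 2) < 1 by rewrite -subr_gt0.
rewrite (gE _ s01) -!EFinM lee_fin le_eqVlt; apply/orP; left; apply/eqP; ring.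
Qed.

(** The constant [B ^ p] splits as [B ^ (p - 1)] from Hoelder's inequality and one [B] from
    [twisted_total_le]. *)
Lemma hilbert_bound_of_tint (H : R * R -> R) : measurable_fun setT H -> (forall z, 0 <= H z) ->
  hyp_a alpha p \/ (condb_integral p alpha <= (1 / (4 * (alpha + 1)))%:E)%E ->
  (forall z, sqn z < 1 -> ((H z)%:E <= tint a N (cpt z))%E) ->
  (\int[nu]_z (dweight alpha z * H z `^ p)%:E <=
   (B `^ p)%:E * \int[nu]_z (dweight alpha z * cmod (cpoly a N (cpt z)) `^ p)%:E)%E.
Proof.
move=> mH H0 hab hH; have md := measurable_dweight alpha; have d0 := dweight_ge0 alpha.
have q0 z : 0 <= H z / B by rewrite divr_ge0 // ltW.
have e z : (dweight alpha z * H z `^ p)%:E = ((B `^ (p - 1))%:E * (dweight alpha z * (B * (H z / B) `^ p))%:E)%E.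
  rewrite -EFinM; congr EFin; rewrite mulrCA; congr (_ * _).
  by rewrite -[H z in LHS](divfK (lt0r_neq0 B0)) (powRM p (q0 z) (ltW B0)) mulrA -powRDn // subrK mulrC.
have -> : (\int[nu]_z (dweight alpha z * H z `^ p)%:E =
   (B `^ (p - 1))%:E * \int[nu]_z (dweight alpha z * (B * (H z / B) `^ p))%:E)%E.
  rewrite -(integralTZl nu); last 3 first.
  - by meas.
  - by move=> z; rewrite lee_fin !mulr_ge0 ?powR_ge0 // ltW.
  - exact: powR_ge0.
  by apply: eq_integral => z _; exact: e.
have -> : B `^ p = B `^ (p - 1) * B by rewrite -powRDn // subrK.
rewrite EFinM -muleA; apply: lee_wpmul2l; first by rewrite lee_fin powR_ge0.
apply: le_trans (twisted_total_le hab).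
have mk := measurable_kerp.
apply: ge0_le_integral; first exact: measurableT.
- by move=> z _; rewrite lee_fin !mulr_ge0 ?powR_ge0 // ltW.
- by meas.
- apply: (@measurable_tonelli12_2 R (fun u : R * (R * R) => (kerp u.1)%:E * (dweight alpha u.2 * cmod (tpoly a N (cpt u.2) u.1) `^ p)%:E)%E); last first.
    by move=> u; rewrite -EFinM lee_fin !mulr_ge0 ?powR_ge0 ?kerp_ge0.
  have mT : measurable_fun setT (fun u : R * (R * R) => cmod (tpoly a N (cpt u.2) u.1)).
    exact: measurable_cmod_tpoly2.
  have mu1 : measurable_fun setT (fun u : R * (R * R) => kerp u.1) by apply: (measurableT_comp mk); meas.
  have mu2 : measurable_fun setT (fun u : R * (R * R) => dweight alpha u.2) by apply: (measurableT_comp md); meas.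
  by meas.
move=> z _; rewrite /dweight; case: ifPn => hz; last first.
  by rewrite mul0r; apply: integral_ge0 => t _; rewrite mul0r mule0.
have w0 : (0 <= ((1 - sqn z) `^ alpha)%:E)%E by rewrite lee_fin powR_ge0.
rewrite EFinM; apply: (le_trans (lee_wpmul2l w0 (tint_holder (H0 z) (hH z hz)))).
have mT := measurable_cmod_tpoly a N (cpt z).
rewrite -(integralTZl mu); last 3 first.
- by meas.
- by move=> t; rewrite lee_fin mulr_ge0 ?kerp_ge0 ?powR_ge0.
- exact: powR_ge0.
rewrite le_eqVlt; apply/orP; left; apply/eqP; apply: eq_integral => t _.
by rewrite -!EFinM; congr EFin; ring.
Qed.

End PolynomialBound.

(** * Complex power series and their area integrals *)

Section ComplexSeries.
Variable R : realType.
Local Notation nu := (@leb2 R).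
Implicit Types (a u : nat -> R[i]).

Lemma ccvg_cseries u : cseries_cvg u -> ccvg_to (fun n => \sum_(k < n) u k) (cseries u).
Proof.
move=> [l [h1 h2]]; rewrite /cseries; split => /=.
- by rewrite (cvg_lim (@Rhausdorff R) h1).
- by rewrite (cvg_lim (@Rhausdorff R) h2).
Qed.

Lemma cvg_real_abs (f : nat -> R) (S : R) : (forall N, \sum_(k < N) `|f k| <= S) ->
  cvgn (fun n => \sum_(k < n) f k).
Proof.
move=> h; have e (g : nat -> R) : (fun n => \sum_(k < n) g k) = series g :> (nat -> R).
  by apply/funext => n; rewrite /series /= big_mkord.
have E n : [normed series f] n = \sum_(k < n) `|f k|.
  exact: esym (congr1 (fun g => g n) (e (fun k => `|f k|))).
rewrite e; apply: normed_cvg; apply: nondecreasing_is_cvgn.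
  by apply/nondecreasing_seqP => n; rewrite !E big_ord_recr /= lerDl.
by exists S => _ [N _ <-]; rewrite E.
Qed.

Lemma cseries_cvg_abs u (S : R) : (forall N, \sum_(k < N) cmod (u k) <= S) -> cseries_cvg u.
Proof.
move=> h; exists (cseries u); split => /=.
- have -> : (fun n => complex.Re (\sum_(k < n) u k)) = (fun n => \sum_(k < n) complex.Re (u k)).
    by apply/funext => n; rewrite Re_sum.
  apply: (@cvg_real_abs (fun k => complex.Re (u k)) S) => N; apply: le_trans (h N).
  by apply: ler_sum => k _; exact: Re_le_cmod.
- have -> : (fun n => complex.Im (\sum_(k < n) u k)) = (fun n => \sum_(k < n) complex.Im (u k)).
    by apply/funext => n; rewrite Im_sum.
  apply: (@cvg_real_abs (fun k => complex.Im (u k)) S) => N; apply: le_trans (h N).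
  by apply: ler_sum => k _; exact: Im_le_cmod.
Qed.

Lemma ccvg_toB u l c : ccvg_to u l -> ccvg_to (fun n => u n - c) (l - c).
Proof.
move=> [h1 h2]; split.
- have e (z : R[i]) : complex.Re (z - c) = complex.Re z - complex.Re c by case: z; case: c.
  by rewrite e; under eq_fun do rewrite e; apply: cvgB => //; exact: cvg_cst.
- have e (z : R[i]) : complex.Im (z - c) = complex.Im z - complex.Im c by case: z; case: c.
  by rewrite e; under eq_fun do rewrite e; apply: cvgB => //; exact: cvg_cst.
Qed.

Lemma ccvg_cmod_le u l (S : R) n0 : ccvg_to u l -> (forall n, (n0 <= n)%N -> cmod (u n) <= S) -> cmod l <= S.
Proof.
move=> /ccvg_cmod h hS.
apply: (@ler_cvg_to _ _ _ _ (fun n => cmod (u n)) (fun=> S) _ _ h (cvg_cst _)).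
by exists n0 => // n /=; exact: hS.
Qed.

Lemma cseries_tail_le u l (S : R) N : ccvg_to (fun n => \sum_(k < n) u k) l ->
  (forall M, \sum_(N <= k < M) cmod (u k) <= S) -> cmod (l - \sum_(k < N) u k) <= S.
Proof.
move=> hl hS; apply: (ccvg_cmod_le (n0 := N) (ccvg_toB (\sum_(k < N) u k) hl)) => M NM.
apply: le_trans (hS M).
have -> : \sum_(k < M) u k - \sum_(k < N) u k = \sum_(N <= k < M) u k.
  by rewrite -!(big_mkord xpredT u) (@big_cat_nat _ _ _ N) //= addrAC subrr add0r.
exact: cmod_sum.
Qed.

Lemma cseries_le u l (S : R) : ccvg_to (fun n => \sum_(k < n) u k) l ->
  (forall M, \sum_(k < M) cmod (u k) <= S) -> cmod l <= S.
Proof.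
move=> hl hS; have := @cseries_tail_le u l S 0 hl; rewrite big_ord0 subr0; apply => M.
by rewrite big_mkord.
Qed.

Lemma geometric_sum_le (rho : R) N : 0 <= rho < 1 -> \sum_(n < N) rho ^+ n <= (1 - rho)^-1.
Proof.
move=> r01; have := binom_sum_le r01 0 N; rewrite expr1; apply: le_trans.
by apply: ler_sum => n _; rewrite addn0 bin0 mul1r.
Qed.

Lemma ccvg_term0 u : cseries_cvg u -> (fun n => cmod (u n)) @ \oo --> (0 : R).
Proof.
move=> [l [h1 h2]].
have e1 : (fun n => complex.Re (\sum_(k < n) u k)) = series (fun k => complex.Re (u k)).
  by apply/funext => n; rewrite Re_sum /series /= big_mkord.
have e2 : (fun n => complex.Im (\sum_(k < n) u k)) = series (fun k => complex.Im (u k)).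
  by apply/funext => n; rewrite Im_sum /series /= big_mkord.
rewrite e1 in h1; rewrite e2 in h2.
have c1 := cvg_series_cvg_0 (cvgP _ h1); have c2 := cvg_series_cvg_0 (cvgP _ h2).
have : (fun n => `|complex.Re (u n)| + `|complex.Im (u n)|) @ \oo --> (`|0 : R| + `|0 : R| : R).
  by apply: cvgD; apply: cvg_norm.
rewrite normr0 addr0 => c3.
apply: (@squeeze_cvgr _ _ _ _ (fun=> 0) (fun n => `|complex.Re (u n)| + `|complex.Im (u n)|)).
- by near=> n; rewrite cmod_ge0 /= cmod_le_ReIm.
- exact: cvg_cst.
- exact: c3.
Unshelve. all: by end_near.
Qed.

(** Convergence at the larger radius [rho = (1 + r) / 2] bounds the terms there, and the rest is a
    geometric series in [r / rho]. *)
Lemma analytic_abs a (r : R) : analytic_on_disk a -> 0 <= r < 1 ->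
  exists S, forall N, \sum_(k < N) cmod (a k) * r ^+ k <= S.
Proof.
move=> ha /andP[r0 r1]; pose rho := (1 + r) / 2.
have rho0 : 0 < rho by rewrite /rho; lra.
have rho1 : rho < 1 by rewrite /rho; lra.
have rrho : r < rho by rewrite /rho; lra.
have c1 : cmod (rho%:C%C : R[i]) < 1 by rewrite cmod_real gtr0_norm.
have := ccvg_term0 (ha _ c1) => /cvgrPdist_lt /(_ _ ltr01) [n0 _ hn].
pose M := 1 + \sum_(k < n0) cmod (a k) * rho ^+ k.
have s0 : 0 <= \sum_(k < n0) cmod (a k) * rho ^+ k.
  by apply: sumr_ge0 => k _; rewrite mulr_ge0 ?cmod_ge0 ?exprn_ge0 // ltW.
have M0 : 0 <= M by rewrite addr_ge0.
have hM k : cmod (a k) * rho ^+ k <= M.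
  case: (ltnP k n0) => kn.
    rewrite /M (bigD1 (Ordinal kn)) //= addrCA lerDl addr_ge0 //.
    by apply: sumr_ge0 => j _; rewrite mulr_ge0 ?cmod_ge0 ?exprn_ge0 // ltW.
  have := hn k kn; rewrite /= sub0r normrN cmodM cmodX cmod_real (gtr0_norm rho0) => h.
  apply: (@le_trans _ _ 1); last by rewrite lerDl.
  by apply: le_trans (ltW h); exact: ler_norm.
have q01 : 0 <= r / rho < 1 by rewrite divr_ge0 ?(ltW rho0) //= ltr_pdivrMr // mul1r.
exists (M * (1 - r / rho)^-1) => N.
apply: le_trans (ler_wpM2l M0 (geometric_sum_le N q01)).
rewrite mulr_sumr; apply: ler_sum => k _.
have -> : cmod (a k) * r ^+ k = (cmod (a k) * rho ^+ k) * (r / rho) ^+ k.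
  by rewrite -mulrA -exprMn [rho * _]mulrC divfK // gt_eqF.
by rewrite ler_wpM2r // exprn_ge0 // divr_ge0 // ltW.
Qed.

Lemma analytic_of_bound a (S : R) : (forall k, cmod (a k) <= S) -> analytic_on_disk a.
Proof.
move=> h z z1; have z01 : 0 <= cmod z < 1 by rewrite cmod_ge0.
have S0 : 0 <= S by apply: le_trans (h 0%N); exact: cmod_ge0.
apply: (@cseries_cvg_abs _ (S * (1 - cmod z)^-1)) => N.
apply: le_trans (ler_wpM2l S0 (geometric_sum_le N z01)).
by rewrite mulr_sumr; apply: ler_sum => k _; rewrite cmodM cmodX ler_wpM2r ?exprn_ge0 ?cmod_ge0.
Qed.

Lemma ccvg_pseries a (z : R[i]) : analytic_on_disk a -> cmod z < 1 ->
  ccvg_to (fun N => cpoly a N z) (pseries_fun a z).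
Proof. by move=> ha z1; exact: ccvg_cseries (ha z z1). Qed.

Lemma cmod_cpt_lt1 (z : R * R) : sqn z < 1 -> cmod (cpt z) < 1.
Proof. by move=> h; rewrite cmod_cpt -sqrtr1 ltr_sqrt. Qed.

Definition diskmod a (z : R * R) : R := if sqn z < 1 then cmod (pseries_fun a (cpt z)) else 0.

Lemma diskmod_ge0 a z : 0 <= diskmod a z.
Proof. by rewrite /diskmod; case: ifP => // _; exact: cmod_ge0. Qed.

Lemma measurable_diskmod a : analytic_on_disk a -> measurable_fun setT (diskmod a).
Proof.
move=> ha; have ms := @measurable_sqn R.
pose g N (z : R * R) := if sqn z < 1 then cmod (cpoly a N (cpt z)) else 0.
have mg N : measurable_fun setT (g N).
  have mc : measurable_fun setT (fun z : R * R => cmod (cpoly a N (cpt z))).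
    by apply: measurable_cmod; apply: cmeasurable_cpoly; exact: cmeasurable_cpt.
  by rewrite /g; meas.
apply: (measurable_fun_cvg mg) => z _; rewrite /g /diskmod; case: ifP => z1; last exact: cvg_cst.
exact/ccvg_cmod/ccvg_pseries/cmod_cpt_lt1.
Qed.

Definition dint (p alpha : R) a : \bar R := (\int[nu]_z (dweight alpha z * diskmod a z `^ p)%:E)%E.

Lemma dint_ge0 p alpha a : (0 <= dint p alpha a)%E.
Proof. by apply: integral_ge0 => z _; rewrite lee_fin mulr_ge0 ?dweight_ge0 ?powR_ge0. Qed.

Lemma bergman_int_dint p alpha a : 0 <= alpha -> analytic_on_disk a ->
  bergman_int p alpha a = (((alpha + 1) / pi)%:E * dint p alpha a)%E.
Proof.
move=> al0 ha; have md := @measurable_diskmod a ha; have mw := @measurable_dweight R alpha.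
rewrite /dint -(integralTZl nu); last 3 first.
- by meas.
- by move=> z; rewrite lee_fin mulr_ge0 ?dweight_ge0 ?powR_ge0.
- by rewrite divr_ge0 ?pi_ge0 // addr_ge0.
rewrite /bergman_int [LHS]integral_mkcond; apply: eq_integral => z _; rewrite patchE -EFinM.
rewrite /dweight /diskmod; case: ifPn => hz; last first.
  case: ifPn => h2; last by rewrite mul0r mulr0.
  by move: hz; rewrite notin_setE.
move: hz; rewrite inE /disk /= -/(sqn z) => ->; congr EFin.
by rewrite /weight -/(sqn z) -/(cpt z); ring.
Qed.

End ComplexSeries.

Lemma integralTsum d (T : measurableType d) (R : realType) (m : {measure set T -> \bar R})
  (I : Type) (r : seq I) (f : I -> T -> \bar R) :
  (forall i, measurable_fun setT (f i)) -> (forall i t, 0 <= f i t)%E ->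
  (\int[m]_t (\sum_(i <- r) f i t)%E = \sum_(i <- r) \int[m]_t f i t)%E.
Proof. by move=> mf f0; apply: ge0_integral_sum => //; exact: measurableT. Qed.

(** * Summability of the coefficients against [1 / (k + 1)] *)

Section CoefficientSum.
Variable R : realType.
Local Notation mu := (@lebesgue_measure R).
Local Notation nu := (@leb2 R).

Definition diskarea : \bar R := (\int[nu]_z (puncdisk z)%:E)%E.

Lemma diskarea_ge0 : (0 <= diskarea)%E.
Proof. by apply: integral_ge0 => z _; rewrite lee_fin puncdisk_ge0. Qed.

Lemma diskarea_fin : (diskarea < +oo)%E.
Proof.
have ms := @measurable_sqn R; have mp := @measurable_puncdisk R.
apply: le_lt_trans (@leb2_disk_fin R); apply: le_integralT.
- by meas.
- by move=> z; rewrite lee_fin puncdisk_ge0.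
- by meas.
- by move=> z; rewrite lee_fin /puncdisk; case: ifP => [/andP[_ ->]//|_]; case: ifP.
Qed.

Lemma diskarea_gt0 : (0 < diskarea)%E.
Proof.
have ms := @measurable_sqn R; have mp := @measurable_puncdisk R.
pose b (x : R) : R := if (0 < x) && (x < 2^-1) then 1 * x `^ (1 - 1) else 0.
have b0 x : 0 <= b x by rewrite /b; case: ifP => // _; rewrite mul1r powR_ge0.
have mb : measurable_fun setT b by rewrite /b; meas.
have h0 : 0 < 2^-1 :> R by rewrite invr_gt0.
have Ib : (\int[mu]_x (b x)%:E = (2^-1)%:E)%E.
  by rewrite (integral_powR_0 ltr01 h0) powRr1 // ltW.
have mb2 : measurable_fun setT (fun z : R * R => (b z.1 * b z.2)%:E).
  have m1 : measurable_fun setT (fun z : R * R => b z.1) by apply: (measurableT_comp mb); meas.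
  have m2 : measurable_fun setT (fun z : R * R => b z.2) by apply: (measurableT_comp mb); meas.
  by meas.
apply: (@lt_le_trans _ _ (\int[nu]_z (b z.1 * b z.2)%:E)%E); last first.
  apply: le_integralT.
  - exact: mb2.
  - by move=> z; rewrite lee_fin; exact: mulr_ge0 (b0 _) (b0 _).
  - by meas.
  move=> [x y]; rewrite lee_fin /b /= subrr !powRr0 mulr1.
  case: ifP => [/andP[x0 x1]|_]; last by rewrite mul0r puncdisk_ge0.
  case: ifP => [/andP[y0 y1]|_]; last by rewrite mulr0 puncdisk_ge0.
  have x2 : x * 2 < 1 by move: x1; rewrite -[2^-1]mul1r ltr_pdivlMr.
  have y2 : y * 2 < 1 by move: y1; rewrite -[2^-1]mul1r ltr_pdivlMr.
  have -> : puncdisk (x, y) = 1; last by rewrite mulr1.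
  rewrite /puncdisk /sqn /=; case: ifP => // /negP; case; apply/andP; split; nra.
rewrite (leb2E mb2); last by move=> z; rewrite lee_fin; exact: mulr_ge0 (b0 _) (b0 _).
have -> : (\int[mu]_x \int[mu]_y (b (x, y).1 * b (x, y).2)%:E = \int[mu]_x ((2^-1)%:E * (b x)%:E))%E.
  apply: eq_integral => x _ /=.
  transitivity (\int[mu]_y ((b x)%:E * (b y)%:E))%E; first by apply: eq_integral => y _; rewrite EFinM.
  rewrite (integralTZl mu); first by rewrite Ib muleC.
  - by meas.
  - by move=> y; rewrite lee_fin.
  - exact: b0.
rewrite (integralTZl mu); first by rewrite Ib -EFinM lte_fin mulr_gt0.
- by meas.
- by move=> x; rewrite lee_fin.
- exact: ltW.
Qed.

Lemma circ_radial (phi : R -> R) (r : R) : 0 <= phi (r ^+ 2) ->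
  circ (fun z => (phi (sqn z))%:E) r = ((phi (r ^+ 2))%:E * diskarea)%E.
Proof.
move=> phi0; have mp := @measurable_puncdisk R.
rewrite /diskarea -(integralTZl nu); last 3 first.
- by meas.
- by move=> z; rewrite lee_fin puncdisk_ge0.
- exact: phi0.
rewrite /circ; apply: eq_integral => z _; rewrite -!EFinM mulrC; congr EFin.
rewrite /puncdisk; case: ifPn => [/andP[z0 _]|_]; last by rewrite !mulr0.
by rewrite sqn_on_circle.
Qed.

Lemma integral_radial (phi : R -> R) : measurable_fun setT phi -> (forall y, 0 <= phi y) ->
  (\int[nu]_z (phi (sqn z))%:E =
   \int[mu]_s ((if 0 < s then 4 * s ^+ 3 * phi (s ^+ 4) else 0)%:E * diskarea))%E.
Proof.
move=> mphi phi0; have ms := @measurable_sqn R.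
have mf : measurable_fun setT (fun z : R * R => (phi (sqn z))%:E).
  by apply/measurable_EFinP; exact: (measurableT_comp mphi ms).
rewrite (polar_circ mf); last by move=> z; rewrite lee_fin.
apply: eq_integral => s _; rewrite circ_radial // -exprM muleA -EFinM.
by congr (_%:E * _)%E; case: ifP; rewrite ?mul0r.
Qed.

(** For [e < 0], [s ^ 4 <= s] bounds the radial integrand by a multiple of [(1 - s) ^ e]. *)
Lemma dweight_int_fin (e : R) : -1 < e -> (\int[nu]_z (dweight e z)%:E < +oo)%E.
Proof.
move=> e1; have ms := @measurable_sqn R; have md := @measurable_dweight R e.
have d0 := @dweight_ge0 R e.
case: (leP 0 e) => e0.
  apply: le_lt_trans (@leb2_disk_fin R); apply: le_integralT.
  - by meas.
  - by move=> z; rewrite lee_fin.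
  - by meas.
  move=> z; rewrite lee_fin /dweight; case: ifP => // z1.
  by rewrite powR_le1 // subr_ge0 (ltW z1) /= lerBlDr lerDl sqn_ge0.
pose phi (y : R) := if y < 1 then (1 - y) `^ e else 0.
have phi0 y : 0 <= phi y by rewrite /phi; case: ifP => // _; exact: powR_ge0.
have mphi : measurable_fun setT phi by rewrite /phi; meas.
rewrite (_ : (fun z => (dweight e z)%:E) = fun z => (phi (sqn z))%:E) // integral_radial //.
have e10 : 0 < e + 1 by move: e1; lra.
have I1 := integral_powR_1 e10 (@ltr01 R).
pose g (s : R) := if (0 < s) && (s < 1) then (e + 1) * (1 - s) `^ (e + 1 - 1) else 0.
have g0 s : 0 <= g s by rewrite /g; case: ifP => // _; rewrite mulr_ge0 ?powR_ge0 // ltW.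
have mg : measurable_fun setT g by rewrite /g; meas.
have mphi4 : measurable_fun setT (fun s : R => phi (s ^+ 4)) by apply: (measurableT_comp mphi); meas.
pose A := fine diskarea.
have AE : diskarea = A%:E by rewrite fineK // ge0_fin_numE ?diskarea_ge0 // diskarea_fin.
have A0 : 0 <= A by apply: fine_ge0; exact: diskarea_ge0.
rewrite AE; apply: (@le_lt_trans _ _ ((4 * A / (e + 1))%:E * \int[mu]_s (g s)%:E)%E); last first.
  by rewrite /g I1 -EFinM ltry.
rewrite -(integralTZl mu); last 3 first.
- by meas.
- by move=> s; rewrite lee_fin.
- by rewrite divr_ge0 ?mulr_ge0 // ltW.
apply: le_integralT.
- by meas.
- move=> s; rewrite -EFinM lee_fin mulr_ge0 //; case: ifP => // s0.
  exact: mulr_ge0 (mulr_ge0 (ler0n R 4) (exprn_ge0 3 (ltW s0))) (phi0 _).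
- by meas.
move=> s; rewrite -!EFinM lee_fin /phi /g.
case: (ltP 0 s) => s0 /=; last by rewrite mul0r mulr0.
have -> : (s ^+ 4 < 1) = (s < 1) by rewrite expr_lt1 // ltW.
case: ifP => s1; last by rewrite !mulr0 mul0r.
rewrite addrK; have s1' : 0 < 1 - s by rewrite subr_gt0.
have -> : 4 * A / (e + 1) * ((e + 1) * (1 - s) `^ e) = 4 * 1 * (1 - s) `^ e * A.
  by field; rewrite gt_eqF.
rewrite ler_wpM2r //; apply: ler_pM; rewrite ?powR_ge0 ?mulr_ge0 ?exprn_ge0 ?(ltW s0) //.
  by rewrite ler_wpM2l // exprn_ile1 // ltW.
have s41 : s ^+ 4 <= s by rewrite -[X in _ <= X]expr1 ler_wiXn2l // ltW.
have s4' : 0 < 1 - s ^+ 4 by rewrite (lt_le_trans s1') // lerD2l lerN2.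
rewrite -[e]opprK !(powRN _ (- e)) lef_pV2 ?posrE ?powR_gt0 //.
by apply: ge0_ler_powR; rewrite ?nnegrE ?oppr_ge0 ?(ltW e0) ?(ltW s1') ?(ltW s4') // lerD2l lerN2.
Qed.

(** The source of the weights [1 / (k + 1)]: a weighted coefficient sum is the area integral of a
    power series in [|z| ^ 2]. *)
Lemma integral_disk_sqnX k :
  (\int[nu]_z (if sqn z < 1 then sqn z ^+ k else 0)%:E = (k.+1%:R^-1)%:E * diskarea)%E.
Proof.
pose phi (y : R) := if (0 <= y) && (y < 1) then y ^+ k else 0.
have phi0 y : 0 <= phi y by rewrite /phi; case: ifP => // /andP[y0 _]; exact: exprn_ge0.
have mphi : measurable_fun setT phi by rewrite /phi; meas.
have -> : (\int[nu]_z (if sqn z < 1 then sqn z ^+ k else 0)%:E = \int[nu]_z (phi (sqn z))%:E)%E.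
  by apply: eq_integral => z _; rewrite /phi sqn_ge0.
rewrite (integral_radial mphi phi0).
pose A := fine diskarea.
have AE : diskarea = A%:E by rewrite fineK // ge0_fin_numE ?diskarea_ge0 // diskarea_fin.
have A0 : 0 <= A by apply: fine_ge0; exact: diskarea_ge0.
pose m : R := (4 * k + 4)%:R.
have m0 : 0 < m by rewrite ltr0n; lia.
have Im := integral_powR_0 m0 (@ltr01 R); rewrite powR1 in Im.
have k0 : 0 < k.+1%:R :> R by rewrite ltr0n.
have mE : m = 4 * k.+1%:R by rewrite /m -natrM; congr (_%:R); lia.
rewrite AE -[RHS]mule1 -Im -EFinM -(integralTZl mu); last 3 first.
- by meas.
- by move=> s; rewrite lee_fin; case: ifP => // _; rewrite mulr_ge0 ?powR_ge0 // ltW.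
- by rewrite mulr_ge0 ?invr_ge0 // ltW.
apply: eq_integral => s _; rewrite -!EFinM; congr EFin.
case: (ltP 0 s) => s0 /=; last by rewrite mul0r mulr0.
rewrite /phi exprn_ge0 ?(ltW s0) //= expr_lt1 ?(ltW s0) //.
case: ifP => s1; last by rewrite !mulr0 mul0r.
have -> : m - 1 = (4 * k + 3)%:R :> R by rewrite /m -[(4 * k + 4)%N]/((4 * k + 4)%N) (_ : (4 * k + 4 = (4 * k + 3).+1)%N) ?mulrS; [ring|lia].
have -> : s `^ (4 * k + 3)%:R = (s ^+ 4) ^+ k * s ^+ 3 by rewrite (powR_mulrn _ (ltW s0)) exprD exprM.
move: k0; rewrite mE; move: (k.+1%:R) ((s ^+ 4) ^+ k) => K S K0.
by field; rewrite gt_eqF.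
Qed.

(** A discrete Parseval identity: as [N < M], indices below [N] that are congruent modulo [M] are
    equal. *)
Lemma sum_rotations (c : nat -> R[i]) N M (w v : R[i]) : (N < M)%N -> cmod w = 1 -> M.-primitive_root w ->
  \sum_(j < M) cmod (cpoly c N (w ^+ j * v)) ^+ 2 = M%:R * \sum_(k < N) cmod (c k) ^+ 2 * (cmod v ^+ 2) ^+ k.
Proof.
move=> NM w1 pw; apply: (@complexI R).
rewrite rmorph_sum rmorphM rmorph_nat rmorph_sum /=.
have wM : w ^+ M = 1 by exact: prim_expr_order.
have w0 : w != 0 by rewrite -cmod_eq0 w1 oner_eq0.
have wc j l : (l <= M)%N -> ((w ^+ j) ^+ l)^*%C = w ^+ (j * (M - l)).
  move=> lM; have u1 : cmod ((w ^+ j) ^+ l) = 1 by rewrite !cmodX w1 !expr1n.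
  have := cmod_mul_conj ((w ^+ j) ^+ l); rewrite u1 expr1n => e.
  have n0 : (w ^+ j) ^+ l != 0 by rewrite !expf_neq0.
  apply: (mulfI n0); rewrite -e -exprM -exprD -mulnDr subnKC // mulnC exprM wM expr1n.
  by rewrite rmorph1.
transitivity (\sum_(j < M) \sum_(k < N) \sum_(l < N) (c k * v ^+ k) * (c l * v ^+ l)^*%C * w ^+ (j * (k + (M - l)))).
  apply: eq_bigr => j _; rewrite cmod_mul_conj /cpoly rmorph_sum big_distrlr /=.
  apply: eq_bigr => k _; apply: eq_bigr => l _.
  rewrite !exprMn mulrCA rmorphM mulnDr exprD -wc; last by rewrite ltnW // (ltn_trans _ NM).
  rewrite !rmorphM /= [w ^+ (j * k)]exprM; ring.
rewrite exchange_big mulr_sumr; apply: eq_bigr => k _ /=.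
rewrite exchange_big (bigD1 k) //= [X in _ + X]big1 ?addr0; last first.
  move=> l lk; rewrite -mulr_sumr (sum_prim_root _ pw).
  case: ifP => [/dvdnP[q hq]|_]; last by rewrite mulr0.
  have kN := ltn_ord k; have lN := ltn_ord l.
  have : (l : nat) != k by [].
  move/eqP; case; have q1 : q = 1%N by nia.
  by move: hq; rewrite q1; lia.
rewrite -mulr_sumr (sum_prim_root _ pw).
have kN := ltn_ord k.
rewrite subnKC; last by rewrite ltnW // (ltn_trans _ NM).
rewrite dvdnn mulrC -cmod_mul_conj cmodM cmodX exprMn; congr (_ * (_ * _)%:C%C).
by rewrite -!exprM mulnC.
Qed.

(** The integral is unchanged when the integrand is averaged over [M] rotations, and the average has
    no cross terms. *)
Lemma parseval_le (W : R -> R) (c : nat -> R[i]) N : measurable_fun setT W -> (forall y, 0 <= W y) ->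
  (\int[nu]_z (W (sqn z) * \sum_(k < N) cmod (c k) ^+ 2 * sqn z ^+ k)%:E <=
   \int[nu]_z (W (sqn z) * cmod (cpoly c N (cpt z)) ^+ 2)%:E)%E.
Proof.
move=> mW W0; have ms := @measurable_sqn R.
have [M [w [NM w1 pw]]] := large_primitive_root R N.
have M0 : 0 < M%:R :> R by rewrite ltr0n (leq_ltn_trans _ NM).
have mWs : measurable_fun setT (fun z : R * R => W (sqn z)) by exact: measurableT_comp mW ms.
pose f (z : R * R) := (W (sqn z) * cmod (cpoly c N (cpt z)) ^+ 2)%:E.
have mf : measurable_fun setT f.
  have m1 : measurable_fun setT (fun z : R * R => cmod (cpoly c N (cpt z))).
    by apply: measurable_cmod; apply: cmeasurable_cpoly; exact: cmeasurable_cpt.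
  by rewrite /f; meas.
have f0 z : (0 <= f z)%E by rewrite lee_fin mulr_ge0 // sqr_ge0.
pose rot (j : nat) (z : R * R) := (complex.Re (w ^+ j) * z.1 - complex.Im (w ^+ j) * z.2,
  complex.Im (w ^+ j) * z.1 + complex.Re (w ^+ j) * z.2).
have cs j : complex.Re (w ^+ j) ^+ 2 + complex.Im (w ^+ j) ^+ 2 = 1.
  by rewrite -cmod_sqr cmodX w1 !expr1n.
have rotc j z : cpt (rot j z) = w ^+ j * cpt z.
  rewrite /rot /cpt /=; case: (w ^+ j) => x y /=.
  by apply/eqP; rewrite eq_complex /= eqxx /= addrC.
have mrot j : measurable_fun setT (rot j) by rewrite /rot; meas.
have mfr j : measurable_fun setT (fun z => f (rot j z)) by exact: measurableT_comp mf (mrot j).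
have Mi : (M%:R%:E * \int[nu]_z f z = \int[nu]_z (\sum_(j < M) f (rot j z))%E)%E.
  rewrite (integralTsum nu (index_enum _) (fun j : 'I_M => mfr j) (fun j z => f0 (rot j z))).
  rewrite (eq_bigr (fun _ => \int[nu]_z f z))%E; last first.
    by move=> j _; exact: (leb2_rotate (cs j) mf f0).
  by rewrite sumr_const card_ord mule_natl.
have pt z : ((\sum_(j < M) f (rot j z))%E = M%:R%:E * (W (sqn z) * \sum_(k < N) cmod (c k) ^+ 2 * sqn z ^+ k)%:E)%E.
  rewrite /f sumEFin -EFinM; congr EFin.
  have sr j : sqn (rot j z) = sqn z.
    by rewrite -!cmod_cpt_sqr rotc cmodM cmodX w1 expr1n mul1r.
  under eq_bigr => j _ do rewrite sr rotc.
  by rewrite -mulr_sumr (sum_rotations c _ NM w1 pw) mulrCA cmod_cpt_sqr.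
have g0 z : (0 <= (W (sqn z) * \sum_(k < N) cmod (c k) ^+ 2 * sqn z ^+ k)%:E)%E.
  by rewrite lee_fin mulr_ge0 ?sumr_ge0 // => k _; rewrite mulr_ge0 ?sqr_ge0 ?exprn_ge0 ?sqn_ge0.
have mg : measurable_fun setT (fun z => (W (sqn z) * \sum_(k < N) cmod (c k) ^+ 2 * sqn z ^+ k)%:E).
  apply/measurable_EFinP; apply: measurable_funM => //.
  by apply: measurable_sum => k; meas.
have : (M%:R%:E * \int[nu]_z (W (sqn z) * \sum_(k < N) cmod (c k) ^+ 2 * sqn z ^+ k)%:E <= M%:R%:E * \int[nu]_z f z)%E.
  rewrite Mi -(integralTZl nu mg g0 (ltW M0)) le_eqVlt; apply/orP; left; apply/eqP.
  by apply: eq_integral => z _; rewrite pt.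
by rewrite lee_pmul2l // ?lte_fin.
Qed.

(** Two cases, according to whether [q ^ (p - 2)] is below [w ^ (gam - alpha)]: if so, [q ^ 2] is
    below a power of [w] and the last term suffices; otherwise [q ^ p w ^ alpha] does. *)
Lemma young_weight (p alpha gam q w : R) : 2 < p -> 0 <= q -> 0 < w ->
  q ^+ 2 * w `^ gam <= q `^ p * w `^ alpha + w `^ (gam + 2 * (gam - alpha) / (p - 2)).
Proof.
move=> p2 q0 w0; have p20 : 0 < p - 2 by rewrite subr_gt0.
case: (leP (q `^ (p - 2)) (w `^ (gam - alpha))) => h.
  have h2 : q ^+ 2 <= w `^ (2 * (gam - alpha) / (p - 2)).
    have e0 : 0 <= 2 / (p - 2) by rewrite divr_ge0 // ltW.
    have := ge0_ler_powR e0 _ _ h; rewrite !nnegrE !powR_ge0 -!powRrM => /(_ isT isT).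
    have -> : (p - 2) * (2 / (p - 2)) = 2%:R by field; rewrite gt_eqF.
    by rewrite powR_mulrn // (_ : (gam - alpha) * (2 / (p - 2)) = 2 * (gam - alpha) / (p - 2)) //; ring.
  rewrite (powRDp _ _ w0) [w `^ gam * _]mulrC.
  apply: (le_trans (ler_wpM2r (powR_ge0 w gam) h2)).
  by rewrite lerDr mulr_ge0 ?powR_ge0.
have q0' : 0 < q.
  rewrite lt_neqAle q0 andbT; apply/negP => /eqP e; move: h; rewrite -e powR0 ?gt_eqF //.
  by rewrite ltNge powR_ge0.
apply: (@le_trans _ _ (q `^ p * w `^ alpha)); last by rewrite lerDl powR_ge0.
have -> : q `^ p = q ^+ 2 * q `^ (p - 2).
  by rewrite -(powR_mulrn 2 q0) -(powRDp _ _ q0'); congr (_ `^ _); ring.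
rewrite -mulrA ler_wpM2l ?sqr_ge0 //.
have -> : w `^ gam = w `^ (gam - alpha) * w `^ alpha by rewrite -(powRDp _ _ w0) subrK.
by rewrite ler_wpM2r ?powR_ge0 // ltW.
Qed.

Section Exponents.
Variables alpha p : R.
Hypotheses (alpha0 : 0 <= alpha) (p_gt : 2 + 2 * alpha < p).

(* Bessel's inequality in the weight [(1 - |z| ^ 2) ^ gam], with [gam < 0] chosen close enough to 0
   for Young's inequality to bound that weighted square norm by the [p]-th power of the Bergman norm. *)
Lemma coef_sum_poly : exists K : R, forall (c : nat -> R[i]) N,
  ((\sum_(k < N) cmod (c k) / k.+1%:R)%:E * diskarea <=
   K%:E + \int[nu]_z (dweight alpha z * cmod (cpoly c N (cpt z)) `^ p)%:E)%E.
Proof.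
have p0 : 0 < p by move: alpha0 p_gt; lra.
have p2 : 2 < p by move: alpha0 p_gt; lra.
have p20 : 0 < p - 2 by rewrite subr_gt0.
(* The exponent [e1] exceeds [-1] for [gam < 0], and [e2] does for
   [gam * p > - (p - 2 - 2 * alpha)]; [gam] is the midpoint of this range. *)
pose gam := - (p - 2 - 2 * alpha) / (2 * p).
have gp : gam * p = - (p - 2 - 2 * alpha) / 2 by rewrite /gam; field; rewrite gt_eqF.
have g0 : gam < 0 by rewrite -(pmulr_llt0 _ p0) gp; move: p_gt; lra.
pose e1 := - gam - 1; pose e2 := gam + 2 * (gam - alpha) / (p - 2).
have e11 : -1 < e1 by rewrite /e1; lra.
have e21 : -1 < e2.
  have -> : e2 = (gam * p - 2 * alpha) / (p - 2) by rewrite /e2; field; rewrite gt_eqF.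
  by rewrite ltr_pdivlMr // gp; move: p_gt; lra.
have F1 := dweight_int_fin e11; have F2 := dweight_int_fin e21.
have ms := @measurable_sqn R.
have m1 := @measurable_dweight R e1; have m2 := @measurable_dweight R e2; have ma := @measurable_dweight R alpha.
have d0 e := @dweight_ge0 R e.
pose I e : \bar R := (\int[nu]_z (dweight e z)%:E)%E.
have I0 e : (0 <= I e)%E by apply: integral_ge0 => z _; rewrite lee_fin.
exists (fine (I e1) + fine (I e2)) => c N.
have -> : (fine (I e1) + fine (I e2))%:E = (I e1 + I e2)%E by rewrite EFinD !fineK // ge0_fin_numE.
pose W (y : R) := if y < 1 then (1 - y) `^ gam else 0.
have W0 y : 0 <= W y by rewrite /W; case: ifP => // _; exact: powR_ge0.
have mW : measurable_fun setT W by rewrite /W; meas.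
have mWs : measurable_fun setT (fun z : R * R => W (sqn z)) by exact: measurableT_comp mW ms.
have mq : measurable_fun setT (fun z : R * R => cmod (cpoly c N (cpt z))).
  by apply: measurable_cmod; apply: cmeasurable_cpoly; exact: cmeasurable_cpt.
pose L (z : R * R) : R := if sqn z < 1 then \sum_(k < N) cmod (c k) * sqn z ^+ k else 0.
have S0 (g : nat -> R) (z : R * R) : (forall k, 0 <= g k) -> 0 <= \sum_(k < N) g k * sqn z ^+ k.
  by move=> g0'; apply: sumr_ge0 => k _; rewrite mulr_ge0 ?exprn_ge0 ?sqn_ge0.
have mS (g : nat -> R) : measurable_fun setT (fun z : R * R => \sum_(k < N) g k * sqn z ^+ k).
  by apply: measurable_sum => k; meas.
have L0 z : 0 <= L z by rewrite /L; case: ifP => // _; apply: (S0 (fun k => cmod (c k))) => k; exact: cmod_ge0.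
have mL : measurable_fun setT L.
  by have := mS (fun k => cmod (c k)); rewrite /L => h; meas.
have IL : ((\sum_(k < N) cmod (c k) / k.+1%:R)%:E * diskarea = \int[nu]_z (L z)%:E)%E.
  have mk k : measurable_fun setT (fun z : R * R => ((cmod (c k))%:E * (if sqn z < 1 then sqn z ^+ k else 0)%:E)%E) by meas.
  have k0 k (z : R * R) : (0 <= (cmod (c k))%:E * (if sqn z < 1 then sqn z ^+ k else 0)%:E)%E.
    by rewrite -EFinM lee_fin mulr_ge0 ?cmod_ge0 //; case: ifP => // _; rewrite exprn_ge0 ?sqn_ge0.
  have -> : (\int[nu]_z (L z)%:E = \int[nu]_z (\sum_(k < N) ((cmod (c k))%:E * (if sqn z < 1 then sqn z ^+ k else 0)%:E))%E)%E.
    apply: eq_integral => z _; under eq_bigr do rewrite -EFinM.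
    rewrite sumEFin; congr EFin; rewrite /L; case: ifP => _ //.
    by rewrite big1 // => k _; rewrite mulr0.
  rewrite (integralTsum nu (index_enum _) (fun j : 'I_N => mk j) (fun j z => k0 j z)).
  rewrite -sumEFin ge0_sume_distrl; last by move=> k _; rewrite lee_fin divr_ge0 ?cmod_ge0.
  apply: eq_bigr => k _; rewrite (integralTZl nu); last 3 first.
  - by meas.
  - by move=> z; rewrite lee_fin; case: ifP => // _; rewrite exprn_ge0 ?sqn_ge0.
  - exact: cmod_ge0.
  by rewrite integral_disk_sqnX muleA -EFinM.
have mWS : measurable_fun setT (fun z => (W (sqn z) * \sum_(k < N) cmod (c k) ^+ 2 * sqn z ^+ k)%:E).
  by apply/measurable_EFinP; apply: measurable_funM => //; exact: (mS (fun k => cmod (c k) ^+ 2)).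
have WS0 z : (0 <= (W (sqn z) * \sum_(k < N) cmod (c k) ^+ 2 * sqn z ^+ k)%:E)%E.
  by rewrite lee_fin mulr_ge0 // (S0 (fun k => cmod (c k) ^+ 2)) // => k; exact: sqr_ge0.
rewrite IL; apply: (@le_trans _ _ (I e1 + \int[nu]_z (W (sqn z) * \sum_(k < N) cmod (c k) ^+ 2 * sqn z ^+ k)%:E)%E).
  rewrite /I -(integralTD nu) //; last 2 first.
  - by meas.
  - by move=> z; rewrite lee_fin.
  apply: le_integralT.
  - by meas.
  - by move=> z; rewrite lee_fin.
  - by apply: emeasurable_funD => //; meas.
  move=> z; rewrite -EFinD lee_fin /L /dweight /W; case: ifP => z1; last by rewrite mul0r addr0.
  set y := sqn z; have y0 : 0 <= y by exact: sqn_ge0.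
  have y1 : 0 < 1 - y by rewrite subr_gt0.
  pose P := (1 - y) `^ gam; have P0 : 0 < P by rewrite powR_gt0.
  have PV : (1 - y) `^ (- gam) = P^-1 by rewrite powRN.
  (* Term by term [C <= 1 / P + P C ^ 2]: the first part sums to at most [(1 - y) ^ e1], the second
     is the weighted square sum. *)
  have s1 : \sum_(k < N) cmod (c k) * y ^+ k <= \sum_(k < N) (y ^+ k * P^-1 + P * (cmod (c k) ^+ 2 * y ^+ k)).
    apply: ler_sum => k _.
    have yk : 0 <= y ^+ k by rewrite exprn_ge0.
    have : cmod (c k) <= P^-1 + P * cmod (c k) ^+ 2.
      have c0 := cmod_ge0 (c k).
      have q1 : P * P^-1 = 1 by rewrite mulfV // gt_eqF.
      have i0 : 0 < P^-1 by rewrite invr_gt0.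
      rewrite -(ler_pM2l P0) mulrDr q1; move: (cmod (c k)) c0 => C C0.
      by have := sqr_ge0 (P * C - 1); nra.
    by move/(ler_wpM2r yk); rewrite mulrDl -mulrA [P^-1 * _]mulrC.
  apply: (le_trans s1); rewrite big_split /= -mulr_suml mulr_sumr lerD2r.
  have -> : (1 - y) `^ e1 = (1 - y)^-1 * P^-1.
    by rewrite /e1 (powRDp _ _ y1) PV mulrC powR_inv1 // ltW.
  rewrite ler_wpM2r ?invr_ge0 ?(ltW P0) //; apply: geometric_sum_le.
  by rewrite y0.
rewrite -[X in (_ <= X)%E]addeA; apply: leeD; first exact: lexx.
apply: (le_trans (parseval_le c N mW W0)).
rewrite /I -(integralTD nu); last 4 first.
- by meas.
- by move=> z; rewrite lee_fin.
- by meas.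
- by move=> z; rewrite lee_fin mulr_ge0 ?powR_ge0.
apply: le_integralT.
- by meas.
- by move=> z; rewrite lee_fin mulr_ge0 ?sqr_ge0.
- by meas.
move=> z; rewrite -EFinD lee_fin /W /dweight; case: ifP => z1; last by rewrite !mul0r addr0.
have y1 : 0 < 1 - sqn z by rewrite subr_gt0.
have := young_weight alpha gam p2 (cmod_ge0 (cpoly c N (cpt z))) y1.
by move=> h; rewrite [X in X <= _]mulrC [X in _ <= X]addrC [X in _ <= X + _]mulrC.
Qed.

Lemma tail_small (g : nat -> R) (S eps : R) : (forall k, 0 <= g k) -> (forall N, \sum_(k < N) g k <= S) ->
  0 < eps -> exists N0, forall N M, (N0 <= N)%N -> \sum_(N <= k < M) g k <= eps.
Proof.
move=> g0 hS eps0.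
have hs : has_sup (range (fun N => \sum_(k < N) g k)).
  by split; [exists (\sum_(k < 0) g k), 0%N|exists S => _ [N _ <-]].
have [_ [N0 _ <-] hN0] := sup_adherent eps0 hs.
exists N0 => N M NN0; case: (leqP N M) => NM; last by rewrite big_geq ?ltW // ltnW.
have h1 : \sum_(k < M) g k <= sup (range (fun N => \sum_(k < N) g k)).
  by apply: (sup_upper_bound hs); exists M.
have h2 : \sum_(k < N0) g k <= \sum_(k < N) g k.
  rewrite -!(big_mkord xpredT g) [X in _ <= X](@big_cat_nat _ _ _ N0) //= lerDl sumr_ge0 //.
have h3 : \sum_(k < M) g k = \sum_(k < N) g k + \sum_(N <= k < M) g k.
  by rewrite -!(big_mkord xpredT g) (@big_cat_nat _ _ _ N).
by move: h1 h2 h3 hN0; lra.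
Qed.

(** Partial sums of the dilate [f (r z)] converge to it uniformly on the disk. Its integral is at
    most [r ^ (- 2) I], by rescaling and because the weight at [z] is at most the weight at [r z].
    The tangent inequality transfers closeness to [p]-th powers. *)
Lemma dilate_approx (a : nat -> R[i]) (r I eps : R) : analytic_on_disk a -> dint p alpha a = I%:E ->
  0 < r < 1 -> 0 < eps -> exists N0, forall N, (N0 <= N)%N ->
  (\int[nu]_z (dweight alpha z * cmod (cpoly (fun k => a k * (r ^+ k)%:C%C) N (cpt z)) `^ p)%:E <=
   (r^-1 ^+ 2 * I + eps)%:E)%E.
Proof.
move=> ha hI r01 eps0; have /andP[r0 r1] := r01.
have p1 : 1 < p by move: alpha0 p_gt; lra.
have r01' : 0 <= r < 1 by rewrite (ltW r0).
have [S hS] := analytic_abs ha r01'.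
have S0 : 0 <= S by have := hS 0%N; rewrite big_ord0.
have al1 : -1 < alpha by move: alpha0; lra.
have FD := dweight_int_fin al1.
have d0 := @dweight_ge0 R alpha; have md := @measurable_dweight R alpha.
pose Dd : \bar R := (\int[nu]_z (dweight alpha z)%:E)%E.
have Dd0 : (0 <= Dd)%E by apply: integral_ge0 => z _; rewrite lee_fin.
have DE : Dd = (fine Dd)%:E by rewrite fineK // ge0_fin_numE.
pose C := p * S `^ (p - 1).
have C0 : 0 <= C by rewrite mulr_ge0 ?powR_ge0 // ltW // (lt_trans ltr01).
have f0 : 0 <= fine Dd by exact: fine_ge0.
pose ep := eps / (C * fine Dd + 1).
have den0 : 0 < C * fine Dd + 1 by rewrite ltr_pwDr // mulr_ge0.
have ep0 : 0 < ep by rewrite divr_gt0.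
have g0 k : 0 <= cmod (a k) * r ^+ k by rewrite mulr_ge0 ?cmod_ge0 ?exprn_ge0 // ltW.
have [N0 hN0] := tail_small g0 hS ep0.
exists N0 => N NN0.
set b := fun k => a k * (r ^+ k)%:C%C.
have cb k : cmod (b k) = cmod (a k) * r ^+ k by rewrite /b cmodM cmod_real ger0_norm // exprn_ge0 // ltW.
have mq : measurable_fun setT (fun z : R * R => cmod (cpoly b N (cpt z))).
  by apply: measurable_cmod; apply: cmeasurable_cpoly; exact: cmeasurable_cpt.
have mf := @measurable_diskmod R a ha.
pose f (z : R * R) := (dweight alpha z * diskmod a z `^ p)%:E.
have mff : measurable_fun setT f by rewrite /f; meas.
have ff0 z : (0 <= f z)%E by rewrite lee_fin mulr_ge0 ?powR_ge0.
pose rz (z : R * R) : R * R := (r * z.1 + 0, r * z.2 + 0).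
have mrz : measurable_fun setT rz by rewrite /rz; meas.
have mfrz : measurable_fun setT (fun z => f (rz z)) by exact: measurableT_comp mff mrz.
have If : (\int[nu]_z f (rz z) = (r^-1 ^+ 2 * I)%:E)%E.
  have rn : r != 0 by rewrite gt_eqF.
  have e : (I%:E = (r ^+ 2)%:E * \int[nu]_z f (rz z))%E.
    by rewrite -hI; exact: (ge0_leb2_affine 0 0 rn mff ff0).
  rewrite EFinM e muleA -EFinM -exprMn mulVf // expr1n mul1e //.
apply: (@le_trans _ _ (\int[nu]_z f (rz z) + (C * ep)%:E * Dd)%E); last first.
  rewrite If DE -EFinM -EFinD lee_fin lerD2l /ep.
  rewrite mulrAC mulrA ler_pdivrMr // [X in X <= _]mulrC; apply: ler_wpM2l; first exact: ltW.
  by rewrite lerDl.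
rewrite /Dd -(integralTZl nu); last 3 first.
- by meas.
- by move=> z; rewrite lee_fin.
- by rewrite mulr_ge0 // ltW.
have mD : measurable_fun setT (fun z => (C * ep)%:E * (dweight alpha z)%:E)%E by meas.
have D0 z : (0 <= (C * ep)%:E * (dweight alpha z)%:E)%E.
  by rewrite -EFinM lee_fin; exact: mulr_ge0 (mulr_ge0 C0 (ltW ep0)) (d0 z).
rewrite -(integralTD nu mfrz (fun z => ff0 (rz z)) mD D0).
apply: le_integralT.
- by meas.
- by move=> z; rewrite lee_fin mulr_ge0 ?powR_ge0.
- exact: (emeasurable_funD mfrz mD).
move=> z; rewrite /f -EFinM -EFinD lee_fin.
case: (ltP (sqn z) 1) => z1; last first.
  have -> : dweight alpha z = 0 by rewrite /dweight ltNge z1.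
  by rewrite mul0r mulr0 addr0 mulr_ge0 ?powR_ge0.
have srz : sqn (rz z) = r ^+ 2 * sqn z by rewrite /sqn /= !addr0 !exprMn mulrDr.
have r21 : r ^+ 2 <= 1 by rewrite exprn_ile1 // ltW.
have srz1 : sqn (rz z) < 1 by rewrite srz (le_lt_trans _ z1) // ler_piMl ?sqn_ge0.
have wz : dweight alpha z <= dweight alpha (rz z).
  rewrite /dweight z1 srz1; apply: ge0_ler_powR; rewrite ?nnegrE ?subr_ge0 ?(ltW z1) ?(ltW srz1) //.
  by rewrite lerD2l lerN2 srz ler_piMl ?sqn_ge0.
set Q := cmod _; set F := diskmod a (rz z).
have F0 : 0 <= F by exact: diskmod_ge0.
have Q0 : 0 <= Q by exact: cmod_ge0.
have cz : cmod (cpt z) <= 1 by exact: ltW (cmod_cpt_lt1 z1).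
have crz : cpt (rz z) = r%:C%C * cpt z.
  by apply/eqP; rewrite eq_complex /= !mul0r subr0 !addr0 !eqxx.
have bz k : b k * cpt z ^+ k = a k * cpt (rz z) ^+ k by rewrite /b crz exprMn rmorphXn mulrA.
have tb k : cmod (a k * cpt (rz z) ^+ k) <= cmod (a k) * r ^+ k.
  by rewrite -bz cmodM cb cmodX ler_piMr // exprn_ile1 // cmod_ge0.
have QS : Q <= S.
  apply: le_trans (hS N); apply: (le_trans (cmod_sum _ _ _)); apply: ler_sum => k _.
  by rewrite bz.
have QF : Q - F <= ep.
  have := @cseries_tail_le R (fun k => a k * cpt (rz z) ^+ k) _ ep N (ccvg_pseries ha (cmod_cpt_lt1 srz1)).
  have tl M : \sum_(N <= k < M) cmod (a k * cpt (rz z) ^+ k) <= ep.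
    by apply: le_trans (hN0 N M NN0); apply: ler_sum => k _.
  move/(_ tl); apply: le_trans.
  rewrite lerBlDr /F /diskmod srz1 -cmodN opprB.
  have -> : Q = cmod (cpoly a N (cpt (rz z)) - pseries_fun a (cpt (rz z)) + pseries_fun a (cpt (rz z))).
    by rewrite subrK /Q /cpoly; congr cmod; apply: eq_bigr => k _; rewrite bz.
  exact: cmodD.
have QP : Q `^ p <= F `^ p + C * ep.
  have := powR_tangent p1 F0 Q0.
  have Qp : Q `^ p = Q `^ (p - 1) * Q.
    have [->|q0] := eqVneq Q 0; first by rewrite mulr0 powR0 // gt_eqF // (lt_trans ltr01).
    by rewrite -powRDn ?subrK // lt_neqAle eq_sym q0.
  have k1 : p * Q `^ (p - 1) * (Q - F) <= C * ep.
    apply: (@le_trans _ _ (p * Q `^ (p - 1) * ep)).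
      by rewrite ler_wpM2l // mulr_ge0 ?powR_ge0 // ltW // (lt_trans ltr01).
    rewrite ler_wpM2r ?(ltW ep0) // /C ler_wpM2l //; first by rewrite ltW // (lt_trans ltr01).
    by apply: ge0_ler_powR; rewrite ?nnegrE // subr_ge0 ltW.
  by move: k1; rewrite Qp mulrBr -(mulrA p _ Q); lra.
apply: (@le_trans _ _ (dweight alpha z * (F `^ p + C * ep))); first by rewrite ler_wpM2l.
by rewrite mulrDr [C * ep * _]mulrC lerD2r ler_wpM2r ?powR_ge0.
Qed.

Lemma bernoulli_le (h : R) n : 0 <= h <= 1 -> 1 - n%:R * h <= (1 - h) ^+ n.
Proof.
move=> /andP[h0 h1]; elim: n => [|n IH]; first by rewrite mul0r subr0.
rewrite exprS; apply: le_trans (ler_wpM2l _ IH); last by rewrite subr_ge0.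
by rewrite -natr1; have := ler0n R n; nra.
Qed.

(** The polynomial estimate is applied to dilates whose radius depends on [N], while the resulting
    bound does not. *)
Lemma coef_summable (a : nat -> R[i]) : analytic_on_disk a -> (dint p alpha a < +oo)%E ->
  exists S : R, forall N, \sum_(k < N) cmod (a k) / k.+1%:R <= S.
Proof.
move=> ha hfin; have [K hK] := coef_sum_poly.
have A0 := diskarea_gt0; have Afin := diskarea_fin.
pose A := fine diskarea.
have AE : diskarea = A%:E by rewrite fineK // ge0_fin_numE ?diskarea_ge0.
have A0' : 0 < A by rewrite -lte_fin -AE.
have hI : dint p alpha a = (fine (dint p alpha a))%:E by rewrite fineK // ge0_fin_numE // dint_ge0.
set I := fine _ in hI.
have I0 : 0 <= I by apply: fine_ge0; exact: dint_ge0.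
exists (2 * (K + 4 * I + 1) / A) => N.
(* By Bernoulli's inequality [(1 - h) ^ k >= 1 / 2] for [k <= N], so dilation costs a factor 2 in
   the coefficients, and at most 4 in the norm integral. *)
pose h : R := (2 * N.+1%:R)^-1.
have N0 : 0 < N.+1%:R :> R by rewrite ltr0n.
have h0 : 0 < h by rewrite invr_gt0 mulr_gt0.
have N1 : 1 <= N.+1%:R :> R by rewrite ler1n.
have hh : h <= 2^-1 by rewrite lef_pV2 ?posrE ?mulr_gt0 // ler_peMr.
have Nh : N.+1%:R * h = 2^-1 by rewrite /h; field; rewrite nat1r gt_eqF.
pose r := 1 - h.
have rh : 2^-1 <= r by rewrite /r; move: hh; lra.
have r01 : 0 < r < 1 by rewrite /r; apply/andP; split; move: h0 hh; lra.
have /andP[r0 r1] := r01.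
have h01 : 0 <= h <= 1 by rewrite (ltW h0) /=; move: hh; lra.
have rk k : (k <= N)%N -> 2^-1 <= r ^+ k.
  move=> kN; apply: le_trans (bernoulli_le k h01).
  have : k%:R * h <= N.+1%:R * h by rewrite ler_wpM2r ?(ltW h0) // ler_nat (leq_trans kN).
  by rewrite Nh; lra.
have [N1' hN1] := dilate_approx ha hI r01 ltr01.
pose N2 := maxn N N1'.
have := hK (fun k => a k * (r ^+ k)%:C%C) N2.
have h2 := hN1 N2 (leq_maxr _ _).
move=> h3; have h4 := le_trans h3 (leeD2l K%:E h2).
have cb k : cmod (a k * (r ^+ k)%:C%C) = cmod (a k) * r ^+ k by rewrite cmodM cmod_real ger0_norm // exprn_ge0 // ltW.
move: h4; rewrite AE -EFinM -EFinD lee_fin => h4.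
rewrite ler_pdivlMr // -ler_pdivrMl // mulrA.
have r2 : r^-1 ^+ 2 * I <= 4 * I.
  rewrite ler_wpM2r // (_ : 4 = (2 : R) ^+ 2); last by rewrite -natrX.
  by rewrite lerXn2r ?nnegrE ?invr_ge0 ?(ltW r0) // -[2]invrK lef_pV2 ?posrE ?invr_gt0.
apply: (@le_trans _ _ ((\sum_(k < N2) cmod (a k * (r ^+ k)%:C%C) / k.+1%:R) * A)); last first.
  by apply: (le_trans h4); move: r2; lra.
rewrite ler_wpM2r ?(ltW A0') //.
apply: (@le_trans _ _ (\sum_(k < N) cmod (a k * (r ^+ k)%:C%C) / k.+1%:R)).
  rewrite mulr_sumr; apply: ler_sum => k _; rewrite cb mulrA ler_wpM2r ?invr_ge0 //.
  by rewrite mulrC ler_wpM2l ?cmod_ge0 // rk // ltnW.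
rewrite -(big_mkord xpredT (fun k => cmod (a k * (r ^+ k)%:C%C) / k.+1%:R)).
rewrite -(big_mkord xpredT (fun k => cmod (a k * (r ^+ k)%:C%C) / k.+1%:R)).
rewrite [X in _ <= X](@big_cat_nat _ _ _ N) ?leq_maxl //= lerDl.
by apply: sumr_ge0 => k _; rewrite divr_ge0 ?cmod_ge0.
Qed.

End Exponents.

End CoefficientSum.

(** * The upper bound on the whole Bergman space *)

Section UpperBound.
Variable R : realType.
Local Notation mu := (@lebesgue_measure R).
Local Notation nu := (@leb2 R).

Lemma fatou_le d (T : measurableType d) (m : {measure set T -> \bar R}) (f : nat -> T -> \bar R)
    (F : T -> \bar R) (C : \bar R) :
  (forall n, measurable_fun setT (f n)) -> (forall n t, 0 <= f n t)%E ->
  (forall t, f ^~ t @ \oo --> F t) -> (forall n, \int[m]_t f n t <= C)%E ->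
  (\int[m]_t F t <= C)%E.
Proof.
move=> mf f0 fF fC.
have -> : (\int[m]_t F t = \int[m]_t limn_einf (f ^~ t))%E.
  by apply: eq_integral => t _; have [-> _] := cvg_limn_einf_sup (fF t).
apply: (@le_trans _ _ (limn_einf (fun n => \int[m]_t f n t))%E).
  by apply: fatou => //; exact: measurableT.
rewrite limn_einf_lim; apply: lime_le; first exact: is_cvg_einfs.
by near=> n; apply: (@le_trans _ _ (\int[m]_t f n t)%E) => //; apply: ereal_inf_lbound; exists n => /=.
Unshelve. all: by end_near.
Qed.

(** Differentiability of the power gives continuity at positive limits; at the limit 0, [u ^ p <= u]
    for [u <= 1] is used instead. *)
Lemma cvg_powR_seq (u : nat -> R) (l p : R) : 1 < p -> (forall n, 0 <= u n) -> u @ \oo --> l ->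
  (fun n => u n `^ p) @ \oo --> l `^ p.
Proof.
move=> p1 u0 ul.
have l0 : 0 <= l by apply: (ler_cvg_to (cvg_cst 0) ul); exact: nearW.
have p0 : 0 < p by rewrite (lt_trans ltr01).
have [{}l0|l0'] := ltP 0 l.
  have [dd _] := is_derive1_powR p l0.
  have c : {for l, continuous (fun x : R => x `^ p)} by move/derivable1_diffP/differentiable_continuous : dd.
  exact: continuous_cvg c ul.
have e : l = 0 by apply/le_anti; rewrite l0 l0'.
rewrite e in ul *; rewrite powR0 ?gt_eqF //.
apply: (@squeeze_cvgr _ _ _ _ (fun=> 0) u); [|exact: cvg_cst|exact: ul].
have u1 : \forall n \near \oo, `|0 - u n| <= 1 by move/cvgrPdist_le : ul; apply.
near=> n; rewrite powR_ge0 /=.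
have un1 : u n <= 1.
  have : `|0 - u n| <= 1 by near: n; exact: u1.
  by rewrite sub0r normrN ger0_norm.
have [->|un0] := eqVneq (u n) 0; first by rewrite powR0 // gt_eqF.
have un : 0 < u n by rewrite lt_neqAle eq_sym un0 u0.
rewrite -[p](subrK 1) (powRDn _ un) ler_piMl //.
by rewrite powR_le1 ?u0 // subr_ge0 ltW.
Unshelve. all: by end_near.
Qed.

Section WithSum.
Variables (a : nat -> R[i]) (S : R).
Hypothesis hS : forall N, \sum_(k < N) cmod (a k) / k.+1%:R <= S.

Lemma cmod_div_nat_le n k (c : R[i]) : cmod (c / (n + k + 1)%:R) <= cmod c / k.+1%:R.
Proof.
rewrite cmodM cmodV cmod_nat; apply: ler_wpM2l; first exact: cmod_ge0.
by rewrite lef_pV2 ?posrE ?ltr0n ?addn1 // ler_nat; lia.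
Qed.

Lemma hilbert_term_cvg n : cseries_cvg (hilbert_term a n).
Proof.
apply: (@cseries_cvg_abs _ _ S) => N; apply: le_trans (hS N); apply: ler_sum => k _.
exact: cmod_div_nat_le.
Qed.

Lemma cmod_hilbert_le n : cmod (hilbert a n) <= S.
Proof.
apply: (cseries_le (ccvg_cseries (hilbert_term_cvg n))) => N; apply: le_trans (hS N).
by apply: ler_sum => k _; exact: cmod_div_nat_le.
Qed.

Lemma analytic_hilbert : analytic_on_disk (hilbert a).
Proof. exact: analytic_of_bound cmod_hilbert_le. Qed.

End WithSum.

Lemma analytic_hcoef (b : nat -> R[i]) N : analytic_on_disk (hcoef b N).
Proof.
apply: (@analytic_of_bound _ _ (\sum_(k < N) cmod (b k) / k.+1%:R)) => n.
by apply: (le_trans (cmod_sum _ _ _)); apply: ler_sum => k _; exact: cmod_div_nat_le.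
Qed.

Lemma diskmod_close (h g : nat -> R[i]) (del : R) (z : R * R) : analytic_on_disk h -> analytic_on_disk g ->
  (forall n, cmod (h n - g n) <= del) -> sqn z < 1 ->
  diskmod h z <= diskmod g z + del * (1 - cmod (cpt z))^-1.
Proof.
move=> ah ag hg z1; have c1 := cmod_cpt_lt1 z1.
have del0 : 0 <= del by apply: le_trans (hg 0%N); exact: cmod_ge0.
rewrite /diskmod z1.
have lh := ccvg_cmod (ccvg_pseries ah c1); have lg := ccvg_cmod (ccvg_pseries ag c1).
have lg' : (fun N => cmod (cpoly g N (cpt z)) + del * (1 - cmod (cpt z))^-1) @ \oo -->
    cmod (pseries_fun g (cpt z)) + del * (1 - cmod (cpt z))^-1 by apply: cvgD => //; exact: cvg_cst.
apply: (ler_cvg_to lh lg'); near=> N.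
have c01 : 0 <= cmod (cpt z) < 1 by rewrite cmod_ge0.
have -> : cpoly h N (cpt z) = cpoly g N (cpt z) + \sum_(k < N) (h k - g k) * cpt z ^+ k.
  by rewrite /cpoly -big_split /=; apply: eq_bigr => k _; ring.
apply: (le_trans (cmodD _ _)); rewrite lerD2l.
apply: (le_trans (cmod_sum _ _ _)).
apply: le_trans (ler_wpM2l del0 (geometric_sum_le N c01)).
by rewrite mulr_sumr; apply: ler_sum => k _; rewrite cmodM cmodX ler_wpM2r ?exprn_ge0 ?cmod_ge0.
Unshelve. all: by end_near.
Qed.

Section Exponents.
Variables alpha p : R.
Hypotheses (alpha0 : 0 <= alpha) (p_gt : 2 + 2 * alpha < p).

(** Truncated dilates do two things at once: their images under [H] have coefficients uniformly
    close to those of [H f], and their norm integrals exceed that of [f] by little. *)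
Lemma approx_poly (a : nat -> R[i]) (S I del : R) : analytic_on_disk a -> dint p alpha a = I%:E ->
  (forall N, \sum_(k < N) cmod (a k) / k.+1%:R <= S) -> 0 < del ->
  exists b N, (forall n, cmod (hilbert a n - hcoef b N n) <= del) /\
  (\int[nu]_z (dweight alpha z * cmod (cpoly b N (cpt z)) `^ p)%:E <= (I + del)%:E)%E.
Proof.
move=> ha hI hS del0.
have S0 : 0 <= S by have := hS 0%N; rewrite big_ord0.
have I0 : 0 <= I by rewrite -lee_fin -hI dint_ge0.
have g0 k : 0 <= cmod (a k) / k.+1%:R by rewrite divr_ge0 ?cmod_ge0.
have d4 : 0 < del / 4 by rewrite divr_gt0.
have [N0 hN0] := tail_small g0 hS d4.
pose T := I + S * N0%:R + 1.
have SN : 0 <= S * N0%:R by rewrite mulr_ge0.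
have T0 : 0 < T by rewrite /T; lra.
(* For [h <= 1 / 2] one has [(1 - h) ^ (- 2) <= 1 + 8 h]; as [T] dominates [I] and [S * N0], this
   [h] costs at most [del / 2] in the norm and [del / 16] in the coefficients below [N0]. *)
pose h := Num.min 2^-1 (del / (16 * T)).
have h0 : 0 < h by rewrite /h lt_min invr_gt0 ltr0n /= divr_gt0 // mulr_gt0.
have h2 : h <= 2^-1 by rewrite /h ge_min lexx.
have hT : h * T <= del / 16.
  have : h <= del / (16 * T) by rewrite /h ge_min lexx orbT.
  move/(ler_wpM2r (ltW T0)) => e; apply: (le_trans e).
  by rewrite le_eqVlt; apply/orP; left; apply/eqP; field; rewrite gt_eqF.
pose r := 1 - h.
have r01 : 0 < r < 1 by rewrite /r; apply/andP; split; move: h0 h2; lra.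
have /andP[r0 r1] := r01.
have h01 : 0 <= h <= 1 by rewrite (ltW h0) /=; move: h2; lra.
have d2 : 0 < del / 2 by rewrite divr_gt0.
have [N1 hN1] := dilate_approx alpha0 p_gt ha hI r01 d2.
pose N := maxn N0 N1.
exists (fun k => a k * (r ^+ k)%:C%C), N; split; last first.
  apply: (le_trans (hN1 N (leq_maxr _ _))); rewrite lee_fin.
  have k1 : r^-1 ^+ 2 <= 1 + 8 * h.
    rewrite exprVn -[_^-1]mul1r ler_pdivrMr ?exprn_gt0 // /r.
    have : 0 <= h * (6 - 15 * h + 8 * h ^+ 2).
      by rewrite mulr_ge0 ?(ltW h0) //; nra.
    by move=> k; apply: (@le_trans _ _ (1 + h * (6 - 15 * h + 8 * h ^+ 2))); [lra|rewrite le_eqVlt; apply/orP; left; apply/eqP; ring].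
  have := ler_wpM2r I0 k1.
  have : h * I <= h * T by rewrite ler_pM2l // /T; lra.
  by move: hT; lra.
move=> n.
have -> : hilbert a n - hcoef (fun k => a k * (r ^+ k)%:C%C) N n =
   (hilbert a n - \sum_(k < N) hilbert_term a n k) + \sum_(k < N) (a k * (1 - r ^+ k)%:C%C) / (n + k + 1)%:R.
  rewrite -addrA; congr (_ + _); rewrite /hcoef -sumrN -sumrN -big_split /=; apply: eq_bigr => k _.
  by rewrite /hilbert_term rmorphB rmorph1; ring.
apply: (le_trans (cmodD _ _)).
have t1 : cmod (hilbert a n - \sum_(k < N) hilbert_term a n k) <= del / 4.
  apply: (cseries_tail_le (ccvg_cseries (hilbert_term_cvg hS n))) => M.
  apply: le_trans (hN0 N M (leq_maxl _ _)); apply: ler_sum => k _; exact: cmod_div_nat_le.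
have t2 : cmod (\sum_(k < N) (a k * (1 - r ^+ k)%:C%C) / (n + k + 1)%:R) <= S * (N0%:R * h) + del / 4.
  apply: (le_trans (cmod_sum _ _ _)).
  have rk0 k : 0 <= 1 - r ^+ k <= 1.
    by rewrite subr_ge0 exprn_ile1 ?(ltW r0) ?(ltW r1) //= gerBl exprn_ge0 // ltW.
  apply: (@le_trans _ _ (\sum_(k < N) cmod (a k) / k.+1%:R * (1 - r ^+ k))).
    apply: ler_sum => k _; have /andP[q0 _] := rk0 k.
    apply: (le_trans (cmod_div_nat_le n k _)).
    by rewrite cmodM cmod_real ger0_norm // mulrAC.
  rewrite -(big_mkord xpredT (fun k => cmod (a k) / k.+1%:R * (1 - r ^+ k))).
  rewrite (@big_cat_nat _ _ _ N0) ?leq_maxl //=; apply: lerD; last first.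
    apply: le_trans (hN0 N0 N (leqnn _)); apply: ler_sum => k _; have /andP[_ q1] := rk0 k.
    by rewrite ler_piMr.
  have Nh0 : 0 <= N0%:R * h by rewrite mulr_ge0 // ltW.
  apply: le_trans (ler_wpM2r Nh0 (hS N0)); rewrite big_mkord mulr_suml; apply: ler_sum => k _.
  rewrite ler_wpM2l //; have := bernoulli_le k h01; rewrite -/r.
  have : k%:R * h <= N0%:R * h by rewrite ler_wpM2r ?(ltW h0) // ler_nat ltnW.
  by lra.
have : h * (S * N0%:R) <= h * T by rewrite ler_pM2l // /T; lra.
have -> : h * (S * N0%:R) = S * (N0%:R * h) by ring.
by move: hT t1 t2; lra.
Qed.

(** Uniformly close coefficients give pointwise convergence in the disk, so Fatou's lemma carries
    the polynomial bound over. Capping [del j] by [eps] keeps the right-hand side within [e] for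
    every [j]. *)
Lemma dint_hilbert_le (a : nat -> R[i]) (S : R) :
  hyp_a alpha p \/ (condb_integral p alpha <= (1 / (4 * (alpha + 1)))%:E)%E ->
  analytic_on_disk a -> (dint p alpha a < +oo)%E ->
  (forall N, \sum_(k < N) cmod (a k) / k.+1%:R <= S) ->
  (dint p alpha (hilbert a) <= (rbeta (bexp alpha p) (1 - bexp alpha p) `^ p)%:E * dint p alpha a)%E.
Proof.
move=> hab ha hfin hS.
set B := rbeta _ _.
have B0 : 0 < B by apply: rbeta01_gt0; exact: bexp01.
have Bp0 : 0 < B `^ p by rewrite powR_gt0.
have hI : dint p alpha a = (fine (dint p alpha a))%:E by rewrite fineK // ge0_fin_numE // dint_ge0.
set I := fine _ in hI.
have p0 : 0 < p by move: alpha0 p_gt; lra.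
have dw0 := @dweight_ge0 R alpha; have mdw := @measurable_dweight R alpha.
have ah := analytic_hilbert hS.
rewrite hI; apply/lee_addgt0Pr => e e0.
pose eps := e / B `^ p.
have eps0 : 0 < eps by rewrite divr_gt0.
have -> : ((B `^ p)%:E * I%:E + e%:E = (B `^ p * (I + eps))%:E)%E.
  by rewrite -EFinM -EFinD; congr EFin; rewrite mulrDr /eps mulrC [B `^ p * (e / _)]mulrC divfK // gt_eqF.
pose del (j : nat) : R := Num.min eps j.+1%:R^-1.
have del0 j : 0 < del j by rewrite /del lt_min eps0 invr_gt0 ltr0n.
have ex j : {bN : (nat -> R[i]) * nat | (forall n, cmod (hilbert a n - hcoef bN.1 bN.2 n) <= del j) /\
  (\int[nu]_z (dweight alpha z * cmod (cpoly bN.1 bN.2 (cpt z)) `^ p)%:E <= (I + del j)%:E)%E}.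
  apply: cid; have [b [N h]] := approx_poly ha hI hS (del0 j); by exists (b, N).
pose H (j : nat) := diskmod (hcoef (sval (ex j)).1 (sval (ex j)).2).
have mH j : measurable_fun setT (H j) by apply: measurable_diskmod; exact: analytic_hcoef.
have H0 j z : 0 <= H j z by exact: diskmod_ge0.
apply: (@fatou_le _ _ nu (fun j z => (dweight alpha z * H j z `^ p)%:E)).
- by move=> j; have mHj := mH j; meas.
- by move=> j z; rewrite lee_fin mulr_ge0 ?powR_ge0.
- move=> z; case: (ltP (sqn z) 1) => z1; last first.
    have dz : dweight alpha z = 0 by rewrite /dweight ltNge z1.
    have -> : (fun j => (dweight alpha z * H j z `^ p)%:E) = fun=> (dweight alpha z * diskmod (hilbert a) z `^ p)%:E.
      apply/funext => j; rewrite dz.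
      by transitivity (0 : \bar R); [rewrite mul0r|rewrite mul0r].
    exact: cvg_cst.
  apply: cvg_EFin; first exact: nearW.
  apply: cvgM; first exact: cvg_cst.
  have cH : (fun j => H j z) @ \oo --> diskmod (hilbert a) z.
    pose q := (1 - cmod (cpt z))^-1.
    have q0 : 0 <= q by rewrite invr_ge0 subr_ge0 ltW // cmod_cpt_lt1.
    have c1 : (fun j => j.+1%:R^-1 * q : R) @ \oo --> (0 * q : R).
      by apply: cvgM; [exact: cvg_harmonic|exact: cvg_cst].
    rewrite mul0r in c1.
    have clos j : `|diskmod (hilbert a) z - H j z| <= j.+1%:R^-1 * q.
      have [hc _] := svalP (ex j).
      have ag := @analytic_hcoef (sval (ex j)).1 (sval (ex j)).2.
      have dj : del j <= j.+1%:R^-1 by rewrite /del ge_min lexx orbT.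
      have hc' n : cmod (hcoef (sval (ex j)).1 (sval (ex j)).2 n - hilbert a n) <= del j.
        by rewrite -cmodN opprB.
      have k1 := diskmod_close ah ag hc z1; have k2 := diskmod_close ag ah hc' z1.
      have k3 : del j * q <= j.+1%:R^-1 * q by rewrite ler_wpM2r.
      apply: le_trans k3; rewrite ler_norml; apply/andP; split.
        by rewrite lerNl opprB lerBlDl.
      by rewrite lerBlDl.
    apply/cvgrPdist_le => ep ep0; move/cvgrPdist_le : c1 => /(_ ep ep0) c1; near=> j.
    apply: (le_trans (clos j)).
    have : `|0 - j.+1%:R^-1 * q| <= ep by near: j; exact: c1.
    by rewrite sub0r normrN; apply: le_trans; exact: ler_norm.
  apply: (cvg_powR_seq _ (fun j => H0 j z) cH); by move: alpha0 p_gt; lra.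
move=> j; have [hc hj] := svalP (ex j).
apply: (le_trans (hilbert_bound_of_tint alpha0 p_gt (a := (sval (ex j)).1) (N := (sval (ex j)).2) (mH j) (H0 j) hab _)).
  move=> z z1; rewrite /H /diskmod z1.
  apply: hilbert_poly_le; first exact: cmod_cpt_lt1.
  by apply: ccvg_pseries; [exact: analytic_hcoef|exact: cmod_cpt_lt1].
rewrite -/B [leRHS]EFinM; apply: lee_wpmul2l; first by rewrite lee_fin ltW.
by apply: (le_trans hj); rewrite lee_fin lerD2l /del ge_min lexx.
Unshelve. all: by end_near.
Qed.

Theorem hilbert_bounded :
  hyp_a alpha p \/ (condb_integral p alpha <= (1 / (4 * (alpha + 1)))%:E)%E ->
  forall a : nat -> R[i], in_bergman p alpha a ->
  [/\ forall n, cseries_cvg (hilbert_term a n), in_bergman p alpha (hilbert a) &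
    bergman_norm p alpha (hilbert a) <= rbeta (bexp alpha p) (1 - bexp alpha p) * bergman_norm p alpha a].
Proof.
move=> hab a [ha hfin].
have k0 : 0 < (alpha + 1) / pi by rewrite divr_gt0 ?pi_gt0 // ltr_wpDl.
have dE b : analytic_on_disk b -> bergman_int p alpha b = (((alpha + 1) / pi)%:E * dint p alpha b)%E.
  exact: bergman_int_dint.
have dfin : (dint p alpha a < +oo)%E.
  move: hfin; rewrite (dE _ ha); have := dint_ge0 p alpha a.
  by case: (dint p alpha a) => [r||] //; rewrite ?ltry // gt0_muley ?lte_fin.
have [S hS] := coef_summable alpha0 p_gt ha dfin.
have ah := analytic_hilbert hS.
have key := dint_hilbert_le hab ha dfin hS.
set B := rbeta _ _ in key *.
have B0 : 0 < B by apply: rbeta01_gt0; exact: bexp01.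
have dI : dint p alpha a = (fine (dint p alpha a))%:E by rewrite fineK // ge0_fin_numE // dint_ge0.
have I0 : 0 <= fine (dint p alpha a) by apply: fine_ge0; exact: dint_ge0.
move: (fine _) dI I0 => I dI I0.
rewrite dI -EFinM in key.
have hfn : dint p alpha (hilbert a) \is a fin_num.
  by rewrite (ge0_fin_numE (dint_ge0 p alpha (hilbert a))); exact: le_lt_trans key (ltry _).
have dhI := esym (fineK hfn).
have J0 : 0 <= fine (dint p alpha (hilbert a)) by apply: fine_ge0; exact: dint_ge0.
move: (fine _) dhI J0 => J dhJ J0.
have JI : J <= B `^ p * I by rewrite -lee_fin -dhJ.
have p0 : 0 < p by move: alpha0 p_gt; lra.
split; first exact: hilbert_term_cvg hS.
- by split; [exact: ah|rewrite (dE _ ah) dhJ -EFinM ltry].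
rewrite /bergman_norm (dE _ ah) (dE _ ha) dI dhJ -!EFinM /=.
move: ((alpha + 1) / pi) k0 => k k0.
have kI : 0 <= k * I by rewrite mulr_ge0 ?(ltW k0).
have kJ : 0 <= k * J by rewrite mulr_ge0 ?(ltW k0).
have -> : B * (k * I) `^ p^-1 = (B `^ p * (k * I)) `^ p^-1.
  by rewrite (powRM _ (powR_ge0 B p) kI) -powRrM mulfV ?gt_eqF // (powRr1 (ltW B0)).
apply: ge0_ler_powR; rewrite ?nnegrE ?invr_ge0 ?(ltW p0) //; first by rewrite mulr_ge0 ?powR_ge0.
by rewrite mulrCA ler_wpM2l // ltW.
Qed.

End Exponents.

End UpperBound.

(** * The series of [(1 - z) ^ (- g)] and of the multiplier [D] *)

Section BinomialSeries.
Variable R : realType.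
Local Notation mu := (@lebesgue_measure R).

(** The rising factorial of [g] divided by [k!], the Taylor coefficients of [(1 - z) ^ (- g)]. *)
Fixpoint risc (g : R) (k : nat) : R := if k is k'.+1 then risc g k' * ((k'%:R + g) / k'.+1%:R) else 1.

Lemma riscS g k : k.+1%:R * risc g k.+1 = (k%:R + g) * risc g k.
Proof. by rewrite /= mulrCA [(_ / _)]mulrC mulVKf ?pnatr_eq0 // mulrC. Qed.

Lemma risc_ge0 g k : 0 <= g -> 0 <= risc g k.
Proof. by move=> g0; elim: k => //= k IH; rewrite mulr_ge0 // divr_ge0 // addr_ge0. Qed.

Lemma risc_le g h k : 0 <= g -> g <= h -> risc g k <= risc h k.
Proof.
move=> g0 gh; elim: k => //= k IH; apply: ler_pM => //.
- exact: risc_ge0.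
- by rewrite divr_ge0 // addr_ge0.
- by rewrite ler_pM2r ?invr_gt0 ?ltr0n // lerD2l.
Qed.

Lemma risc1 k : risc 1 k = 1.
Proof. by elim: k => //= k ->; rewrite mul1r natr1 mulfV // pnatr_eq0. Qed.

Lemma risc0 k : risc 0 k = (k == 0%N)%:R.
Proof. by elim: k => //= -[|k] ->; rewrite ?mul1r ?addr0 mul0r. Qed.

Lemma risc_le1 g k : 0 <= g <= 1 -> risc g k <= 1.
Proof. by move=> /andP[g0 g1]; rewrite -(risc1 k) risc_le. Qed.

Definition conv (A : comNzRingType) (a b : nat -> A) (n : nat) : A := \sum_(k < n.+1) a k * b (n - k)%N.

Lemma conv_shift (A : comNzRingType) (a b : nat -> A) n :
  \sum_(k < n.+2) k%:R * (a k * b (n.+1 - k)%N) = \sum_(k < n.+1) (k.+1%:R * a k.+1) * b (n - k)%N.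
Proof.
rewrite big_ord_recl mul0r add0r; apply: eq_bigr => k _.
by rewrite /= /bump /= add1n subSS mulrA.
Qed.

(** The Chu-Vandermonde identity. Multiplying by [n + 1 = k + (n + 1 - k)] and applying [riscS] to
    each half gives the recursion of the right-hand side. *)
Lemma conv_risc g h n : conv (risc g) (risc h) n = risc (g + h) n.
Proof.
elim: n => [|n IH]; first by rewrite /conv big_ord_recl big_ord0 addr0 mulr1.
have n0 : n.+1%:R != 0 :> R by rewrite pnatr_eq0.
apply: (mulfI n0); rewrite riscS -IH /conv mulr_sumr.
transitivity (\sum_(k < n.+2) k%:R * (risc g k * risc h (n.+1 - k)%N) +
  \sum_(k < n.+2) (n.+1 - k)%:R * (risc g k * risc h (n.+1 - k)%N)).
  rewrite -big_split /=; apply: eq_bigr => k _.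
  by rewrite -mulrDl -natrD subnKC // -ltnS.
rewrite conv_shift [X in _ + X]big_ord_recr /= subnn mul0r addr0 -big_split /= mulr_sumr.
apply: eq_bigr => k _; have kn : (k <= n)%N by rewrite -ltnS.
rewrite riscS subSn // mulrCA riscS.
by rewrite (_ : n%:R = k%:R + (n - k)%:R); [ring|rewrite -natrD subnKC].
Qed.

(** The coefficients of [D z], the integral of [u ^ (- g) (1 - u z) ^ (g - 1)] over [0 < u < 1]; at
    [z = 1] this is [B (1 - g, g)]. *)
Definition dcoef (g : R) (n : nat) : R := risc (1 - g) n / (n%:R + (1 - g)).

(** The coefficients [T] of [z f' D] satisfy two relations: [(1 - z) f' = g f] gives [TS], and
    clearing the denominators of [dcoef] gives [E], whose 1 is a coefficient of
    [(1 - z) ^ (- g) (1 - z) ^ (g - 1)]. Eliminating [T] leaves the recursion of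
    [B (n + 1, 1 - g)]. *)
Lemma conv_dcoef g n : g < 1 -> (n.+1%:R + (1 - g)) * conv (risc g) (dcoef g) n.+1 = n.+1%:R * conv (risc g) (dcoef g) n.
Proof.
move=> g1; have pos m : m%:R + (1 - g) != 0 by rewrite gt_eqF // ltr_wpDl // subr_gt0.
pose T m := \sum_(k < m.+1) k%:R * (risc g k * dcoef g (m - k)%N).
have E m : (m%:R + (1 - g)) * conv (risc g) (dcoef g) m = T m + 1.
  transitivity (T m + conv (risc g) (risc (1 - g)) m); last first.
    by rewrite conv_risc (_ : g + (1 - g) = 1) ?risc1 //; ring.
  rewrite /conv /T mulr_sumr -big_split /=; apply: eq_bigr => k _.
  have km : (k <= m)%N by rewrite -ltnS.
  have -> : risc (1 - g) (m - k) = ((m - k)%:R + (1 - g)) * dcoef g (m - k) by rewrite /dcoef mulrC divfK.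
  by rewrite (_ : m%:R = k%:R + (m - k)%:R); [ring|rewrite -natrD subnKC].
have TS : T n.+1 = T n + g * conv (risc g) (dcoef g) n.
  rewrite /T conv_shift /conv mulr_sumr -big_split /=; apply: eq_bigr => k _.
  by rewrite riscS; ring.
rewrite E TS -[T n](addrK 1) -E -natr1; ring.
Qed.

Lemma conv_dcoef_rbeta g n : g < 1 -> conv (risc g) (dcoef g) n = rbeta n.+1%:R (1 - g).
Proof.
move=> g1; have g1' : 0 < 1 - g by rewrite subr_gt0.
elim: n => [|n IH].
  by rewrite /conv big_ord_recl big_ord0 addr0 mul1r subnn /dcoef /= add0r rbeta1l // mul1r.
have p : n.+1%:R + (1 - g) != 0 by rewrite gt_eqF // ltr_wpDl.
apply: (mulfI p); rewrite conv_dcoef // IH.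
by have := @rbeta_recl R n.+1%:R (1 - g) (ltr0n R n.+1) g1'; rewrite natr1.
Qed.

Lemma ccvg_of_cmod (u : nat -> R[i]) l : (fun n => cmod (u n - l)) @ \oo --> (0 : R) -> ccvg_to u l.
Proof.
move=> h; split.
- have e (z : R[i]) : complex.Re (z - l) = complex.Re z - complex.Re l by case: z; case: l {h}.
  apply/cvgrPdist_le => eps eps0; move/cvgrPdist_le : h => /(_ eps eps0) h.
  near=> n; have : `|0 - cmod (u n - l)| <= eps by near: n; exact: h.
  rewrite sub0r normrN (ger0_norm (cmod_ge0 _)); apply: le_trans.
  by rewrite distrC -e; exact: Re_le_cmod.
- have e (z : R[i]) : complex.Im (z - l) = complex.Im z - complex.Im l by case: z; case: l {h}.
  apply/cvgrPdist_le => eps eps0; move/cvgrPdist_le : h => /(_ eps eps0) h.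
  near=> n; have : `|0 - cmod (u n - l)| <= eps by near: n; exact: h.
  rewrite sub0r normrN (ger0_norm (cmod_ge0 _)); apply: le_trans.
  by rewrite distrC -e; exact: Im_le_cmod.
Unshelve. all: by end_near.
Qed.

Lemma cseries_eq (u : nat -> R[i]) l : ccvg_to (fun n => \sum_(k < n) u k) l -> cseries u = l.
Proof.
case: l => x y [h1 h2]; rewrite /cseries.
by rewrite (cvg_lim (@Rhausdorff R) h1) (cvg_lim (@Rhausdorff R) h2).
Qed.

Lemma ccvg_toM (u v : nat -> R[i]) l m : ccvg_to u l -> ccvg_to v m -> ccvg_to (fun n => u n * v n) (l * m).
Proof.
move=> [u1 u2] [v1 v2].
have re (z w : R[i]) : complex.Re (z * w) = complex.Re z * complex.Re w - complex.Im z * complex.Im w by case: z; case: w.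
have im (z w : R[i]) : complex.Im (z * w) = complex.Re z * complex.Im w + complex.Im z * complex.Re w by case: z; case: w.
split.
- rewrite re (_ : (fun n => _) = fun n => complex.Re (u n) * complex.Re (v n) - complex.Im (u n) * complex.Im (v n)).
    by apply: cvgB; apply: cvgM.
  by apply/funext => n; rewrite re.
- rewrite im (_ : (fun n => _) = fun n => complex.Re (u n) * complex.Im (v n) + complex.Im (u n) * complex.Re (v n)).
    by apply: cvgD; apply: cvgM.
  by apply/funext => n; rewrite im.
Qed.

Lemma ccvg_to_close (u v : nat -> R[i]) l (e : nat -> R) : ccvg_to v l ->
  (forall n, cmod (u n - v n) <= e n) -> e @ \oo --> (0 : R) -> ccvg_to u l.
Proof.
move=> vl uv e0; apply: ccvg_of_cmod.
have h1 := ccvg_cmod (ccvg_toB l vl); rewrite subrr cmod0 in h1.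
have h2 : (fun n => e n + cmod (v n - l)) @ \oo --> (0 + 0 : R) by apply: cvgD.
rewrite addr0 in h2.
apply: (@squeeze_cvgr _ _ _ _ (fun=> 0) (fun n => e n + cmod (v n - l))); [|exact: cvg_cst|exact: h2].
near=> n; rewrite cmod_ge0 /=.
have -> : u n - l = (u n - v n) + (v n - l) by ring.
by apply: (le_trans (cmodD _ _)); rewrite lerD2r.
Unshelve. all: by end_near.
Qed.

Lemma cpoly_conv (a b : nat -> R[i]) N z : cpoly (conv a b) N z =
  \sum_(k < N) \sum_(l < N | (k + l < N)%N) (a k * z ^+ k) * (b l * z ^+ l).
Proof.
rewrite /cpoly /conv; elim: N => [|N IH]; first by rewrite !big_ord0.
rewrite big_ord_recr /= IH.
have step (k : 'I_N.+1) : \sum_(l < N.+1 | (k + l < N.+1)%N) a k * z ^+ k * (b l * z ^+ l) =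
    \sum_(l < N | (k + l < N)%N) a k * z ^+ k * (b l * z ^+ l) + a k * z ^+ k * (b (N - k)%N * z ^+ (N - k)).
  have kN : (k <= N)%N by rewrite -ltnS.
  pose f l := a k * z ^+ k * (b l * z ^+ l).
  have red M : (N - k < M)%N -> \sum_(l < M | (k + l < N.+1)%N) f l = \sum_(l < (N - k).+1) f l.
    move=> h; rewrite (big_ord_widen_cond _ xpredT f h) /=; apply: eq_bigl => l.
    by rewrite ltnS -leq_subRL // [in RHS]ltnS.
  have red2 M : (N - k <= M)%N -> \sum_(l < M | (k + l < N)%N) f l = \sum_(l < (N - k)) f l.
    by move=> h; rewrite (big_ord_widen_cond _ xpredT f h) /=; apply: eq_bigl => l; rewrite ltn_subRL.
  rewrite -/(f _) (red N.+1) ?ltnS ?leq_subr // (red2 N) ?leq_subr //.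
  by rewrite big_ord_recr.
rewrite [RHS](eq_bigr _ (fun k _ => step k)) big_split /=; congr (_ + _).
  rewrite [RHS]big_ord_recr /= [X in _ + X]big_pred0 ?addr0 // => l.
  by apply/negbTE; rewrite -leqNgt leq_addr.
rewrite mulr_suml; apply: eq_bigr => k _; have kN : (k <= N)%N by rewrite -ltnS.
have zN : z ^+ N = z ^+ k * z ^+ (N - k) by rewrite -exprD subnKC.
by rewrite zN; ring.
Qed.

(** The square partial sums exceed the triangular ones by pairs with [k + l >= N], which at a larger
    radius [rho] contribute at most a multiple of [(r / rho) ^ N]. *)
Lemma pseries_conv (a b : nat -> R[i]) (z : R[i]) : analytic_on_disk a -> analytic_on_disk b -> cmod z < 1 ->
  ccvg_to (fun N => cpoly (conv a b) N z) (pseries_fun a z * pseries_fun b z).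
Proof.
move=> ha hb z1; set r := cmod z in z1.
have r0 : 0 <= r by exact: cmod_ge0.
have [rho [rho0 rrho rho01]] : exists rho : R, [/\ 0 < rho, r < rho & 0 <= rho < 1].
  by exists ((1 + r) / 2); split; [lra|lra|apply/andP; split; lra].
have [Sa hSa] := analytic_abs ha rho01; have [Sb hSb] := analytic_abs hb rho01.
have q01 : 0 <= r / rho < 1 by rewrite divr_ge0 ?(ltW rho0) //= ltr_pdivrMr // mul1r.
have /andP[q0 q1] := q01.
have Sa0 : 0 <= Sa by have := hSa 0%N; rewrite big_ord0.
apply: (@ccvg_to_close _ (fun N => cpoly a N z * cpoly b N z) _ (fun N => (Sa * Sb) * (r / rho) ^+ N)).
- by apply: ccvg_toM; exact: ccvg_pseries.
- move=> N; rewrite cpoly_conv -cmodN opprB /cpoly big_distrlr /=.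
  have -> : \sum_(i < N) \sum_(j < N) a i * z ^+ i * (b j * z ^+ j) -
      \sum_(k < N) \sum_(l < N | (k + l < N)%N) a k * z ^+ k * (b l * z ^+ l) =
      \sum_(k < N) \sum_(l < N | ~~ (k + l < N)%N) a k * z ^+ k * (b l * z ^+ l).
    rewrite -sumrB; apply: eq_bigr => k _.
    by rewrite (bigID (fun l : 'I_N => (k + l < N)%N)) /= addrAC subrr add0r.
  apply: (@le_trans _ _ (\sum_(k < N) \sum_(l < N) (cmod (a k) * rho ^+ k) * (cmod (b l) * rho ^+ l) * (r / rho) ^+ N)).
    apply: (le_trans (cmod_sum _ _ _)); apply: ler_sum => k _.
    apply: (le_trans (cmod_sum _ _ _)); rewrite big_mkcond /=; apply: ler_sum => l _.
    have p0 : 0 <= (cmod (a k) * rho ^+ k) * (cmod (b l) * rho ^+ l).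
      by rewrite !mulr_ge0 ?cmod_ge0 ?exprn_ge0 // ltW.
    case: ifPn => kl; last by rewrite mulr_ge0 // exprn_ge0.
    rewrite -leqNgt in kl.
    have -> : cmod (a k * z ^+ k * (b l * z ^+ l)) =
        (cmod (a k) * rho ^+ k) * (cmod (b l) * rho ^+ l) * (r / rho) ^+ (k + l).
      rewrite !cmodM !cmodX -/r exprD !expr_div_n; field.
      by rewrite !expf_neq0 ?gt_eqF.
    by rewrite ler_wpM2l // ler_wiXn2l // ltW.
  rewrite (eq_bigr (fun k : 'I_N => cmod (a k) * rho ^+ k * ((\sum_(l < N) cmod (b l) * rho ^+ l) * (r / rho) ^+ N))); last first.
    by move=> k _; rewrite mulr_suml mulr_sumr; apply: eq_bigr => l _; ring.
  rewrite -mulr_suml mulrA ler_wpM2r ?exprn_ge0 //; apply: ler_pM; [| |exact: hSa|exact: hSb].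
  + by apply: sumr_ge0 => k _; rewrite mulr_ge0 ?cmod_ge0 ?exprn_ge0 // ltW.
  + by apply: sumr_ge0 => k _; rewrite mulr_ge0 ?cmod_ge0 ?exprn_ge0 // ltW.
- rewrite -[X in _ --> X](mulr0 (Sa * Sb)); apply: cvgM; first exact: cvg_cst.
  by apply: cvg_expr; rewrite ger0_norm.
Qed.

Definition riscC (g : R) (k : nat) : R[i] := (risc g k)%:C%C.

Lemma analytic_riscC g : 0 <= g <= 1 -> analytic_on_disk (riscC g).
Proof.
move=> g01; apply: (@analytic_of_bound _ _ 1) => k; have /andP[g0 g1] := g01.
by rewrite cmod_real ger0_norm ?risc_ge0 // risc_le1.
Qed.

Lemma conv_real (a b : nat -> R) n : conv (fun k => (a k)%:C%C) (fun k => (b k)%:C%C) n = ((conv a b n)%:C%C : R[i]).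
Proof. by rewrite rmorph_sum; apply: eq_bigr => k _; rewrite rmorphM. Qed.

Lemma pseries_risc_add g h z : 0 <= g -> 0 <= h -> g + h <= 1 -> cmod z < 1 ->
  pseries_fun (riscC (g + h)) z = pseries_fun (riscC g) z * pseries_fun (riscC h) z.
Proof.
move=> g0 h0 gh z1.
have ag : analytic_on_disk (riscC g) by apply: analytic_riscC; rewrite g0; lra.
have ah : analytic_on_disk (riscC h) by apply: analytic_riscC; rewrite h0; lra.
apply: cseries_eq; have := pseries_conv ag ah z1.
have -> : conv (riscC g) (riscC h) = riscC (g + h); last by [].
by apply/funext => n; rewrite conv_real conv_risc.
Qed.

Lemma pseries_risc0 z : pseries_fun (riscC 0) z = 1.
Proof.
apply: cseries_eq; apply: ccvg_of_cmod.
apply: (@cvg_trans _ ((fun=> 0 : R) @ \oo)); last exact: cvg_cst.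
apply: near_eq_cvg; near=> n.
have n0 : (0 < n)%N by near: n; exists 1%N.
have h M : \sum_(k < M.+1) riscC 0 k * z ^+ k = 1.
  rewrite big_ord_recl big1 => [|k _]; first by rewrite /riscC risc0 mul1r addr0.
  by rewrite /riscC risc0 /= mul0r.
by move: (h n.-1); rewrite (prednK n0) => ->; rewrite subrr cmod0.
Unshelve. all: by end_near.
Qed.

Lemma pseries_risc1 z : cmod z < 1 -> pseries_fun (riscC 1) z * (1 - z) = 1.
Proof.
move=> z1.
have a1 : analytic_on_disk (riscC 1) by apply: analytic_riscC; rewrite ler01 lexx.
have h := ccvg_cmod (ccvg_toB 1 (ccvg_toM (ccvg_pseries a1 z1)
  (v := fun=> 1 - z) (m := 1 - z) (conj (cvg_cst _) (cvg_cst _)))).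
have h2 : (fun n => cmod z ^+ n) @ \oo --> (0 : R).
  by apply: cvg_expr; rewrite ger0_norm ?cmod_ge0.
have e n : cmod (cpoly (riscC 1) n z * (1 - z) - 1) = cmod z ^+ n.
  have -> : cpoly (riscC 1) n z = bsum 0 n z.
    by apply: eq_bigr => k _; rewrite /riscC risc1 addn0 bin0.
  by rewrite mulrC bsum0 -cmodX -cmodN; congr cmod; ring.
rewrite (funext e) in h.
have e0 := cvg_lim (@Rhausdorff R) h2; rewrite (cvg_lim (@Rhausdorff R) (h _ _)) in e0.
by apply/eqP; rewrite -subr_eq0 -cmod_eq0 e0.
Qed.

(** The series [F] of exponent [1 / q] satisfies [F ^ q (1 - z) = 1] by additivity of exponents,
    which fixes its modulus; the series of exponent [m / q] is [F ^ m]. *)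
Lemma cmod_pseries_risc (m q : nat) z : (0 < q)%N -> (m <= q)%N -> cmod z < 1 ->
  cmod (pseries_fun (riscC (m%:R / q%:R)) z) = cmod (1 - z) `^ (- (m%:R / q%:R)).
Proof.
move=> q0 mq z1; have qR : 0 < q%:R :> R by rewrite ltr0n.
pose F := pseries_fun (riscC (q%:R^-1)) z.
have pw k : (k <= q)%N -> pseries_fun (riscC (k%:R / q%:R)) z = F ^+ k.
  elim: k => [|k IH] kq; first by rewrite mul0r pseries_risc0.
  have k1 : k%:R / q%:R + q%:R^-1 = k.+1%:R / q%:R :> R by rewrite -natr1 mulrDl mul1r.
  rewrite -k1 pseries_risc_add ?divr_ge0 ?invr_ge0 //; last by rewrite k1 ler_pdivrMr // mul1r ler_nat.
  by rewrite IH ?exprSr // ltnW.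
have z1n : 0 < cmod (1 - z) by apply: lt_le_trans (cmod_1B_ge (rho := cmod z) _); rewrite ?subr_gt0 // cmod_ge0.
have c0 := cmod_ge0 F.
have Fq : cmod F ^+ q = cmod (1 - z) `^ (- 1).
  have := pseries_risc1 z1; have := pw q (leqnn q); rewrite mulfV ?gt_eqF // => -> /(congr1 (@cmod R)).
  rewrite cmodM cmodX cmod1 => e.
  by rewrite powR_inv1 ?ltW // -[RHS]mul1r -e mulfK // gt_eqF.
rewrite pw // cmodX.
have -> : - (m%:R / q%:R) = (- 1) * (m%:R / q%:R) :> R by ring.
rewrite powRrM -Fq -(powR_mulrn q c0) -powRrM -(powR_mulrn m c0); congr (_ `^ _).
by rewrite mulrC divfK // gt_eqF.
Qed.

Lemma binom_cvg (m q : nat) (u : R) : (0 < q)%N -> (m <= q)%N -> 0 < u < 1 ->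
  (fun N => \sum_(k < N) risc (m%:R / q%:R) k * u ^+ k) @ \oo --> (1 - u) `^ (- (m%:R / q%:R)).
Proof.
move=> q0 mq /andP[u0 u1]; have qR : 0 < q%:R :> R by rewrite ltr0n.
have g01 : 0 <= (m%:R / q%:R : R) <= 1.
  by rewrite divr_ge0 //= ler_pdivrMr // mul1r ler_nat.
have /andP[g0 _] := g01.
have c1 : cmod (u%:C%C : R[i]) < 1 by rewrite cmod_real gtr0_norm.
have h := ccvg_cmod (ccvg_pseries (analytic_riscC g01) c1).
rewrite (cmod_pseries_risc q0 mq c1) in h.
have e : cmod (1 - u%:C%C : R[i]) = 1 - u.
  by rewrite -(rmorph1 (real_complex R)) -rmorphB cmod_real gtr0_norm // subr_gt0.
rewrite e in h.
have -> : (fun N => \sum_(k < N) risc (m%:R / q%:R) k * u ^+ k) = (fun N => cmod (cpoly (riscC (m%:R / q%:R)) N u%:C%C)); last exact: h.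
apply/funext => N; rewrite /cpoly.
have -> : \sum_(k < N) riscC (m%:R / q%:R) k * u%:C%C ^+ k = (\sum_(k < N) risc (m%:R / q%:R) k * u ^+ k)%:C%C.
  by rewrite rmorph_sum; apply: eq_bigr => k _; rewrite rmorphM rmorphXn.
rewrite cmod_real ger0_norm // sumr_ge0 // => k _.
by rewrite mulr_ge0 ?risc_ge0 // exprn_ge0 // ltW.
Qed.

Lemma binom_partial_le (m q : nat) (u : R) N : (0 < q)%N -> (m <= q)%N -> 0 < u < 1 ->
  \sum_(k < N) risc (m%:R / q%:R) k * u ^+ k <= (1 - u) `^ (- (m%:R / q%:R)).
Proof.
move=> q0 mq u01; have h := binom_cvg q0 mq u01; have /andP[u0 _] := u01.
apply: (ler_cvg_to (cvg_cst _) h); near=> M.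
have NM : (N <= M)%N by near: M; exists N.
have t0 k : 0 <= risc (m%:R / q%:R) k * u ^+ k by rewrite mulr_ge0 ?risc_ge0 ?divr_ge0 // exprn_ge0 // ltW.
rewrite -!(big_mkord xpredT (fun k => risc (m%:R / q%:R) k * u ^+ k)).
by rewrite [X in _ <= X](@big_cat_nat _ _ _ N) //= lerDl sumr_ge0.
Unshelve. all: by end_near.
Qed.

Lemma integral_powR_nat (a : R) k : 0 < a ->
  (\int[mu]_u (if (0 < u) && (u < 1) then u `^ (a - 1) * u ^+ k else 0)%:E = ((k%:R + a)^-1)%:E)%E.
Proof.
move=> a0; have ka : 0 < k%:R + a by rewrite ltr_wpDl.
have h := integral_powR_0 ka (@ltr01 R); rewrite powR1 in h.
rewrite -[RHS]mule1 -h -(integralTZl mu); last 3 first.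
- by meas.
- by move=> u; rewrite lee_fin; case: ifP => // _; rewrite mulr_ge0 ?powR_ge0 // ltW.
- by rewrite invr_ge0 ltW.
apply: eq_integral => u _; rewrite -EFinM; congr EFin; case: ifP => [/andP[u0 u1]|_]; last by rewrite mulr0.
rewrite mulKf ?gt_eqF // -addrA (powRDp k%:R (a - 1) u0) (powR_mulrn k (ltW u0)); exact: mulrC.
Qed.

(** The binomial series is integrated termwise against [u ^ (a - 1)]: its partial sums lie below the
    kernel, which bounds the limit above, and Fatou's lemma bounds it below. *)
Lemma beta_series (m q : nat) (a : R) : (0 < q)%N -> (m < q)%N -> 0 < a ->
  (fun N => \sum_(k < N) risc (m%:R / q%:R) k / (k%:R + a)) @ \oo --> rbeta a (1 - m%:R / q%:R).
Proof.
move=> q0 mq a0; have mq' := ltnW mq; have qR : 0 < q%:R :> R by rewrite ltr0n.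
set g : R := m%:R / q%:R.
have g0 : 0 <= g by rewrite divr_ge0.
have g1 : 0 < 1 - g by rewrite subr_gt0 ltr_pdivrMr // mul1r ltr_nat.
pose f N (u : R) : R := if (0 < u) && (u < 1) then u `^ (a - 1) * \sum_(k < N) risc g k * u ^+ k else 0.
have mf N : measurable_fun setT (f N).
  have ms : measurable_fun setT (fun u : R => \sum_(k < N) risc g k * u ^+ k).
    by apply: measurable_sum => k; meas.
  by rewrite /f; meas.
have f0 N u : 0 <= f N u.
  rewrite /f; case: ifP => // /andP[u0 u1]; rewrite mulr_ge0 ?powR_ge0 // sumr_ge0 // => k _.
  by rewrite mulr_ge0 ?risc_ge0 // exprn_ge0 // ltW.
have If N : (\int[mu]_u (f N u)%:E = (\sum_(k < N) risc g k / (k%:R + a))%:E)%E.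
  pose h (k : 'I_N) (u : R) : \bar R := ((risc g k)%:E * (if (0 < u) && (u < 1) then u `^ (a - 1) * u ^+ k else 0)%:E)%E.
  have mh k : measurable_fun setT (h k) by rewrite /h; meas.
  have i0 (k : 'I_N) (u : R) : 0 <= (if (0 < u) && (u < 1) then u `^ (a - 1) * u ^+ k else 0).
    by case: ifP => // /andP[u0 _]; rewrite mulr_ge0 ?powR_ge0 // exprn_ge0 // ltW.
  have h0 k u : (0 <= h k u)%E by rewrite /h -EFinM lee_fin mulr_ge0 ?risc_ge0.
  transitivity (\int[mu]_u (\sum_(k < N) h k u)%E)%E.
    apply: eq_integral => u _; rewrite /h; under eq_bigr do rewrite -EFinM.
    rewrite sumEFin; congr EFin; rewrite /f; case: ifP => _; last by rewrite big1 // => k _; rewrite mulr0.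
    by rewrite mulr_sumr; apply: eq_bigr => k _; rewrite mulrCA.
  rewrite (integralTsum mu (index_enum _) mh h0) -sumEFin; apply: eq_bigr => k _.
  rewrite (integralTZl mu); last 3 first.
  - by meas.
  - by move=> u; rewrite lee_fin.
  - exact: risc_ge0.
  by rewrite (integral_powR_nat k a0) -EFinM.
have bE := rbetaE a0 g1.
have le N : \sum_(k < N) risc g k / (k%:R + a) <= rbeta a (1 - g).
  rewrite -lee_fin -If -bE; apply: le_integralT.
  - by have mfN := mf N; meas.
  - by move=> u; rewrite lee_fin.
  - by have mb := measurable_bker a (1 - g); meas.
  move=> u; rewrite lee_fin /f /bker; case: ifP => // u01.
  rewrite ler_wpM2l ?powR_ge0 // (_ : 1 - g - 1 = - g); last by ring.
  exact: binom_partial_le.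
have nd : {homo (fun N => \sum_(k < N) risc g k / (k%:R + a)) : n m / (n <= m)%N >-> n <= m}.
  apply/nondecreasing_seqP => n; rewrite big_ord_recr /= lerDl.
  by rewrite divr_ge0 ?risc_ge0 // addr_ge0 // ltW.
have cv : cvgn (fun N => \sum_(k < N) risc g k / (k%:R + a)).
  by apply: nondecreasing_is_cvgn => //; exists (rbeta a (1 - g)) => _ [N _ <-].
have up : limn (fun N => \sum_(k < N) risc g k / (k%:R + a)) <= rbeta a (1 - g).
  by apply: limr_le => //; exact: nearW.
have lo : rbeta a (1 - g) <= limn (fun N => \sum_(k < N) risc g k / (k%:R + a)).
  rewrite -lee_fin -bE; apply: (@fatou_le _ _ _ mu (fun N u => (f N u)%:E)).
  - by move=> N; have mfN := mf N; meas.
  - by move=> N u; rewrite lee_fin.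
  - move=> u; apply: cvg_EFin; first exact: nearW.
    rewrite /f /bker; case: ifP => u01; last exact: cvg_cst.
    apply: cvgM; first exact: cvg_cst.
    by rewrite (_ : 1 - g - 1 = - g); [exact: binom_cvg|ring].
  - by move=> N; rewrite If lee_fin; exact: nondecreasing_cvgn_le.
have -> : rbeta a (1 - g) = limn (fun N => \sum_(k < N) risc g k / (k%:R + a)).
  by apply/le_anti; rewrite lo up.
exact: cv.
Qed.

End BinomialSeries.

(** * The multiplier near 1 and the norms of the test functions *)

Section LowerBound.
Variable R : realType.
Local Notation mu := (@lebesgue_measure R).
Local Notation nu := (@leb2 R).

Lemma rat_between (a b : R) : 0 <= a -> a < b -> b <= 1 ->
  exists m q : nat, [/\ (0 < m)%N, (m < q)%N & a < m%:R / q%:R < b].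
Proof.
move=> a0 ab b1; pose q := (Num.truncn (b - a)^-1).+1.
have ba0 : 0 < b - a by rewrite subr_gt0.
have i0 : 0 <= (b - a)^-1 by rewrite invr_ge0 ltW.
have q0 : 0 < q%:R :> R by rewrite ltr0n.
have hq : 1 < q%:R * (b - a).
  have /andP[_ h] := truncn_itv i0.
  by rewrite -ltr_pdivrMr // div1r.
have aq0 : 0 <= a * q%:R by rewrite mulr_ge0 // ltW.
have /andP[h1 h2] := truncn_itv aq0.
pose m := (Num.truncn (a * q%:R)).+1.
have amq : a < m%:R / q%:R by rewrite ltr_pdivlMr.
have mbq : m%:R / q%:R < b.
  rewrite ltr_pdivrMr // /m -natr1.
  by move: h1 hq; rewrite mulrBr [q%:R * b]mulrC [q%:R * a]mulrC; lra.
exists m, q; split => //; last by rewrite amq.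
by have := lt_le_trans mbq b1; rewrite ltr_pdivrMr // mul1r ltr_nat.
Qed.

Lemma ccvg_real (u : nat -> R) (l : R) : u @ \oo --> l -> ccvg_to (fun n => (u n)%:C%C) (l%:C%C : R[i]).
Proof. by move=> h; split => //=; exact: cvg_cst. Qed.

Section Exponent.
Variables m q : nat.
Hypotheses (m0 : (0 < m)%N) (mq : (m < q)%N).
Let g : R := m%:R / q%:R.
Let q0 : (0 < q)%N. Proof. exact: leq_ltn_trans (leq0n m) mq. Qed.

Lemma ratio01 : 0 < g < 1.
Proof.
have qR : 0 < q%:R :> R by rewrite ltr0n.
by rewrite /g divr_gt0 ?ltr0n //= ltr_pdivrMr // mul1r ltr_nat.
Qed.

Lemma analytic_ratio : analytic_on_disk (riscC g).
Proof. by have /andP[g0 g1] := ratio01; apply: analytic_riscC; rewrite !ltW. Qed.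

Lemma hilbert_riscC n : hilbert (riscC g) n = (rbeta n.+1%:R (1 - g))%:C%C.
Proof.
apply: cseries_eq.
have h := ccvg_real (beta_series q0 mq (ltr0n R n.+1)).
have -> : (fun N => \sum_(k < N) hilbert_term (riscC g) n k) =
  (fun N => (\sum_(k < N) risc g k / (k%:R + n.+1%:R))%:C%C); last exact: h.
apply/funext => N; rewrite rmorph_sum; apply: eq_bigr => k _.
rewrite /hilbert_term /riscC rmorphM fmorphV -natrD rmorph_nat.
by congr (_ / _%:R); lia.
Qed.

Definition dcoefC (h : R) (n : nat) : R[i] := (dcoef h n)%:C%C.

Lemma dcoef_ge0 (h : R) n : h < 1 -> 0 <= dcoef h n.
Proof.
move=> h1; have h1' : 0 <= 1 - h by rewrite subr_ge0 ltW.
exact: divr_ge0 (risc_ge0 n h1') (addr_ge0 (ler0n R n) h1').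
Qed.

Lemma analytic_dcoefC (h : R) : 0 <= h < 1 -> analytic_on_disk (dcoefC h).
Proof.
move=> /andP[h0 h1]; have h1' : 0 < 1 - h by rewrite subr_gt0.
apply: (@analytic_of_bound _ _ (1 - h)^-1) => n; rewrite cmod_real ger0_norm ?dcoef_ge0 //.
rewrite /dcoef -[X in _ <= X]mul1r; apply: ler_pM.
- by rewrite risc_ge0 // ltW.
- by rewrite invr_ge0 addr_ge0 // ltW.
- by rewrite risc_le1 // (ltW h1') gerBl.
- have n1 : 0 < n%:R + (1 - h) by rewrite ltr_wpDl.
  by rewrite lef_pV2 ?posrE // lerDr.
Qed.

Lemma pseries_hilbert_riscC (z : R[i]) : cmod z < 1 ->
  pseries_fun (hilbert (riscC g)) z = pseries_fun (riscC g) z * pseries_fun (dcoefC g) z.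
Proof.
move=> z1; have /andP[g0 g1] := ratio01.
have ad : analytic_on_disk (dcoefC g) by apply: analytic_dcoefC; rewrite (ltW g0).
apply: cseries_eq; have := pseries_conv analytic_ratio ad z1.
have -> : conv (riscC g) (dcoefC g) = hilbert (riscC g); last by [].
by apply/funext => n; rewrite conv_real conv_dcoef_rbeta // hilbert_riscC.
Qed.

(** The Beta series for the exponent [1 - g = (q - m) / q], which is rational again. *)
Lemma dcoef_cvg : (fun N => \sum_(n < N) dcoef g n) @ \oo --> rbeta g (1 - g).
Proof.
have /andP[g0 g1] := ratio01; have g1' : 0 < 1 - g by rewrite subr_gt0.
have mq' : (q - m < q)%N by lia.
have e : (q - m)%:R / q%:R = 1 - g :> R.
  by rewrite natrB ?(ltnW mq) // mulrBl mulfV // pnatr_eq0 -lt0n.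
have e2 : 1 - (1 - g) = g by ring.
by have := beta_series q0 mq' g1'; rewrite e e2 (rbeta_sym (1 - g) g); exact.
Qed.

Lemma dcoef_sum_le N : \sum_(n < N) dcoef g n <= rbeta g (1 - g).
Proof.
have /andP[g0 g1] := ratio01.
apply: (ler_cvg_to (cvg_cst _) dcoef_cvg); near=> M.
have NM : (N <= M)%N by near: M; exists N.
rewrite -!(big_mkord xpredT (dcoef g)) [X in _ <= X](@big_cat_nat _ _ _ N) //= lerDl.
by apply: sumr_ge0 => k _; exact: dcoef_ge0.
Unshelve. all: by end_near.
Qed.

(** The sum bounded by [eps] majorises [|D 1 - D z|]. *)
Lemma cmod_dseries_ge (z : R[i]) (eps : R) : cmod z < 1 ->
  (forall N, \sum_(n < N) dcoef g n * cmod (1 - z ^+ n) <= eps) ->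
  rbeta g (1 - g) - eps <= cmod (pseries_fun (dcoefC g) z).
Proof.
move=> z1 h; have /andP[g0 g1] := ratio01.
have ad : analytic_on_disk (dcoefC g) by apply: analytic_dcoefC; rewrite (ltW g0).
have c1 : (fun N => \sum_(n < N) dcoef g n - eps) @ \oo --> rbeta g (1 - g) - eps.
  by apply: cvgB; [exact: dcoef_cvg|exact: cvg_cst].
apply: (ler_cvg_to c1 (ccvg_cmod (ccvg_pseries ad z1))); near=> N.
rewrite lerBlDr; apply: le_trans (lerD (lexx _) (h N)).
have s0 : 0 <= \sum_(n < N) dcoef g n by apply: sumr_ge0 => n _; exact: dcoef_ge0.
rewrite -(ger0_norm s0) -cmod_real rmorph_sum.
have -> : \sum_(n < N) (dcoef g n)%:C%C = cpoly (dcoefC g) N z + \sum_(n < N) (dcoef g n)%:C%C * (1 - z ^+ n).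
  by rewrite /cpoly -big_split; apply: eq_bigr => n _ /=; rewrite /dcoefC; ring.
apply: (le_trans (cmodD _ _)); rewrite lerD2l.
apply: (le_trans (cmod_sum _ _ _)); apply: ler_sum => n _.
by rewrite cmodM cmod_real ger0_norm // dcoef_ge0.
Unshelve. all: by end_near.
Qed.

Lemma diskmod_ratio (z : R * R) : sqn z < 1 -> diskmod (riscC g) z = cmod (1 - cpt z) `^ (- g).
Proof. by move=> z1; rewrite /diskmod z1; apply: cmod_pseries_risc (cmod_cpt_lt1 z1); [exact: q0|exact: ltnW]. Qed.

End Exponent.

Lemma cmod_1BX_le (z : R[i]) n : cmod z <= 1 -> cmod (1 - z ^+ n) <= n%:R * cmod (1 - z).
Proof.
move=> z1; rewrite -(bsum0 n z) cmodM mulrC ler_wpM2r ?cmod_ge0 //.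
apply: (le_trans (cmod_sum _ _ _)); apply: (@le_trans _ _ (\sum_(k < n) 1)); last by rewrite sumr_const card_ord.
by apply: ler_sum => k _; rewrite addn0 bin0 mul1r cmodX exprn_ile1 ?cmod_ge0.
Qed.

(** A domination uniform for [g] in [[g0, x)]: the numerators decrease in [g], and the denominators
    differ by at most the constant factor. It lets one tail estimate, for [g0], serve all [g]. *)
Lemma dcoef_le (g0 g x : R) n : 0 <= g0 -> g0 <= g -> g < x -> x < 1 ->
  dcoef g n <= (1 - g0) / (1 - x) * dcoef g0 n.
Proof.
move=> h0 h1 h2 h3.
have x1 : 0 < 1 - x by rewrite subr_gt0.
have n0 : 0 <= n%:R :> R by exact: ler0n.
have d1 : 0 < n%:R + (1 - g) by lra.
have d0 : 0 < n%:R + (1 - g0) by lra.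
have r1 : risc (1 - g) n <= risc (1 - g0) n by apply: risc_le; lra.
have r0 : 0 <= risc (1 - g) n by apply: risc_ge0; lra.
rewrite /dcoef mulrCA; apply: ler_pM => //; first by rewrite invr_ge0 ltW.
rewrite -[X in X <= _]mul1r ler_pdivrMr // mulrAC ler_pdivlMr // mul1r.
rewrite mulrAC ler_pdivlMr //.
by nra.
Qed.

(* The multiplier [D = Hf / f] stays close to [D 1 = pi / sin (pi g)] near [1], uniformly in the exponent. *)
Lemma dseries_near1 (m0 q0 : nat) (x eps : R) : (0 < m0)%N -> (m0 < q0)%N -> x < 1 -> 0 < eps ->
  exists2 del : R, 0 < del <= 1 & forall m q : nat, (0 < m)%N -> (m < q)%N ->
    m0%:R / q0%:R <= m%:R / q%:R :> R -> m%:R / q%:R < x ->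
    forall z : R[i], cmod z < 1 -> cmod (1 - z) < del ->
    rbeta (m%:R / q%:R) (1 - m%:R / q%:R) - eps <= cmod (pseries_fun (dcoefC (m%:R / q%:R)) z).
Proof.
move=> m00 mq0 x1 eps0; have /andP[h0 h1] := ratio01 m00 mq0.
set g0 := m0%:R / q0%:R in h0 h1 *.
pose K := (1 - g0) / (1 - x).
have x1' : 0 < 1 - x by rewrite subr_gt0.
have K0 : 0 < K by rewrite divr_gt0 // subr_gt0.
pose S0 := rbeta g0 (1 - g0).
have hS N : \sum_(n < N) dcoef g0 n <= S0 by exact: dcoef_sum_le.
have S00 : 0 <= S0 by have := hS 0%N; rewrite big_ord0.
have d0 n : 0 <= dcoef g0 n by exact: dcoef_ge0.
pose e1 := eps / (4 * K).
have e10 : 0 < e1 by rewrite divr_gt0 // mulr_gt0.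
have [N0 hN0] := tail_small d0 hS e10.
(* With [|1 - z| <= eps / (2 L)] the first [N0] terms cost at most [eps / 2], by
   [|1 - z ^ n| <= n |1 - z|]; [e1] leaves [eps / 2] for the tail, where [|1 - z ^ n| <= 2]. *)
pose L := K * S0 * N0%:R + 1.
have L1 : 0 < L by rewrite /L ltr_wpDl // mulr_ge0 // mulr_ge0 // ltW.
exists (Num.min 1 (eps / (2 * L))).
  by rewrite lt_min ltr01 /= divr_gt0 ?mulr_gt0 //= ge_min lexx.
move=> m q mp mq g0g gx z z1 zd.
set g := m%:R / q%:R in g0g gx *.
have zd' : cmod (1 - z) * (2 * L) <= eps.
  by rewrite -ler_pdivlMr ?mulr_gt0 // (le_trans (ltW zd)) // ge_min lexx orbT.
apply: cmod_dseries_ge => // N.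
have c0 := cmod_ge0 (1 - z).
have z1' := ltW z1.
have t0 n : 0 <= dcoef g0 n * cmod (1 - z ^+ n) by rewrite mulr_ge0 // cmod_ge0.
have head : \sum_(n < N0) dcoef g0 n * cmod (1 - z ^+ n) <= S0 * (N0%:R * cmod (1 - z)).
  apply: le_trans (ler_wpM2r _ (hS N0)); last by rewrite mulr_ge0.
  rewrite mulr_suml; apply: ler_sum => n _; rewrite ler_wpM2l //.
  apply: (le_trans (cmod_1BX_le n z1')); rewrite ler_wpM2r // ler_nat ltnW //.
have tail M : \sum_(N0 <= n < M) dcoef g0 n * cmod (1 - z ^+ n) <= e1 * 2.
  apply: (@le_trans _ _ ((\sum_(N0 <= n < M) dcoef g0 n) * 2)); last by rewrite ler_wpM2r // hN0.
  rewrite mulr_suml; apply: ler_sum => n _; rewrite ler_wpM2l //.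
  apply: (le_trans (cmodD _ _)); rewrite cmodN cmod1 cmodX.
  have : cmod z ^+ n <= 1 by rewrite exprn_ile1 ?cmod_ge0.
  by lra.
have tot : \sum_(n < N) dcoef g0 n * cmod (1 - z ^+ n) <= S0 * (N0%:R * cmod (1 - z)) + e1 * 2.
  apply: (@le_trans _ _ (\sum_(n < maxn N N0) dcoef g0 n * cmod (1 - z ^+ n))).
    rewrite -!(big_mkord xpredT (fun n => dcoef g0 n * cmod (1 - z ^+ n))).
    rewrite [X in _ <= X](@big_cat_nat _ _ _ N) ?leq_maxl //= lerDl; exact: sumr_ge0.
  rewrite -(big_mkord xpredT (fun n => dcoef g0 n * cmod (1 - z ^+ n))).
  rewrite (@big_cat_nat _ _ _ N0) ?leq_maxr //= big_mkord; apply: lerD; first exact: head.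
  exact: tail.
apply: (@le_trans _ _ (K * \sum_(n < N) dcoef g0 n * cmod (1 - z ^+ n))).
  rewrite mulr_sumr; apply: ler_sum => n _; rewrite mulrA ler_wpM2r ?cmod_ge0 //.
  by apply: dcoef_le => //; exact: ltW.
apply: (le_trans (ler_wpM2l (ltW K0) tot)).
have e1K : K * (e1 * 2) = eps / 2 by rewrite /e1; field; rewrite gt_eqF.
have : K * (S0 * (N0%:R * cmod (1 - z))) <= cmod (1 - z) * L by rewrite /L; nra.
by rewrite [K * (_ + _)]mulrDr e1K; move: zd'; lra.
Qed.

Section TestNorms.
Variable alpha : R.
Hypothesis alpha0 : 0 <= alpha.

(** For [e = g p] this is the integrand of the norm of the test function [(1 - z) ^ (- g)]. *)
Definition pole (e : R) (z : R * R) : R := dweight alpha z * cmod (1 - cpt z) `^ (- e).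

Lemma pole_ge0 e z : 0 <= pole e z.
Proof. by rewrite mulr_ge0 ?dweight_ge0 ?powR_ge0. Qed.

Lemma measurable_pole e : measurable_fun setT (pole e).
Proof.
have md := @measurable_dweight R alpha.
have mc : measurable_fun setT (fun z : R * R => cmod (1 - cpt z)).
  apply: measurable_cmod; split => /=; meas.
by rewrite /pole; meas.
Qed.

Definition flip (w : R * R) : R * R := (-1 * w.1 + 1, -1 * w.2 + 0).

Lemma integral_flip (F : R * R -> R) : measurable_fun setT F -> (forall z, 0 <= F z) ->
  (\int[nu]_z (F z)%:E = \int[nu]_w (F (flip w))%:E)%E.
Proof.
move=> mF F0; have n1 : (-1 : R) != 0 by rewrite oppr_eq0 oner_eq0.
have mFE : measurable_fun setT (fun z => (F z)%:E) by exact/measurable_EFinP.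
have FE0 z : (0 <= (F z)%:E)%E by rewrite lee_fin.
rewrite (ge0_leb2_affine 1 0 n1 mFE FE0) sqrrN expr1n mul1e.
by [].
Qed.

Lemma cmod_flip w : cmod (1 - cpt (flip w)) = Num.sqrt (sqn w).
Proof.
rewrite /cmod /flip /cpt /sqn /=; congr Num.sqrt; ring.
Qed.

Lemma sqn_flip w : sqn (flip w) = 1 - 2 * w.1 + sqn w.
Proof. by rewrite /sqn /flip /=; ring. Qed.

Lemma integral_sqn_powR_fin (b : R) : - 1 < b ->
  (\int[nu]_w (if (0 < sqn w) && (sqn w < 4) then sqn w `^ b else 0)%:E < +oo)%E.
Proof.
move=> b1; pose phi (y : R) := if (0 < y) && (y < 4) then y `^ b else 0.
have phi0 y : 0 <= phi y by rewrite /phi; case: ifP => // _; exact: powR_ge0.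
have mphi : measurable_fun setT phi by rewrite /phi; meas.
rewrite -/(phi _) (integral_radial mphi phi0).
pose A := fine (@diskarea R).
have AE : @diskarea R = A%:E by rewrite fineK // ge0_fin_numE ?diskarea_ge0 // diskarea_fin.
have A0 : 0 <= A by apply: fine_ge0; exact: diskarea_ge0.
have a0 : 0 < 4 + 4 * b by move: b1; lra.
have I2 := integral_powR_0 a0 (ltr0n R 2).
rewrite AE; apply: (@le_lt_trans _ _ ((4 * A / (4 + 4 * b))%:E *
   \int[mu]_s (if (0 < s) && (s < 2) then (4 + 4 * b) * s `^ (4 + 4 * b - 1) else 0)%:E)%E); last first.
  by rewrite I2 -EFinM ltry.
have g0 (s : R) : 0 <= (if (0 < s) && (s < 2) then (4 + 4 * b) * s `^ (4 + 4 * b - 1) else 0).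
  by case: ifP => // _; rewrite mulr_ge0 ?powR_ge0 // ltW.
have mphi4 : measurable_fun setT (fun s : R => phi (s ^+ 4)) by apply: (measurableT_comp mphi); meas.
rewrite -(integralTZl mu); last 3 first.
- by meas.
- by move=> s; rewrite lee_fin.
- by rewrite divr_ge0 ?mulr_ge0 // ltW.
apply: le_integralT.
- by meas.
- move=> s; rewrite -EFinM lee_fin mulr_ge0 //; case: ifP => // s0.
  exact: mulr_ge0 (mulr_ge0 (ler0n R 4) (exprn_ge0 3 (ltW s0))) (phi0 _).
- by meas.
move=> s; rewrite -!EFinM lee_fin /phi.
case: (ltP 0 s) => s0 /=; last by rewrite mul0r mulr0.
rewrite exprn_gt0 //=; case: ifP => s4; last first.
  by rewrite mulr0 mul0r mulr_ge0 ?divr_ge0 ?mulr_ge0 // ?(ltW a0) //; case: ifP => // _; rewrite mulr_ge0 ?powR_ge0 // ltW.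
have -> : s < 2.
  rewrite ltNge; apply/negP => s2; move: s4; rewrite ltNge; case/negP.
  by apply: (@le_trans _ _ ((2 : R) ^+ 4)); [rewrite -natrX ler_nat|rewrite lerXn2r ?nnegrE // ltW].
rewrite le_eqVlt; apply/orP; left; apply/eqP.
have -> : (s ^+ 4) `^ b = s `^ (4 * b) by rewrite -(powR_mulrn 4 (ltW s0)) -powRrM.
have -> : s `^ (4 + 4 * b - 1) = s ^+ 3 * s `^ (4 * b).
  rewrite (_ : 4 + 4 * b - 1 = 3%:R + 4 * b); last by ring.
  by rewrite (powRDp _ _ s0) (powR_mulrn 3 (ltW s0)).
by field; rewrite gt_eqF.
Qed.

(** In [w = 1 - z] one has [1 - |z| ^ 2 <= 2 |w|] on the disk, so the integrand is at most
    [2 ^ alpha |w| ^ (alpha - e)], integrable in the plane near 0 as [alpha - e > -2]. *)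
Lemma pole_fin (e : R) : e < 2 + alpha -> (\int[nu]_z (pole e z)%:E < +oo)%E.
Proof.
move=> he; have b1 : - 1 < (alpha - e) / 2 by move: he; lra.
have F := integral_sqn_powR_fin b1.
have ms := @measurable_sqn R; have mp := measurable_pole e.
rewrite (integral_flip mp (pole_ge0 e)).
set G := (\int[nu]_w _)%E in F.
have G0 : (0 <= G)%E by apply: integral_ge0 => w _; rewrite lee_fin; case: ifP => // _; exact: powR_ge0.
apply: (@le_lt_trans _ _ ((2 `^ alpha)%:E * G)%E); last first.
  have -> : G = (fine G)%:E by rewrite fineK // ge0_fin_numE.
  by rewrite -EFinM ltry.
rewrite -(integralTZl nu); last 3 first.
- by meas.
- by move=> w; rewrite lee_fin; case: ifP => // _; exact: powR_ge0.
- exact: powR_ge0.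
have mpf : measurable_fun setT (fun w => pole e (flip w)).
  by apply: (measurableT_comp mp); rewrite /flip; meas.
apply: le_integralT.
- by meas.
- by move=> w; rewrite lee_fin pole_ge0.
- by meas.
move=> w; rewrite -EFinM lee_fin /pole cmod_flip /dweight sqn_flip.
case: ifPn => w1; last first.
  by rewrite mul0r mulr_ge0 ?powR_ge0 //; case: ifP => // _; exact: powR_ge0.
set r := Num.sqrt (sqn w).
have r2 : r ^+ 2 = sqn w by rewrite sqr_sqrtr // sqn_ge0.
have r0 : 0 <= r by exact: sqrtr_ge0.
have w1r : w.1 <= r.
  by apply: (le_trans (ler_norm _)); rewrite -sqrtr_sqr ler_wsqrtr // lerDl sqr_ge0.
have rpos : 0 < r.
  rewrite lt_neqAle r0 andbT; apply/negP => /eqP e0.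
  by move: w1 w1r; rewrite -r2 -e0; lra.
have rlt : r < 2 by move: w1; rewrite -r2; nra.
have -> : (0 < sqn w) && (sqn w < 4).
  by rewrite -r2 exprn_gt0 //=; nra.
have d1 : 0 <= 1 - (1 - 2 * w.1 + sqn w) by rewrite subr_ge0 ltW.
have d2 : 1 - (1 - 2 * w.1 + sqn w) <= 2 * r by rewrite -r2; nra.
have -> : sqn w `^ ((alpha - e) / 2) = r `^ alpha * r `^ (- e).
  by rewrite -r2 -(powR_mulrn 2 r0) -powRrM -(powRDp _ _ rpos); congr (_ `^ _); field.
rewrite mulrA ler_wpM2r ?powR_ge0 // -powRM //.
by apply: ge0_ler_powR; rewrite ?nnegrE // mulr_ge0.
Qed.

(** Gives divergence as [e] tends to [2 + alpha]. On the triangle [0 < w.2 < w.1 < 1 / 4], with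
    [w = 1 - z], one has [1 - |z| ^ 2 >= w.1] and [|w| <= 2 w.1]; integrating [w.1 ^ (alpha - e)]
    there gives the denominator, and the remaining constants are made independent of [e]. *)
Lemma pole_ge (e : R) : 0 <= e -> e < 2 + alpha ->
  ((2 `^ (- (2 + alpha)) * 4^-1 `^ (2 + alpha) / (2 + alpha - e))%:E <= \int[nu]_z (pole e z)%:E)%E.
Proof.
move=> e0 he; have mp := measurable_pole e.
have d0 : 0 < 2 + alpha - e by rewrite subr_gt0.
rewrite (integral_flip mp (pole_ge0 e)).
have mpf : measurable_fun setT (fun w => pole e (flip w)).
  by apply: (measurableT_comp mp); rewrite /flip; meas.
pose c := 2 `^ (- (2 + alpha)) : R.
have c0 : 0 <= c by exact: powR_ge0.
pose J (w : R * R) : R := if (0 < w.1) && (w.1 < 4^-1) then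
  (if (0 < w.2) && (w.2 < w.1) then c * w.1 `^ (alpha - e) else 0) else 0.
have J0 w : 0 <= J w by rewrite /J; case: ifP => // _; case: ifP => // _; rewrite mulr_ge0 ?powR_ge0.
have mJ : measurable_fun setT (fun w => (J w)%:E) by rewrite /J; meas.
have q40 : 0 < 4^-1 :> R by rewrite invr_gt0.
apply: (@le_trans _ _ (\int[nu]_w (J w)%:E)%E).
  rewrite (leb2E mJ); last by move=> w; rewrite lee_fin.
  have I1 := integral_powR_0 d0 q40.
  have i1 (x1 : R) : 0 < x1 -> (\int[mu]_y (if (0 < y) && (y < x1) then 1 else 0)%:E = x1%:E)%E.
    move=> x10; have := integral_powR_0 (@ltr01 R) x10; rewrite powRr1 ?(ltW x10) // => <-.
    by apply: eq_integral => y _; case: ifP => // _; rewrite subrr powRr0 mulr1.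
  have -> : (\int[mu]_x1 \int[mu]_y (J (x1, y))%:E = \int[mu]_x1 ((c / (2 + alpha - e))%:E *
      (if (0 < x1) && (x1 < 4^-1) then (2 + alpha - e) * x1 `^ (2 + alpha - e - 1) else 0)%:E))%E.
    apply: eq_integral => x1 _; rewrite /J /=; case: ifP => [/andP[x10 x14]|_]; last first.
      by rewrite mule0; apply: integral0_eq.
    transitivity (\int[mu]_y ((c * x1 `^ (alpha - e))%:E * (if (0 < y) && (y < x1) then 1 else 0)%:E))%E.
      by apply: eq_integral => y _; rewrite -EFinM; congr EFin; case: ifP; rewrite ?mulr1 ?mulr0.
    rewrite (integralTZl mu); last 3 first.
    - by meas.
    - by move=> y; rewrite lee_fin; case: ifP.
    - by rewrite mulr_ge0 ?powR_ge0.
    rewrite (i1 _ x10) -!EFinM; congr EFin.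
    have -> : x1 `^ (2 + alpha - e - 1) = x1 `^ (alpha - e) * x1.
      by rewrite -(powRDn _ x10); congr (_ `^ _); ring.
    by field; rewrite gt_eqF.
  rewrite (integralTZl mu); last 3 first.
  - by meas.
  - by move=> x1; rewrite lee_fin; case: ifP => // _; rewrite mulr_ge0 ?powR_ge0 // ltW.
  - by rewrite divr_ge0 // ltW.
  rewrite I1 -EFinM lee_fin -/c mulrAC ler_wpM2l ?divr_ge0 ?(ltW d0) //.
  have h : (0 < 4^-1 :> R) && (4^-1 <= 1 :> R) by rewrite q40 invf_le1 // ler1n.
  by apply: (ger_powR h); rewrite gerBl.
apply: le_integralT.
- exact: mJ.
- by move=> w; rewrite lee_fin.
- by meas.
move=> [x1 y]; rewrite lee_fin /J /=; case: ifP => [/andP[x10 x14]|_]; last exact: pole_ge0.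
case: ifP => [/andP[y0 yx]|_]; last exact: pole_ge0.
rewrite /pole cmod_flip /dweight sqn_flip.
have x4 : x1 * 4 < 1 by move: x14; rewrite -[4^-1]mul1r ltr_pdivlMr.
have sq : sqn (x1, y) = x1 ^+ 2 + y ^+ 2 by [].
have lt1 : 1 - 2 * (x1, y).1 + sqn (x1, y) < 1 by rewrite sq /=; nra.
rewrite lt1; set r := Num.sqrt (sqn (x1, y)).
have r0 : 0 <= r by exact: sqrtr_ge0.
have r2 : r ^+ 2 = x1 ^+ 2 + y ^+ 2 by rewrite sqr_sqrtr // sqn_ge0.
have rpos : 0 < r by rewrite sqrtr_gt0 sq; nra.
have rx : r <= 2 * x1 by nra.
have h1 : x1 `^ alpha <= (1 - (1 - 2 * (x1, y).1 + sqn (x1, y))) `^ alpha.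
  by apply: ge0_ler_powR; rewrite ?nnegrE ?subr_ge0 ?(ltW lt1) ?(ltW x10) // sq /=; nra.
have h2 : c * x1 `^ (- e) <= r `^ (- e).
  apply: (@le_trans _ _ ((2 * x1) `^ (- e))).
    rewrite powRM ?(ltW x10) // ler_wpM2r ?powR_ge0 // /c; apply: ler_powR; first by rewrite ler1n.
    by rewrite lerN2 ltW.
  rewrite !powRN lef_pV2 ?posrE ?powR_gt0 ?mulr_gt0 //.
  by apply: ge0_ler_powR; rewrite ?nnegrE ?mulr_ge0 ?(ltW x10).
rewrite (powRDp _ _ x10) mulrCA; apply: ler_pM; rewrite ?powR_ge0 ?mulr_ge0 ?powR_ge0 //.
Qed.

Lemma pole_far (e del : R) z : 0 <= e -> e <= 2 + alpha -> 0 < del <= 1 -> del <= cmod (1 - cpt z) ->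
  pole e z <= del `^ (- (2 + alpha)) * dweight alpha z.
Proof.
move=> e0 he /andP[d0 d1] hd; rewrite /pole mulrC ler_wpM2r ?dweight_ge0 //.
apply: (@le_trans _ _ (del `^ (- e))).
  rewrite !powRN lef_pV2 ?posrE ?powR_gt0 ?(lt_le_trans d0 hd) //.
  by apply: ge0_ler_powR; rewrite ?nnegrE ?cmod_ge0 // ltW.
rewrite !powRN lef_pV2 ?posrE ?powR_gt0 //.
by apply: ger_powR; rewrite ?d0.
Qed.

End TestNorms.

End LowerBound.

(** * Sharpness of the constant *)

Section Sharpness.
Variable R : realType.
Local Notation mu := (@lebesgue_measure R).
Local Notation nu := (@leb2 R).
Variables alpha p : R.
Hypotheses (alpha0 : 0 <= alpha) (p_gt : 2 + 2 * alpha < p).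

Lemma ge0_lt_oo_real (x : \bar R) : (0 <= x)%E -> (x < +oo)%E -> exists2 r : R, x = r%:E & 0 <= r.
Proof. by case: x => [r||] //; rewrite lee_fin => r0 _; exists r. Qed.

Lemma in_bergman_dint (a : nat -> R[i]) : in_bergman p alpha a <-> analytic_on_disk a /\ (dint p alpha a < +oo)%E.
Proof.
have k0 : 0 < (alpha + 1) / pi by rewrite divr_gt0 ?pi_gt0 // ltr_wpDl.
split=> -[ha hfin]; split => //.
- move: hfin; rewrite (bergman_int_dint p alpha0 ha); have := dint_ge0 p alpha a.
  by case: (dint p alpha a) => [r||] //; rewrite ?ltry // gt0_muley ?lte_fin.
- rewrite (bergman_int_dint p alpha0 ha); have := dint_ge0 p alpha a.
  by move: hfin; case: (dint p alpha a) => [r||] // _ _; rewrite -EFinM ltry.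
Qed.

Lemma dint_ratio (m q : nat) : (0 < m)%N -> (m < q)%N ->
  dint p alpha (riscC (m%:R / q%:R)) = (\int[nu]_z (pole alpha (m%:R / q%:R * p) z)%:E)%E.
Proof.
move=> m0 mq; apply: eq_integral => z _; congr EFin; rewrite /pole.
case: (ltP (sqn z) 1) => z1; last by rewrite /dweight ltNge z1 /= !mul0r.
by rewrite (diskmod_ratio mq z1) -powRrM mulNr.
Qed.

(** Continuity is read off the reflection formula. *)
Lemma rbeta_near (x eps : R) : 0 < x < 1 -> 0 < eps -> exists2 eta : R, 0 < eta &
  forall g, 0 < g < 1 -> `|x - g| < eta -> rbeta x (1 - x) - eps <= rbeta g (1 - g).
Proof.
move=> x01 eps0.
have s0 : sin (pi * x) != 0 by rewrite gt_eqF // sin_gt0_01.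
have c : (fun g : R => pi / sin (pi * g)) y @[y --> x] --> pi / sin (pi * x).
  apply: cvgM; first exact: cvg_cst.
  apply: cvgV => //.
  apply: (@continuous_comp _ _ _ (fun g : R => pi * g) sin); last exact: continuous_sin.
  by apply: cvgM; [exact: cvg_cst|exact: cvg_id].
move/cvgrPdist_le : c => /(_ eps eps0) [eta /= eta0 h].
exists eta => // g g01 xg; rewrite (rbeta_reflection x01) (rbeta_reflection g01).
have := h g xg; rewrite ler_norml => /andP[_]; lra.
Qed.

(** Within [del] of 1 the factorisation [H f = f D] gives [|H f| >= c |f|]; elsewhere [|f| ^ p] is
    bounded uniformly in the exponent, which makes the additive error. *)
Lemma hilbert_ratio_ge (m q : nat) (c del : R) : (0 < m)%N -> (m < q)%N -> m%:R / q%:R * p <= 2 + alpha ->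
  0 <= c -> 0 < del <= 1 -> analytic_on_disk (hilbert (riscC (m%:R / q%:R : R))) ->
  (forall z : R[i], cmod z < 1 -> cmod (1 - z) < del -> c <= cmod (pseries_fun (dcoefC (m%:R / q%:R)) z)) ->
  ((c `^ p)%:E * dint p alpha (riscC (m%:R / q%:R)) <=
   dint p alpha (hilbert (riscC (m%:R / q%:R))) +
   (c `^ p * del `^ (- (2 + alpha)))%:E * \int[nu]_z (dweight alpha z)%:E)%E.
Proof.
move=> m0 mq hgp c0 del01 ah hD; set g : R := m%:R / q%:R in hgp ah hD *.
have /andP[g0 g1] := ratio01 R m0 mq.
have p0 : 0 < p by move: alpha0 p_gt; lra.
have md := @measurable_dweight R alpha; have d0 := @dweight_ge0 R alpha.
have mp := @measurable_pole R alpha (g * p).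
have mH := measurable_diskmod ah.
rewrite (dint_ratio m0 mq) -/g /dint.
rewrite -(integralTZl nu); last 3 first.
- by meas.
- by move=> z; rewrite lee_fin pole_ge0.
- exact: powR_ge0.
rewrite -(integralTZl nu); last 3 first.
- by meas.
- by move=> z; rewrite lee_fin.
- by rewrite mulr_ge0 ?powR_ge0.
rewrite -(integralTD nu); last 4 first.
- by meas.
- by move=> z; rewrite lee_fin mulr_ge0 ?powR_ge0.
- by meas.
- by move=> z; rewrite -EFinM lee_fin !mulr_ge0 ?powR_ge0.
apply: le_integralT.
- by meas.
- by move=> z; rewrite -EFinM lee_fin mulr_ge0 ?powR_ge0 ?pole_ge0.
- by meas.
move=> z; rewrite -!EFinM -EFinD lee_fin.
case: (ltP (sqn z) 1) => z1; last first.
  by rewrite /pole /dweight ltNge z1 /= !mul0r !mulr0 addr0.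
have cz := cmod_cpt_lt1 z1.
case: (ltP (cmod (1 - cpt z)) del) => hz.
  apply: (@le_trans _ _ (dweight alpha z * diskmod (hilbert (riscC g)) z `^ p)); last first.
    by rewrite lerDl !mulr_ge0 ?powR_ge0.
  rewrite {1}/diskmod z1 (pseries_hilbert_riscC m0 mq cz) cmodM -/g.
  have -> : cmod (pseries_fun (riscC g) (cpt z)) = cmod (1 - cpt z) `^ (- g).
    by rewrite -(diskmod_ratio mq z1) /diskmod z1.
  rewrite (powRM _ (powR_ge0 _ _) (cmod_ge0 _)) -powRrM mulNr (mulrA (dweight alpha z)) -/(pole alpha (g * p) z).
  rewrite [X in X <= _]mulrC; apply: ler_wpM2l; first exact: pole_ge0.
  by apply: ge0_ler_powR; rewrite ?nnegrE ?cmod_ge0 ?(ltW p0) // hD.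
apply: (@le_trans _ _ (c `^ p * del `^ (- (2 + alpha)) * dweight alpha z)); last first.
  by rewrite lerDr mulr_ge0 ?powR_ge0.
rewrite -mulrA ler_wpM2l ?powR_ge0 //.
by apply: pole_far => //; rewrite mulr_ge0 // ltW.
Qed.

(** The error term [A * M] does not depend on the final exponent [g], while the norm of the test
    function grows without bound as [g] tends to [x]; so a [g] close enough to [x] absorbs the
    error. *)
Lemma hilbert_norm_ge (c : R) :
  hyp_a alpha p \/ (condb_integral p alpha <= (1 / (4 * (alpha + 1)))%:E)%E ->
  c < rbeta (bexp alpha p) (1 - bexp alpha p) ->
  exists a : nat -> R[i], in_bergman p alpha a /\ c * bergman_norm p alpha a < bergman_norm p alpha (hilbert a).
Proof.
move=> hab cB; have x01 := bexp01 alpha0 p_gt; set x := bexp alpha p in x01 cB *.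
have /andP[x0 x1] := x01; set B := rbeta _ _ in cB *.
have B0 : 0 < B by exact: rbeta01_gt0.
have p0 : 0 < p by move: alpha0 p_gt; lra.
have xp : x * p = 2 + alpha by rewrite /x /bexp divfK // gt_eqF.
pose c1 := Num.max c 0.
have c10 : 0 <= c1 by rewrite le_max lexx orbT.
have cc1 : c <= c1 by rewrite le_max lexx.
have c1B : c1 < B by rewrite gt_max cB.
pose eps := (B - c1) / 4.
have eps0 : 0 < eps by rewrite divr_gt0 // subr_gt0.
pose c2 := B - 2 * eps.
have c12 : c1 < c2 by rewrite /c2 /eps; lra.
have c20 : 0 < c2 by exact: le_lt_trans c12.
have [eta eta0 heta] := rbeta_near x01 eps0.
have lt1 : Num.max 0 (x - eta) < x by rewrite gt_max x0 /= gtrBl.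
have le1 : 0 <= Num.max 0 (x - eta) by rewrite le_max lexx.
(* A lower limit for the admissible exponents: the Beta value stays within [eps] of [B] beyond it,
   and [del] can be chosen for all of them together. *)
have [m0 [q0 [m00 mq0 /andP[hg1 hg2]]]] := rat_between le1 lt1 (ltW x1).
have [del del01 hdel] := dseries_near1 m00 mq0 x1 eps0.
have al1 : -1 < alpha by move: alpha0; lra.
have FD := dweight_int_fin al1.
have d0 := @dweight_ge0 R alpha.
have W0 : (0 <= \int[nu]_z (dweight alpha z)%:E)%E by apply: integral_ge0 => z _; rewrite lee_fin.
have [W WE W0'] := ge0_lt_oo_real W0 FD.
pose M := del `^ (- (2 + alpha)) * W.
have M0 : 0 <= M by rewrite mulr_ge0 ?powR_ge0.
pose cst : R := 2 `^ (- (2 + alpha)) * 4^-1 `^ (2 + alpha).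
have cst0 : 0 < cst by rewrite mulr_gt0 ?powR_gt0 // invr_gt0.
pose A := c2 `^ p; pose A1 := c1 `^ p.
have AA1 : A1 < A by apply: gt0_ltr_powR; rewrite ?nnegrE // ltW.
have A0 : 0 <= A by exact: powR_ge0.
have AA10 : 0 < A - A1 by rewrite subr_gt0.
(* Once the norm integral [I] is at least [L], the gap [(A - A1) * I] exceeds the error [A * M]; by
   [pole_ge] this holds for [x - g] at most [cst / (L * p)]. *)
pose L := A * M / (A - A1) + 1.
have L0 : 0 < L by rewrite ltr_wpDl //; exact: divr_ge0 (mulr_ge0 A0 M0) (ltW AA10).
have t0 : 0 < cst / (L * p) by rewrite divr_gt0 // mulr_gt0.
have lt2 : Num.max (m0%:R / q0%:R) (x - cst / (L * p)) < x by rewrite gt_max hg2 /= gtrBl.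
have le2 : 0 <= Num.max (m0%:R / q0%:R) (x - cst / (L * p)) by rewrite le_max divr_ge0.
have [m [q [mp mq /andP[hg3 hg4]]]] := rat_between le2 lt2 (ltW x1).
set g : R := m%:R / q%:R in hg3 hg4.
move: hg3; rewrite gt_max => /andP[g0g gL].
have /andP[g00 g11] := ratio01 R mp mq; rewrite -/g in g00 g11.
have gp : g * p < 2 + alpha by rewrite -xp ltr_pM2r.
have ha : analytic_on_disk (riscC g) by exact: analytic_ratio mp mq.
have fin1 := pole_fin alpha0 gp.
have low := pole_ge alpha0 (mulr_ge0 (ltW g00) (ltW p0)) gp.
rewrite -/g -(dint_ratio mp mq) in fin1; rewrite -(dint_ratio mp mq) -/g in low.
have inb : in_bergman p alpha (riscC g) by apply/in_bergman_dint; split.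
(* Membership of the image makes its integral finite, so that the estimates can be compared as real
   numbers. *)
have [_ inh _] := hilbert_bounded alpha0 p_gt hab inb.
have [ah finh] := (in_bergman_dint _).1 inh.
have nearD (z : R[i]) : cmod z < 1 -> cmod (1 - z) < del -> c2 <= cmod (pseries_fun (dcoefC g) z).
  move=> z1 zd; apply: le_trans (hdel m q mp mq (ltW g0g) hg4 z z1 zd).
  have g01 : 0 < g < 1 by rewrite g00.
  have dist : `|x - g| < eta.
    rewrite gtr0_norm ?subr_gt0 //.
    have /andP[_ h] : (0 < m0%:R / q0%:R :> R) && (x - eta < m0%:R / q0%:R) by rewrite -gt_max.
    by rewrite ltrBlDl -ltrBlDr (lt_trans h).
  by have := heta g g01 dist; rewrite -/B /c2 -/g; lra.
have key := hilbert_ratio_ge mp mq (ltW gp) (ltW c20) del01 ah nearD.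
have If := dint_ge0 p alpha (riscC g); have Jf := dint_ge0 p alpha (hilbert (riscC g)).
have [I IE I0] := ge0_lt_oo_real If fin1; have [J JE J0] := ge0_lt_oo_real Jf finh.
rewrite -/g IE JE WE -!EFinM -EFinD lee_fin -/A -mulrA -/M in key.
rewrite IE lee_fin -/cst in low.
have LI : L <= I.
  apply: le_trans low; rewrite ler_pdivlMr ?subr_gt0 //.
  have : (x - g) * (L * p) <= cst.
    by rewrite -ler_pdivlMr ?mulr_gt0 //; move: gL; lra.
  by rewrite -xp; have -> : L * (x * p - g * p) = (x - g) * (L * p) by ring.
have main : A1 * I < J.
  have : A * M < (A - A1) * I.
    apply: (@lt_le_trans _ _ ((A - A1) * L)); last by rewrite ler_pM2l.
    have -> : (A - A1) * L = A * M + (A - A1) by rewrite mulrDr mulr1 [_ * (_ / _)]mulrC divfK // gt_eqF.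
    by rewrite ltrDl.
  by rewrite mulrBl; move: key; lra.
exists (riscC g); split => //.
have k0 : 0 < (alpha + 1) / pi by rewrite divr_gt0 ?pi_gt0 // ltr_wpDl.
rewrite /bergman_norm (bergman_int_dint p alpha0 ha) (bergman_int_dint p alpha0 ah) IE JE -!EFinM /=.
move: ((alpha + 1) / pi) k0 => k k0.
have kI : 0 <= k * I by rewrite mulr_ge0 ?(ltW k0).
apply: (@le_lt_trans _ _ (c1 * (k * I) `^ p^-1)); first by rewrite ler_wpM2r ?powR_ge0.
have -> : c1 * (k * I) `^ p^-1 = (A1 * (k * I)) `^ p^-1.
  by rewrite (powRM _ (powR_ge0 c1 p) kI) -powRrM mulfV ?gt_eqF // (powRr1 c10).
apply: gt0_ltr_powR; rewrite ?nnegrE ?invr_gt0 //.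
- by rewrite mulr_ge0 ?powR_ge0.
- by rewrite mulr_ge0 // ltW.
- by rewrite mulrCA ltr_pM2l.
Qed.

End Sharpness.

Theorem theorem1p1 (R : realType) (alpha p : R) :
  0 <= alpha ->
  ((2 + alpha + Num.sqrt (alpha ^+ 2 + 7 / 2 * alpha + 3) <= p
      /\ p < 2 * (2 + alpha))
   \/
   (2 + 2 * alpha < p
      /\ p < 2 + alpha + Num.sqrt (alpha ^+ 2 + 7 / 2 * alpha + 3)
      /\ (condb_integral p alpha <= (1 / (4 * (alpha + 1)))%:E)%E)) ->
  let C := pi / sin ((2 + alpha) * pi / p) in
  (* H is bounded on A^p_alpha with norm at most C ... *)
  (forall a : nat -> R[i], in_bergman p alpha a ->
     (forall n, cseries_cvg (hilbert_term a n))
     /\ in_bergman p alpha (hilbert a)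
     /\ bergman_norm p alpha (hilbert a) <= C * bergman_norm p alpha a)
  /\
  (* ... and no smaller constant works, i.e. ||H|| = C *)
  (forall c : R, c < C ->
     exists a : nat -> R[i], in_bergman p alpha a
       /\ c * bergman_norm p alpha a < bergman_norm p alpha (hilbert a)).
Proof.
move=> alpha0 hab.
have D0 : 0 <= alpha ^+ 2 + 7 / 2 * alpha + 3 by rewrite !addr_ge0 ?sqr_ge0 // mulr_ge0.
(* This puts the threshold of (a) above [2 + 2 * alpha], so both cases share the lower bound on
   [p]. *)
have s1 : alpha < Num.sqrt (alpha ^+ 2 + 7 / 2 * alpha + 3).
  rewrite -[X in X < _](ger0_norm alpha0) -sqrtr_sqr ltr_sqrt; last by have := sqr_ge0 alpha; nra.
  by move: alpha0; lra.
have p_gt : 2 + 2 * alpha < p by case: hab => [[h _]|[h _]] //; move: h s1; lra.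
have {}hab : hyp_a alpha p \/ (condb_integral p alpha <= (1 / (4 * (alpha + 1)))%:E)%E.
  by case: hab => [[h _]|[_ [_ h]]]; [left|right].
move=> C; have CE : C = rbeta (bexp alpha p) (1 - bexp alpha p).
  rewrite (rbeta_reflection (bexp01 alpha0 p_gt)) /C /bexp; congr (pi / sin _); ring.
rewrite CE; split=> [a ia|c cB].
  by have [h1 h2 h3] := hilbert_bounded alpha0 p_gt hab ia.
exact: hilbert_norm_ge.
Qed.
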